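(* Let $\alpha\in\mathbb{R}\setminus\mathbb{Q}$, $\lambda\in\mathbb{R}$, $\eta>0$, and let $v:\mathbb{R}/\mathbb{Z}\to\mathbb{R}$ be real analytic with an analytic extension to a neighborhood of $\{|\Im x|\le\eta\}$. Suppose that, for every $\theta\in\mathbb{R}$, $\hat H_{\lambda v,\alpha,\theta}$ satisfies a strong localization estimate with parameters $C_0>1$, $\epsilon_0>0$, $\epsilon_1=2\pi\eta$ and $\bar C>0$ (the parameters not depending on $\theta$). Then for every $\delta>0$ there is a constant $C(\lambda,v,\alpha,\eta,\delta)$ such that for every $E\in\Sigma_{\lambda v,\alpha}$ and every $k\ge1$, $$\sup_{|\Im x|<\eta}\|A_k(x)\|\le C(\lambda,v,\alpha,\eta,\delta)\,e^{\delta k},$$ where $A(x)=\begin{pmatrix}E-\lambda v(x)&-1\\1&0\end{pmatrix}$ and $A_k(x)=A(x+(k-1)\alpha)A(x+(k-2)\alpha)\cdots A(x)$.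
   Context: $\|x\|_{\mathbb{R}/\mathbb{Z}}=\min_{\ell\in\mathbb{Z}}|x-\ell|$. Schrödinger operator: $(H_{\lambda v,\alpha,x}u)_n=u_{n+1}+u_{n-1}+\lambda v(x+n\alpha)u_n$ on $\ell^2(\mathbb{Z})$; its spectrum does not depend on $x$ and is denoted $\Sigma_{\lambda v,\alpha}$. Aubry dual: with $\hat v_k$ the Fourier coefficients of $v$, $(\hat H_{\lambda v,\alpha,\theta}\hat u)_n=\sum_{k\in\mathbb{Z}}\lambda\hat v_k\hat u_{n-k}+2\cos(2\pi(\theta+n\alpha))\hat u_n$. Resonances: given $\theta\in\mathbb{R}$ and $\epsilon_0>0$, $k\in\mathbb{Z}$ is an $\epsilon_0$-resonance for $\theta$ if $\|2\theta-k\alpha\|_{\mathbb{R}/\mathbb{Z}}\le e^{-\epsilon_0|k|}$ and $\|2\theta-k\alpha\|_{\mathbb{R}/\mathbb{Z}}=\min_{|j|\le|k|}\|2\theta-j\alpha\|_{\mathbb{R}/\mathbb{Z}}$. The $\epsilon_0$-resonances are ordered as $0=|n_0|<|n_1|\le|n_2|\le\cdots$. If there are only finitely many, $n_0,\dots,n_{j_\theta}$, set $n_{j_\theta+1}=\infty$. Strong localization estimate: $\hat H_{\lambda v,\alpha,\theta}$ satisfies a strong localization estimate with parameters $C_0>1$, $\epsilon_0>0$, $\epsilon_1>0$, $\bar C>0$ if for every $\hat u$ with $\hat H_{\lambda v,\alpha,\theta}\hat u=E\hat u$ for some $E\in\Sigma_{\lambda v,\alpha}$, $\hat u_0=1$ and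 $|\hat u_k|\le1+|k|$ for all $k$, one has $|\hat u_k|\le\bar C e^{-\epsilon_1|k|}$ whenever $C_0|n_j|<|k|<C_0^{-1}|n_{j+1}|$ for some $j$, where $\{n_j\}$ are the $\epsilon_0$-resonances for $\theta$. *)

(* Defs.v *)
From Stdlib Require Export Reals ZArith.
From Coquelicot Require Export Coquelicot.
Open Scope R_scope.

(** ** Preliminaries *)

Definition irrational (alpha : R) : Prop :=
  forall p q : Z, q <> 0%Z -> alpha <> IZR p / IZR q.

(* [||x||_{R/Z}]; the infimum is attained. *)
Definition dist_RZ (x : R) : R :=
  real (Glb_Rbar (fun r => exists l : Z, r = Rabs (x - IZR l))).

(* [e^{2 pi i t}] *)
Definition expi (t : R) : C := (cos (2 * PI * t), sin (2 * PI * t)).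

(* Both one-sided series are required to converge separately. *)
Definition is_sumZ {V : NormedModule R_AbsRing} (f : Z -> V) (l : V) : Prop :=
  exists lp lm : V,
    is_series (fun n : nat => f (Z.of_nat n)) lp /\
    is_series (fun n : nat => f (- Z.of_nat (S n))%Z) lm /\
    l = plus lp lm.

(** ** Bounded operators on complex [l^2(Z)] and their spectra *)

Definition in_l2 (u : Z -> C) : Prop :=
  exists s : R, is_sumZ (V := R_NormedModule) (fun n => Cmod (u n) ^ 2) s.

(* Meaningful only when [in_l2 u]. *)
Definition l2_norm (u : Z -> C) : R :=
  sqrt (Series (fun n : nat => Cmod (u (Z.of_nat n)) ^ 2) +
        Series (fun n : nat => Cmod (u (- Z.of_nat (S n))%Z) ^ 2)).

(* [z] is in the resolvent set when [T - z] has a bounded two-sided inverse [G]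
   on [l^2(Z)]; [G] is automatically linear on [l^2(Z)] when [T] is. *)
Definition in_resolvent (T : (Z -> C) -> (Z -> C)) (z : C) : Prop :=
  exists (G : (Z -> C) -> (Z -> C)) (M : R),
    (forall f : Z -> C, in_l2 f ->
       in_l2 (G f) /\
       l2_norm (G f) <= M * l2_norm f /\
       forall n : Z, (T (G f) n - z * G f n)%C = f n) /\
    (forall u : Z -> C, in_l2 u ->
       forall n : Z, G (fun m => (T u m - z * u m)%C) n = u n).

Definition in_spectrum (T : (Z -> C) -> (Z -> C)) (z : C) : Prop :=
  ~ in_resolvent T z.

(** ** The Schroedinger operator and its Aubry dual *)

Definition schrodinger (lambda : R) (v : R -> R) (alpha x : R)
    (u : Z -> C) (n : Z) : C :=
  (u (n + 1)%Z + u (n - 1)%Z + RtoC (lambda * v (x + IZR n * alpha)%R) * u n)%C.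

(* The spectrum of [H_{lambda v, alpha, x}] is the same for all phases [x], so
   it is taken at [x = 0].  The operator is self-adjoint, so its spectrum is a
   set of reals. *)
Definition Sigma (lambda : R) (v : R -> R) (alpha : R) (E : R) : Prop :=
  in_spectrum (schrodinger lambda v alpha 0) (RtoC E).

Definition fourier_coef (v : R -> R) (k : Z) : C :=
  RInt (V := C_R_CompleteNormedModule)
    (fun x => (RtoC (v x) * expi (- (IZR k * x)))%C) 0 1.

(* [w = (\hat H_{lambda v, alpha, theta} u)_n].  A relation, because [u] need
   not be in [l^2(Z)]: the convolution series is required to converge. *)
Definition dual_value (lambda : R) (v : R -> R) (alpha theta : R)
    (u : Z -> C) (n : Z) (w : C) : Prop :=
  exists s : C,
    is_sumZ (V := C_R_NormedModule)
      (fun k => (RtoC lambda * fourier_coef v k * u (n - k)%Z)%C) s /\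
    w = (s + RtoC (2 * cos (2 * PI * (theta + IZR n * alpha))) * u n)%C.

(** ** Resonances and strong localization *)

Definition resonance (alpha theta eps0 : R) (k : Z) : Prop :=
  dist_RZ (2 * theta - IZR k * alpha) <= exp (- eps0 * IZR (Z.abs k)) /\
  forall j : Z, (Z.abs j <= Z.abs k)%Z ->
    dist_RZ (2 * theta - IZR k * alpha) <= dist_RZ (2 * theta - IZR j * alpha).

(* The ordered list [n_0, n_1, ...] of resonances: [None] stands for the value
   infinity used once the list is exhausted.  Since [k] and [-k] may both be
   resonances, such a list need not be unique.  [0 < |n_1|] follows from
   [ro_zero] and [ro_inj]. *)
Record resonance_order (alpha theta eps0 : R) (n : nat -> option Z) : Prop := {
  ro_zero : n 0%nat = Some 0%Z;
  ro_all : forall k, resonance alpha theta eps0 k <-> exists j, n j = Some k;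
  ro_inj : forall i j k, n i = Some k -> n j = Some k -> i = j;
  ro_end : forall j, n j = None -> n (S j) = None;
  ro_mono : forall j k l, n j = Some k -> n (S j) = Some l ->
    (Z.abs k <= Z.abs l)%Z
}.

Definition between_resonances (C0 : R) (n : nat -> option Z) (j : nat) (k : Z)
    : Prop :=
  (exists nj : Z, n j = Some nj /\ C0 * IZR (Z.abs nj) < IZR (Z.abs k)) /\
  match n (S j) with
  | Some m => IZR (Z.abs k) < / C0 * IZR (Z.abs m)
  | None => True
  end.

Definition strong_localization (lambda : R) (v : R -> R) (alpha theta : R)
    (C0 eps0 eps1 Cbar : R) : Prop :=
  forall (E : R) (u : Z -> C),
    Sigma lambda v alpha E ->
    (forall n : Z, dual_value lambda v alpha theta u n (RtoC E * u n)%C) ->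
    u 0%Z = RtoC 1 ->
    (forall k : Z, Cmod (u k) <= 1 + IZR (Z.abs k)) ->
    forall (n : nat -> option Z) (j : nat) (k : Z),
      resonance_order alpha theta eps0 n ->
      between_resonances C0 n j k ->
      Cmod (u k) <= Cbar * exp (- eps1 * IZR (Z.abs k)).

(** ** Analytic extensions *)

Definition analytic_at (f : C -> C) (z0 : C) : Prop :=
  exists (a : nat -> C) (r : R), 0 < r /\
    forall z : C, Cmod (z - z0) < r ->
      is_pseries (K := C_AbsRing) (V := C_NormedModule) a (z - z0)%C (f z).

(* [vc] is an analytic extension of [v : R/Z -> R] to a neighborhood of
   [{|Im z| <= eta}] in the cylinder [C/Z], which is represented by a
   1-periodic open subset [U] of [C].  This makes [v] itself real analytic. *)
Definition analytic_extension (v : R -> R) (eta : R) (vc : C -> C) : Prop :=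
  exists U : C -> Prop,
    open (T := C_UniformSpace) U /\
    (forall z : C, Rabs (Im z) <= eta -> U z) /\
    (forall z : C, U (z + 1)%C <-> U z) /\
    (forall z : C, U z -> vc (z + 1)%C = vc z) /\
    (forall z : C, U z -> analytic_at vc z) /\
    (forall x : R, vc (RtoC x) = RtoC (v x)).

(** ** The Schroedinger cocycle *)

Definition transfer (lambda : R) (vc : C -> C) (E : R) (z : C)
    : matrix (T := C) 2 2 :=
  mk_matrix 2 2 (fun i j =>
    match i, j with
    | O, O => (RtoC E - RtoC lambda * vc z)%C
    | O, _ => (- (1))%C
    | _, O => RtoC 1
    | _, _ => RtoC 0
    end).

(* [A_k(z) = A(z + (k-1) alpha) ... A(z)] *)
Fixpoint transfer_iter (lambda : R) (vc : C -> C) (alpha E : R) (k : nat)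
    (z : C) : matrix (T := C) 2 2 :=
  match k with
  | O => Mone (T := C_Ring)
  | S k' => Mmult (T := C_Ring)
              (transfer lambda vc E (z + RtoC (INR k' * alpha))%C)
              (transfer_iter lambda vc alpha E k' z)
  end.

Definition vnorm (w : matrix (T := C) 2 1) : R :=
  sqrt (Cmod (coeff_mat (RtoC 0) w 0 0) ^ 2 +
        Cmod (coeff_mat (RtoC 0) w 1 0) ^ 2).

(* Operator norm with respect to the Euclidean norm of [C^2]. *)
Definition opnorm (M : matrix (T := C) 2 2) : R :=
  real (Lub_Rbar (fun r => exists w : matrix (T := C) 2 1,
    vnorm w <= 1 /\ r = vnorm (Mmult (T := C_Ring) M w))).

(* Main.v *)
(** An energy [E] in the spectrum has approximate eigenvectors; passing to the
    dual side, averaging and taking a limit gives a phase [theta] and an exact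
    dual solution [u] with [u_0 = 1] and [|u_k| <= 1 + |k|].

    Let [K] be such that [||m alpha|| >= 1/(4K)] for [0 < |m| <= K]; since
    [alpha] is irrational, there are arbitrarily large such [K].  At most one
    resonance [r] with [|r| <= K/2] has size well above [ln K], so one of two
    windows ending at scales [T] and [K/2], which do not depend on [E] or
    [theta], is free of resonances, and [u] decays exponentially there.
    Truncating [u] inside the window gives a trigonometric polynomial [W] such
    that [(expi theta W(z), W(z - alpha))] is invariant under the cocycle up to
    an error [tau], uniformly on [|Im z| <= eta'] for a fixed [eta' < eta].

    This vector is bounded below by some [sigma] much larger than [tau]: if it
    were small at one point it would stay small along a stretch of the orbit
    shorter than [K], whose points are [1/(4K)]-separated and return to every
    short interval within a bounded time.  Newton interpolation would then make
    [W] small on a whole horizontal line, contradicting that its mean is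
    [u_0 = 1].

    In the frame given by the section, the cocycle is thus upper triangular
    with unimodular diagonal, up to an arbitrarily small error after rescaling,
    so [|A_k| <= K1 (1 + 2 eps)^k] on [|Im z| <= eta'] with [K1] independent of
    [E].  Interpolating with the crude exponential bound on a slightly larger
    strip (three lines) reaches [|Im z| < eta]. *)

Require Import Defs.
From Stdlib Require Import Lra Lia Classical ClassicalEpsilon FunctionalExtensionality.

(** * Finite sums over intervals of integers *)

(** The obstacle is uniformity: [theta], [u] and the position of the resonances vary with [E], while
    the constant must not. So cut-off, number of nodes and [sigma] are computed from data
    independent of [E], for two windows fixed in advance, and the bound inside the strip is the
    larger of two constants. A window starting at [n] must reach a large multiple of
    [(n + 1) (1 + ln K)]: the section can be as large as [exp (2 pi eta n)], so interpolation takes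
    of order [n + 1] nodes, and nodes [1/(4K)] apart cost [8K] to that power. With [n] of order
    [ln K], then [(ln K)^2], two successive windows fit below [K] because [K] dominates [(ln K)^3].

    The decay rate [2 pi eta] leaves no room at the edge of the strip, whence [eta' < eta]. The room
    beyond [eta] used by three lines comes from compactness of the closed strip modulo 1, which
    gives uniform analyticity on a strip of height [h > eta]. Contour shifts rest on a uniform
    quadratic Taylor remainder, and the approximate eigenvectors on a Neumann series that would
    otherwise invert the operator. *)

Fixpoint rsum (f : Z -> R) (a : Z) (n : nat) : R :=
  match n with
  | O => 0
  | S m => rsum f a m + f (a + Z.of_nat m)%Z
  end.

Fixpoint csum (f : Z -> C) (a : Z) (n : nat) : C :=
  match n with
  | O => RtoC 0
  | S m => (csum f a m + f (a + Z.of_nat m)%Z)%C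
  end.

Definition rsym (f : Z -> R) (N : nat) : R := rsum f (- Z.of_nat N) (2 * N + 1).
Definition csym (f : Z -> C) (N : nat) : C := csum f (- Z.of_nat N) (2 * N + 1).

Lemma rsum_ext f g a n :
  (forall k, (a <= k < a + Z.of_nat n)%Z -> f k = g k) -> rsum f a n = rsum g a n.
Proof.
  induction n as [|n IH]; intros H; [reflexivity|].
  cbn [rsum]; rewrite IH, H; [reflexivity|lia|intros; apply H; lia].
Qed.

Lemma csum_ext f g a n :
  (forall k, (a <= k < a + Z.of_nat n)%Z -> f k = g k) -> csum f a n = csum g a n.
Proof.
  induction n as [|n IH]; intros H; [reflexivity|].
  cbn [csum]; rewrite IH, H; [reflexivity|lia|intros; apply H; lia].
Qed.

Lemma rsum_plus f g a n :
  rsum (fun k => f k + g k) a n = rsum f a n + rsum g a n.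
Proof. induction n as [|n IH]; cbn [rsum]; [ring|rewrite IH; ring]. Qed.

Lemma rsum_scal c f a n : rsum (fun k => c * f k) a n = c * rsum f a n.
Proof. induction n as [|n IH]; cbn [rsum]; [ring|rewrite IH; ring]. Qed.

Lemma csum_plus f g a n :
  csum (fun k => f k + g k)%C a n = (csum f a n + csum g a n)%C.
Proof. induction n as [|n IH]; cbn [csum]; [ring|rewrite IH; ring]. Qed.

Lemma csum_minus f g a n :
  csum (fun k => f k - g k)%C a n = (csum f a n - csum g a n)%C.
Proof. induction n as [|n IH]; cbn [csum]; [ring|rewrite IH; ring]. Qed.

Lemma csum_scal c f a n : csum (fun k => c * f k)%C a n = (c * csum f a n)%C.
Proof. induction n as [|n IH]; cbn [csum]; [ring|rewrite IH; ring]. Qed.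

Lemma rsum_le f g a n :
  (forall k, (a <= k < a + Z.of_nat n)%Z -> f k <= g k) -> rsum f a n <= rsum g a n.
Proof.
  induction n as [|n IH]; intros H; cbn [rsum]; [lra|].
  apply Rplus_le_compat; [apply IH; intros; apply H; lia|apply H; lia].
Qed.

Lemma rsum_const c a n : rsum (fun _ => c) a n = INR n * c.
Proof.
  induction n as [|n IH]; [cbn; ring|].
  cbn [rsum]; rewrite IH, S_INR; ring.
Qed.

Lemma rsum_ge0 f a n :
  (forall k, (a <= k < a + Z.of_nat n)%Z -> 0 <= f k) -> 0 <= rsum f a n.
Proof.
  intros H; rewrite <- (Rmult_0_r (INR n)), <- (rsum_const 0 a n).
  now apply rsum_le.
Qed.

Lemma Cmod_csum f a n : Cmod (csum f a n) <= rsum (fun k => Cmod (f k)) a n.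
Proof.
  induction n as [|n IH]; cbn [csum rsum]; [rewrite Cmod_0; lra|].
  eapply Rle_trans; [apply Cmod_triangle|lra].
Qed.

Lemma Cmod_csum_le f g a n :
  (forall k, (a <= k < a + Z.of_nat n)%Z -> Cmod (f k) <= g k) ->
  Cmod (csum f a n) <= rsum g a n.
Proof.
  intros H; eapply Rle_trans; [apply Cmod_csum|now apply rsum_le].
Qed.

Lemma rsum_shift f s a n : rsum (fun k => f (k + s)%Z) a n = rsum f (a + s) n.
Proof.
  induction n as [|n IH]; cbn [rsum]; [reflexivity|].
  rewrite IH; do 2 f_equal; lia.
Qed.

Lemma csum_shift f s a n : csum (fun k => f (k + s)%Z) a n = csum f (a + s) n.
Proof.
  induction n as [|n IH]; cbn [csum]; [reflexivity|].
  rewrite IH; do 2 f_equal; lia.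
Qed.

Lemma rsum_app f a n m : rsum f a (n + m) = rsum f a n + rsum f (a + Z.of_nat n) m.
Proof.
  induction m as [|m IH]; [rewrite Nat.add_0_r; cbn; ring|].
  rewrite Nat.add_succ_r; cbn [rsum]; rewrite IH, Rplus_assoc.
  do 3 f_equal; lia.
Qed.

Lemma csum_app f a n m :
  csum f a (n + m) = (csum f a n + csum f (a + Z.of_nat n) m)%C.
Proof.
  induction m as [|m IH]; [rewrite Nat.add_0_r; cbn; ring|].
  rewrite Nat.add_succ_r; cbn [csum]; rewrite IH, <- Cplus_assoc.
  do 3 f_equal; lia.
Qed.

Lemma rsum_0 f a n :
  (forall k, (a <= k < a + Z.of_nat n)%Z -> f k = 0) -> rsum f a n = 0.
Proof.
  intros H; rewrite (rsum_ext f (fun _ => 0) a n H), rsum_const; ring.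
Qed.

Lemma csum_0 f a n :
  (forall k, (a <= k < a + Z.of_nat n)%Z -> f k = RtoC 0) -> csum f a n = RtoC 0.
Proof.
  intros H; induction n as [|n IH]; [reflexivity|].
  cbn [csum]; rewrite IH, H; [ring|lia|intros; apply H; lia].
Qed.

Lemma rsum_subrange f a n b m :
  (b <= a)%Z -> (a + Z.of_nat n <= b + Z.of_nat m)%Z ->
  (forall k, (b <= k < b + Z.of_nat m)%Z -> ~ (a <= k < a + Z.of_nat n)%Z -> f k = 0) ->
  rsum f b m = rsum f a n.
Proof.
  intros H1 H2 H.
  pose (p := Z.to_nat (a - b)); pose (q := (m - n - p)%nat).
  replace m with (p + (n + q))%nat by lia.
  rewrite rsum_app, rsum_app, (rsum_0 f b p), (rsum_0 f (b + Z.of_nat p + Z.of_nat n) q).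
  - replace (b + Z.of_nat p)%Z with a by lia; ring.
  - intros k Hk; apply H; lia.
  - intros k Hk; apply H; lia.
Qed.

Lemma csum_subrange f a n b m :
  (b <= a)%Z -> (a + Z.of_nat n <= b + Z.of_nat m)%Z ->
  (forall k, (b <= k < b + Z.of_nat m)%Z -> ~ (a <= k < a + Z.of_nat n)%Z -> f k = RtoC 0) ->
  csum f b m = csum f a n.
Proof.
  intros H1 H2 H.
  pose (p := Z.to_nat (a - b)); pose (q := (m - n - p)%nat).
  replace m with (p + (n + q))%nat by lia.
  rewrite csum_app, csum_app, (csum_0 f b p), (csum_0 f (b + Z.of_nat p + Z.of_nat n) q).
  - replace (b + Z.of_nat p)%Z with a by lia; ring.
  - intros k Hk; apply H; lia.
  - intros k Hk; apply H; lia.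
Qed.

Lemma rsum_subrange_le f a n b m :
  (b <= a)%Z -> (a + Z.of_nat n <= b + Z.of_nat m)%Z ->
  (forall k, (b <= k < b + Z.of_nat m)%Z -> 0 <= f k) ->
  rsum f a n <= rsum f b m.
Proof.
  intros H1 H2 H.
  pose (p := Z.to_nat (a - b)); pose (q := (m - n - p)%nat).
  replace m with (p + (n + q))%nat by lia.
  rewrite rsum_app, rsum_app.
  replace (b + Z.of_nat p)%Z with a by lia.
  assert (0 <= rsum f b p) by (apply rsum_ge0; intros; apply H; lia).
  assert (0 <= rsum f (a + Z.of_nat n) q) by (apply rsum_ge0; intros; apply H; lia).
  lra.
Qed.

Lemma rsum_term_le f a n k :
  (a <= k < a + Z.of_nat n)%Z ->
  (forall j, (a <= j < a + Z.of_nat n)%Z -> 0 <= f j) -> f k <= rsum f a n.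
Proof.
  intros Hk H.
  replace (f k) with (rsum f k 1)
    by (cbn; rewrite Z.add_0_r; ring).
  apply rsum_subrange_le; [lia|lia|exact H].
Qed.

Lemma csum_swap f a n b m :
  csum (fun j => csum (fun k => f j k) b m) a n =
  csum (fun k => csum (fun j => f j k) a n) b m.
Proof.
  induction n as [|n IH]; cbn [csum].
  - symmetry; apply csum_0; reflexivity.
  - now rewrite IH, <- csum_plus.
Qed.

Lemma rsum_swap f a n b m :
  rsum (fun j => rsum (fun k => f j k) b m) a n =
  rsum (fun k => rsum (fun j => f j k) a n) b m.
Proof.
  induction n as [|n IH]; cbn [rsum].
  - symmetry; apply rsum_0; reflexivity.
  - now rewrite IH, <- rsum_plus.
Qed.

Lemma csum_single f a n k :
  (a <= k < a + Z.of_nat n)%Z ->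
  (forall j, (a <= j < a + Z.of_nat n)%Z -> j <> k -> f j = RtoC 0) -> csum f a n = f k.
Proof.
  intros Hk H; rewrite (csum_subrange f k 1); [|lia|lia|intros j H1 H2; apply H; lia].
  cbn; rewrite Z.add_0_r; ring.
Qed.

Lemma rsym_succ f N :
  rsym f (S N) = rsym f N + f (Z.of_nat (S N)) + f (- Z.of_nat (S N))%Z.
Proof.
  unfold rsym.
  replace (2 * S N + 1)%nat with (1 + ((2 * N + 1) + 1))%nat by lia.
  rewrite rsum_app, rsum_app.
  replace (- Z.of_nat (S N) + Z.of_nat 1)%Z with (- Z.of_nat N)%Z by lia.
  replace (- Z.of_nat N + Z.of_nat (2 * N + 1))%Z with (Z.of_nat (S N)) by lia.
  cbn [rsum]; rewrite !Z.add_0_r; ring.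
Qed.

Lemma csym_succ f N :
  csym f (S N) = (csym f N + f (Z.of_nat (S N)) + f (- Z.of_nat (S N))%Z)%C.
Proof.
  unfold csym.
  replace (2 * S N + 1)%nat with (1 + ((2 * N + 1) + 1))%nat by lia.
  rewrite csum_app, csum_app.
  replace (- Z.of_nat (S N) + Z.of_nat 1)%Z with (- Z.of_nat N)%Z by lia.
  replace (- Z.of_nat N + Z.of_nat (2 * N + 1))%Z with (Z.of_nat (S N)) by lia.
  cbn [csum]; rewrite !Z.add_0_r; ring.
Qed.

Lemma rsym_0 f : rsym f 0 = f 0%Z.
Proof. unfold rsym; cbn; ring. Qed.

Lemma csym_0 f : csym f 0 = f 0%Z.
Proof. unfold csym; cbn; ring. Qed.

Lemma INR_IZR_abs (k : Z) : IZR (Z.abs k) = INR (Z.abs_nat k).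
Proof. now rewrite INR_IZR_INZ, Zabs2Nat.id_abs. Qed.

(** * Sums of [exp (- c |k|)] over the integers *)

Definition geom_const (c : R) : R := 2 / (1 - exp (- c)).

Lemma geom_const_pos c : 0 < c -> 0 < geom_const c.
Proof.
  intros Hc; apply Rdiv_lt_0_compat; [lra|].
  assert (exp (- c) < 1) by (rewrite <- exp_0; apply exp_increasing; lra); lra.
Qed.

Lemma geom_const_ge2 c : 0 < c -> 2 <= geom_const c.
Proof.
  intros Hc.
  assert (H1 : 0 < exp (- c) < 1)
    by (split; [apply exp_pos|rewrite <- exp_0; apply exp_increasing; lra]).
  unfold geom_const; apply (Rmult_le_reg_r (1 - exp (- c))); [lra|].
  unfold Rdiv; rewrite Rmult_assoc, Rinv_l; lra.
Qed.

(** [geom_const c - 2] is the two-sided tail [2 q / (1 - q)] with [q = exp (- c)]. Keeping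
    [exp (- c N)] on the right makes each induction step an identity; the two lemmas that follow
    discard it. *)
Lemma rsym_exp_diff c D N :
  0 < c -> (D <= N)%nat ->
  rsym (fun k => exp (- c * IZR (Z.abs k))) N
    - rsym (fun k => exp (- c * IZR (Z.abs k))) D
    <= (geom_const c - 2) * (exp (- c * INR D) - exp (- c * INR N)).
Proof.
  intros Hc HN; induction HN as [|N HN IH]; [lra|].
  rewrite rsym_succ.
  replace (Z.abs (- Z.of_nat (S N))) with (Z.of_nat (S N)) by lia.
  replace (Z.abs (Z.of_nat (S N))) with (Z.of_nat (S N)) by lia.
  rewrite <- INR_IZR_INZ.
  enough (2 * exp (- c * INR (S N)) <=
    (geom_const c - 2) * (exp (- c * INR N) - exp (- c * INR (S N)))) by lra.
  assert (H1 : exp (- c) < 1) by (rewrite <- exp_0; apply exp_increasing; lra).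
  replace (- c * INR (S N)) with (- c * INR N + - c) by (rewrite S_INR; ring).
  rewrite exp_plus; right.
  unfold geom_const; field; lra.
Qed.

Lemma rsym_exp_le c N :
  0 < c -> rsym (fun k => exp (- c * IZR (Z.abs k))) N <= geom_const c.
Proof.
  intros Hc.
  generalize (rsym_exp_diff c 0 N Hc (Nat.le_0_l N)); rewrite rsym_0.
  change (INR 0) with 0; change (IZR (Z.abs 0)) with 0.
  rewrite Rmult_0_r, exp_0.
  generalize (geom_const_ge2 c Hc) (exp_pos (- c * INR N)); nra.
Qed.

Lemma rsym_exp_tail c D N :
  0 < c -> (D <= N)%nat ->
  rsym (fun k => exp (- c * IZR (Z.abs k))) N
    - rsym (fun k => exp (- c * IZR (Z.abs k))) D <= geom_const c * exp (- c * INR D).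
Proof.
  intros Hc HN; generalize (rsym_exp_diff c D N Hc HN).
  generalize (geom_const_ge2 c Hc) (exp_pos (- c * INR N)) (exp_pos (- c * INR D)); nra.
Qed.

Lemma csym_minus_le f g D N :
  (D <= N)%nat -> (forall k, (Z.abs k <= Z.of_nat N)%Z -> Cmod (f k) <= g k) ->
  Cmod (csym f N - csym f D) <= rsym g N - rsym g D.
Proof.
  intros HN; induction HN as [|N HN IH]; intros H.
  - rewrite !Rminus_diag.
    replace (csym f D - csym f D)%C with (RtoC 0) by ring; rewrite Cmod_0; lra.
  - rewrite csym_succ, rsym_succ.
    replace (csym f N + f (Z.of_nat (S N)) + f (- Z.of_nat (S N))%Z - csym f D)%C
      with ((csym f N - csym f D) + f (Z.of_nat (S N)) + f (- Z.of_nat (S N))%Z)%C by ring.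
    eapply Rle_trans; [apply Cmod_triangle|].
    eapply Rle_trans; [apply Rplus_le_compat_r, Cmod_triangle|].
    specialize (IH ltac:(intros; apply H; lia)).
    generalize (H (Z.of_nat (S N)) ltac:(lia)) (H (- Z.of_nat (S N))%Z ltac:(lia)); lra.
Qed.

(** * Limits of complex sequences and sums over the integers *)

(** An epsilon form in [Cmod], to which estimates apply directly; [is_series_Clim] and [psum_Clim]
    are the bridges from series. *)
Definition Clim (u : nat -> C) (l : C) : Prop :=
  forall eps, 0 < eps -> exists N, forall n, (N <= n)%nat -> Cmod (u n - l) < eps.

Lemma Clim_ext u v l : (forall n, u n = v n) -> Clim u l -> Clim v l.
Proof.
  intros H Hu eps He; destruct (Hu eps He) as [N HN].
  exists N; intros n Hn; rewrite <- H; auto.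
Qed.

Lemma Clim_const c : Clim (fun _ => c) c.
Proof.
  intros eps He; exists 0%nat; intros n _.
  replace (c - c)%C with (RtoC 0) by ring; now rewrite Cmod_0.
Qed.

Lemma Clim_plus u v l m :
  Clim u l -> Clim v m -> Clim (fun n => u n + v n)%C (l + m)%C.
Proof.
  intros Hu Hv eps He.
  destruct (Hu (eps / 2) ltac:(lra)) as [N1 H1], (Hv (eps / 2) ltac:(lra)) as [N2 H2].
  exists (Nat.max N1 N2); intros n Hn.
  replace (u n + v n - (l + m))%C with ((u n - l) + (v n - m))%C by ring.
  eapply Rle_lt_trans; [apply Cmod_triangle|].
  generalize (H1 n ltac:(lia)) (H2 n ltac:(lia)); lra.
Qed.

Lemma Clim_scal c u l : Clim u l -> Clim (fun n => c * u n)%C (c * l)%C.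
Proof.
  intros Hu eps He; generalize (Cmod_ge_0 c); intros Hc.
  destruct (Hu (eps / (Cmod c + 1))) as [N H]; [apply Rdiv_lt_0_compat; lra|].
  exists N; intros n Hn; specialize (H n Hn).
  replace (c * u n - c * l)%C with (c * (u n - l))%C by ring.
  rewrite Cmod_mult.
  apply (Rmult_lt_compat_r (Cmod c + 1)) in H; [|lra].
  unfold Rdiv in H; rewrite Rmult_assoc, Rinv_l in H by lra.
  generalize (Cmod_ge_0 (u n - l)); nra.
Qed.

Lemma Clim_minus u v l m :
  Clim u l -> Clim v m -> Clim (fun n => u n - v n)%C (l - m)%C.
Proof.
  intros Hu Hv.
  apply (Clim_ext (fun n => u n + (- RtoC 1) * v n)%C).
  - intros n; ring.
  - replace (l - m)%C with (l + (- RtoC 1) * m)%C by ring.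
    apply Clim_plus, Clim_scal; assumption.
Qed.

Lemma Clim_mult u v l m :
  Clim u l -> Clim v m -> Clim (fun n => u n * v n)%C (l * m)%C.
Proof.
  intros Hu Hv.
  assert (Hprod : Clim (fun n => (u n - l) * (v n - m))%C (RtoC 0)).
  { intros eps He.
    destruct (Hu 1 ltac:(lra)) as [N1 H1], (Hv eps He) as [N2 H2].
    exists (Nat.max N1 N2); intros n Hn.
    specialize (H1 n ltac:(lia)); specialize (H2 n ltac:(lia)).
    replace ((u n - l) * (v n - m) - 0)%C with ((u n - l) * (v n - m))%C by ring.
    rewrite Cmod_mult.
    generalize (Cmod_ge_0 (u n - l)) (Cmod_ge_0 (v n - m)); nra. }
  assert (H := Clim_plus _ _ _ _ (Clim_plus _ _ _ _ Hprod (Clim_scal l _ _ Hv)) (Clim_scal m _ _ Hu)).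
  assert (H' := Clim_minus _ _ _ _ H (Clim_const (l * m)%C)).
  replace (l * m)%C with (0 + l * m + m * l - l * m)%C by ring.
  refine (Clim_ext _ _ _ _ H'); intros n; ring.
Qed.

Lemma Clim_csum (u : nat -> Z -> C) l a n :
  (forall k, Clim (fun i => u i k) (l k)) ->
  Clim (fun i => csum (u i) a n) (csum l a n).
Proof.
  intros H; induction n as [|n IH]; cbn [csum]; [apply Clim_const|].
  now apply Clim_plus.
Qed.

Lemma Clim_Cmod_le u l b :
  Clim u l -> (exists N, forall n, (N <= n)%nat -> Cmod (u n) <= b) -> Cmod l <= b.
Proof.
  intros Hu [N HN]; apply Rnot_lt_le; intros Hlt.
  destruct (Hu (Cmod l - b) ltac:(lra)) as [N' HN'].
  pose (n := Nat.max N N').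
  generalize (HN n ltac:(lia)) (HN' n ltac:(lia)); intros H1 H2.
  assert (H3 : Cmod l <= Cmod (u n) + Cmod (u n - l)).
  { replace l with (u n + - (u n - l))%C at 1 by ring.
    eapply Rle_trans; [apply Cmod_triangle|]; rewrite Cmod_opp; lra. }
  lra.
Qed.

Lemma Clim_unique u l m : Clim u l -> Clim u m -> l = m.
Proof.
  intros Hl Hm.
  assert (H : Cmod (l - m) <= 0).
  { apply (Clim_Cmod_le (fun n => u n - u n)%C).
    - now apply Clim_minus.
    - exists 0%nat; intros n _; replace (u n - u n)%C with (RtoC 0) by ring.
      rewrite Cmod_0; lra. }
  assert (H' : (l - m)%C = 0).
  { apply Cmod_eq_0; generalize (Cmod_ge_0 (l - m)); lra. }
  replace l with ((l - m) + m)%C by ring; rewrite H'; ring.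
Qed.

Lemma Clim_uniform_finite (u : nat -> Z -> C) v B e :
  (forall k, Clim (fun i => u i k) (v k)) -> 0 < e ->
  exists N, forall i k, (N <= i)%nat -> (Z.abs k <= Z.of_nat B)%Z -> Cmod (u i k - v k) < e.
Proof.
  intros Hlim He; induction B as [|B [N HN]].
  - destruct (Hlim 0%Z e He) as [N HN]; exists N; intros i k Hi Hk.
    replace k with 0%Z by lia; auto.
  - destruct (Hlim (Z.of_nat (S B)) e He) as [N1 H1].
    destruct (Hlim (- Z.of_nat (S B))%Z e He) as [N2 H2].
    exists (Nat.max N (Nat.max N1 N2)); intros i k Hi Hk.
    destruct (Z.eq_dec k (Z.of_nat (S B))) as [->|]; [apply H1; lia|].
    destruct (Z.eq_dec k (- Z.of_nat (S B))) as [->|]; [apply H2; lia|].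
    apply HN; lia.
Qed.

Lemma is_series_Clim (f : nat -> C) (l : C) :
  is_series (V := C_R_NormedModule) f l <->
  Clim (sum_n (G := C_R_NormedModule) f) l.
Proof.
  split.
  - intros H eps He.
    apply (filterlim_locally_ball_norm (K := R_AbsRing) (U := C_R_NormedModule)) with
      (eps := mkposreal eps He) in H.
    destruct H as [N HN]; exists N; intros n Hn.
    rewrite Cmod_norm; exact (HN n Hn).
  - intros H.
    apply (filterlim_locally_ball_norm (K := R_AbsRing) (U := C_R_NormedModule)).
    intros eps; destruct (H eps (cond_pos eps)) as [N HN].
    exists N; intros n Hn; generalize (HN n Hn); rewrite Cmod_norm; auto.
Qed.

Lemma sum_n_C_S (g : nat -> C) n :
  sum_n (G := C_R_NormedModule) g (S n) = (sum_n (G := C_R_NormedModule) g n + g (S n))%C.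
Proof. exact (sum_Sn (G := C_R_NormedModule) g n). Qed.

Lemma sum_n_C_0 (g : nat -> C) : sum_n (G := C_R_NormedModule) g 0 = g 0%nat.
Proof. exact (sum_O (G := C_R_NormedModule) g). Qed.

Lemma csym_sum_n (f : Z -> C) N :
  csym f (S N) = (sum_n (G := C_R_NormedModule) (fun n => f (Z.of_nat n)) (S N)
    + sum_n (G := C_R_NormedModule) (fun n => f (- Z.of_nat (S n))%Z) N)%C.
Proof.
  induction N as [|N IH].
  - rewrite csym_succ, csym_0, sum_n_C_S, !sum_n_C_0; reflexivity.
  - rewrite csym_succ, IH, (sum_n_C_S (fun n => f (Z.of_nat n)) (S N)),
      (sum_n_C_S (fun n => f (- Z.of_nat (S n))%Z) N); ring.
Qed.

Lemma is_sumZ_Clim f l :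
  is_sumZ (V := C_R_NormedModule) f l -> Clim (csym f) l.
Proof.
  intros (lp & lm & Hp & Hm & ->).
  apply is_series_Clim in Hp; apply is_series_Clim in Hm.
  intros eps He.
  destruct (Hp (eps / 2) ltac:(lra)) as [N1 H1], (Hm (eps / 2) ltac:(lra)) as [N2 H2].
  exists (S (Nat.max N1 N2)); intros [|n] Hn; [lia|].
  rewrite csym_sum_n; change plus with Cplus.
  match goal with |- Cmod ((?a + ?b) - (lp + lm)) < _ =>
    replace ((a + b) - (lp + lm))%C with ((a - lp) + (b - lm))%C by ring end.
  eapply Rle_lt_trans; [apply Cmod_triangle|].
  generalize (H1 (S n) ltac:(lia)) (H2 n ltac:(lia)); lra.
Qed.

Lemma exp_mult_INR c n : exp (c * INR n) = exp c ^ n.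
Proof.
  induction n as [|n IH]; [now rewrite Rmult_0_r, exp_0|].
  rewrite S_INR, Rmult_plus_distr_l, Rmult_1_r, exp_plus, IH; cbn; ring.
Qed.

Lemma exp_monotone x y : x <= y -> exp x <= exp y.
Proof. intros [H| ->]; [left; now apply exp_increasing|right; reflexivity]. Qed.

Lemma ex_series_exp c : 0 < c -> ex_series (fun n => exp (- c * INR n)).
Proof.
  intros Hc; apply (ex_series_ext (fun n => exp (- c) ^ n)).
  - intros n; symmetry; apply exp_mult_INR.
  - apply ex_series_geom; rewrite Rabs_right by (left; apply exp_pos).
    rewrite <- exp_0; apply exp_increasing; lra.
Qed.

(** Convergence of the symmetric sums does not give convergence of the two halves. Exponential decay
    makes each half converge absolutely, and uniqueness of the limit then identifies the value. *)
Lemma is_sumZ_intro f l A c :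
  0 < c -> (forall k, Cmod (f k) <= A * exp (- c * IZR (Z.abs k))) ->
  Clim (csym f) l -> is_sumZ (V := C_R_NormedModule) f l.
Proof.
  intros Hc Hf Hl.
  assert (HA : 0 <= A).
  { generalize (Hf 0%Z) (Cmod_ge_0 (f 0%Z)).
    change (IZR (Z.abs 0)) with 0; rewrite Rmult_0_r, exp_0; lra. }
  assert (Hser : forall g : nat -> C,
    (forall n, Cmod (g n) <= A * exp (- c * INR n)) ->
    exists lg, is_series (V := C_R_NormedModule) g lg).
  { intros g Hg.
    destruct (ex_series_le (V := C_R_CompleteNormedModule) g
      (fun n => A * exp (- c * INR n))) as [lg Hlg].
    - intros n; rewrite <- Cmod_norm; apply Hg.
    - apply (ex_series_scal (V := R_NormedModule) A), ex_series_exp, Hc.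
    - now exists lg. }
  destruct (Hser (fun n => f (Z.of_nat n))) as [lp Hp].
  { intros n; eapply Rle_trans; [apply Hf|].
    rewrite Z.abs_eq, <- INR_IZR_INZ by lia; lra. }
  destruct (Hser (fun n => f (- Z.of_nat (S n))%Z)) as [lm Hm].
  { intros n; eapply Rle_trans; [apply Hf|].
    replace (Z.abs (- Z.of_nat (S n))) with (Z.of_nat (S n)) by lia.
    rewrite <- INR_IZR_INZ; apply Rmult_le_compat_l; [lra|].
    left; apply exp_increasing; rewrite S_INR; nra. }
  exists lp, lm; repeat split; auto.
  apply (Clim_unique (csym f)); [assumption|].
  apply is_sumZ_Clim; exists lp, lm; auto.
Qed.

(** * Exponentials *)

Lemma expi_plus s t : expi (s + t) = (expi s * expi t)%C.
Proof.
  unfold expi, Cmult; cbn [fst snd].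
  rewrite Rmult_plus_distr_l, cos_plus, sin_plus; f_equal; ring.
Qed.

Lemma Cmod_expi t : Cmod (expi t) = 1.
Proof.
  unfold Cmod, expi; cbn [fst snd].
  replace (cos (2 * PI * t) ^ 2 + sin (2 * PI * t) ^ 2) with 1; [apply sqrt_1|].
  generalize (sin2_cos2 (2 * PI * t)); unfold Rsqr; lra.
Qed.

Lemma expi_0 : expi 0 = RtoC 1.
Proof. unfold expi; rewrite Rmult_0_r, cos_0, sin_0; reflexivity. Qed.

Lemma expi_opp t : (expi t * expi (- t))%C = RtoC 1.
Proof. rewrite <- expi_plus, Rplus_opp_r; apply expi_0. Qed.

Lemma expi_nat n : expi (INR n) = RtoC 1.
Proof.
  induction n as [|n IH]; [apply expi_0|].
  rewrite S_INR, expi_plus, IH; unfold expi.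
  rewrite Rmult_1_r, cos_2PI, sin_2PI; change (1, 0) with (RtoC 1); ring.
Qed.

Lemma expi_Z k : expi (IZR k) = RtoC 1.
Proof.
  destruct (Z_le_gt_dec 0 k) as [Hk|Hk].
  - rewrite <- (Z2Nat.id k Hk), <- INR_IZR_INZ; apply expi_nat.
  - generalize (expi_opp (INR (Z.to_nat (- k)))); rewrite expi_nat.
    replace (- INR (Z.to_nat (- k))) with (IZR k); [intros <-; ring|].
    rewrite INR_IZR_INZ, Z2Nat.id, opp_IZR by lia; ring.
Qed.

Lemma expi_period t k : expi (t + IZR k) = expi t.
Proof. rewrite expi_plus, expi_Z; ring. Qed.

Lemma expi_eq1 t : expi t = RtoC 1 -> exists k : Z, t = IZR k.
Proof.
  intros H; unfold expi in H; injection H as H1 H2.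
  assert (H3 : sin (PI * t) = 0).
  { replace (2 * PI * t) with (2 * (PI * t)) in H1 by ring.
    rewrite cos_2a_sin in H1; nra. }
  apply sin_eq_0_0 in H3; destruct H3 as [k Hk]; exists k.
  apply (Rmult_eq_reg_l PI); [lra|apply PI_neq0].
Qed.

(** The character [e^(2 pi i k z)] at complex [z], written as modulus times phase. *)
Definition ez (k : Z) (z : C) : C :=
  (RtoC (exp (- (2 * PI * IZR k * Im z))) * expi (IZR k * Re z))%C.

Lemma ez_add k j z : ez (k + j) z = (ez k z * ez j z)%C.
Proof.
  unfold ez; rewrite plus_IZR.
  replace (- (2 * PI * (IZR k + IZR j) * Im z))
    with (- (2 * PI * IZR k * Im z) + - (2 * PI * IZR j * Im z)) by ring.
  replace ((IZR k + IZR j) * Re z) with (IZR k * Re z + IZR j * Re z) by ring.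
  rewrite exp_plus, expi_plus, RtoC_mult; ring.
Qed.

Lemma ez_0 z : ez 0 z = RtoC 1.
Proof.
  unfold ez; replace (- (2 * PI * 0 * Im z)) with 0 by ring.
  rewrite Rmult_0_l, exp_0, expi_0; ring.
Qed.

Lemma ez_plus k z w : ez k (z + w)%C = (ez k z * ez k w)%C.
Proof.
  unfold ez; cbn [Re Im fst snd Cplus].
  replace (- (2 * PI * IZR k * (snd z + snd w)))
    with (- (2 * PI * IZR k * snd z) + - (2 * PI * IZR k * snd w)) by ring.
  replace (IZR k * (fst z + fst w)) with (IZR k * fst z + IZR k * fst w) by ring.
  rewrite exp_plus, expi_plus, RtoC_mult; unfold Re, Im; ring.
Qed.

Lemma ez_real k (x : R) : ez k (RtoC x) = expi (IZR k * x).
Proof.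
  unfold ez; cbn; rewrite Rmult_0_r, Ropp_0, exp_0; ring.
Qed.

Lemma Cmod_ez k z : Cmod (ez k z) = exp (- (2 * PI * IZR k * Im z)).
Proof.
  unfold ez; rewrite Cmod_mult, Cmod_expi, Cmod_R, Rabs_right; [ring|].
  left; apply exp_pos.
Qed.

Lemma Cmod_ez_le k z y :
  Rabs (Im z) <= y -> Cmod (ez k z) <= exp (2 * PI * y * IZR (Z.abs k)).
Proof.
  intros H; rewrite Cmod_ez, abs_IZR; apply exp_monotone.
  replace (- (2 * PI * IZR k * Im z)) with (2 * PI * (- (IZR k * Im z))) by ring.
  rewrite (Rmult_assoc (2 * PI)).
  apply Rmult_le_compat_l; [generalize PI_RGT_0; lra|].
  eapply Rle_trans; [apply Rle_abs|].
  rewrite Rabs_Ropp, Rabs_mult, (Rmult_comm y).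
  apply Rmult_le_compat_l; [apply Rabs_pos|assumption].
Qed.

(** * Complex-valued functions of a real variable *)

Definition Ccont (F : R -> C) : Prop :=
  forall x eps, 0 < eps ->
    exists d, 0 < d /\ forall y, Rabs (y - x) < d -> Cmod (F y - F x) < eps.

Lemma Ccont_const c : Ccont (fun _ => c).
Proof.
  intros x eps He; exists 1; split; [lra|]; intros y _.
  replace (c - c)%C with (RtoC 0) by ring; now rewrite Cmod_0.
Qed.

Lemma Ccont_plus F G : Ccont F -> Ccont G -> Ccont (fun x => F x + G x)%C.
Proof.
  intros HF HG x eps He.
  destruct (HF x (eps / 2) ltac:(lra)) as (d1 & Hd1 & H1).
  destruct (HG x (eps / 2) ltac:(lra)) as (d2 & Hd2 & H2).
  exists (Rmin d1 d2); split; [now apply Rmin_pos|].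
  intros y Hy.
  replace (F y + G y - (F x + G x))%C with ((F y - F x) + (G y - G x))%C by ring.
  eapply Rle_lt_trans; [apply Cmod_triangle|].
  generalize (H1 y (Rlt_le_trans _ _ _ Hy (Rmin_l _ _)))
             (H2 y (Rlt_le_trans _ _ _ Hy (Rmin_r _ _))); lra.
Qed.

Lemma Ccont_mult F G : Ccont F -> Ccont G -> Ccont (fun x => F x * G x)%C.
Proof.
  intros HF HG x eps He.
  pose (M := 1 + Cmod (F x) + Cmod (G x)).
  generalize (Cmod_ge_0 (F x)) (Cmod_ge_0 (G x)); intros HFx HGx.
  assert (HM : 1 <= M) by (unfold M; lra).
  pose (e := Rmin 1 (eps / (3 * M))).
  assert (He' : 0 < e).
  { apply Rmin_pos; [lra|apply Rdiv_lt_0_compat; lra]. }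
  destruct (HF x e He') as (d1 & Hd1 & H1).
  destruct (HG x e He') as (d2 & Hd2 & H2).
  exists (Rmin d1 d2); split; [now apply Rmin_pos|].
  intros y Hy.
  specialize (H1 y (Rlt_le_trans _ _ _ Hy (Rmin_l _ _))).
  specialize (H2 y (Rlt_le_trans _ _ _ Hy (Rmin_r _ _))).
  assert (He1 : e <= 1) by apply Rmin_l.
  assert (He2 : e * (3 * M) <= eps).
  { replace eps with (eps / (3 * M) * (3 * M)) by (field; lra).
    apply Rmult_le_compat_r; [lra|apply Rmin_r]. }
  replace (F y * G y - F x * G x)%C
    with ((F y - F x) * (G y - G x) + F x * (G y - G x) + (F y - F x) * G x)%C by ring.
  eapply Rle_lt_trans; [apply Cmod_triangle|].
  eapply Rle_lt_trans; [apply Rplus_le_compat_r, Cmod_triangle|].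
  rewrite !Cmod_mult.
  generalize (Cmod_ge_0 (F y - F x)) (Cmod_ge_0 (G y - G x)); intros H3 H4.
  set (a := Cmod (F y - F x)) in *; set (b := Cmod (G y - G x)) in *.
  assert (a * b <= e * M) by nra.
  assert (Cmod (F x) * b <= M * e) by (apply Rmult_le_compat; unfold M; lra).
  assert (a * Cmod (G x) <= e * M) by (apply Rmult_le_compat; unfold M; lra).
  assert (a * b < e * M); [|lra].
  apply Rle_lt_trans with (e * b); [nra|].
  apply Rmult_lt_compat_l; lra.
Qed.

Lemma Ccont_minus F G : Ccont F -> Ccont G -> Ccont (fun x => F x - G x)%C.
Proof.
  intros HF HG; apply Ccont_plus; [assumption|].
  intros x eps He; destruct (HG x eps He) as (d & Hd & H).
  exists d; split; [assumption|]; intros y Hy.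
  replace (- G y - - G x)%C with (- (G y - G x))%C by ring.
  rewrite Cmod_opp; auto.
Qed.

Lemma Ccont_shift F s : Ccont F -> Ccont (fun x => F (x + s)).
Proof.
  intros HF x eps He; destruct (HF (x + s) eps He) as (d & Hd & H).
  exists d; split; [assumption|]; intros y Hy; apply H.
  now replace (y + s - (x + s)) with (y - x) by ring.
Qed.

Lemma Ccont_ext F G : (forall x, F x = G x) -> Ccont F -> Ccont G.
Proof.
  intros E HF x eps He; destruct (HF x eps He) as (d & Hd & H).
  exists d; split; [assumption|]; intros y Hy; rewrite <- !E; auto.
Qed.

Lemma Ccont_continuous F x :
  Ccont F -> continuous (U := C_R_NormedModule) F x.
Proof.
  intros HF; apply (filterlim_locally_ball_norm (K := R_AbsRing) (U := C_R_NormedModule)).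
  intros eps; destruct (HF x eps (cond_pos eps)) as (d & Hd & H).
  exists (mkposreal d Hd); intros y Hy.
  unfold ball_norm; rewrite <- Cmod_norm; exact (H y Hy).
Qed.

Lemma Cmod_le_Rabs (z : C) : Cmod z <= Rabs (Re z) + Rabs (Im z).
Proof.
  replace z with (RtoC (Re z) + Ci * RtoC (Im z))%C at 1.
  - eapply Rle_trans; [apply Cmod_triangle|].
    rewrite Cmod_mult, Cmod_Ci, !Cmod_R; lra.
  - destruct z as [x y]; unfold Cplus, Cmult, RtoC, Ci, Re, Im; cbn [fst snd].
    f_equal; ring.
Qed.

Lemma im_le_Cmod (z : C) : Rabs (Im z) <= Cmod z.
Proof. eapply Rle_trans; [apply Rmax_r|apply Rmax_Cmod]. Qed.

(** Both bounds come from [1 + t <= exp t]: taken at [- t] it gives [exp t <= 1 / (1 - t)], which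
    [1 + t + 2 t^2] dominates for [|t| <= 1/2]. *)
Lemma Rabs_exp_taylor t : Rabs t <= / 2 -> Rabs (exp t - 1 - t) <= 2 * t ^ 2.
Proof.
  intros Ht; apply Rabs_le_between in Ht.
  generalize (exp_ineq1_le t) (exp_ineq1_le (- t)); intros H1 H2.
  assert (H3 : exp t * exp (- t) = 1) by (rewrite <- exp_plus, Rplus_opp_r; apply exp_0).
  assert (H4 : exp t * (1 + - t) <= 1).
  { rewrite <- H3 at 2; apply Rmult_le_compat_l; [left; apply exp_pos|assumption]. }
  apply Rabs_le; split; [nra|].
  assert (1 <= (1 + t + 2 * t ^ 2) * (1 - t)) by nra.
  assert (exp t <= 1 + t + 2 * t ^ 2); [|lra].
  apply (Rmult_le_reg_r (1 - t)); lra.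
Qed.

Lemma Rabs_sin_le x : Rabs (sin x) <= Rabs x.
Proof.
  destruct (MVT_abs sin cos 0 x) as (c & Hc & _).
  - intros c _; apply derivable_pt_lim_sin.
  - rewrite sin_0, !Rminus_0_r in Hc; rewrite Hc.
    assert (Rabs (cos c) <= 1) by (apply Rabs_le; apply COS_bound).
    generalize (Rabs_pos x); nra.
Qed.

Lemma Rabs_cos_taylor x : Rabs (cos x - 1) <= x ^ 2.
Proof.
  replace x with (2 * (x / 2)) at 1 by field.
  rewrite cos_2a_sin.
  replace (1 - 2 * sin (x / 2) * sin (x / 2) - 1) with (- (2 * (sin (x / 2)) ^ 2)) by ring.
  rewrite Rabs_Ropp, Rabs_right by nra.
  generalize (Rabs_sin_le (x / 2)); intros H.
  apply pow_maj_Rabs with (n := 2%nat) in H; rewrite pow2_abs in H.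
  nra.
Qed.

Lemma Rabs_sin_taylor x : Rabs x <= 1 -> Rabs (sin x - x) <= x ^ 2.
Proof.
  intros Hx.
  destruct (MVT_gen sin 0 x cos) as (e & He & Hd).
  - intros t _; apply is_derive_Reals, derivable_pt_lim_sin.
  - intros t _; apply continuity_sin.
  - rewrite sin_0, !Rminus_0_r in Hd.
    replace (sin x - x) with ((cos e - 1) * x) by (rewrite Hd; ring).
    rewrite Rabs_mult.
    generalize (Rabs_cos_taylor e) (Rabs_pos x); intros H1 H2.
    assert (H3 : Rabs e <= Rabs x).
    { unfold Rmin, Rmax in He; destruct (Rle_dec 0 x).
      - rewrite !Rabs_right; lra.
      - rewrite !Rabs_left1; lra. }
    assert (H4 : e ^ 2 <= x ^ 2) by (rewrite <- (pow2_abs e), <- (pow2_abs x); apply pow_incr; split; [apply Rabs_pos|assumption]).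
    rewrite <- (pow2_abs x) in *; nra.
Qed.

Lemma Cmod_sqr_re_im (w : C) : Cmod w ^ 2 = Re w ^ 2 + Im w ^ 2.
Proof. apply Cmod2_alt. Qed.

Lemma ez_taylor k : exists B s, 0 < s /\ 0 <= B /\
  forall w, Cmod w <= s -> Cmod (ez k w - 1 - w * (RtoC (2 * PI * IZR k) * Ci)) <= B * Cmod w ^ 2.
Proof.
  pose (K := 2 * PI * Rabs (IZR k) + 1).
  assert (HP := PI_RGT_0).
  assert (HK : 1 <= K) by (generalize (Rabs_pos (IZR k)); unfold K; nra).
  exists (12 * K ^ 2), (/ (2 * K)).
  split; [apply Rinv_0_lt_compat; lra|split; [nra|]].
  intros w Hw.
  set (a := 2 * PI * IZR k * Re w); set (b := - (2 * PI * IZR k * Im w)).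
  assert (Hq : forall t, Rabs t <= Cmod w ->
    Rabs (2 * PI * IZR k * t) <= / 2 /\ (2 * PI * IZR k * t) ^ 2 <= K ^ 2 * t ^ 2).
  { intros t Ht; split.
    - rewrite !Rabs_mult, (Rabs_right 2), (Rabs_right PI) by lra.
      apply Rle_trans with (K * / (2 * K)); [|right; field; lra].
      apply Rmult_le_compat; [|apply Rabs_pos| |lra].
      + generalize (Rabs_pos (IZR k)); nra.
      + unfold K; lra.
    - rewrite Rpow_mult_distr; apply Rmult_le_compat_r; [apply pow2_ge_0|].
      rewrite <- (pow2_abs (2 * PI * IZR k)), !Rabs_mult, (Rabs_right 2), (Rabs_right PI) by lra.
      apply pow_incr; split; [generalize (Rabs_pos (IZR k)); nra|unfold K; lra]. }
  destruct (Hq (Re w) (re_le_Cmod w)) as [Ha1 Ha2].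
  destruct (Hq (Im w) (im_le_Cmod w)) as [Hb1 Hb2].
  fold a in Ha1, Ha2.
  assert (Hb3 : Rabs b <= / 2) by (unfold b; rewrite Rabs_Ropp; exact Hb1).
  assert (Hb4 : b ^ 2 <= K ^ 2 * Im w ^ 2) by (unfold b; nra).
  replace (ez k w - 1 - w * (RtoC (2 * PI * IZR k) * Ci))%C
    with ((exp b * cos a - 1 - b, exp b * sin a - a) : C).
  2:{ unfold ez, expi; fold b.
      replace (2 * PI * (IZR k * Re w)) with a by (unfold a; ring).
      unfold Cminus, Cplus, Copp, Cmult, RtoC, Ci; cbn [fst snd]; unfold a, b, Re, Im.
      f_equal; ring. }
  eapply Rle_trans; [apply Cmod_le_Rabs|]; cbn [Re Im fst snd].
  assert (E1 := Rabs_exp_taylor b Hb3).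
  assert (E2 := Rabs_cos_taylor a).
  assert (E3 := Rabs_sin_taylor a ltac:(lra)).
  assert (Hexp : exp b <= 3).
  { apply Rabs_le_between in E1; apply Rabs_le_between in Hb3; nra. }
  assert (Hexp0 := exp_pos b).
  replace (exp b * cos a - 1 - b) with ((exp b - 1 - b) + exp b * (cos a - 1)) by ring.
  replace (exp b * sin a - a) with (exp b * (sin a - a) + a * (exp b - 1 - b) + a * b) by ring.
  assert (T1 : Rabs (exp b - 1 - b + exp b * (cos a - 1)) <= 2 * b ^ 2 + 3 * a ^ 2).
  { eapply Rle_trans; [apply Rabs_triang|]; rewrite (Rabs_mult (exp b)), (Rabs_right (exp b)) by lra.
    generalize (Rabs_pos (cos a - 1)); nra. }
  assert (T2 : Rabs (exp b * (sin a - a) + a * (exp b - 1 - b) + a * b)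
    <= 3 * a ^ 2 + 2 * b ^ 2 + (a ^ 2 + b ^ 2)).
  { eapply Rle_trans; [apply Rabs_triang|].
    eapply Rle_trans; [apply Rplus_le_compat_r, Rabs_triang|].
    rewrite !Rabs_mult, (Rabs_right (exp b)) by lra.
    assert (Rabs a * Rabs b <= a ^ 2 + b ^ 2).
    { rewrite <- (pow2_abs a), <- (pow2_abs b); generalize (Rabs_pos a) (Rabs_pos b); nra. }
    generalize (Rabs_pos (sin a - a)) (Rabs_pos (exp b - 1 - b)) (Rabs_pos a); nra. }
  rewrite Cmod_sqr_re_im; nra.
Qed.

Lemma expi_ez t : expi t = ez 1 (RtoC t).
Proof. rewrite ez_real; f_equal; ring. Qed.

Lemma Ccont_expi k : Ccont (fun x => expi (k * x)).
Proof.
  intros x eps He.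
  destruct (ez_taylor 1) as (B & s & Hs & HB & H).
  pose (L := B * s + 2 * PI).
  assert (HP := PI_RGT_0).
  assert (HL : 0 < L) by (unfold L; nra).
  pose (m := Rmin s (eps / L)).
  assert (Hm : 0 < m) by (apply Rmin_pos; [lra|now apply Rdiv_lt_0_compat]).
  assert (Hk : 0 < Rabs k + 1) by (generalize (Rabs_pos k); lra).
  exists (m / (Rabs k + 1)); split; [now apply Rdiv_lt_0_compat|].
  intros y Hy.
  replace (k * y) with (k * x + k * (y - x)) by ring.
  rewrite expi_plus.
  replace (expi (k * x) * expi (k * (y - x)) - expi (k * x))%C
    with (expi (k * x) * (expi (k * (y - x)) - 1))%C by ring.
  rewrite Cmod_mult, Cmod_expi, Rmult_1_l.
  set (t := k * (y - x)).
  assert (Ht : Rabs t < m).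
  { unfold t; rewrite Rabs_mult.
    apply (Rmult_lt_compat_r (Rabs k + 1)) in Hy; [|lra].
    unfold Rdiv in Hy; rewrite Rmult_assoc, Rinv_l in Hy by lra.
    generalize (Rabs_pos (y - x)) (Rabs_pos k); nra. }
  assert (Hts : Rabs t <= s) by (eapply Rle_trans; [left; exact Ht|apply Rmin_l]).
  assert (HtL : L * Rabs t < eps).
  { apply Rlt_le_trans with (L * (eps / L)); [|right; field; lra].
    apply Rmult_lt_compat_l; [lra|].
    eapply Rlt_le_trans; [exact Ht|apply Rmin_r]. }
  specialize (H (RtoC t)); rewrite Cmod_R in H; specialize (H Hts).
  rewrite expi_ez.
  replace (ez 1 (RtoC t) - 1)%C with ((ez 1 (RtoC t) - 1 - RtoC t * (RtoC (2 * PI * 1) * Ci))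
    + RtoC t * (RtoC (2 * PI * 1) * Ci))%C by ring.
  eapply Rle_lt_trans; [apply Cmod_triangle|].
  eapply Rle_lt_trans; [|exact HtL].
  rewrite !Cmod_mult, Cmod_Ci, !Cmod_R, (Rabs_right (2 * PI * 1)) by nra.
  assert (Hb : B * Rabs t ^ 2 <= B * s * Rabs t).
  { rewrite Rmult_assoc; apply Rmult_le_compat_l; [lra|].
    generalize (Rabs_pos t); nra. }
  unfold L; lra.
Qed.

Definition Cint (F : R -> C) : C := RInt (V := C_R_CompleteNormedModule) F 0 1.

Lemma ex_RInt_Ccont F a b : Ccont F -> ex_RInt (V := C_R_NormedModule) F a b.
Proof.
  intros HF; apply (ex_RInt_continuous (V := C_R_CompleteNormedModule)).
  intros z _; now apply Ccont_continuous.
Qed.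

Lemma Cint_correct F : Ccont F -> is_RInt (V := C_R_NormedModule) F 0 1 (Cint F).
Proof.
  intros HF; apply (RInt_correct (V := C_R_CompleteNormedModule)), ex_RInt_Ccont, HF.
Qed.

Lemma Cint_unique F l : is_RInt (V := C_R_NormedModule) F 0 1 l -> Cint F = l.
Proof. apply (is_RInt_unique (V := C_R_CompleteNormedModule)). Qed.

Lemma Cint_ext F G : (forall x, F x = G x) -> Cint F = Cint G.
Proof. intros H; apply (RInt_ext (V := C_R_CompleteNormedModule)); intros x _; apply H. Qed.

Lemma Cint_plus F G :
  Ccont F -> Ccont G -> Cint (fun x => F x + G x)%C = (Cint F + Cint G)%C.
Proof.
  intros HF HG; apply Cint_unique.
  apply (is_RInt_plus (V := C_R_NormedModule)); now apply Cint_correct.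
Qed.

Lemma Cint_minus F G :
  Ccont F -> Ccont G -> Cint (fun x => F x - G x)%C = (Cint F - Cint G)%C.
Proof.
  intros HF HG; apply Cint_unique.
  apply (is_RInt_minus (V := C_R_NormedModule)); now apply Cint_correct.
Qed.

Lemma scal_1_C (c : C) : scal (V := C_R_NormedModule) 1 c = c.
Proof. exact (scal_one (V := C_R_NormedModule) c). Qed.

Lemma Cint_const c : Cint (fun _ => c) = c.
Proof.
  apply Cint_unique.
  assert (H := is_RInt_const (V := C_R_NormedModule) 0 1 c).
  rewrite Rminus_0_r, scal_1_C in H; exact H.
Qed.

Lemma Cint_scal c F : Ccont F -> Cint (fun x => c * F x)%C = (c * Cint F)%C.
Proof.
  intros HF; apply Cint_unique.
  assert (H := Cint_correct F HF).
  assert (H1 := is_RInt_fct_extend_fst (U := R_NormedModule) (V := R_NormedModule) F 0 1 _ H).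
  assert (H2 := is_RInt_fct_extend_snd (U := R_NormedModule) (V := R_NormedModule) F 0 1 _ H).
  unfold Cmult at 2.
  apply (is_RInt_fct_extend_pair (U := R_NormedModule) (V := R_NormedModule)); cbn [fst snd Cmult].
  - apply (is_RInt_minus (V := R_NormedModule)); apply (is_RInt_scal (V := R_NormedModule)); assumption.
  - apply (is_RInt_plus (V := R_NormedModule)); apply (is_RInt_scal (V := R_NormedModule)); assumption.
Qed.

Lemma Cmod_Cint_le F M :
  Ccont F -> (forall x, Cmod (F x) <= M) -> Cmod (Cint F) <= M.
Proof.
  intros HF HM; rewrite Cmod_norm.
  apply (norm_RInt_le (V := C_R_NormedModule) F (fun _ => M) 0 1).
  - lra.
  - intros x _; rewrite <- Cmod_norm; apply HM.
  - now apply Cint_correct.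
  - assert (H := is_RInt_const (V := R_NormedModule) 0 1 M).
    rewrite Rminus_0_r in H; unfold scal in H; cbn in H; unfold mult in H; cbn in H.
    rewrite Rmult_1_l in H; exact H.
Qed.

Lemma Cint_shift F s :
  Ccont F -> (forall x, F (x + 1) = F x) -> Cint (fun x => F (x + s)) = Cint F.
Proof.
  intros HF Hper; apply Cint_unique.
  destruct (ex_RInt_Ccont F 0 s HF) as [l Hl].
  assert (H1 : is_RInt (V := C_R_NormedModule) F 1 (1 + s) l).
  { apply (is_RInt_ext (V := C_R_NormedModule) (fun x => scal 1 (F (1 * x + -1)))).
    - intros x _; rewrite scal_1_C.
      rewrite <- Hper; f_equal; ring.
    - apply (is_RInt_comp_lin (V := C_R_NormedModule)).
      replace (1 * 1 + -1) with 0 by ring; replace (1 * (1 + s) + -1) with s by ring.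
      assumption. }
  assert (H2 : is_RInt (V := C_R_NormedModule) F s (1 + s) (Cint F)).
  { replace (Cint F) with (plus (G := C_R_NormedModule) (plus (G := C_R_NormedModule) (opp l) (Cint F)) l).
    - apply (is_RInt_Chasles (V := C_R_NormedModule)) with 1; [|assumption].
      apply (is_RInt_Chasles (V := C_R_NormedModule)) with 0; [|now apply Cint_correct].
      now apply (is_RInt_swap (V := C_R_NormedModule)).
    - change (((- l + Cint F) + l)%C = Cint F); ring. }
  apply (is_RInt_ext (V := C_R_NormedModule) (fun x => scal 1 (F (1 * x + s)))).
  - intros x _; rewrite scal_1_C.
    f_equal; ring.
  - apply (is_RInt_comp_lin (V := C_R_NormedModule)).
    replace (1 * 0 + s) with s by ring; replace (1 * 1 + s) with (1 + s) by ring.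
    assumption.
Qed.

(** Translating by half a wavelength, [1 / (2 k)], negates the integrand, so the integral equals its
    own negative. *)
Lemma Cint_expi k : k <> 0%Z -> Cint (fun x => expi (IZR k * x)) = RtoC 0.
Proof.
  intros Hk; assert (Hk' : IZR k <> 0) by now apply not_0_IZR.
  set (F := fun x => expi (IZR k * x)).
  assert (HF : Ccont F) by apply Ccont_expi.
  assert (Hper : forall x, F (x + 1) = F x).
  { intros x; unfold F; replace (IZR k * (x + 1)) with (IZR k * x + IZR k) by ring.
    apply expi_period. }
  assert (H : Cint F = (- RtoC 1 * Cint F)%C).
  { rewrite <- (Cint_shift F (/ (2 * IZR k)) HF Hper) at 1.
    rewrite <- Cint_scal by assumption; apply Cint_ext; intros x; unfold F.
    replace (IZR k * (x + / (2 * IZR k))) with (/ 2 + IZR k * x) by (field; assumption).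
    rewrite expi_plus; f_equal; unfold expi.
    replace (2 * PI * / 2) with PI by field.
    rewrite cos_PI, sin_PI; unfold Copp, RtoC; cbn [fst snd]; f_equal; ring. }
  apply Cmod_eq_0.
  assert (H2 : Cmod (RtoC 2 * Cint F)%C = 0).
  { replace (RtoC 2 * Cint F)%C with (Cint F - (- RtoC 1 * Cint F))%C by ring.
    rewrite <- H; replace (Cint F - Cint F)%C with (RtoC 0) by ring; apply Cmod_0. }
  rewrite Cmod_mult, Cmod_R, Rabs_right in H2; lra.
Qed.

(** * Periodic holomorphic functions on a strip *)

(* Uniform complex differentiability with a quadratic remainder; this is all of
   holomorphy that is needed to shift contours. *)
Definition holo_strip (h : R) (f : C -> C) : Prop :=
  (forall z, Rabs (Im z) <= h -> f (z + 1)%C = f z) /\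
  exists B s, 0 < s /\ 0 <= B /\
    forall z, Rabs (Im z) <= h -> Cmod (f z) <= B /\
      exists d, Cmod d <= B /\
        forall w, Rabs (Im (z + w)%C) <= h -> Cmod w <= s ->
          Cmod (f (z + w)%C - f z - w * d) <= B * Cmod w ^ 2.

Lemma holo_strip_const h c : holo_strip h (fun _ => c).
Proof.
  split; [reflexivity|].
  exists (Cmod c), 1; split; [lra|]; split; [apply Cmod_ge_0|].
  intros z _; split; [lra|].
  exists (RtoC 0); rewrite Cmod_0; split; [apply Cmod_ge_0|].
  intros w _ _; replace (c - c - w * 0)%C with (RtoC 0) by ring; rewrite Cmod_0.
  generalize (Cmod_ge_0 c) (Cmod_ge_0 w); nra.
Qed.

Lemma holo_strip_plus h f g :
  holo_strip h f -> holo_strip h g -> holo_strip h (fun z => f z + g z)%C.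
Proof.
  intros (Pf & B1 & s1 & Hs1 & HB1 & Hf) (Pg & B2 & s2 & Hs2 & HB2 & Hg).
  split; [intros z Hz; now rewrite Pf, Pg|].
  exists (B1 + B2), (Rmin s1 s2); split; [now apply Rmin_pos|]; split; [lra|].
  intros z Hz.
  destruct (Hf z Hz) as (Bf & d1 & Hd1 & Df), (Hg z Hz) as (Bg & d2 & Hd2 & Dg).
  split; [eapply Rle_trans; [apply Cmod_triangle|lra]|].
  exists (d1 + d2)%C; split; [eapply Rle_trans; [apply Cmod_triangle|lra]|].
  intros w Hw Hws.
  specialize (Df w Hw (Rle_trans _ _ _ Hws (Rmin_l _ _))).
  specialize (Dg w Hw (Rle_trans _ _ _ Hws (Rmin_r _ _))).
  replace (f (z + w) + g (z + w) - (f z + g z) - w * (d1 + d2))%C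
    with ((f (z + w) - f z - w * d1) + (g (z + w) - g z - w * d2))%C by ring.
  eapply Rle_trans; [apply Cmod_triangle|lra].
Qed.

Lemma holo_strip_mult h f g :
  holo_strip h f -> holo_strip h g -> holo_strip h (fun z => f z * g z)%C.
Proof.
  intros (Pf & B1 & s1 & Hs1 & HB1 & Hf) (Pg & B2 & s2 & Hs2 & HB2 & Hg).
  split; [intros z Hz; now rewrite Pf, Pg|].
  pose (B := 1 + B1 + B2).
  exists (4 * B ^ 2), (Rmin 1 (Rmin s1 s2)).
  split; [apply Rmin_pos; [lra|now apply Rmin_pos]|]; split; [nra|].
  assert (HB : 1 <= B) by (unfold B; lra).
  intros z Hz.
  destruct (Hf z Hz) as (Bf & d1 & Hd1 & Df), (Hg z Hz) as (Bg & d2 & Hd2 & Dg).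
  assert (HfB : Cmod (f z) <= B) by (unfold B; lra).
  assert (HgB : Cmod (g z) <= B) by (unfold B; lra).
  assert (Hd1B : Cmod d1 <= B) by (unfold B; lra).
  assert (Hd2B : Cmod d2 <= B) by (unfold B; lra).
  assert (Hmul : forall a b, Cmod a <= B -> Cmod b <= B -> Cmod (a * b) <= B ^ 2).
  { intros a b Ha Hb; rewrite Cmod_mult.
    generalize (Cmod_ge_0 a) (Cmod_ge_0 b); nra. }
  split; [generalize (Hmul _ _ HfB HgB); nra|].
  exists (f z * d2 + d1 * g z)%C; split.
  { eapply Rle_trans; [apply Cmod_triangle|].
    generalize (Hmul _ _ HfB Hd2B) (Hmul _ _ Hd1B HgB); nra. }
  intros w Hw Hws.
  assert (Hw1 : Cmod w <= 1) by (eapply Rle_trans; [exact Hws|apply Rmin_l]).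
  assert (Hws' := Rle_trans _ _ _ Hws (Rmin_r _ _)).
  specialize (Df w Hw (Rle_trans _ _ _ Hws' (Rmin_l _ _))).
  specialize (Dg w Hw (Rle_trans _ _ _ Hws' (Rmin_r _ _))).
  destruct (Hg (z + w)%C Hw) as (Bgw & _).
  set (e1 := (f (z + w) - f z - w * d1)%C) in *.
  set (e2 := (g (z + w) - g z - w * d2)%C) in *.
  replace (f (z + w) * g (z + w) - f z * g z - w * (f z * d2 + d1 * g z))%C
    with (f z * e2 + w * w * (d1 * d2) + w * (d1 * e2) + e1 * g (z + w)%C)%C
    by (unfold e1, e2; ring).
  generalize (Cmod_ge_0 w) (Cmod_ge_0 e1) (Cmod_ge_0 e2) (Hmul _ _ Hd1B Hd2B); intros W0 E1 E2 H12.
  assert (He1 : Cmod e1 <= B * Cmod w ^ 2) by (eapply Rle_trans; [exact Df|apply Rmult_le_compat_r; [nra|unfold B; lra]]).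
  assert (He2 : Cmod e2 <= B * Cmod w ^ 2) by (eapply Rle_trans; [exact Dg|apply Rmult_le_compat_r; [nra|unfold B; lra]]).
  assert (Hq : 0 <= Cmod w ^ 2) by nra.
  assert (T1 : Cmod (f z * e2) <= B ^ 2 * Cmod w ^ 2).
  { rewrite Cmod_mult; generalize (Cmod_ge_0 (f z)); intros.
    replace (B ^ 2 * Cmod w ^ 2) with (B * (B * Cmod w ^ 2)) by ring.
    now apply Rmult_le_compat. }
  assert (T2 : Cmod (w * w * (d1 * d2)) <= B ^ 2 * Cmod w ^ 2).
  { rewrite Cmod_mult, (Cmod_mult w w).
    replace (B ^ 2 * Cmod w ^ 2) with (Cmod w * Cmod w * B ^ 2) by ring.
    apply Rmult_le_compat_l; [nra|assumption]. }
  assert (T3 : Cmod (w * (d1 * e2)) <= B ^ 2 * Cmod w ^ 2).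
  { rewrite !Cmod_mult.
    replace (B ^ 2 * Cmod w ^ 2) with (1 * (B * (B * Cmod w ^ 2))) by ring.
    generalize (Cmod_ge_0 d1); intros.
    apply Rmult_le_compat; [assumption|nra|assumption|].
    now apply Rmult_le_compat. }
  assert (T4 : Cmod (e1 * g (z + w)%C) <= B ^ 2 * Cmod w ^ 2).
  { rewrite Cmod_mult.
    replace (B ^ 2 * Cmod w ^ 2) with ((B * Cmod w ^ 2) * B) by ring.
    apply Rmult_le_compat; [assumption|apply Cmod_ge_0|assumption|unfold B; lra]. }
  eapply Rle_trans; [apply Cmod_triangle|].
  eapply Rle_trans; [apply Rplus_le_compat_r, Cmod_triangle|].
  eapply Rle_trans; [apply Rplus_le_compat_r, Rplus_le_compat_r, Cmod_triangle|].
  lra.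
Qed.

Lemma holo_strip_translate h f (a : R) :
  holo_strip h f -> holo_strip h (fun z => f (z + RtoC a)%C).
Proof.
  intros (Pf & B & s & Hs & HB & Hf).
  assert (HI : forall z, Im (z + RtoC a)%C = Im z) by (intros [x y]; cbn; ring).
  split.
  - intros z Hz; replace (z + 1 + RtoC a)%C with (z + RtoC a + 1)%C by ring.
    apply Pf; now rewrite HI.
  - exists B, s; split; [assumption|]; split; [assumption|]; intros z Hz.
    destruct (Hf (z + RtoC a)%C) as (Hb & d & Hd & Df); [now rewrite HI|].
    split; [assumption|]; exists d; split; [assumption|]; intros w Hw Hws.
    replace (z + w + RtoC a)%C with (z + RtoC a + w)%C by ring; apply Df; [|assumption].
    replace (z + RtoC a + w)%C with (z + w + RtoC a)%C by ring; now rewrite HI.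
Qed.

Lemma ez_period k z : ez k (z + 1)%C = ez k z.
Proof.
  rewrite ez_plus, ez_real, Rmult_1_r, expi_Z; ring.
Qed.

Lemma holo_strip_ez h k : 0 <= h -> holo_strip h (ez k).
Proof.
  intros Hh; split; [intros z _; apply ez_period|].
  destruct (ez_taylor k) as (B & s & Hs & HB & H).
  pose (M := exp (2 * PI * h * IZR (Z.abs k))).
  pose (D := Cmod (RtoC (2 * PI * IZR k) * Ci)).
  assert (HM : 0 < M) by apply exp_pos.
  assert (HD : 0 <= D) by apply Cmod_ge_0.
  exists (M * (1 + B + D)), s; split; [assumption|]; split; [nra|].
  intros z Hz; assert (Hez := Cmod_ez_le k z h Hz); fold M in Hez.
  assert (H0 := Cmod_ge_0 (ez k z)).
  split; [nra|].
  exists (ez k z * (RtoC (2 * PI * IZR k) * Ci))%C; split.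
  - rewrite Cmod_mult; fold D; nra.
  - intros w _ Hws; specialize (H w Hws).
    rewrite ez_plus.
    replace (ez k z * ez k w - ez k z - w * (ez k z * (RtoC (2 * PI * IZR k) * Ci)))%C
      with (ez k z * (ez k w - 1 - w * (RtoC (2 * PI * IZR k) * Ci)))%C by ring.
    rewrite Cmod_mult.
    assert (HQ := pow2_ge_0 (Cmod w)).
    apply Rle_trans with (M * (B * Cmod w ^ 2)).
    + apply Rmult_le_compat; [assumption|apply Cmod_ge_0|assumption|assumption].
    + rewrite Rmult_assoc; apply Rmult_le_compat_l; [lra|]; nra.
Qed.

Lemma holo_strip_bounded h f :
  holo_strip h f -> exists B, 0 <= B /\ forall z, Rabs (Im z) <= h -> Cmod (f z) <= B.
Proof.
  intros (_ & B & s & _ & HB & H); exists B; split; [assumption|].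
  intros z Hz; apply (H z Hz).
Qed.

Lemma holo_strip_line h f z :
  holo_strip h f -> Rabs (Im z) <= h -> Ccont (fun x => f (z + RtoC x)%C).
Proof.
  intros (_ & B & s & Hs & HB & H) Hz x eps He.
  assert (HI : forall t, Im (z + RtoC t)%C = Im z) by (intros t; destruct z; cbn; ring).
  pose (L := B + B * s + 1).
  assert (HL : 0 < L) by (unfold L; nra).
  exists (Rmin s (eps / L)); split; [apply Rmin_pos; [lra|now apply Rdiv_lt_0_compat]|].
  intros y Hy.
  destruct (H (z + RtoC x)%C) as (_ & d & Hd & D); [now rewrite HI|].
  specialize (D (RtoC (y - x))).
  replace (z + RtoC x + RtoC (y - x))%C with (z + RtoC y)%C in D by (rewrite RtoC_minus; ring).
  rewrite HI, Cmod_R in D.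
  assert (Hys : Rabs (y - x) <= s) by (left; eapply Rlt_le_trans; [exact Hy|apply Rmin_l]).
  specialize (D Hz Hys).
  replace (f (z + RtoC y) - f (z + RtoC x))%C with
    ((f (z + RtoC y) - f (z + RtoC x) - RtoC (y - x) * d) + RtoC (y - x) * d)%C by ring.
  eapply Rle_lt_trans; [apply Cmod_triangle|].
  rewrite Cmod_mult, Cmod_R.
  assert (HyL : L * Rabs (y - x) < eps).
  { apply Rlt_le_trans with (L * (eps / L)); [|right; field; lra].
    apply Rmult_lt_compat_l; [lra|].
    eapply Rlt_le_trans; [exact Hy|apply Rmin_r]. }
  eapply Rle_lt_trans; [|exact HyL].
  generalize (Rabs_pos (y - x)); intros Hp.
  assert (B * Rabs (y - x) ^ 2 <= B * s * Rabs (y - x)).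
  { rewrite Rmult_assoc; apply Rmult_le_compat_l; [lra|]; nra. }
  unfold L; nra.
Qed.

(** Cut [[0, y]] into [N] equal steps: each changes [P] by at most [C0 (y / N)^2], hence all
    together by [C0 y^2 / N], which is arbitrarily small. *)
Lemma quadratic_increment_const (P : R -> C) (h C0 s : R) :
  0 < s -> 0 <= C0 ->
  (forall y y', Rabs y <= h -> Rabs y' <= h -> Rabs (y' - y) <= s ->
     Cmod (P y' - P y) <= C0 * (y' - y) ^ 2) ->
  forall y, Rabs y <= h -> P y = P 0.
Proof.
  intros Hs HC H y Hy.
  assert (Hmain : forall n : nat, Rabs y <= s * INR (S n) ->
    Cmod (P y - P 0) <= C0 * y ^ 2 * / INR (S n)).
  { intros n Hn.
    assert (HN : 0 < INR (S n)) by (apply lt_0_INR; lia).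
    assert (Hi : forall i, (i <= S n)%nat ->
      Cmod (P (INR i * (y / INR (S n)))%R - P 0) <= INR i * (C0 * (y / INR (S n)) ^ 2)).
    { intros i; induction i as [|i IH]; intros Hi.
      - change (INR 0) with 0; rewrite !Rmult_0_l.
        replace (P 0 - P 0)%C with (RtoC 0) by ring; rewrite Cmod_0; lra.
      - replace (P (INR (S i) * (y / INR (S n)))%R - P 0)%C with
          ((P (INR (S i) * (y / INR (S n)))%R - P (INR i * (y / INR (S n)))%R)
           + (P (INR i * (y / INR (S n)))%R - P 0))%C by ring.
        eapply Rle_trans; [apply Cmod_triangle|].
        specialize (IH ltac:(lia)).
        assert (Hin : forall j, (j <= S n)%nat -> Rabs (INR j * (y / INR (S n))) <= h).
        { intros j Hj; apply le_INR in Hj.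
          assert (Hj0 := pos_INR j).
          unfold Rdiv; rewrite !Rabs_mult, (Rabs_right (INR j)), (Rabs_right (/ INR (S n))); try lra.
          - apply Rle_trans with (INR (S n) * (Rabs y * / INR (S n))).
            + apply Rmult_le_compat_r; [|assumption].
              apply Rmult_le_pos; [apply Rabs_pos|left; now apply Rinv_0_lt_compat].
            + apply Rle_trans with (Rabs y); [right; field; lra|assumption].
          - left; now apply Rinv_0_lt_compat. }
        assert (Hstep := H (INR i * (y / INR (S n))) (INR (S i) * (y / INR (S n)))
          (Hin i ltac:(lia)) (Hin (S i) Hi)).
        replace (INR (S i) * (y / INR (S n)) - INR i * (y / INR (S n))) with (y / INR (S n))
          in Hstep by (rewrite (S_INR i); ring).
        assert (Hys : Rabs (y / INR (S n)) <= s).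
        { unfold Rdiv; rewrite Rabs_mult, (Rabs_right (/ INR (S n)))
            by (left; now apply Rinv_0_lt_compat).
          apply (Rmult_le_reg_r (INR (S n))); [assumption|].
          rewrite Rmult_assoc, Rinv_l; lra. }
        specialize (Hstep Hys).
        replace (INR (S i) * (C0 * (y / INR (S n)) ^ 2)) with
          (C0 * (y / INR (S n)) ^ 2 + INR i * (C0 * (y / INR (S n)) ^ 2)) by (rewrite (S_INR i); ring).
        now apply Rplus_le_compat. }
    specialize (Hi (S n) (le_n _)).
    replace (INR (S n) * (y / INR (S n))) with y in Hi by (field; lra).
    eapply Rle_trans; [exact Hi|right; field; lra]. }
  assert (Hz : Cmod (P y - P 0) = 0).
  { apply Rle_antisym; [|apply Cmod_ge_0].
    apply Rnot_lt_le; intros Hlt.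
    assert (Hk : 0 <= C0 * y ^ 2) by nra.
    destruct (archimed_cor1 (Cmod (P y - P 0) / (C0 * y ^ 2 + 1))) as (n1 & Hn1 & Hn1').
    { apply Rdiv_lt_0_compat; lra. }
    destruct (INR_unbounded (Rabs y / s)) as [n2 Hn2].
    pose (n := (n1 + n2)%nat).
    assert (Hn : Rabs y <= s * INR (S n)).
    { apply Rle_trans with (s * INR n2).
      - apply (Rmult_le_reg_r (/ s)); [now apply Rinv_0_lt_compat|].
        replace (s * INR n2 * / s) with (INR n2) by (field; lra).
        unfold Rdiv in Hn2; lra.
      - apply Rmult_le_compat_l; [lra|]; apply le_INR; unfold n; lia. }
    specialize (Hmain n Hn).
    assert (Hinv : / INR (S n) <= / INR n1).
    { apply Rinv_le_contravar; [apply lt_0_INR; lia|apply le_INR; unfold n; lia]. }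
    assert (Hp : 0 < / INR (S n)) by (apply Rinv_0_lt_compat, lt_0_INR; lia).
    assert (Hq : (C0 * y ^ 2 + 1) * / INR n1 < Cmod (P y - P 0)).
    { apply Rlt_le_trans with ((C0 * y ^ 2 + 1) * (Cmod (P y - P 0) / (C0 * y ^ 2 + 1)));
        [apply Rmult_lt_compat_l; lra|right; field; lra]. }
    nra. }
  apply Cmod_eq_0 in Hz.
  replace (P y) with ((P y - P 0) + P 0)%C by ring; rewrite Hz; ring.
Qed.

(** Moving up by [t] changes [f] by [i t f'], moving right by [t] changes it by [t f']. So the
    vertical increment is [i] times the horizontal one up to [O(t^2)], and the horizontal one has
    integral 0 by periodicity. The mean over a line is thus a function of its height with quadratic
    increments, hence constant. *)
Lemma Cint_holo_strip h f :
  holo_strip h f -> forall y, Rabs y <= h ->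
  Cint (fun x => f (RtoC x + Ci * RtoC y)%C) = Cint (fun x => f (RtoC x)).
Proof.
  intros Hf y Hy.
  assert (HI : forall x t, Im (RtoC x + Ci * RtoC t)%C = t) by (intros; cbn; ring).
  assert (Hc : forall t, Rabs t <= h -> Ccont (fun x => f (RtoC x + Ci * RtoC t)%C)).
  { intros t Ht; apply (Ccont_ext (fun x => f ((Ci * RtoC t) + RtoC x)%C)).
    - intros x; f_equal; ring.
    - apply (holo_strip_line h); [assumption|].
      replace (Im (Ci * RtoC t)) with t by (cbn; ring); assumption. }
  transitivity (Cint (fun x => f (RtoC x + Ci * RtoC 0)%C)).
  2:{ apply Cint_ext; intros x; f_equal; ring. }
  destruct Hf as (Pf & B & s & Hs & HB & H).
  apply (quadratic_increment_const (fun t => Cint (fun x => f (RtoC x + Ci * RtoC t)%C))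
           h (2 * B) s); try assumption; [lra|].
  clear y Hy; intros y y' Hy Hy' Hyy.
  set (t := y' - y).
  set (F := fun x => f (RtoC x + Ci * RtoC y)%C).
  assert (HF : Ccont F) by now apply Hc.
  assert (HFper : forall x, F (x + 1) = F x).
  { intros x; unfold F; rewrite RtoC_plus.
    replace (RtoC x + RtoC 1 + Ci * RtoC y)%C with (RtoC x + Ci * RtoC y + 1)%C by ring.
    apply Pf; now rewrite HI. }
  assert (E : (Cint (fun x => f (RtoC x + Ci * RtoC y')%C) - Cint F)%C =
    Cint (fun x => (f (RtoC x + Ci * RtoC y') - F x) - Ci * (F (x + t)%R - F x))%C).
  { rewrite Cint_minus, Cint_minus, Cint_scal, Cint_minus, (Cint_shift F t); auto.
    - ring.
    - now apply Ccont_shift.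
    - apply Ccont_minus; [now apply Ccont_shift|assumption].
    - apply Ccont_minus; auto.
    - apply Ccont_mult; [apply Ccont_const|].
      apply Ccont_minus; [now apply Ccont_shift|assumption]. }
  fold F; rewrite E.
  apply Cmod_Cint_le.
  - apply Ccont_minus; [apply Ccont_minus; auto|].
    apply Ccont_mult; [apply Ccont_const|].
    apply Ccont_minus; [now apply Ccont_shift|assumption].
  - intros x; unfold F.
    destruct (H (RtoC x + Ci * RtoC y)%C) as (_ & d & _ & D); [now rewrite HI|].
    assert (D1 := D (Ci * RtoC t)%C); assert (D2 := D (RtoC t)).
    rewrite Cmod_mult, Cmod_Ci, Cmod_R, Rmult_1_l in D1; rewrite Cmod_R in D2.
    replace (RtoC x + Ci * RtoC y + Ci * RtoC t)%C with (RtoC x + Ci * RtoC y')%C in D1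
      by (unfold t; rewrite RtoC_minus; ring).
    replace (RtoC x + Ci * RtoC y + RtoC t)%C with (RtoC (x + t) + Ci * RtoC y)%C in D2
      by (rewrite RtoC_plus; ring).
    rewrite HI in D1, D2; specialize (D1 Hy' Hyy); specialize (D2 Hy Hyy).
    rewrite pow2_abs in D1, D2.
    match goal with |- Cmod ?e <= _ => replace e with
      ((f (RtoC x + Ci * RtoC y') - f (RtoC x + Ci * RtoC y) - Ci * RtoC t * d)
       + - (Ci * (f (RtoC (x + t) + Ci * RtoC y) - f (RtoC x + Ci * RtoC y) - RtoC t * d)))%C
      by ring end.
    eapply Rle_trans; [apply Cmod_triangle|].
    rewrite Cmod_opp, (Cmod_mult Ci), Cmod_Ci; lra.
Qed.

(** * Fourier coefficients *)

Definition coef (f : C -> C) (k : Z) : C :=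
  Cint (fun x => f (RtoC x) * ez (- k) (RtoC x))%C.

(** The product of [f] with [ez (- k)] is periodic and holomorphic, so its mean is the same on every
    horizontal line; [ez k z] appears when the exponential is recentred at [z]. *)
Lemma coef_line h f k z :
  holo_strip h f -> Rabs (Im z) <= h ->
  Cint (fun x => f (z + RtoC x) * expi (- (IZR k * x)))%C = (coef f k * ez k z)%C.
Proof.
  intros Hf Hz.
  assert (Hh : 0 <= h) by (generalize (Rabs_pos (Im z)); lra).
  set (g := fun z => (f z * ez (- k) z)%C).
  assert (Hg : holo_strip h g) by (apply holo_strip_mult; [assumption|now apply holo_strip_ez]).
  assert (Hl : Ccont (fun x => g (z + RtoC x)%C)) by now apply (holo_strip_line h).
  assert (E : Cint (fun x => g (z + RtoC x)%C) = coef f k).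
  { change (coef f k) with (Cint (fun x => g (RtoC x))).
    rewrite <- (Cint_holo_strip h g Hg (Im z) Hz).
    set (F := fun x => g (RtoC x + Ci * RtoC (Im z))%C).
    assert (EF : forall x, F (x + Re z) = g (z + RtoC x)%C).
    { intros x; unfold F; f_equal; rewrite RtoC_plus.
      destruct z as [a b]; unfold Re, Im, RtoC, Ci, Cplus, Cmult; cbn [fst snd]; f_equal; ring. }
    rewrite <- (Cint_shift F (Re z)).
    - apply Cint_ext; intros x; now rewrite EF.
    - apply (Ccont_ext (fun x => F (x - Re z + Re z))).
      + intros x; f_equal; ring.
      + apply (Ccont_ext (fun x => g (z + RtoC (x - Re z))%C)); [intros; now rewrite EF|].
        exact (Ccont_shift (fun x => g (z + RtoC x)%C) (- Re z) Hl).
    - intros x; unfold F; rewrite RtoC_plus.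
      replace (RtoC x + RtoC 1 + Ci * RtoC (Im z))%C with (RtoC x + Ci * RtoC (Im z) + 1)%C by ring.
      apply Hg; replace (Im (RtoC x + Ci * RtoC (Im z))%C) with (Im z) by (cbn; ring); assumption. }
  rewrite <- E, Cmult_comm, <- Cint_scal by assumption.
  apply Cint_ext; intros x; unfold g.
  rewrite ez_plus, ez_real, opp_IZR.
  replace (- IZR k * x) with (- (IZR k * x)) by ring.
  assert (Hinv : (ez k z * ez (- k) z)%C = 1) by (rewrite <- ez_add, Z.add_opp_diag_r; apply ez_0).
  replace (ez k z * (f (z + RtoC x) * (ez (- k) z * expi (- (IZR k * x)))))%C
    with (ez k z * ez (- k) z * (f (z + RtoC x) * expi (- (IZR k * x))))%C by ring.
  rewrite Hinv; ring.
Qed.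

Lemma Cmod_coef_le h f M y :
  holo_strip h f -> 0 <= y <= h ->
  (forall z, Rabs (Im z) <= y -> Cmod (f z) <= M) ->
  forall k, Cmod (coef f k) <= M * exp (- (2 * PI * y) * IZR (Z.abs k)).
Proof.
  intros Hf Hy HM k.
  assert (Hz : exists t, Rabs t <= y /\ IZR k * t = - (IZR (Z.abs k) * y)).
  { destruct (Z_le_gt_dec 0 k) as [Hk|Hk].
    - exists (- y); split; [rewrite Rabs_Ropp, Rabs_right; lra|].
      rewrite Z.abs_eq by assumption; ring.
    - exists y; split; [rewrite Rabs_right; lra|].
      rewrite Z.abs_neq, opp_IZR by lia; ring. }
  destruct Hz as (t & Ht & Hkt).
  assert (HI : Im (Ci * RtoC t)%C = t) by (cbn; ring).
  assert (E := coef_line h f k (Ci * RtoC t)%C Hf ltac:(rewrite HI; lra)).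
  assert (Hez : Cmod (ez k (Ci * RtoC t)%C) = exp (2 * PI * y * IZR (Z.abs k))).
  { rewrite Cmod_ez, HI; f_equal.
    replace (- (2 * PI * IZR k * t)) with (- (2 * PI * (IZR k * t))) by ring.
    rewrite Hkt; ring. }
  assert (Hb : Cmod (coef f k * ez k (Ci * RtoC t)%C) <= M).
  { rewrite <- E; apply Cmod_Cint_le.
    - apply Ccont_mult; [apply (holo_strip_line h); [assumption|rewrite HI; lra]|].
      apply (Ccont_ext (fun x => expi (- IZR k * x))); [intros; f_equal; ring|apply Ccont_expi].
    - intros x; rewrite Cmod_mult, Cmod_expi, Rmult_1_r; apply HM.
      replace (Im (Ci * RtoC t + RtoC x)%C) with t by (cbn; ring); assumption. }
  rewrite Cmod_mult, Hez in Hb.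
  replace (- (2 * PI * y) * IZR (Z.abs k)) with (- (2 * PI * y * IZR (Z.abs k))) by ring.
  rewrite exp_Ropp.
  apply (Rmult_le_reg_r (exp (2 * PI * y * IZR (Z.abs k)))); [apply exp_pos|].
  set (e := exp (2 * PI * y * IZR (Z.abs k))) in *.
  assert (He : 0 < e) by apply exp_pos.
  rewrite Rmult_assoc, Rinv_l; lra.
Qed.

Lemma unif_cont_Ccont F eps :
  Ccont F -> 0 < eps -> exists d, 0 < d /\
    forall x y, -1 <= x <= 2 -> -1 <= y <= 2 -> Rabs (y - x) < d -> Cmod (F y - F x) < eps.
Proof.
  intros HF He.
  destruct (unifcont_normed_1d (V := C_R_NormedModule) F (-1) 2
    (fun x _ => Ccont_continuous F x HF) (mkposreal eps He)) as [d H].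
  exists d; split; [apply cond_pos|]; intros x y Hx Hy Hxy.
  rewrite Cmod_norm; exact (H x y Hx Hy Hxy).
Qed.

Lemma Ccont_expi_neg k : Ccont (fun x => expi (- (k * x))).
Proof. apply (Ccont_ext (fun x => expi (- k * x))); [intros; f_equal; ring|apply Ccont_expi]. Qed.

(* Riemann-Lebesgue: translating by half a period of the exponential flips its sign. *)
Lemma riemann_lebesgue F eps :
  Ccont F -> (forall x, F (x + 1) = F x) -> 0 < eps ->
  exists N, forall k, (Z.of_nat N <= Z.abs k)%Z ->
    Cmod (Cint (fun x => F x * expi (- (IZR k * x)))%C) < eps.
Proof.
  intros HF Hper He.
  destruct (unif_cont_Ccont F eps HF He) as (d & Hd & Hu).
  destruct (INR_unbounded (/ d)) as [N HN].
  exists (S N); intros k Hk.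
  assert (Hk0 : IZR k <> 0) by (apply not_0_IZR; lia).
  set (s := / (2 * IZR k)).
  assert (HkN : / d < Rabs (IZR k)).
  { rewrite <- abs_IZR; eapply Rlt_le_trans; [exact HN|].
    rewrite INR_IZR_INZ; apply IZR_le; lia. }
  assert (Hdi : 0 < / d) by now apply Rinv_0_lt_compat.
  assert (Hs : Rabs s < d /\ Rabs s <= 1).
  { unfold s; rewrite Rabs_inv, Rabs_mult, (Rabs_right 2) by lra.
    assert (H1 : 1 <= Rabs (IZR k)) by (rewrite <- abs_IZR; apply IZR_le; lia).
    split.
    - rewrite <- (Rinv_inv d); apply Rinv_lt_contravar; [apply Rmult_lt_0_compat|]; lra.
    - rewrite <- Rinv_1; apply Rinv_le_contravar; lra. }
  set (H := fun x => (F x * expi (- (IZR k * x)))%C).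
  assert (HH : Ccont H) by (apply Ccont_mult; [assumption|apply Ccont_expi_neg]).
  assert (HHper : forall x, H (x + 1) = H x).
  { intros x; unfold H; rewrite Hper; f_equal.
    rewrite <- (expi_period (- (IZR k * x)) (- k)), opp_IZR; f_equal; ring. }
  assert (E : (RtoC 2 * Cint H)%C = Cint (fun x => (F x - F (x + s)%R) * expi (- (IZR k * x)))%C).
  { transitivity (Cint H + Cint H)%C; [ring|].
    rewrite <- (Cint_shift H s HH HHper) at 2.
    rewrite <- Cint_plus; [|assumption|now apply Ccont_shift].
    apply Cint_ext; intros x; unfold H.
    replace (- (IZR k * (x + s))) with (- / 2 + - (IZR k * x)) by (unfold s; field; assumption).
    rewrite expi_plus.
    replace (expi (- / 2)) with (- RtoC 1)%C; [ring|].
    unfold expi; replace (2 * PI * - / 2) with (- PI) by field.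
    rewrite cos_neg, sin_neg, cos_PI, sin_PI; unfold Copp, RtoC; cbn [fst snd]; f_equal; ring. }
  set (D := fun x => ((F x - F (x + s)%R) * expi (- (IZR k * x)))%C) in *.
  assert (HD : Ccont D).
  { apply Ccont_mult; [apply Ccont_minus; [assumption|now apply Ccont_shift]|apply Ccont_expi_neg]. }
  assert (HDb : Cmod (Cint D) <= eps).
  { rewrite Cmod_norm.
    apply (norm_RInt_le (V := C_R_NormedModule) D (fun _ => eps) 0 1); [lra| |now apply Cint_correct|].
    - intros x Hx; rewrite <- Cmod_norm; unfold D.
      rewrite Cmod_mult, Cmod_expi, Rmult_1_r.
      destruct Hs as [Hs1 Hs2]; apply Rabs_le_between in Hs2.
      left; replace (F x - F (x + s)%R)%C with (- (F (x + s)%R - F x))%C by ring.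
      rewrite Cmod_opp; apply Hu; [lra|lra|].
      now replace (x + s - x) with s by ring.
    - assert (Hc := is_RInt_const (V := R_NormedModule) 0 1 eps).
      rewrite Rminus_0_r in Hc; unfold scal in Hc; cbn in Hc; unfold mult in Hc; cbn in Hc.
      rewrite Rmult_1_l in Hc; exact Hc. }
  rewrite <- E, Cmod_mult, Cmod_R, Rabs_right in HDb by lra.
  generalize (Cmod_ge_0 (Cint H)); intros; fold H; lra.
Qed.

(** Dividing by [expi x - 1] instead of [x] keeps the quotient 1-periodic. Its denominator vanishes
    only at integers, where [G] is given the limit [d / (2 pi i)]; continuity there is where the
    quadratic remainder of [f] enters. *)
Lemma difference_quotient_Ccont h f z :
  holo_strip h f -> Rabs (Im z) <= h ->
  exists G, Ccont G /\ (forall x, G (x + 1) = G x) /\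
    forall x, (f (z + RtoC x) - f z)%C = (G x * (expi x - 1))%C.
Proof.
  intros Hf Hz.
  set (g := fun x => f (z + RtoC x)%C).
  assert (Hg : Ccont g) by now apply (holo_strip_line h).
  destruct Hf as (Pf & B & s & Hs & HB & H).
  assert (HI : forall t, Im (z + RtoC t)%C = Im z) by (intros t; destruct z; cbn; ring).
  assert (Hper1 : forall x, g (x + 1) = g x).
  { intros x; unfold g; rewrite RtoC_plus.
    replace (z + (RtoC x + RtoC 1))%C with (z + RtoC x + 1)%C by ring.
    apply Pf; now rewrite HI. }
  assert (Hpern : forall (n : nat) x, g (x + INR n) = g x).
  { intros n; induction n as [|n IH]; intros x; [now rewrite Rplus_0_r|].
    rewrite S_INR, <- Rplus_assoc, Hper1; apply IH. }
  assert (Hper : forall (m : Z) x, g (x + IZR m) = g x).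
  { intros m x; destruct (Z_le_gt_dec 0 m) as [Hm|Hm].
    - rewrite <- (Z2Nat.id m), <- INR_IZR_INZ by assumption; apply Hpern.
    - rewrite <- (Hpern (Z.to_nat (- m)) (x + IZR m)); f_equal.
      rewrite INR_IZR_INZ, Z2Nat.id, opp_IZR by lia; ring. }
  destruct (H z Hz) as (_ & d & Hd & D).
  pose proof PI_RGT_0 as HP.
  set (w0 := (RtoC (2 * PI * 1) * Ci)%C).
  assert (Hw0 : Cmod w0 = 2 * PI).
  { unfold w0; rewrite Cmod_mult, Cmod_Ci, Cmod_R, Rabs_right; lra. }
  assert (Hw0' : w0 <> RtoC 0) by (apply Cmod_gt_0; lra).
  set (G := fun x => if excluded_middle_informative (expi x = RtoC 1) then (d / w0)%C
                     else ((g x - g 0%R) / (expi x - 1))%C).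
  assert (Hg0 : g 0 = f z) by (unfold g; f_equal; ring).
  assert (HGeq : forall x, (g x - g 0%R)%C = (G x * (expi x - 1))%C).
  { intros x; unfold G; destruct (excluded_middle_informative (expi x = RtoC 1)) as [E|E].
    - rewrite E; destruct (expi_eq1 x E) as [m ->].
      rewrite <- (Hper m 0), Rplus_0_l; ring.
    - field; intros E'; apply E.
      replace (expi x) with (expi x - 1 + 1)%C by ring; rewrite E'; ring. }
  exists G; split; [|split].
  - intros x eps He.
    destruct (excluded_middle_informative (expi x = RtoC 1)) as [E|E].
    + destruct (expi_eq1 x E) as [m Hm].
      destruct (ez_taylor 1) as (B' & s' & Hs' & HB' & T).
      pose (K := B * (2 * PI) + B * B').
      assert (HK : 0 <= K) by (unfold K; nra).
      pose (r := Rmin (Rmin s s') (Rmin (PI / (B' + 1)) (eps / (K + 1)))).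
      assert (Hr : 0 < r).
      { repeat apply Rmin_pos; try assumption; apply Rdiv_lt_0_compat; lra. }
      exists r; split; [assumption|]; intros y Hy.
      set (t := y - x) in *.
      assert (Hr1 : r <= s) by (eapply Rle_trans; [apply Rmin_l|apply Rmin_l]).
      assert (Hr2 : r <= s') by (eapply Rle_trans; [apply Rmin_l|apply Rmin_r]).
      assert (Hr3 : r * (B' + 1) <= PI).
      { replace PI with (PI / (B' + 1) * (B' + 1)) by (field; lra).
        apply Rmult_le_compat_r; [lra|].
        eapply Rle_trans; [apply Rmin_r|apply Rmin_l]. }
      assert (Hr4 : r * (K + 1) <= eps).
      { replace eps with (eps / (K + 1) * (K + 1)) by (field; lra).
        apply Rmult_le_compat_r; [lra|].
        eapply Rle_trans; [apply Rmin_r|apply Rmin_r]. }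
      assert (HGx : G x = (d / w0)%C).
      { unfold G; destruct (excluded_middle_informative (expi x = RtoC 1)); tauto. }
      rewrite HGx.
      unfold G; destruct (excluded_middle_informative (expi y = RtoC 1)) as [E'|E'].
      { replace (d / w0 - d / w0)%C with (RtoC 0) by ring; now rewrite Cmod_0. }
      assert (Hey : expi y = expi t).
      { replace y with (t + x) by (unfold t; ring); rewrite Hm; apply expi_period. }
      assert (Hgy : g y = g t).
      { replace y with (t + x) by (unfold t; ring); rewrite Hm; apply Hper. }
      rewrite Hgy, Hey; rewrite Hey in E'.
      pose proof (D (RtoC t)) as D1; pose proof (T (RtoC t)) as T1.
      rewrite Cmod_R in D1, T1; rewrite HI, pow2_abs in D1; rewrite pow2_abs in T1.
      specialize (D1 Hz ltac:(lra)); specialize (T1 ltac:(lra)).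
      rewrite <- expi_ez in T1; fold (g t) in D1; rewrite <- Hg0 in D1.
      fold w0 in T1.
      set (e1 := (g t - g 0%R - RtoC t * d)%C) in *.
      set (e2 := (expi t - 1 - RtoC t * w0)%C) in *.
      assert (Hden : (expi t - 1)%C <> RtoC 0).
      { intros E2; apply E'; replace (expi t) with (expi t - 1 + 1)%C by ring.
        rewrite E2; ring. }
      replace ((g t - g 0%R) / (expi t - 1) - d / w0)%C
        with ((w0 * e1 - d * e2) / (w0 * (expi t - 1)))%C
        by (unfold e1, e2; field; split; assumption).
      rewrite Cmod_div by (apply Cmult_neq_0; assumption).
      rewrite Cmod_mult, Hw0.
      assert (Ht0 : 0 < Rabs t).
      { apply Rabs_pos_lt; intros E3; apply E'; rewrite E3; apply expi_0. }
      (* Half of the linear term [2 pi |t|] survives the quadratic error, because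
         [r (B' + 1) <= pi]. *)
      assert (Hlow : PI * Rabs t <= Cmod (expi t - 1)).
      { assert (Ht2 : Cmod (RtoC t * w0) = Rabs t * (2 * PI)) by now rewrite Cmod_mult, Cmod_R, Hw0.
        assert (Ht3 : Cmod (RtoC t * w0) <= Cmod (expi t - 1) + Cmod e2).
        { replace (RtoC t * w0)%C with ((expi t - 1) + - e2)%C by (unfold e2; ring).
          eapply Rle_trans; [apply Cmod_triangle|rewrite Cmod_opp; lra]. }
        assert (B' * t ^ 2 <= PI * Rabs t); [|lra].
        rewrite <- pow2_abs.
        assert (B' * Rabs t <= PI) by nra.
        nra. }
      assert (Hnum : Cmod (w0 * e1 - d * e2) <= K * t ^ 2).
      { unfold Cminus; eapply Rle_trans; [apply Cmod_triangle|].
        rewrite Cmod_opp, !Cmod_mult, Hw0; unfold K.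
        assert (2 * PI * Cmod e1 <= 2 * PI * (B * t ^ 2)) by (apply Rmult_le_compat_l; lra).
        assert (Cmod d * Cmod e2 <= B * (B' * t ^ 2))
          by (apply Rmult_le_compat; try apply Cmod_ge_0; assumption).
        lra. }
      apply Rle_lt_trans with (K * Rabs t).
      * assert (Hpos : 0 < 2 * PI * Cmod (expi t - 1)).
        { apply Rmult_lt_0_compat; [lra|].
          apply Rlt_le_trans with (2 := Hlow); apply Rmult_lt_0_compat; lra. }
        apply (Rmult_le_reg_r (2 * PI * Cmod (expi t - 1))); [assumption|].
        unfold Rdiv; rewrite Rmult_assoc, Rinv_l by lra.
        rewrite Rmult_1_r; eapply Rle_trans; [exact Hnum|].
        rewrite <- pow2_abs.
        assert (1 <= 2 * PI * PI).
        { generalize PI2_1; nra. }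
        assert (Rabs t <= 2 * PI * Cmod (expi t - 1)) by nra.
        replace (K * Rabs t ^ 2) with (K * Rabs t * Rabs t) by ring.
        apply Rmult_le_compat_l; [nra|assumption].
      * nra.
    + assert (Hden : (expi x - 1)%C <> RtoC 0).
      { intros E2; apply E; replace (expi x) with (expi x - 1 + 1)%C by ring; rewrite E2; ring. }
      apply Cmod_gt_0 in Hden; set (c := Cmod (expi x - 1)) in *.
      pose (M := 1 + Cmod (G x)).
      assert (HM : 1 <= M) by (generalize (Cmod_ge_0 (G x)); unfold M; lra).
      pose (e := Rmin (c / 2) (eps * c / (4 * M))).
      assert (He' : 0 < e).
      { apply Rmin_pos; [lra|apply Rdiv_lt_0_compat; nra]. }
      assert (Hexp : Ccont expi).
      { apply (Ccont_ext (fun x => expi (1 * x))); [intros; f_equal; ring|apply Ccont_expi]. }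
      destruct (Hg x e He') as (d1 & Hd1 & C1), (Hexp x e He') as (d2 & Hd2 & C2).
      exists (Rmin d1 d2); split; [now apply Rmin_pos|]; intros y Hy.
      specialize (C1 y (Rlt_le_trans _ _ _ Hy (Rmin_l _ _))).
      specialize (C2 y (Rlt_le_trans _ _ _ Hy (Rmin_r _ _))).
      assert (Hlow : c / 2 <= Cmod (expi y - 1)).
      { assert (c <= Cmod (expi y - 1) + Cmod (expi y - expi x)).
        { unfold c; replace (expi x - 1)%C with ((expi y - 1) + - (expi y - expi x))%C by ring.
          eapply Rle_trans; [apply Cmod_triangle|rewrite Cmod_opp; lra]. }
        assert (e <= c / 2) by apply Rmin_l; lra. }
      assert (Hprod : ((G y - G x) * (expi y - 1))%C
        = ((g y - g x) - G x * (expi y - expi x))%C).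
      { generalize (HGeq x) (HGeq y); intros E1 E2.
        replace ((G y - G x) * (expi y - 1))%C
          with (G y * (expi y - 1) - G x * (expi x - 1) - G x * (expi y - expi x))%C by ring.
        rewrite <- E1, <- E2; ring. }
      assert (Hb : Cmod ((G y - G x) * (expi y - 1)) < 2 * M * e).
      { rewrite Hprod; unfold Cminus at 1; eapply Rle_lt_trans; [apply Cmod_triangle|].
        rewrite Cmod_opp, Cmod_mult.
        generalize (Cmod_ge_0 (G x)) (Cmod_ge_0 (expi y - expi x)); unfold M; nra. }
      rewrite Cmod_mult in Hb.
      assert (He2 : 2 * M * e <= eps * (c / 2)).
      { apply Rle_trans with (2 * M * (eps * c / (4 * M))); [|right; field; lra].
        apply Rmult_le_compat_l; [lra|apply Rmin_r]. }
      apply (Rmult_lt_reg_r (c / 2)); [lra|].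
      generalize (Cmod_ge_0 (G y - G x)); nra.
  - intros x; unfold G; rewrite (expi_period x 1), Hper1; reflexivity.
  - intros x; rewrite <- Hg0; apply HGeq.
Qed.

(* Chernoff's argument: the coefficients of [f - f z] telescope in those of the
   difference quotient [G]. *)
Theorem fourier_inversion h f z :
  holo_strip h f -> Rabs (Im z) <= h ->
  Clim (csym (fun k => coef f k * ez k z)%C) (f z).
Proof.
  intros Hf Hz.
  destruct (difference_quotient_Ccont h f z Hf Hz) as (G & HG & HGper & HGeq).
  set (g := fun x => f (z + RtoC x)%C).
  assert (Hg : Ccont g) by now apply (holo_strip_line h).
  set (Gh := fun k => Cint (fun x => G x * expi (- (IZR k * x)))%C).
  assert (HGc : forall k, Ccont (fun x => G x * expi (- (IZR k * x)))%C).
  { intros k; apply Ccont_mult; [assumption|apply Ccont_expi_neg]. }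
  assert (Hk : forall k, (coef f k * ez k z)%C =
    (f z * Cint (fun x => expi (- (IZR k * x))) + (Gh (k - 1)%Z - Gh k))%C).
  { intros k; rewrite <- (coef_line h f k z Hf Hz); unfold Gh.
    rewrite <- Cint_scal, <- Cint_minus, <- Cint_plus; auto using Ccont_expi_neg.
    - apply Cint_ext; intros x.
      replace (f (z + RtoC x)%C) with (f (z + RtoC x) - f z + f z)%C by ring.
      rewrite HGeq, minus_IZR.
      replace (- ((IZR k - 1) * x)) with (- (IZR k * x) + x) by ring.
      rewrite expi_plus; ring.
    - apply Ccont_mult; [apply Ccont_const|apply Ccont_expi_neg].
    - apply Ccont_minus; auto. }
  assert (Hsum : forall N, csym (fun k => coef f k * ez k z)%C N
    = (f z + (Gh (- Z.of_nat N - 1)%Z - Gh (Z.of_nat N)))%C).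
  { intros N; induction N as [|N IH].
    - rewrite csym_0, Hk; f_equal.
      rewrite (Cint_ext _ (fun _ => RtoC 1)), Cint_const; [ring|].
      intros x; replace (- (0 * x)) with 0 by ring; apply expi_0.
    - rewrite csym_succ, IH, !Hk.
      assert (H0 : forall k, k <> 0%Z -> Cint (fun x => expi (- (IZR k * x))) = RtoC 0).
      { intros k Hk0; rewrite <- (Cint_expi (- k)) by lia; apply Cint_ext.
        intros x; rewrite opp_IZR; f_equal; ring. }
      rewrite !H0 by lia.
      replace (Z.of_nat (S N) - 1)%Z with (Z.of_nat N) by lia.
      replace (- Z.of_nat (S N))%Z with (- Z.of_nat N - 1)%Z by lia.
      ring. }
  intros eps He.
  destruct (riemann_lebesgue G (eps / 2) HG HGper ltac:(lra)) as [N HN].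
  exists N; intros n Hn; rewrite Hsum.
  match goal with |- Cmod (?a + (?b - ?c) - _) < _ =>
    replace (a + (b - c) - a)%C with (b + - c)%C by ring end.
  eapply Rle_lt_trans; [apply Cmod_triangle|]; rewrite Cmod_opp.
  generalize (HN (- Z.of_nat n - 1)%Z ltac:(lia)) (HN (Z.of_nat n) ltac:(lia)).
  unfold Gh; lra.
Qed.

Lemma fourier_coef_eq v vc :
  (forall x : R, vc (RtoC x) = RtoC (v x)) -> forall k, fourier_coef v k = coef vc k.
Proof.
  intros H k; unfold fourier_coef, coef.
  apply Cint_ext; intros x; rewrite H, ez_real, opp_IZR; do 2 f_equal; ring.
Qed.

(* Hadamard's three lines inequality up to a constant, obtained by
   interpolating the two bounds on each Fourier coefficient. *)
Lemma three_lines h y y' s f m1 m2 :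
  holo_strip h f -> 0 <= y' <= h -> 0 <= s <= 1 -> 0 <= y -> y < (1 - s) * y' + s * h ->
  (forall z, Rabs (Im z) <= y' -> Cmod (f z) <= exp m1) ->
  (forall z, Rabs (Im z) <= h -> Cmod (f z) <= exp m2) ->
  forall z, Rabs (Im z) <= y ->
    Cmod (f z) <= geom_const (2 * PI * ((1 - s) * y' + s * h - y)) * exp ((1 - s) * m1 + s * m2).
Proof.
  intros Hf Hy' Hs Hy0 Hy H1 H2 z Hz.
  pose proof PI_RGT_0 as HP.
  set (g := (1 - s) * y' + s * h - y) in *.
  assert (Hg : 0 < 2 * PI * g) by (unfold g; apply Rmult_lt_0_compat; lra).
  assert (Hzh : Rabs (Im z) <= h) by nra.
  assert (Hc : forall k, Cmod (coef f k * ez k z)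
    <= exp ((1 - s) * m1 + s * m2) * exp (- (2 * PI * g) * IZR (Z.abs k))).
  { intros k; rewrite Cmod_mult.
    assert (C1 := Cmod_coef_le h f _ y' Hf Hy' H1 k).
    assert (C2 := Cmod_coef_le h f _ h Hf ltac:(lra) H2 k).
    rewrite <- exp_plus in C1, C2.
    assert (Hco : Cmod (coef f k) <= exp ((1 - s) * (m1 + - (2 * PI * y') * IZR (Z.abs k))
      + s * (m2 + - (2 * PI * h) * IZR (Z.abs k)))).
    { set (a := m1 + - (2 * PI * y') * IZR (Z.abs k)) in *.
      set (b := m2 + - (2 * PI * h) * IZR (Z.abs k)) in *.
      destruct (Rle_dec a b).
      - eapply Rle_trans; [exact C1|]; apply exp_monotone; nra.
      - eapply Rle_trans; [exact C2|]; apply exp_monotone; nra. }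
    eapply Rle_trans.
    { apply Rmult_le_compat; [apply Cmod_ge_0|apply Cmod_ge_0|exact Hco|].
      apply (Cmod_ez_le k z y Hz). }
    rewrite <- !exp_plus; right; f_equal; unfold g; ring. }
  apply (Clim_Cmod_le _ _ _ (fourier_inversion h f z Hf Hzh)).
  exists 0%nat; intros n _.
  eapply Rle_trans; [apply Cmod_csum_le; intros k _; apply Hc|].
  rewrite rsum_scal, Rmult_comm; apply Rmult_le_compat_r; [left; apply exp_pos|].
  now apply rsym_exp_le.
Qed.

(** * From local power series to uniform differentiability *)

Fixpoint psum (a : nat -> C) (w : C) (n : nat) : C :=
  match n with
  | O => RtoC 0
  | S m => (psum a w m + w ^ m * a m)%C
  end.

(** [dpow w n] is [n w^(n-1)], written by the product rule so that it follows the recursion of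
    [w ^ n]; [dpsum] is the termwise derivative of [psum]. *)
Fixpoint dpow (w : C) (n : nat) : C :=
  match n with
  | O => RtoC 0
  | S m => (w ^ m + w * dpow w m)%C
  end.

Fixpoint dpsum (a : nat -> C) (w : C) (n : nat) : C :=
  match n with
  | O => RtoC 0
  | S m => (dpsum a w m + dpow w m * a m)%C
  end.

Lemma Cmod_dpow w r n : Cmod w <= r -> Cmod (dpow w n) * r <= INR n * r ^ n.
Proof.
  intros Hw; assert (H0 := Cmod_ge_0 w).
  induction n as [|n IH]; cbn [dpow]; [rewrite Cmod_0; cbn; lra|].
  apply Rle_trans with ((Cmod w ^ n + Cmod w * Cmod (dpow w n)) * r).
  - apply Rmult_le_compat_r; [lra|].
    eapply Rle_trans; [apply Cmod_triangle|]; rewrite Cmod_mult, Cmod_pow; lra.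
  - rewrite S_INR; cbn [pow].
    assert (Cmod w ^ n <= r ^ n) by now apply pow_incr.
    generalize (Cmod_ge_0 (dpow w n)); intros Hd.
    assert (Cmod w * (Cmod (dpow w n) * r) <= r * (INR n * r ^ n)).
    { apply Rmult_le_compat; try assumption; nra. }
    nra.
Qed.

(** The remainder satisfies [e_(n+1) = (w + k) e_n + k^2 dpow w n]. The factor [r^2] on the left
    replaces the natural power [r^(n-2)] by [r^n], so that [n = 0] and [n = 1] are covered as
    well. *)
Lemma Cmod_pow_taylor w k r n :
  Cmod w <= r -> Cmod (w + k) <= r ->
  Cmod ((w + k) ^ n - w ^ n - k * dpow w n) * r ^ 2 <= INR n ^ 2 * Cmod k ^ 2 * r ^ n.
Proof.
  intros Hw Hwk.
  assert (Hr : 0 <= r) by (generalize (Cmod_ge_0 w); lra).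
  induction n as [|n IH].
  - replace ((w + k) ^ 0 - w ^ 0 - k * dpow w 0)%C with (RtoC 0) by (cbn; ring).
    rewrite Cmod_0; cbn; lra.
  - set (e := ((w + k) ^ n - w ^ n - k * dpow w n)%C) in *.
    replace ((w + k) ^ S n - w ^ S n - k * dpow w (S n))%C
      with ((w + k) * e + k * k * dpow w n)%C by (unfold e; cbn [dpow Cpow]; ring).
    apply Rle_trans with ((r * Cmod e + Cmod k ^ 2 * Cmod (dpow w n)) * r ^ 2).
    + apply Rmult_le_compat_r; [nra|].
      eapply Rle_trans; [apply Cmod_triangle|]; rewrite !Cmod_mult.
      generalize (Cmod_ge_0 e); nra.
    + assert (Hd := Cmod_dpow w r n Hw).
      assert (Hrn : 0 <= r ^ n) by now apply pow_le.
      assert (Hk : 0 <= Cmod k ^ 2) by apply pow2_ge_0.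
      assert (Hn := pos_INR n).
      assert (T1 : r * (Cmod e * r ^ 2) <= r * (INR n ^ 2 * Cmod k ^ 2 * r ^ n))
        by now apply Rmult_le_compat_l.
      assert (T2 : Cmod k ^ 2 * r * (Cmod (dpow w n) * r) <= Cmod k ^ 2 * r * (INR n * r ^ n)).
      { apply Rmult_le_compat_l; [nra|assumption]. }
      rewrite S_INR; cbn [pow] in *.
      assert (0 <= Cmod k ^ 2 * (r * r ^ n)) by (apply Rmult_le_pos; nra).
      cbn [pow] in *; nra.
Qed.

Lemma psum_Clim a w l :
  is_pseries (K := C_AbsRing) (V := C_NormedModule) a w l -> Clim (psum a w) l.
Proof.
  intros H.
  assert (Hpow : forall n, pow_n (K := C_AbsRing) w n = (w ^ n)%C).
  { induction n as [|n IH]; [reflexivity|]; cbn [pow_n Cpow]; now rewrite IH. }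
  assert (Hs : forall n, sum_n (G := C_NormedModule)
    (fun k => scal (pow_n (K := C_AbsRing) w k) (a k)) n = psum a w (S n)).
  { induction n as [|n IH].
    - rewrite sum_O; cbn; unfold scal; cbn; unfold mult; cbn; ring.
    - rewrite sum_Sn, IH, Hpow; reflexivity. }
  intros eps He.
  apply (filterlim_locally_ball_norm (K := C_AbsRing) (U := C_NormedModule)) with
    (eps := mkposreal eps He) in H.
  destruct H as [N HN]; exists (S N); intros [|n] Hn; [lia|].
  rewrite <- Hs; exact (HN n ltac:(lia)).
Qed.

Lemma eventually_bounded (u : nat -> R) N b :
  (forall n, (N <= n)%nat -> u n <= b) -> exists B, forall n, u n <= B.
Proof.
  revert b; induction N as [|N IH]; intros b H; [exists b; intros; apply H; lia|].
  apply (IH (Rmax b (u N))); intros n Hn.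
  destruct (Nat.eq_dec n N) as [->|Hne]; [apply Rmax_r|].
  eapply Rle_trans; [apply H; lia|apply Rmax_l].
Qed.

Lemma psum_terms_bounded a w l :
  Clim (psum a w) l -> exists M, 0 <= M /\ forall n, Cmod (a n) * Cmod w ^ n <= M.
Proof.
  intros H; destruct (H 1 ltac:(lra)) as [N HN].
  destruct (eventually_bounded (fun n => Cmod (a n) * Cmod w ^ n) N 2) as [M HM].
  - intros n Hn.
    rewrite <- Cmod_pow, <- Cmod_mult, Cmult_comm.
    replace (w ^ n * a n)%C with ((psum a w (S n) - l) + - (psum a w n - l))%C
      by (cbn [psum]; ring).
    eapply Rle_trans; [apply Cmod_triangle|]; rewrite Cmod_opp.
    generalize (HN n Hn) (HN (S n) ltac:(lia)); lra.
  - exists M; split; [|assumption].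
    eapply Rle_trans; [|apply (HM 0%nat)]; cbn.
    generalize (Cmod_ge_0 (a 0%nat)); lra.
Qed.

Lemma INR_le_pow2 n : INR n <= 2 ^ n.
Proof.
  induction n as [|n IH]; [cbn; lra|]; rewrite S_INR; cbn [pow].
  assert (1 <= 2 ^ n) by (apply pow_R1_Rle; lra); lra.
Qed.

Lemma INR_sqr_le_pow4 n : INR n ^ 2 <= 4 ^ n.
Proof.
  replace 4 with (2 * 2) by ring; rewrite Rpow_mult_distr.
  generalize (INR_le_pow2 n) (pos_INR n); nra.
Qed.

Fixpoint hsum (n : nat) : R := match n with O => 0 | S m => hsum m + (/ 2) ^ m end.

Lemma hsum_le2 n : hsum n <= 2.
Proof.
  assert (hsum n = 2 - 2 * (/ 2) ^ n).
  { induction n as [|n IH]; cbn [hsum pow]; lra. }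
  assert (0 < (/ 2) ^ n) by (apply pow_lt; lra); lra.
Qed.

Lemma psum_bound (t : nat -> C) (u : nat -> C) K :
  0 <= K -> u 0%nat = RtoC 0 -> (forall n, u (S n) = (u n + t n)%C) ->
  (forall n, Cmod (t n) <= K * (/ 2) ^ n) -> forall n, Cmod (u n) <= 2 * K.
Proof.
  intros HK H0 HS Ht n.
  assert (H : Cmod (u n) <= K * hsum n).
  { induction n as [|n IH]; [rewrite H0, Cmod_0; cbn; lra|].
    rewrite HS; eapply Rle_trans; [apply Cmod_triangle|]; cbn [hsum].
    generalize (Ht n); lra. }
  generalize (hsum_le2 n); nra.
Qed.

Lemma geometric_Clim_exists (t : nat -> C) (u : nat -> C) K q :
  0 <= q < 1 -> u 0%nat = RtoC 0 -> (forall n, u (S n) = (u n + t n)%C) ->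
  (forall n, Cmod (t n) <= K * q ^ n) -> exists l, Clim u l.
Proof.
  intros HK H0 HS Ht.
  destruct (ex_series_le (V := C_R_CompleteNormedModule) t (fun n => K * q ^ n)) as [l Hl].
  - intros n; rewrite <- Cmod_norm; apply Ht.
  - apply (ex_series_scal (V := R_NormedModule) K), ex_series_geom.
    rewrite Rabs_right; lra.
  - exists l; apply is_series_Clim in Hl.
    assert (E : forall n, u (S n) = sum_n (G := C_R_NormedModule) t n).
    { induction n as [|n IH]; [rewrite sum_n_C_0, HS, H0; ring|].
      rewrite sum_n_C_S, HS, IH; reflexivity. }
    intros eps He; destruct (Hl eps He) as [N HN].
    exists (S N); intros [|n] Hn; [lia|]; rewrite E; apply HN; lia.
Qed.

(** At radius [q = R0 / 2] the terms of the series are bounded by some [M]. Passing to [r = q / 8]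
    gains [8^(-n)]: a factor [4^n] absorbs the [n^2] of the second-order remainder of [w^n], and the
    remaining [2^(-n)] makes the sums converge. *)
Lemma analytic_at_local f z0 :
  analytic_at f z0 ->
  exists r B, 0 < r /\ 0 <= B /\ forall z, Cmod (z - z0) < r ->
    Cmod (f z) <= B /\ exists d, Cmod d <= B /\
      forall w, Cmod w < r -> Cmod (f (z + w)%C - f z - w * d) <= B * Cmod w ^ 2.
Proof.
  intros (a & R0 & HR0 & H).
  assert (HC : forall w, Cmod w < R0 -> Clim (psum a w) (f (z0 + w)%C)).
  { intros w Hw; apply psum_Clim.
    replace w with (z0 + w - z0)%C at 1 by ring; apply H.
    now replace (z0 + w - z0)%C with w by ring. }
  set (q := R0 / 2).
  assert (Hq : 0 < q) by (unfold q; lra).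
  assert (HqC : Cmod (RtoC q) = q) by (rewrite Cmod_R, Rabs_right; lra).
  destruct (psum_terms_bounded a (RtoC q) _ (HC (RtoC q) ltac:(rewrite HqC; unfold q; lra)))
    as (M & HM & Ha).
  rewrite HqC in Ha.
  set (r := q / 8).
  assert (Hr : 0 < r) by (unfold r; lra).
  assert (Har : forall n, Cmod (a n) * r ^ n * 4 ^ n <= M * (/ 2) ^ n).
  { intros n; apply (Rmult_le_reg_r (2 ^ n)); [apply pow_lt; lra|].
    rewrite !Rmult_assoc, <- !Rpow_mult_distr.
    replace (/ 2 * 2) with 1 by lra; replace (r * (4 * 2)) with q by (unfold r; field).
    rewrite pow1; generalize (Ha n); lra. }
  assert (H4 : forall n, 1 <= 4 ^ n) by (intros; apply pow_R1_Rle; lra).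
  assert (Hrn : forall n, 0 <= Cmod (a n) * r ^ n).
  { intros n; apply Rmult_le_pos; [apply Cmod_ge_0|apply pow_le; lra]. }
  assert (HR4 : r < R0) by (unfold r, q; lra).
  pose (B := 2 * M + 2 * (M * / r) + 2 * (M * / r ^ 2)).
  assert (Hir : 0 < / r) by now apply Rinv_0_lt_compat.
  assert (Hir2 : 0 < / r ^ 2) by (apply Rinv_0_lt_compat; nra).
  assert (HMr : 0 <= M * / r) by nra.
  assert (HMr2 : 0 <= M * / r ^ 2) by nra.
  exists (r / 2), B; split; [lra|]; split; [unfold B; lra|].
  assert (Hb : forall w, Cmod w <= r -> Cmod (f (z0 + w)%C) <= 2 * M).
  { intros w Hw; apply (Clim_Cmod_le _ _ _ (HC w ltac:(lra))).
    exists 0%nat; intros n _.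
    apply (psum_bound (fun n => w ^ n * a n)%C); auto; intros k.
    rewrite Cmod_mult, Cmod_pow.
    eapply Rle_trans; [|apply Har].
    apply Rle_trans with (Cmod (a k) * r ^ k).
    - rewrite Rmult_comm; apply Rmult_le_compat_l; [apply Cmod_ge_0|].
      apply pow_incr; split; [apply Cmod_ge_0|assumption].
    - generalize (Hrn k) (H4 k); nra. }
  intros z Hz; set (w0 := (z - z0)%C) in *.
  assert (Ez : z = (z0 + w0)%C) by (unfold w0; ring).
  assert (Hw0 : Cmod w0 <= r) by lra.
  split; [rewrite Ez; generalize (Hb w0 Hw0); unfold B; lra|].
  assert (Hd : forall n, Cmod (dpow w0 n * a n) <= M * / r * (/ 2) ^ n).
  { intros n; rewrite Cmod_mult.
    apply (Rmult_le_reg_r r); [assumption|].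
    replace (M * / r * (/ 2) ^ n * r) with (M * (/ 2) ^ n) by (field; lra).
    eapply Rle_trans; [|apply Har].
    replace (Cmod (dpow w0 n) * Cmod (a n) * r) with (Cmod (a n) * (Cmod (dpow w0 n) * r)) by ring.
    rewrite Rmult_assoc; apply Rmult_le_compat_l; [apply Cmod_ge_0|].
    eapply Rle_trans; [apply (Cmod_dpow w0 r n Hw0)|].
    rewrite Rmult_comm; apply Rmult_le_compat_l; [apply pow_le; lra|].
    eapply Rle_trans; [apply INR_le_pow2|apply pow_incr; lra]. }
  destruct (geometric_Clim_exists (fun n => dpow w0 n * a n)%C (dpsum a w0) (M * / r) (/ 2))
    as [d Hd']; auto; [lra|].
  exists d; split.
  { apply Rle_trans with (2 * (M * / r)); [|unfold B; lra].
    apply (Clim_Cmod_le _ _ _ Hd'); exists 0%nat; intros n _.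
    apply (psum_bound (fun n => dpow w0 n * a n)%C); auto. }
  intros k Hk.
  assert (Hwk : Cmod (w0 + k) <= r) by (eapply Rle_trans; [apply Cmod_triangle|lra]).
  apply Rle_trans with (2 * (M * / r ^ 2 * Cmod k ^ 2)).
  2:{ unfold B; generalize (pow2_ge_0 (Cmod k)); nra. }
  assert (HL : Clim (fun n => psum a (w0 + k) n - psum a w0 n - k * dpsum a w0 n)%C
    (f (z + k) - f z - k * d)%C).
  { apply Clim_minus; [apply Clim_minus|now apply Clim_scal].
    - replace (z + k)%C with (z0 + (w0 + k))%C by (unfold w0; ring); apply HC; lra.
    - rewrite Ez; apply HC; lra. }
  apply (Clim_Cmod_le _ _ _ HL); exists 0%nat; intros n _.
  apply (psum_bound (fun n => ((w0 + k) ^ n - w0 ^ n - k * dpow w0 n) * a n)%C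
    (fun n => psum a (w0 + k) n - psum a w0 n - k * dpsum a w0 n)%C).
  - apply Rmult_le_pos; [assumption|apply pow2_ge_0].
  - cbn; ring.
  - intros m; cbn [psum dpsum]; ring.
  - intros m; rewrite Cmod_mult.
    apply (Rmult_le_reg_r (r ^ 2)); [nra|].
    replace (M * / r ^ 2 * Cmod k ^ 2 * (/ 2) ^ m * r ^ 2)
      with (Cmod k ^ 2 * (M * (/ 2) ^ m)) by (field; lra).
    apply Rle_trans with (Cmod k ^ 2 * (Cmod (a m) * r ^ m * 4 ^ m)).
    2:{ apply Rmult_le_compat_l; [apply pow2_ge_0|apply Har]. }
    set (e := ((w0 + k) ^ m - w0 ^ m - k * dpow w0 m)%C).
    replace (Cmod e * Cmod (a m) * r ^ 2) with (Cmod (a m) * (Cmod e * r ^ 2)) by ring.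
    replace (Cmod k ^ 2 * (Cmod (a m) * r ^ m * 4 ^ m))
      with (Cmod (a m) * (4 ^ m * Cmod k ^ 2 * r ^ m)) by ring.
    apply Rmult_le_compat_l; [apply Cmod_ge_0|].
    eapply Rle_trans; [apply (Cmod_pow_taylor w0 k r m Hw0 Hwk)|].
    apply Rmult_le_compat_r; [apply pow_le; lra|].
    apply Rmult_le_compat_r; [apply pow2_ge_0|apply INR_sqr_le_pow4].
Qed.

(** A single number [delta] encodes both the radius [8 delta] of a good disc and its bound
    [/ delta], so one lower bound on [delta] over the compact box [[0, 1] x [- eta, eta]] makes both
    uniform. Periodicity carries the estimates from the box to the strip, and the same radius widens
    the strip by [d]. *)
Lemma analytic_extension_holo_strip v eta vc :
  0 <= eta -> analytic_extension v eta vc -> exists h, eta < h /\ holo_strip h vc.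
Proof.
  intros Heta (U & HU & HUs & HUp & Hvp & Han & _).
  pose (loc := fun (z0 : C) r B => forall z, Cmod (z - z0) < r -> U z /\
    Cmod (vc z) <= B /\ exists d, Cmod d <= B /\
      forall w, Cmod w < r -> Cmod (vc (z + w)%C - vc z - w * d) <= B * Cmod w ^ 2).
  assert (Hloc : forall u v : R, exists d : posreal, Rabs v <= eta -> loc (u, v) (8 * d) (/ d)).
  { intros u y; destruct (classic (Rabs y <= eta)) as [Hy|Hy].
    2:{ exists (mkposreal 1 Rlt_0_1); tauto. }
    assert (HUz : U (u, y)) by (apply HUs; exact Hy).
    destruct (analytic_at_local vc (u, y) (Han _ HUz)) as (r & B & Hr & HB & H).
    destruct (HU _ HUz) as [e He].
    assert (Hi : 0 < / (B + 1)) by (apply Rinv_0_lt_compat; lra).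
    assert (Hd : 0 < Rmin (Rmin r e / 8) (/ (B + 1))).
    { apply Rmin_pos; [|assumption].
      assert (0 < Rmin r e) by (apply Rmin_pos; [assumption|apply cond_pos]); lra. }
    exists (mkposreal _ Hd); cbn; intros _.
    set (d := Rmin (Rmin r e / 8) (/ (B + 1))) in *.
    assert (Hd1 : 8 * d <= Rmin r e).
    { assert (d <= Rmin r e / 8) by apply Rmin_l; lra. }
    assert (Hd2 : B <= / d).
    { assert (d <= / (B + 1)) by apply Rmin_r.
      apply Rle_trans with (B + 1); [lra|].
      rewrite <- (Rinv_inv (B + 1)); apply Rinv_le_contravar; lra. }
    intros z Hz; split; [|].
    - apply He, C_NormedModule_mixin_compat1.
      eapply Rlt_le_trans; [exact Hz|]; eapply Rle_trans; [exact Hd1|apply Rmin_r].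
    - assert (Hrd : 8 * d <= r) by (eapply Rle_trans; [exact Hd1|apply Rmin_l]).
      destruct (H z ltac:(lra)) as (Hb & c & Hc & Hq).
      split; [lra|]; exists c; split; [lra|]; intros w Hw.
      eapply Rle_trans; [apply Hq; lra|].
      apply Rmult_le_compat_r; [apply pow2_ge_0|assumption]. }
  pose (delta := fun u v => proj1_sig (constructive_indefinite_description _ (Hloc u v))).
  assert (Hdelta : forall u v, Rabs v <= eta -> loc (u, v) (8 * delta u v) (/ delta u v)).
  { intros u y; unfold delta; destruct (constructive_indefinite_description _ (Hloc u y)); auto. }
  destruct (compactness_value_2d 0 1 (- eta) eta delta) as [d Hd].
  assert (Hd0 := cond_pos d).
  assert (Hunit : forall x y, 0 <= x <= 1 -> Rabs y <= eta + d -> loc (x, y) (4 * d) (/ d)).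
  { intros x y Hx Hy.
    assert (Hyc : exists y', - eta <= y' <= eta /\ Rabs (y - y') <= d).
    { apply Rabs_le_between in Hy.
      destruct (Rle_dec y (- eta)); [exists (- eta)|destruct (Rle_dec y eta); [exists y|exists eta]];
        (split; [lra|]); apply Rabs_le; lra. }
    destruct Hyc as (y' & Hy' & Hyy).
    (* Clamping [y] into [[- eta, eta]] costs at most [d], and [e = delta u t >= d]: a point within
       [4 d] of [(x, y)] lies within [4 d + d + 2 e <= 7 e < 8 e] of the centre [(u, t)]. *)
    destruct (NNPP _ (Hd x y' Hx Hy')) as (u & t & Hu & Ht & Hxu & Hyt & Hdd).
    assert (L := Hdelta u t ltac:(apply Rabs_le; lra)).
    set (e := delta u t) in *; assert (He := cond_pos e).
    assert (Hed : / e <= / d) by (apply Rinv_le_contravar; lra).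
    intros z Hz; destruct (L z) as (HUz & Hb & c & Hc & Hq).
    - replace (z - (u, t))%C with ((z - (x, y)) + ((x - u)%R, (y - t)%R))%C.
      2:{ destruct z; unfold Cminus, Cplus, Copp; cbn; f_equal; ring. }
      eapply Rle_lt_trans; [apply Cmod_triangle|].
      assert (Cmod (x - u, y - t) <= Rabs (x - u) + Rabs (y - t)) by apply Cmod_le_Rabs.
      assert (Rabs (y - t) <= Rabs (y - y') + Rabs (y' - t)).
      { replace (y - t) with ((y - y') + (y' - t)) by ring; apply Rabs_triang. }
      lra.
    - split; [assumption|]; split; [lra|]; exists c; split; [lra|]; intros w Hw.
      eapply Rle_trans; [apply Hq; lra|].
      apply Rmult_le_compat_r; [apply pow2_ge_0|assumption]. }
  assert (Hper : forall (n : nat) z, U z -> U (z + RtoC (INR n))%C /\ vc (z + RtoC (INR n))%C = vc z).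
  { intros n z Hz; induction n as [|n [IH1 IH2]].
    - replace (z + RtoC (INR 0))%C with z by (cbn; ring); auto.
    - rewrite S_INR, RtoC_plus, Cplus_assoc; split; [now apply HUp|].
      rewrite Hvp; assumption. }
  assert (Hback : forall (n : nat) z, U z -> U (z - RtoC (INR n))%C).
  { intros n z Hz; induction n as [|n IH].
    - replace (z - RtoC (INR 0))%C with z by (cbn; ring); auto.
    - apply HUp; rewrite S_INR, RtoC_plus.
      now replace (z - (RtoC (INR n) + RtoC 1) + 1)%C with (z - RtoC (INR n))%C by ring. }
  assert (HperZ : forall (m : Z) z, U z -> U (z + RtoC (IZR m))%C /\ vc (z + RtoC (IZR m))%C = vc z).
  { intros m z Hz; destruct (Z_le_gt_dec 0 m) as [Hm|Hm].
    - rewrite <- (Z2Nat.id m Hm), <- INR_IZR_INZ; now apply Hper.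
    - assert (Em : IZR m = - INR (Z.to_nat (- m))) by (rewrite INR_IZR_INZ, Z2Nat.id, opp_IZR by lia; ring).
      rewrite Em, RtoC_opp.
      change (z + - RtoC (INR (Z.to_nat (- m))))%C with (z - RtoC (INR (Z.to_nat (- m))))%C.
      assert (Hb := Hback (Z.to_nat (- m)) z Hz); split; [assumption|].
      rewrite <- (proj2 (Hper (Z.to_nat (- m)) _ Hb)); f_equal; ring. }
  assert (Hid : 0 < / d) by now apply Rinv_0_lt_compat.
  exists (eta + d); split; [lra|].
  assert (Hall : forall z, Rabs (Im z) <= eta + d -> exists m : Z,
    loc (z - RtoC (IZR m))%C (4 * d) (/ d)).
  { intros z Hz; destruct (archimed (Re z)) as [A1 A2].
    exists (up (Re z) - 1)%Z.
    replace (z - RtoC (IZR (up (Re z) - 1)))%C with ((Re z - IZR (up (Re z) - 1), Im z) : C).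
    - apply Hunit; [rewrite minus_IZR; lra|assumption].
    - destruct z; unfold Cminus, Cplus, Copp, RtoC; cbn; f_equal; ring. }
  assert (Ez : forall m t, t = (t - RtoC (IZR m) + RtoC (IZR m))%C) by (intros; ring).
  split.
  - intros z Hz; apply Hvp; destruct (Hall z Hz) as [m L].
    rewrite (Ez m z); apply HperZ, L.
    replace (z - RtoC (IZR m) - (z - RtoC (IZR m)))%C with (RtoC 0) by ring; rewrite Cmod_0; lra.
  - exists (/ d), (2 * d).
    split; [lra|]; split; [lra|]; intros z Hz.
    destruct (Hall z Hz) as [m L].
    destruct (L (z - RtoC (IZR m))%C) as (HUz & Hb & c & Hc & Hq).
    { replace (z - RtoC (IZR m) - (z - RtoC (IZR m)))%C with (RtoC 0) by ring; rewrite Cmod_0; lra. }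
    assert (HV := proj2 (HperZ m _ HUz)); rewrite <- Ez in HV.
    split; [rewrite HV; assumption|]; exists c; split; [assumption|]; intros w _ Hw.
    destruct (L (z + w - RtoC (IZR m))%C) as (HUw & _).
    { replace (z + w - RtoC (IZR m) - (z - RtoC (IZR m)))%C with w by ring; lra. }
    assert (HVw := proj2 (HperZ m _ HUw)); rewrite <- Ez in HVw.
    rewrite HV, HVw.
    replace (z + w - RtoC (IZR m))%C with (z - RtoC (IZR m) + w)%C by ring.
    apply Hq; lra.
Qed.

(** * Square-summable sequences and the spectrum *)

(** States that the norm is at most [s] through finite symmetric sums; series appear only in
    [in_l2_bound] and [l2_bound_in], which translate to and from [in_l2]. *)
Definition l2_bound (u : Z -> C) (s : R) : Prop :=
  0 <= s /\ forall B, rsym (fun n => Cmod (u n) ^ 2) B <= s ^ 2.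

Lemma rsym_term_le f B k :
  (Z.abs k <= Z.of_nat B)%Z -> (forall j, 0 <= f j) -> f k <= rsym f B.
Proof. intros Hk Hf; apply rsum_term_le; [lia|auto]. Qed.

Lemma rsym_le_compat f B B' :
  (B <= B')%nat -> (forall j, 0 <= f j) -> rsym f B <= rsym f B'.
Proof. intros HB Hf; apply rsum_subrange_le; [lia|lia|auto]. Qed.

Lemma rsym_support f B B' :
  (B <= B')%nat -> (forall j, (Z.of_nat B < Z.abs j)%Z -> f j = 0) -> rsym f B' = rsym f B.
Proof.
  intros HB Hf; apply rsum_subrange; [lia|lia|]; intros k _ Hk; apply Hf; lia.
Qed.

Lemma rsym_shift_support f B s B' :
  (Z.of_nat B + Z.abs s <= Z.of_nat B')%Z ->
  (forall j, (Z.of_nat B < Z.abs j)%Z -> f j = 0) ->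
  rsym (fun n => f (n + s)%Z) B' = rsym f B.
Proof.
  intros HB Hf; unfold rsym at 1; rewrite rsum_shift.
  apply rsum_subrange; [lia|lia|]; intros k _ Hk; apply Hf; lia.
Qed.

(** Young's inequality with the weights for which norms [s] and [t] add up to exactly [(s + t)^2],
    as the triangle inequality [l2_bound_plus] requires. *)
Lemma Cmod_plus_sqr_le (a b : C) s t :
  0 < s -> 0 < t ->
  Cmod (a + b) ^ 2 <= (1 + t / s) * Cmod a ^ 2 + (1 + s / t) * Cmod b ^ 2.
Proof.
  intros Hs Ht.
  set (x := Cmod a); set (y := Cmod b).
  assert (H : Cmod (a + b) ^ 2 <= (x + y) ^ 2).
  { apply pow_incr; split; [apply Cmod_ge_0|apply Cmod_triangle]. }
  assert (Hst : 0 < s * t) by now apply Rmult_lt_0_compat.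
  assert (E : (1 + t / s) * x ^ 2 + (1 + s / t) * y ^ 2 - (x + y) ^ 2
    = (t * x - s * y) ^ 2 / (s * t)) by (field; lra).
  assert (0 <= (t * x - s * y) ^ 2 / (s * t)).
  { apply Rmult_le_pos; [apply pow2_ge_0|left; now apply Rinv_0_lt_compat]. }
  lra.
Qed.

Lemma l2_bound_0 u n : l2_bound u 0 -> u n = RtoC 0.
Proof.
  intros [_ H]; apply Cmod_eq_0.
  assert (Hn := rsym_term_le (fun n => Cmod (u n) ^ 2) (Z.to_nat (Z.abs n)) n ltac:(lia)
    (fun j => pow2_ge_0 _)).
  specialize (H (Z.to_nat (Z.abs n))); cbn beta in Hn.
  generalize (Cmod_ge_0 (u n)); nra.
Qed.

Lemma l2_bound_plus u v s t :
  l2_bound u s -> l2_bound v t -> l2_bound (fun n => u n + v n)%C (s + t).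
Proof.
  intros Hu Hv.
  destruct (Rle_lt_or_eq_dec 0 s (proj1 Hu)) as [Hs|<-].
  2:{ rewrite Rplus_0_l; split; [apply Hv|]; intros B.
      unfold rsym; rewrite <- (rsum_ext (fun n => Cmod (v n) ^ 2)); [apply Hv|].
      intros k _; rewrite (l2_bound_0 u k Hu), Cplus_0_l; reflexivity. }
  destruct (Rle_lt_or_eq_dec 0 t (proj1 Hv)) as [Ht|<-].
  2:{ rewrite Rplus_0_r; split; [apply Hu|]; intros B.
      unfold rsym; rewrite <- (rsum_ext (fun n => Cmod (u n) ^ 2)); [apply Hu|].
      intros k _; rewrite (l2_bound_0 v k Hv), Cplus_0_r; reflexivity. }
  split; [lra|]; intros B.
  apply Rle_trans with (rsym (fun n => (1 + t / s) * Cmod (u n) ^ 2 + (1 + s / t) * Cmod (v n) ^ 2) B).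
  - apply rsum_le; intros; now apply Cmod_plus_sqr_le.
  - unfold rsym; rewrite rsum_plus, !rsum_scal.
    assert (Hts : 0 < t / s) by now apply Rdiv_lt_0_compat.
    assert (Hst : 0 < s / t) by now apply Rdiv_lt_0_compat.
    apply Rle_trans with ((1 + t / s) * s ^ 2 + (1 + s / t) * t ^ 2); [|right; field; lra].
    apply Rplus_le_compat; (apply Rmult_le_compat_l; [lra|]); [apply Hu|apply Hv].
Qed.

Lemma l2_bound_scal c u s :
  l2_bound u s -> l2_bound (fun n => c * u n)%C (Cmod c * s).
Proof.
  intros [Hs Hu]; generalize (Cmod_ge_0 c); intros Hc; split; [nra|]; intros B.
  unfold rsym; rewrite (rsum_ext _ (fun n => Cmod c ^ 2 * Cmod (u n) ^ 2)).
  - rewrite rsum_scal, Rpow_mult_distr.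
    apply Rmult_le_compat_l; [apply pow2_ge_0|apply Hu].
  - intros; rewrite Cmod_mult; ring.
Qed.

Lemma l2_bound_term u s n : l2_bound u s -> Cmod (u n) <= s.
Proof.
  intros [Hs H].
  assert (Hn := rsym_term_le (fun n => Cmod (u n) ^ 2) (Z.to_nat (Z.abs n)) n ltac:(lia)
    (fun j => pow2_ge_0 _)).
  specialize (H (Z.to_nat (Z.abs n))); cbn beta in Hn.
  generalize (Cmod_ge_0 (u n)); nra.
Qed.

(** Lower semicontinuity of the norm: if a finite section of [v] exceeded [s^2], the same section of
    some [u N] would already exceed it. *)
Lemma l2_bound_lim (u : nat -> Z -> C) v s :
  (forall i, l2_bound (u i) s) -> (forall n, Clim (fun i => u i n) (v n)) -> l2_bound v s.
Proof.
  intros Hu Hlim; split; [apply (Hu 0%nat)|]; intros B; apply Rnot_lt_le; intros Hlt.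
  set (L := rsym (fun n => Cmod (v n) ^ 2) B) in *.
  set (m := INR (2 * B + 1)).
  assert (Hm : 0 < m) by (apply lt_0_INR; lia).
  (* Each of the [m] squares moves by at most [e (2 s + 1)], since [e <= 1]; using [2 s + 2] instead
     leaves a strict inequality. *)
  set (e := Rmin 1 ((L - s ^ 2) / (m * (2 * s + 2)))).
  assert (Hs := proj1 (Hu 0%nat)).
  assert (He : 0 < e).
  { apply Rmin_pos; [lra|]; apply Rdiv_lt_0_compat; [lra|nra]. }
  destruct (Clim_uniform_finite u v B e Hlim He) as [N HN].
  assert (HLe : L < rsym (fun n => Cmod (u N n) ^ 2 + e * (2 * s + 2)) B).
  { unfold L, rsym.
    assert (Hpt : forall k, (- Z.of_nat B <= k < - Z.of_nat B + Z.of_nat (2 * B + 1))%Z ->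
      Cmod (v k) ^ 2 <= Cmod (u N k) ^ 2 + e * (2 * s + 1)).
    { intros k Hk; specialize (HN N k (Nat.le_refl N) ltac:(lia)).
      assert (Hv : Cmod (v k) <= Cmod (u N k) + e).
      { replace (v k) with (u N k + - (u N k - v k))%C by ring.
        eapply Rle_trans; [apply Cmod_triangle|]; rewrite Cmod_opp; lra. }
      assert (Hus := l2_bound_term _ _ k (Hu N)).
      assert (e <= 1) by apply Rmin_l.
      generalize (Cmod_ge_0 (v k)) (Cmod_ge_0 (u N k)); nra. }
    eapply Rle_lt_trans; [apply rsum_le; exact Hpt|].
    rewrite !rsum_plus, !rsum_const; fold m; nra. }
  unfold rsym in HLe; rewrite rsum_plus, rsum_const in HLe; fold m in HLe.
  assert (Hus := proj2 (Hu N) B); unfold rsym in Hus.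
  assert (m * (e * (2 * s + 2)) <= L - s ^ 2); [|lra].
  apply Rle_trans with (m * ((L - s ^ 2) / (m * (2 * s + 2)) * (2 * s + 2))); [|right; field; lra].
  apply Rmult_le_compat_l; [lra|]; apply Rmult_le_compat_r; [lra|apply Rmin_r].
Qed.

Lemma rsym_sum_n (f : Z -> R) N :
  rsym f (S N) = sum_n (fun n => f (Z.of_nat n)) (S N)
    + sum_n (fun n => f (- Z.of_nat (S n))%Z) N.
Proof.
  induction N as [|N IH].
  - rewrite rsym_succ, rsym_0, sum_Sn, !sum_O; reflexivity.
  - rewrite rsym_succ, IH, (sum_Sn (fun n => f (Z.of_nat n)) (S N)),
      (sum_Sn (fun n => f (- Z.of_nat (S n))%Z) N).
    unfold plus; cbn [AbelianMonoid.plus]; cbn; ring.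
Qed.

Lemma sum_n_le_is_series (a : nat -> R) l n :
  (forall k, 0 <= a k) -> is_series a l -> sum_n a n <= l.
Proof.
  intros Ha Hl.
  apply (is_lim_seq_incr_compare (sum_n a) l Hl).
  intros k; rewrite sum_Sn; unfold plus; cbn; generalize (Ha (S k)); lra.
Qed.

Lemma in_l2_bound u : in_l2 u -> l2_bound u (l2_norm u).
Proof.
  intros (s & lp & lm & Hp & Hm & _).
  split; [apply sqrt_pos|]; intros B; unfold l2_norm.
  rewrite (is_series_unique _ _ Hp), (is_series_unique _ _ Hm).
  assert (Hpos : forall g : nat -> Z, forall k, 0 <= Cmod (u (g k)) ^ 2) by (intros; apply pow2_ge_0).
  assert (Hlp := fun n => sum_n_le_is_series _ _ n (Hpos Z.of_nat) Hp).
  assert (Hlm := fun n => sum_n_le_is_series _ _ n (Hpos (fun n => - Z.of_nat (S n))%Z) Hm).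
  assert (H0p : 0 <= lp).
  { eapply Rle_trans; [|apply (Hlp 0%nat)]; rewrite sum_O; apply pow2_ge_0. }
  assert (H0m : 0 <= lm).
  { eapply Rle_trans; [|apply (Hlm 0%nat)]; rewrite sum_O; apply pow2_ge_0. }
  rewrite pow2_sqrt by lra.
  eapply Rle_trans; [apply (rsym_le_compat _ B (S B)); [lia|intros; apply pow2_ge_0]|].
  rewrite rsym_sum_n; generalize (Hlp (S B)) (Hlm B); lra.
Qed.

Lemma l2_bound_in u s : l2_bound u s -> in_l2 u /\ l2_norm u <= s.
Proof.
  intros [Hs H].
  set (fp := fun n : nat => Cmod (u (Z.of_nat n)) ^ 2).
  set (fm := fun n : nat => Cmod (u (- Z.of_nat (S n))%Z) ^ 2).
  assert (Hinc : forall f : nat -> R, (forall k, 0 <= f k) -> forall n, sum_n f n <= sum_n f (S n)).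
  { intros f Hf n; rewrite sum_Sn; unfold plus; cbn; generalize (Hf (S n)); lra. }
  assert (Hpos : forall f : nat -> R, (forall k, 0 <= f k) -> forall n, 0 <= sum_n f n).
  { intros f Hf n; induction n; [rewrite sum_O; auto|].
    eapply Rle_trans; [exact IHn|now apply Hinc]. }
  assert (Hfp : forall k, 0 <= fp k) by (intros; apply pow2_ge_0).
  assert (Hfm : forall k, 0 <= fm k) by (intros; apply pow2_ge_0).
  assert (Hsum : forall n, sum_n fp n + sum_n fm n <= s ^ 2).
  { intros n; specialize (H (S n)); rewrite rsym_sum_n in H; fold fp fm in H.
    generalize (Hinc fp Hfp n); lra. }
  assert (Hex : forall f : nat -> R, (forall k, 0 <= f k) -> (forall n, sum_n f n <= s ^ 2) ->
    exists l : R, is_series f l).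
  { intros f Hf Hb.
    destruct (ex_finite_lim_seq_incr (sum_n f) (s ^ 2) (Hinc f Hf) Hb) as [l Hl].
    now exists l. }
  destruct (Hex fp Hfp) as [lp Hp].
  { intros n; generalize (Hsum n) (Hpos fm Hfm n); lra. }
  destruct (Hex fm Hfm) as [lm Hm].
  { intros n; generalize (Hsum n) (Hpos fp Hfp n); lra. }
  split; [exists (lp + lm), lp, lm; auto|].
  unfold l2_norm; fold fp fm.
  rewrite (is_series_unique _ _ Hp), (is_series_unique _ _ Hm).
  rewrite <- (sqrt_pow2 s Hs); apply sqrt_le_1_alt.
  apply (is_lim_seq_le (fun n => sum_n fp n + sum_n fm n) (fun _ => s ^ 2) (lp + lm) (s ^ 2) Hsum).
  - apply (is_lim_seq_plus' (sum_n fp) (sum_n fm)); assumption.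
  - apply is_lim_seq_const.
Qed.

(** * Jacobi operators with bounded potential and their inversion *)

Definition jacobi (w : Z -> R) (u : Z -> C) (n : Z) : C :=
  (u (n + 1)%Z + u (n - 1)%Z + RtoC (w n) * u n)%C.

Definition rdot (a b : C) : R := Re a * Re b + Im a * Im b.

Lemma rdot_self a : rdot a a = Cmod a ^ 2.
Proof. rewrite Cmod_sqr_re_im; unfold rdot; ring. Qed.

Lemma Cmod_jacobi_sqr w W u n :
  (forall k, Rabs (w k) <= W) ->
  Cmod (jacobi w u n) ^ 2 <=
    3 * Cmod (u (n + 1)%Z) ^ 2 + 3 * Cmod (u (n - 1)%Z) ^ 2 + 3 * W ^ 2 * Cmod (u n) ^ 2.
Proof.
  intros Hw; unfold jacobi.
  set (a := Cmod (u (n + 1)%Z)); set (b := Cmod (u (n - 1)%Z)); set (c := Cmod (RtoC (w n) * u n)).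
  assert (H : Cmod (u (n + 1)%Z + u (n - 1)%Z + RtoC (w n) * u n) <= a + b + c).
  { eapply Rle_trans; [apply Cmod_triangle|]; unfold c.
    generalize (Cmod_triangle (u (n + 1)%Z) (u (n - 1)%Z)); fold a b; lra. }
  assert (Hc : c ^ 2 <= W ^ 2 * Cmod (u n) ^ 2).
  { unfold c; rewrite Cmod_mult, Cmod_R, Rpow_mult_distr.
    apply Rmult_le_compat_r; [apply pow2_ge_0|].
    apply pow_incr; split; [apply Rabs_pos|apply Hw]. }
  assert (H' := pow_incr _ _ 2 (conj (Cmod_ge_0 _) H)).
  generalize (pow2_ge_0 (a - b)) (pow2_ge_0 (a - c)) (pow2_ge_0 (b - c)); nra.
Qed.

Lemma jacobi_l2_sqr w W u B :
  (forall k, Rabs (w k) <= W) ->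
  rsym (fun n => Cmod (jacobi w u n) ^ 2) B
    <= (6 + 3 * W ^ 2) * rsym (fun n => Cmod (u n) ^ 2) (S B).
Proof.
  intros Hw; set (f := fun n => Cmod (u n) ^ 2).
  assert (Hf : forall k, 0 <= f k) by (intros; apply pow2_ge_0).
  apply Rle_trans with (rsym (fun n => 3 * f (n + 1)%Z + 3 * f (n + -1)%Z + 3 * W ^ 2 * f n) B).
  { apply rsum_le; intros; now apply Cmod_jacobi_sqr. }
  unfold rsym at 1; rewrite !rsum_plus, !rsum_scal, !rsum_shift.
  assert (H1 : rsum f (- Z.of_nat B + 1) (2 * B + 1) <= rsym f (S B))
    by (apply rsum_subrange_le; [lia|lia|auto]).
  assert (H2 : rsum f (- Z.of_nat B + -1) (2 * B + 1) <= rsym f (S B))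
    by (apply rsum_subrange_le; [lia|lia|auto]).
  assert (H3 : rsum f (- Z.of_nat B) (2 * B + 1) <= rsym f (S B))
    by (apply rsum_subrange_le; [lia|lia|auto]).
  generalize (pow2_ge_0 W); nra.
Qed.

(** Summation by parts; the margin of two sites between [B] and [B'] removes all boundary terms. *)
Lemma jacobi_symmetric w u g B B' :
  (forall n, (Z.of_nat B < Z.abs n)%Z -> u n = RtoC 0) -> (B + 2 <= B')%nat ->
  rsym (fun n => rdot (u n) (jacobi w g n)) B' = rsym (fun n => rdot (jacobi w u n) (g n)) B'.
Proof.
  intros Hu HB.
  assert (H0 : forall c, rdot (RtoC 0) c = 0) by (intros; unfold rdot; cbn; ring).
  set (p := fun n => rdot (u (n - 1)%Z) (g n)).
  set (m := fun n => rdot (u (n + 1)%Z) (g n)).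
  set (d := fun n => w n * rdot (u n) (g n)).
  transitivity (rsym (fun n => p (n + 1)%Z + m (n + -1)%Z + d n) B').
  { apply rsum_ext; intros n _; unfold p, m, d.
    replace (n + 1 - 1)%Z with n by lia; replace (n + -1 + 1)%Z with n by lia.
    replace (n + -1)%Z with (n - 1)%Z by lia.
    unfold jacobi, rdot, Cplus, Cmult, RtoC, Re, Im; cbn [fst snd]; ring. }
  transitivity (rsym (fun n => p n + m n + d n) B').
  { unfold rsym; rewrite !rsum_plus; do 2 f_equal.
    - apply (eq_trans (rsym_shift_support p (S B) 1 B' ltac:(lia)
        ltac:(intros; unfold p; rewrite Hu by lia; apply H0))).
      symmetry; apply rsym_support; [lia|intros; unfold p; rewrite Hu by lia; apply H0].
    - apply (eq_trans (rsym_shift_support m (S B) (-1) B' ltac:(lia)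
        ltac:(intros; unfold m; rewrite Hu by lia; apply H0))).
      symmetry; apply rsym_support; [lia|intros; unfold m; rewrite Hu by lia; apply H0]. }
  apply rsum_ext; intros n _; unfold p, m, d.
  unfold jacobi, rdot, Cplus, Cmult, RtoC, Re, Im; cbn [fst snd]; ring.
Qed.

Definition richardson (w : Z -> R) (tau : R) (u : Z -> C) (n : Z) : C :=
  (u n - RtoC tau * jacobi w (jacobi w u) n)%C.

Definition truncate (B : nat) (u : Z -> C) (n : Z) : C :=
  if Z_le_dec (Z.abs n) (Z.of_nat B) then u n else RtoC 0.

Lemma truncate_in B u n : (Z.abs n <= Z.of_nat B)%Z -> truncate B u n = u n.
Proof. intros H; unfold truncate; destruct Z_le_dec; [reflexivity|lia]. Qed.

Lemma truncate_out B u n : (Z.of_nat B < Z.abs n)%Z -> truncate B u n = RtoC 0.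
Proof. intros H; unfold truncate; destruct Z_le_dec; [lia|reflexivity]. Qed.

Lemma jacobi_support w u B :
  (forall n, (Z.of_nat B < Z.abs n)%Z -> u n = RtoC 0) ->
  forall n, (Z.of_nat (S B) < Z.abs n)%Z -> jacobi w u n = RtoC 0.
Proof. intros Hu n Hn; unfold jacobi; rewrite !Hu by lia; ring. Qed.

Lemma jacobi_lim w (u : nat -> Z -> C) v n :
  (forall k, Clim (fun i => u i k) (v k)) -> Clim (fun i => jacobi w (u i) n) (jacobi w v n).
Proof.
  intros H; unfold jacobi; apply Clim_plus; [apply Clim_plus; apply H|].
  apply Clim_scal, H.
Qed.

(* The approximate inverse [tau T] of [T] leaves the residual [1 - tau T^2],
   a contraction on l^2 as soon as [T] is bounded below on finitely supported
   sequences; hence the Neumann series for [T^-1] converges. *)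
Lemma jacobi_invertible w W c :
  (forall k, Rabs (w k) <= W) -> 0 < c <= 1 ->
  (forall psi B, (forall n, (Z.of_nat B < Z.abs n)%Z -> psi n = RtoC 0) ->
     c ^ 2 * rsym (fun n => Cmod (psi n) ^ 2) B
       <= rsym (fun n => Cmod (jacobi w psi n) ^ 2) (S B)) ->
  exists (G : (Z -> C) -> (Z -> C)) (M : R),
    (forall f, in_l2 f -> in_l2 (G f) /\ l2_norm (G f) <= M * l2_norm f /\
       forall n, jacobi w (G f) n = f n) /\
    (forall u, in_l2 u -> forall n, G (fun m => jacobi w u m) n = u n).
Proof.
  intros Hw Hc Hlow.
  pose (b2 := 6 + 3 * W ^ 2).
  assert (Hb2 : 6 <= b2) by (generalize (pow2_ge_0 W); unfold b2; lra).
  pose (tau := / b2).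
  assert (Htau : 0 < tau) by (apply Rinv_0_lt_compat; lra).
  assert (Htb : tau * b2 = 1) by (unfold tau; field; lra).
  assert (Htau1 : tau <= 1) by nra.
  pose (q2 := 1 - tau * c ^ 2).
  assert (Hq2 : 0 <= q2 < 1) by (unfold q2; split; nra).
  pose (q := sqrt q2).
  assert (Hqq : q ^ 2 = q2) by (apply pow2_sqrt; lra).
  assert (Hq : 0 <= q < 1).
  { split; [apply sqrt_pos|]; unfold q; rewrite <- sqrt_1; apply sqrt_lt_1; lra. }
  pose (T := jacobi w); pose (S' := richardson w tau).
  assert (HTl2 : forall u s, l2_bound u s -> l2_bound (T u) (b2 * s)).
  { intros u s [Hs Hu]; split; [nra|]; intros B.
    eapply Rle_trans; [apply (jacobi_l2_sqr w W u B Hw)|]; fold b2.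
    specialize (Hu (S B)).
    assert (0 <= rsym (fun n => Cmod (u n) ^ 2) (S B))
      by (apply rsum_ge0; intros; apply pow2_ge_0).
    rewrite Rpow_mult_distr; apply Rle_trans with (b2 * s ^ 2); [nra|].
    apply Rmult_le_compat_r; nra. }
  (* The squared norm of [r - tau T^2 r] is [|r|^2 - 2 tau |T r|^2 + tau^2 |T^2 r|^2]. As
     [tau b2 = 1], the last term is at most [tau |T r|^2], and the lower bound on [T r] leaves the
     factor [1 - tau c^2]. *)
  assert (Hfin : forall r B B', (forall n, (Z.of_nat B < Z.abs n)%Z -> r n = RtoC 0) ->
    (B + 4 <= B')%nat ->
    rsym (fun n => Cmod (S' r n) ^ 2) B' <= q2 * rsym (fun n => Cmod (r n) ^ 2) B).
  { intros r B B' Hr HB.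
    set (Nr := rsym (fun n => Cmod (r n) ^ 2) B).
    set (NT := rsym (fun n => Cmod (T r n) ^ 2) (S B)).
    set (NTT := rsym (fun n => Cmod (T (T r) n) ^ 2) B').
    assert (HTr := jacobi_support w r B Hr); fold T in HTr.
    assert (E : rsym (fun n => Cmod (S' r n) ^ 2) B' = Nr - 2 * tau * NT + tau ^ 2 * NTT).
    { transitivity (rsym (fun n => Cmod (r n) ^ 2 + (- 2 * tau) * rdot (r n) (T (T r) n)
        + tau ^ 2 * Cmod (T (T r) n) ^ 2) B').
      { apply rsum_ext; intros n _; unfold S', richardson.
        change (jacobi w (jacobi w r) n) with (T (T r) n).
        rewrite !Cmod_sqr_re_im; unfold rdot, Cminus, Cplus, Cmult, Copp, RtoC, Re, Im.
        cbn [fst snd]; ring. }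
      unfold rsym at 1; rewrite !rsum_plus, !rsum_scal.
      change (rsum (fun n => rdot (r n) (T (T r) n)) (- Z.of_nat B') (2 * B' + 1))
        with (rsym (fun n => rdot (r n) (jacobi w (T r) n)) B').
      rewrite (jacobi_symmetric w r (T r) B B' Hr ltac:(lia)).
      assert (E1 : rsym (fun n => rdot (jacobi w r n) (T r n)) B' = NT).
      { transitivity (rsym (fun n => Cmod (T r n) ^ 2) B').
        - apply rsum_ext; intros; apply rdot_self.
        - apply rsym_support; [lia|]; intros j Hj; rewrite HTr, Cmod_0 by lia; ring. }
      assert (E2 : rsum (fun n => Cmod (r n) ^ 2) (- Z.of_nat B') (2 * B' + 1) = Nr).
      { apply rsym_support; [lia|]; intros j Hj; rewrite Hr, Cmod_0 by lia; ring. }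
      rewrite E1, E2; unfold NTT, rsym; ring. }
    assert (HNTT : NTT <= b2 * NT).
    { eapply Rle_trans; [apply (jacobi_l2_sqr w W (T r) B' Hw)|]; fold b2; right; f_equal.
      apply rsym_support; [lia|]; intros j Hj; rewrite HTr, Cmod_0 by lia; ring. }
    assert (HNT := Hlow r B Hr); fold T Nr NT in HNT.
    rewrite E.
    assert (tau ^ 2 * NTT <= tau * NT).
    { replace (tau * NT) with (tau ^ 2 * (b2 * NT))
        by (replace (tau ^ 2 * (b2 * NT)) with (tau * b2 * (tau * NT)) by ring; rewrite Htb; ring).
      apply Rmult_le_compat_l; [nra|assumption]. }
    unfold q2; nra. }
  (* [S'] looks only two sites away, so on [|n| <= B] it cannot tell [u] from its truncation at
     [B + 2]; this extends the contraction to all of l^2. *)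
  assert (HSl2 : forall u s, l2_bound u s -> l2_bound (S' u) (q * s)).
  { intros u s [Hs Hu]; split; [nra|]; intros B.
    apply Rle_trans with (rsym (fun n => Cmod (S' (truncate (B + 2) u) n) ^ 2) B).
    - right; apply rsum_ext; intros n Hn; do 2 f_equal.
      unfold S', richardson, jacobi; rewrite !truncate_in by lia; reflexivity.
    - eapply Rle_trans; [apply (rsym_le_compat _ B (B + 2 + 4)); [lia|intros; apply pow2_ge_0]|].
      eapply Rle_trans.
      { apply (Hfin _ (B + 2)%nat); [intros; now apply truncate_out|lia]. }
      rewrite Rpow_mult_distr, Hqq; apply Rmult_le_compat_l; [lra|].
      eapply Rle_trans; [|apply (Hu (B + 2)%nat)]; right.
      apply rsum_ext; intros n Hn; rewrite truncate_in by lia; reflexivity. }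
  pose (res := fix res (f : Z -> C) (j : nat) : Z -> C :=
    match j with O => f | S i => S' (res f i) end).
  assert (Hres : forall f s, l2_bound f s -> forall j, l2_bound (res f j) (q ^ j * s)).
  { intros f s Hf j; induction j as [|j IH]; cbn [res pow]; [now rewrite Rmult_1_l|].
    rewrite Rmult_assoc; now apply HSl2. }
  pose (part := fix part (f : Z -> C) (j : nat) : Z -> C :=
    match j with O => (fun _ => RtoC 0) | S i => fun n => (part f i n + RtoC tau * T (res f i) n)%C end).
  assert (HTlin : forall u v a n, T (fun k => u k + a * v k)%C n = (T u n + a * T v n)%C).
  { intros u v a n; unfold T, jacobi; ring. }
  assert (Hpart : forall f j n, T (part f j) n = (f n - res f j n)%C).
  { intros f j; induction j as [|j IH]; intros n.
    - cbn [part res]; unfold T, jacobi; ring.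
    - cbn [part res]; rewrite HTlin, IH; unfold S', richardson; fold (T (res f j)); fold T; ring. }
  assert (Hstep : forall f s, l2_bound f s -> forall i,
    l2_bound (fun n => RtoC tau * T (res f i) n)%C (s * q ^ i)).
  { intros f s Hf i.
    assert (H := l2_bound_scal (RtoC tau) _ _ (HTl2 _ _ (Hres f s Hf i))).
    rewrite Cmod_R, Rabs_right in H by lra.
    replace (tau * (b2 * (q ^ i * s))) with (tau * b2 * (s * q ^ i)) in H by ring.
    rewrite Htb, Rmult_1_l in H; exact H. }
  assert (Hpl2 : forall f s, l2_bound f s -> forall j,
    l2_bound (part f j) (s / (1 - q) * (1 - q ^ j))).
  { intros f s Hf j; induction j as [|j IH].
    - cbn [part pow]; rewrite Rminus_diag, Rmult_0_r; split; [lra|]; intros B.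
      unfold rsym; rewrite rsum_0; [lra|]; intros; rewrite Cmod_0; ring.
    - replace (s / (1 - q) * (1 - q ^ S j)) with (s / (1 - q) * (1 - q ^ j) + s * q ^ j)
        by (cbn [pow]; field; lra).
      cbn [part]; apply l2_bound_plus; [assumption|now apply Hstep]. }
  (* [G f] is the pointwise limit of the partial sums [part f j] of the Neumann series, which exists
     for square-summable [f] by geometric decay. *)
  pose (G := fun f n => epsilon (inhabits (RtoC 0)) (fun l => Clim (fun j => part f j n) l)).
  assert (HG : forall f s, l2_bound f s -> forall n, Clim (fun j => part f j n) (G f n)).
  { intros f s Hf n; unfold G; apply epsilon_spec.
    apply (geometric_Clim_exists (fun i => RtoC tau * T (res f i) n)%C _ s q Hq); [reflexivity|reflexivity|].
    intros i; exact (l2_bound_term _ _ n (Hstep f s Hf i)). }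
  assert (Hqlim : forall a, 0 <= a -> forall e, 0 < e -> exists N, forall j, (N <= j)%nat -> a * q ^ j < e).
  { intros a Ha e He.
    destruct (pow_lt_1_zero q ltac:(rewrite Rabs_right; lra) (e / (a + 1))
      ltac:(apply Rdiv_lt_0_compat; lra)) as [N HN].
    exists N; intros j Hj; specialize (HN j Hj).
    rewrite Rabs_right in HN by (apply Rle_ge, pow_le; lra).
    apply (Rmult_lt_compat_r (a + 1)) in HN; [|lra].
    replace (e / (a + 1) * (a + 1)) with e in HN by (field; lra).
    assert (0 <= q ^ j) by (apply pow_le; lra); nra. }
  assert (HTG : forall f s, l2_bound f s -> forall n, T (G f) n = f n).
  { intros f s Hf n.
    apply (Clim_unique (fun j => T (part f j) n)); [apply jacobi_lim, (HG f s Hf)|].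
    intros e He; destruct (Hqlim s (proj1 Hf) e He) as [N HN]; exists N; intros j Hj.
    rewrite Hpart; replace (f n - res f j n - f n)%C with (- res f j n)%C by ring.
    rewrite Cmod_opp; eapply Rle_lt_trans; [apply (l2_bound_term _ _ n (Hres f s Hf j))|].
    rewrite Rmult_comm; auto. }
  assert (HGl2 : forall f s, l2_bound f s -> l2_bound (G f) (/ (1 - q) * s)).
  { intros f s Hf; assert (Hs := proj1 Hf).
    assert (Hi : 0 < / (1 - q)) by (apply Rinv_0_lt_compat; lra).
    apply (l2_bound_lim (part f)); [|apply (HG f s Hf)].
    intros j; destruct (Hpl2 f s Hf j) as [_ H]; split; [nra|]; intros B.
    eapply Rle_trans; [apply H|].
    assert (0 <= q ^ j) by (apply pow_le; lra).
    assert (Hqj : q ^ j <= 1) by (rewrite <- (pow1 j); apply pow_incr; lra).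
    apply pow_incr; split.
    - apply Rmult_le_pos; [apply Rmult_le_pos|]; lra.
    - apply Rle_trans with (s / (1 - q) * 1); [|right; unfold Rdiv; ring].
      apply Rmult_le_compat_l; [apply Rmult_le_pos|]; lra. }
  exists G, (/ (1 - q)); split.
  - intros f Hf; apply in_l2_bound in Hf.
    destruct (l2_bound_in _ _ (HGl2 f _ Hf)) as [H1 H2].
    split; [assumption|]; split; [assumption|]; exact (HTG f _ Hf).
  - intros u Hu n; apply in_l2_bound in Hu; set (s := l2_norm u) in *.
    assert (HTu := HTl2 u s Hu).
    change (fun m => jacobi w u m) with (T u).
    (* Left inverse: [d] is in the kernel of [T], so the iterates of [S'] fix it while their norms
       tend to 0. *)
    set (d := fun n => (G (T u) n + (- RtoC 1) * u n)%C).
    assert (Hd : exists t, l2_bound d t).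
    { eexists; apply l2_bound_plus; [apply (HGl2 _ _ HTu)|apply l2_bound_scal, Hu]. }
    destruct Hd as [t Hd].
    assert (HTd : forall k, T d k = RtoC 0).
    { intros k; unfold d; rewrite HTlin, (HTG _ _ HTu); ring. }
    assert (Hresd : forall j k, res d j k = d k).
    { induction j as [|j IH]; intros k; [reflexivity|].
      cbn [res]; unfold S', richardson, jacobi; rewrite !IH.
      fold (jacobi w d).
      assert (H1 := HTd (k + 1)%Z); assert (H2 := HTd (k - 1)%Z); assert (H3 := HTd k).
      unfold T, jacobi in H1, H2, H3; rewrite H1, H2, H3; ring. }
    assert (Hd0 : d n = RtoC 0).
    { apply Cmod_eq_0, Rle_antisym; [|apply Cmod_ge_0].
      apply Rnot_lt_le; intros Hlt.
      destruct (Hqlim t (proj1 Hd) _ Hlt) as [N HN].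
      assert (H := l2_bound_term _ _ n (Hres d t Hd N)); rewrite Hresd in H.
      specialize (HN N (le_n _)); lra. }
    replace (G (T u) n) with (d n + u n)%C by (unfold d; ring).
    rewrite Hd0; ring.
Qed.

Lemma schrodinger_jacobi lambda v alpha E u n :
  (schrodinger lambda v alpha 0 u n - RtoC E * u n)%C
    = jacobi (fun n => lambda * v (IZR n * alpha) - E) u n.
Proof.
  unfold schrodinger, jacobi; rewrite Rplus_0_l, RtoC_minus; ring.
Qed.

(** Weyl's criterion by contradiction: if no such [psi] existed, the operator minus [E] would be
    bounded below on finitely supported sequences, and [jacobi_invertible] would put [E] in the
    resolvent set. The constant is [Rmin eps 1] because that lemma asks for [c <= 1]. *)
Lemma Sigma_approximate_eigenvector lambda v alpha E V eps :
  (forall x, Rabs (v x) <= V) -> Sigma lambda v alpha E -> 0 < eps ->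
  exists psi B, (forall n, (Z.of_nat B < Z.abs n)%Z -> psi n = RtoC 0) /\
    0 < rsym (fun n => Cmod (psi n) ^ 2) B /\
    rsym (fun n => Cmod (jacobi (fun n => lambda * v (IZR n * alpha) - E) psi n) ^ 2) (S B)
      <= eps ^ 2 * rsym (fun n => Cmod (psi n) ^ 2) B.
Proof.
  intros HV HE Heps; apply NNPP; intros Hno; apply HE.
  set (w := fun n => lambda * v (IZR n * alpha) - E) in *.
  destruct (jacobi_invertible w (Rabs lambda * V + Rabs E) (Rmin eps 1)) as (G & M & HG1 & HG2).
  - intros k; unfold w, Rminus; eapply Rle_trans; [apply Rabs_triang|].
    rewrite Rabs_Ropp, Rabs_mult; apply Rplus_le_compat_r, Rmult_le_compat_l; [apply Rabs_pos|apply HV].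
  - split; [apply Rmin_pos; lra|apply Rmin_r].
  - intros psi B Hpsi.
    set (N := rsym (fun n => Cmod (psi n) ^ 2) B).
    assert (HN : 0 <= N) by (apply rsum_ge0; intros; apply pow2_ge_0).
    destruct (Rle_lt_or_eq_dec 0 N HN) as [HN'|HN'].
    + apply Rnot_lt_le; intros Hlt; apply Hno; exists psi, B; repeat split; auto.
      fold N; left; eapply Rlt_le_trans; [exact Hlt|].
      apply Rmult_le_compat_r; [assumption|]; apply pow_incr; split; [|apply Rmin_l].
      left; apply Rmin_pos; lra.
    + rewrite <- HN', Rmult_0_r; apply rsum_ge0; intros; apply pow2_ge_0.
  - exists G, M; split.
    + intros f Hf; destruct (HG1 f Hf) as (H1 & H2 & H3); repeat split; auto.
      intros n; rewrite schrodinger_jacobi; apply H3.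
    + intros u Hu n; rewrite <- (HG2 u Hu n); f_equal.
      apply functional_extensionality; intros m.
      apply schrodinger_jacobi.
Qed.

(** * Almost periodic sums *)

Lemma irrational_expi alpha n : irrational alpha -> n <> 0%Z -> expi (IZR n * alpha) <> RtoC 1.
Proof.
  intros Ha Hn H; apply expi_eq1 in H; destruct H as [k Hk].
  apply (Ha k n Hn); rewrite <- Hk; field; now apply not_0_IZR.
Qed.

Lemma Cmod_geometric_le t a n :
  expi t <> RtoC 1 ->
  Cmod (csum (fun m => expi (IZR m * t)) a n) <= 2 / Cmod (expi t - 1).
Proof.
  intros Ht.
  assert (Hd : (expi t - 1)%C <> RtoC 0).
  { intros E; apply Ht; replace (expi t) with (expi t - 1 + 1)%C by ring; rewrite E; ring. }
  assert (E : (csum (fun m => expi (IZR m * t)) a n * (expi t - 1))%C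
    = (expi (IZR (a + Z.of_nat n) * t) - expi (IZR a * t))%C).
  { induction n as [|n IH]; cbn [csum].
    - rewrite Z.add_0_r; ring.
    - rewrite Cmult_plus_distr_r, IH.
      replace (a + Z.of_nat (S n))%Z with (a + Z.of_nat n + 1)%Z by lia.
      rewrite (plus_IZR (a + Z.of_nat n) 1).
      replace ((IZR (a + Z.of_nat n) + 1) * t) with (IZR (a + Z.of_nat n) * t + t) by ring.
      rewrite expi_plus; ring. }
  apply Cmod_gt_0 in Hd.
  apply (Rmult_le_reg_r (Cmod (expi t - 1))); [assumption|].
  rewrite <- Cmod_mult, E; unfold Cminus at 1.
  eapply Rle_trans; [apply Cmod_triangle|]; rewrite Cmod_opp, !Cmod_expi.
  right; field; lra.
Qed.

(** The bound does not depend on the range of [j]: each nonzero frequency contributes a geometric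
    sum that stays bounded, so averages over long ranges tend to 0. *)
Lemma csum_trig_bounded (q : Z -> C) (t : Z -> R) b m :
  (forall k, q k <> RtoC 0 -> expi (t k) <> RtoC 1) ->
  forall a n, Cmod (csum (fun j => csum (fun k => q k * expi (IZR j * t k))%C b m) a n)
    <= rsum (fun k => Cmod (q k) * (2 / Cmod (expi (t k) - 1))) b m.
Proof.
  intros Hq a n; rewrite csum_swap; apply Cmod_csum_le; intros k _.
  rewrite csum_scal, Cmod_mult.
  destruct (classic (q k = RtoC 0)) as [E|E].
  - rewrite E, Cmod_0; lra.
  - apply Rmult_le_compat_l; [apply Cmod_ge_0|]; apply Cmod_geometric_le; auto.
Qed.

(** The Fourier series with coefficients [psi], sampled at the orbit point [m beta]. *)
Definition trig_sum (psi : Z -> C) (beta : R) (B : nat) (m : Z) : C :=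
  csym (fun n => psi n * expi (IZR m * (IZR n * beta)))%C B.

Lemma Cconj_csum f a n : Cconj (csum f a n) = csum (fun k => Cconj (f k)) a n.
Proof.
  induction n as [|n IH]; cbn [csum].
  - unfold Cconj, RtoC; cbn; f_equal; ring.
  - now rewrite Cplus_conj, IH.
Qed.

Lemma Cconj_expi t : Cconj (expi t) = expi (- t).
Proof.
  unfold Cconj, expi; cbn [fst snd].
  replace (2 * PI * - t) with (- (2 * PI * t)) by ring.
  now rewrite cos_neg, sin_neg.
Qed.

Lemma csum_RtoC f a n : csum (fun k => RtoC (f k)) a n = RtoC (rsum f a n).
Proof.
  induction n as [|n IH]; cbn [csum rsum]; [reflexivity|]; now rewrite IH, RtoC_plus.
Qed.

(** Parseval along an orbit. In the expanded square the diagonal gives the same constant for every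
    [m]; the other terms have frequencies [(k - j) beta], which are not integers, so their sums stay
    bounded. The error is independent of the starting point [a], which lets [good_centre] average
    over translates. *)
Lemma trig_sum_mean_square psi beta B :
  irrational beta ->
  exists K, forall a n, Rabs (rsum (fun m => Cmod (trig_sum psi beta B m) ^ 2) a n
    - INR n * rsym (fun k => Cmod (psi k) ^ 2) B) <= K.
Proof.
  intros Hb.
  set (off := fun k j => if Z.eq_dec k j then RtoC 0 else (psi k * Cconj (psi j))%C).
  set (t := fun k j => IZR (k - j) * beta).
  exists (rsym (fun k => rsym (fun j => Cmod (off k j) * (2 / Cmod (expi (t k j) - 1))) B) B).
  intros a n.
  set (N := rsym (fun k => Cmod (psi k) ^ 2) B).
  assert (E : forall m, RtoC (Cmod (trig_sum psi beta B m) ^ 2) =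
    (RtoC N + csym (fun k => csym (fun j => off k j * expi (IZR m * t k j)) B) B)%C).
  { intros m; rewrite Cmod2_conj; unfold trig_sum at 2.
    unfold csym at 1; rewrite Cconj_csum; fold (csym (fun k => Cconj (psi k * expi (IZR m * (IZR k * beta)))) B).
    rewrite Cmult_comm; unfold N, rsym, trig_sum, csym at 2.
    rewrite <- csum_RtoC, <- csum_scal; unfold csym at 2; rewrite <- csum_plus.
    apply csum_ext; intros k Hk.
    transitivity (csym (fun j => (if Z.eq_dec k j then RtoC (Cmod (psi k) ^ 2) else RtoC 0)
      + off k j * expi (IZR m * t k j))%C B).
    - rewrite Cmult_comm; unfold csym; rewrite <- csum_scal.
      apply csum_ext; intros j _.
      rewrite Cmult_conj, Cconj_expi.
      replace (psi k * expi (IZR m * (IZR k * beta)) * (Cconj (psi j) * expi (- (IZR m * (IZR j * beta)))))%C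
        with (psi k * Cconj (psi j) * (expi (IZR m * (IZR k * beta)) * expi (- (IZR m * (IZR j * beta)))))%C by ring.
      rewrite <- expi_plus.
      replace (IZR m * (IZR k * beta) + - (IZR m * (IZR j * beta))) with (IZR m * t k j)
        by (unfold t; rewrite minus_IZR; ring).
      unfold off; destruct (Z.eq_dec k j) as [<-|].
      + unfold t; rewrite Z.sub_diag, Rmult_0_l, Rmult_0_r, expi_0, Cmod2_conj; ring.
      + ring.
    - unfold csym; rewrite csum_plus; f_equal.
      rewrite (csum_single _ _ _ k); [destruct Z.eq_dec; [reflexivity|tauto]|lia|].
      intros j _ Hj; destruct Z.eq_dec; [congruence|reflexivity]. }
  assert (Esum : RtoC (rsum (fun m => Cmod (trig_sum psi beta B m) ^ 2) a n - INR n * N) =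
    csum (fun k => csum (fun m => csum (fun j => off k j * expi (IZR m * t k j)) (- Z.of_nat B) (2 * B + 1))%C
       a n) (- Z.of_nat B) (2 * B + 1)).
  { rewrite RtoC_minus, <- csum_RtoC, <- csum_swap.
    rewrite (csum_ext _ _ a n (fun m _ => E m)), csum_plus, csum_RtoC, rsum_const.
    unfold csym; ring. }
  rewrite <- Cmod_R, Esum; apply Cmod_csum_le; intros k _.
  apply csum_trig_bounded; intros j Hj.
  unfold off in Hj; destruct (Z.eq_dec k j) as [->|Hkj]; [tauto|].
  apply irrational_expi; [assumption|lia].
Qed.

Lemma rsum_le_exists f g a n :
  (0 < n)%nat -> rsum f a n <= rsum g a n -> exists k, f k <= g k.
Proof.
  intros Hn H; apply NNPP; intros Hno.
  assert (Hlt : forall k, g k < f k).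
  { intros k; apply Rnot_le_lt; intros Hk; apply Hno; now exists k. }
  clear Hno; revert H; apply Rlt_not_le.
  destruct n as [|n]; [lia|]; clear Hn; cbn [rsum].
  assert (rsum g a n <= rsum f a n) by (apply rsum_le; intros; left; auto).
  generalize (Hlt (a + Z.of_nat n)%Z); lra.
Qed.

(** A difference, so that its sums telescope. It has order [|l|^(-3/2)]: summable, yet with inverse
    square root of order [|l|^(3/4)], slower than linear. The recentring to [|u_k| <= 1 + |k|]
    depends on this gap. *)
Definition weight (l : Z) : R :=
  / sqrt (1 + IZR (Z.abs l)) - / sqrt (2 + IZR (Z.abs l)).

Lemma IZR_abs_pos l : 0 <= IZR (Z.abs l).
Proof. apply IZR_le; lia. Qed.

Lemma weight_lower l : 1 <= 16 * sqrt (1 + IZR (Z.abs l)) ^ 3 * weight l.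
Proof.
  assert (Hl := IZR_abs_pos l); unfold weight.
  set (x := IZR (Z.abs l)) in *.
  set (s := sqrt (1 + x)); set (t := sqrt (2 + x)).
  assert (Hs2 : s ^ 2 = 1 + x) by (apply pow2_sqrt; lra).
  assert (Ht2 : t ^ 2 = 2 + x) by (apply pow2_sqrt; lra).
  assert (Hs : 1 <= s) by (rewrite <- sqrt_1; apply sqrt_le_1_alt; lra).
  assert (Ht : 1 <= t) by (rewrite <- sqrt_1; apply sqrt_le_1_alt; lra).
  assert (Hts : t <= 2 * s) by nra.
  assert (E : / s - / t = / (s * t * (s + t))).
  { assert (Hd : (t - s) * (s + t) = 1) by nra.
    apply (Rmult_eq_reg_r (s * t * (s + t))); [|assert (0 < s * t) by nra; nra].
    rewrite Rinv_l by (assert (0 < s * t) by nra; nra).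
    rewrite <- Hd; field; lra. }
  rewrite E.
  assert (Hp : 0 < s * t * (s + t)) by (assert (0 < s * t) by nra; nra).
  assert (s * t <= 2 * (s * s)) by nra.
  assert (Hle : s * t * (s + t) <= 2 * (s * s) * (3 * s)) by (apply Rmult_le_compat; nra).
  assert (Hle' : s * t * (s + t) <= 16 * s ^ 3) by (assert (0 < s ^ 3) by (apply pow_lt; lra); nra).
  rewrite <- (Rinv_r (s * t * (s + t))) by lra.
  apply Rmult_le_compat_r; [left; now apply Rinv_0_lt_compat|assumption].
Qed.

Lemma weight_pos l : 0 < weight l.
Proof.
  assert (H := weight_lower l).
  assert (0 < sqrt (1 + IZR (Z.abs l))) by (apply sqrt_lt_R0; generalize (IZR_abs_pos l); lra).
  assert (0 < sqrt (1 + IZR (Z.abs l)) ^ 3) by now apply pow_lt.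
  apply Rnot_le_lt; intros Hw; nra.
Qed.

Lemma rsym_weight_le R0 : rsym weight R0 <= 2.
Proof.
  enough (H : rsym weight R0 <= 2 - 2 * / sqrt (2 + INR R0)).
  { assert (0 < / sqrt (2 + INR R0))
      by (apply Rinv_0_lt_compat, sqrt_lt_R0; generalize (pos_INR R0); lra).
    lra. }
  induction R0 as [|n IH].
  - rewrite rsym_0; unfold weight; cbn [Z.abs].
    change (INR 0) with 0; rewrite !Rplus_0_r, sqrt_1, Rinv_1.
    assert (/ sqrt 2 <= 1); [|lra].
    rewrite <- Rinv_1; apply Rinv_le_contravar; [lra|].
    rewrite <- sqrt_1; apply sqrt_le_1_alt; lra.
  - rewrite rsym_succ; set (x := rsym weight n) in *; unfold weight.
    replace (Z.abs (- Z.of_nat (S n))) with (Z.of_nat (S n)) by lia.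
    replace (Z.abs (Z.of_nat (S n))) with (Z.of_nat (S n)) by lia.
    rewrite <- INR_IZR_INZ, S_INR.
    replace (1 + (INR n + 1)) with (2 + INR n) by ring; lra.
Qed.

(* Averaging over [m]: both families have mean squares computed by
   [trig_sum_mean_square], so some centre [m] is no worse than the average. *)
Lemma good_centre psi phi beta B eps R0 :
  irrational beta -> 0 < eps ->
  let N := rsym (fun k => Cmod (psi k) ^ 2) B in
  0 < N -> rsym (fun k => Cmod (phi k) ^ 2) (S B) <= eps ^ 2 * N ->
  exists m, N <= 4 * Cmod (trig_sum psi beta B m) ^ 2 /\
    forall l, (Z.abs l <= Z.of_nat R0)%Z ->
      weight l * Cmod (trig_sum psi beta B (l + m)) ^ 2 <= 8 * Cmod (trig_sum psi beta B m) ^ 2 /\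
      weight l * Cmod (trig_sum phi beta (S B) (l + m)) ^ 2
        <= 8 * eps ^ 2 * Cmod (trig_sum psi beta B m) ^ 2.
Proof.
  intros Hb Heps N HN Hphi.
  destruct (trig_sum_mean_square psi beta B Hb) as [K1 H1].
  destruct (trig_sum_mean_square phi beta (S B) Hb) as [K2 H2].
  fold N in H1.
  set (a := fun m => Cmod (trig_sum psi beta B m) ^ 2) in *.
  set (e := fun m => Cmod (trig_sum phi beta (S B) m) ^ 2) in *.
  set (N' := rsym (fun k => Cmod (phi k) ^ 2) (S B)) in *.
  assert (Ha : forall m, 0 <= a m) by (intros; apply pow2_ge_0).
  assert (He : forall m, 0 <= e m) by (intros; apply pow2_ge_0).
  set (i2 := / eps ^ 2).
  assert (Hi2 : 0 < i2) by (apply Rinv_0_lt_compat, pow_lt; assumption).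
  assert (Hi2' : i2 * eps ^ 2 = 1) by (unfold i2; field; lra).
  assert (HK1 : 0 <= K1) by (eapply Rle_trans; [apply Rabs_pos|apply (H1 0%Z 0%nat)]).
  assert (HK2 : 0 <= K2) by (eapply Rle_trans; [apply Rabs_pos|apply (H2 0%Z 0%nat)]).
  (* Enough translates to outweigh the bounded errors: per translate the left side amounts to at
     most [6 N] and the right side to [8 N], and the surplus [2 N (n + 1)] must exceed the terms in
     [K1] and [K2]. *)
  destruct (INR_unbounded ((2 * (K1 + i2 * K2) + 8 * K1) / (2 * N))) as [n Hn].
  assert (HnN : 2 * (K1 + i2 * K2) + 8 * K1 <= 2 * N * INR (S n)).
  { apply (Rmult_lt_compat_r (2 * N)) in Hn; [|lra].
    unfold Rdiv in Hn; rewrite Rmult_assoc, Rinv_l in Hn by lra.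
    rewrite S_INR; lra. }
  set (wt := weight) in *.
  set (W := rsym wt R0).
  assert (HW : W <= 2) by apply rsym_weight_le.
  assert (HW0 : 0 <= W) by (apply rsum_ge0; intros; left; apply weight_pos).
  (* The added [2 N] keeps the centre from being negligible: it yields [N <= 4 a m] along with the
     weighted bounds. *)
  destruct (rsum_le_exists
    (fun m => rsym (fun l => wt l * (a (l + m)%Z + i2 * e (l + m)%Z)) R0 + 2 * N)
    (fun m => 8 * a m) 0 (S n) ltac:(lia)) as [m Hm].
  - rewrite rsum_plus, rsum_const, rsum_scal; unfold rsym at 1.
    rewrite rsum_swap.
    apply Rle_trans with (rsym (fun l => wt l * (2 * N * INR (S n) + (K1 + i2 * K2))) R0
      + INR (S n) * (2 * N)).
    + apply Rplus_le_compat_r, rsum_le; intros l _.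
      rewrite rsum_scal, rsum_plus, rsum_scal.
      apply Rmult_le_compat_l; [left; apply weight_pos|].
      rewrite (rsum_ext (fun j => a (l + j)%Z) (fun j => a (j + l)%Z)) by (intros; f_equal; lia).
      rewrite (rsum_ext (fun j => e (l + j)%Z) (fun j => e (j + l)%Z)) by (intros; f_equal; lia).
      rewrite !rsum_shift.
      assert (A1 := H1 (0 + l)%Z (S n)); assert (A2 := H2 (0 + l)%Z (S n)).
      apply Rabs_le_between in A1; apply Rabs_le_between in A2.
      assert (i2 * N' <= N).
      { apply Rle_trans with (i2 * (eps ^ 2 * N)); [apply Rmult_le_compat_l; lra|].
        rewrite <- Rmult_assoc, Hi2'; lra. }
      assert (A3 : i2 * rsum e (0 + l) (S n) <= i2 * (INR (S n) * N' + K2))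
        by (apply Rmult_le_compat_l; lra).
      assert (A4 : INR (S n) * (i2 * N') <= INR (S n) * N)
        by (apply Rmult_le_compat_l; [apply pos_INR|assumption]).
      lra.
    + assert (A1 := H1 0%Z (S n)); apply Rabs_le_between in A1.
      unfold rsym at 1; rewrite (rsum_ext _ (fun l => (2 * N * INR (S n) + (K1 + i2 * K2)) * wt l))
        by (intros; ring).
      rewrite rsum_scal; fold (rsym wt R0); fold W.
      assert (0 <= INR (S n)) by apply pos_INR.
      assert (0 <= 2 * N * INR (S n) + (K1 + i2 * K2)) by nra.
      nra.
  - exists m.
    assert (Hterm : forall l, (Z.abs l <= Z.of_nat R0)%Z ->
      wt l * (a (l + m)%Z + i2 * e (l + m)%Z) <= 8 * a m - 2 * N).
    { intros l Hl.
      assert (H := rsym_term_le (fun l => wt l * (a (l + m)%Z + i2 * e (l + m)%Z)) R0 l Hl).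
      cbn beta in H.
      eapply Rle_trans; [apply H|lra].
      intros j; apply Rmult_le_pos; [left; apply weight_pos|].
      generalize (Ha (j + m)%Z) (He (j + m)%Z); nra. }
    split.
    + assert (H := Hterm 0%Z ltac:(lia)).
      assert (0 <= wt 0%Z * (a (0 + m)%Z + i2 * e (0 + m)%Z)).
      { apply Rmult_le_pos; [left; apply weight_pos|].
        generalize (Ha (0 + m)%Z) (He (0 + m)%Z); nra. }
      fold (a m); lra.
    + intros l Hl; assert (H := Hterm l Hl).
      fold (a (l + m)%Z) (e (l + m)%Z) (a m).
      assert (Hw := weight_pos l); fold wt in Hw.
      generalize (Ha (l + m)%Z) (He (l + m)%Z); intros Ha1 He1.
      assert (0 <= i2 * e (l + m)%Z) by nra.
      split; [nra|].
      assert (Hie : wt l * (i2 * e (l + m)%Z) <= 8 * a m) by nra.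
      replace (wt l * e (l + m)%Z) with (eps ^ 2 * (wt l * (i2 * e (l + m)%Z)))
        by (replace (eps ^ 2 * (wt l * (i2 * e (l + m)%Z))) with (i2 * eps ^ 2 * (wt l * e (l + m)%Z)) by ring;
            rewrite Hi2'; ring).
      replace (8 * eps ^ 2 * a m) with (eps ^ 2 * (8 * a m)) by ring.
      apply Rmult_le_compat_l; [apply pow2_ge_0|assumption].
Qed.

(** * Diagonal compactness *)

(** Lists the integers as 0, -1, 1, -2, 2, ..., with nondecreasing modulus; the same order later
    lists the resonances. *)
Definition zof (n : nat) : Z :=
  if Nat.even n then Z.of_nat (Nat.div2 n) else (- Z.of_nat (Nat.div2 (S n)))%Z.

Lemma zof_double n : zof (2 * n) = Z.of_nat n.
Proof. unfold zof; rewrite Nat.even_mul, Nat.div2_double; reflexivity. Qed.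

Lemma zof_double_S n : zof (2 * n + 1) = (- Z.of_nat (S n))%Z.
Proof.
  unfold zof; rewrite Nat.even_add, Nat.even_mul; cbn [Nat.even orb Bool.eqb].
  replace (S (2 * n + 1)) with (2 * S n)%nat by lia; rewrite Nat.div2_double; reflexivity.
Qed.

Lemma zof_surjective k : exists n, zof n = k.
Proof.
  destruct (Z_le_gt_dec 0 k).
  - exists (2 * Z.to_nat k)%nat; rewrite zof_double; lia.
  - exists (2 * Z.to_nat (- k - 1) + 1)%nat; rewrite zof_double_S; lia.
Qed.

Lemma zof_cases n :
  exists m, (n = (2 * m)%nat /\ zof n = Z.of_nat m) \/
            (n = (2 * m + 1)%nat /\ zof n = (- Z.of_nat (S m))%Z).
Proof.
  destruct (Nat.Even_or_Odd n) as [[m ->]|[m ->]]; exists m.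
  - left; split; [reflexivity|apply zof_double].
  - right; split; [reflexivity|apply zof_double_S].
Qed.

Lemma zof_injective n m : zof n = zof m -> n = m.
Proof.
  destruct (zof_cases n) as (a & [[-> Ha]|[-> Ha]]), (zof_cases m) as (b & [[-> Hb]|[-> Hb]]);
    rewrite Ha, Hb; lia.
Qed.

Lemma zof_monotone n m : (n <= m)%nat -> (Z.abs (zof n) <= Z.abs (zof m))%Z.
Proof.
  destruct (zof_cases n) as (a & [[-> Ha]|[-> Ha]]), (zof_cases m) as (b & [[-> Hb]|[-> Hb]]);
    rewrite Ha, Hb; lia.
Qed.

Lemma dependent_sequence {A : Type} (P : nat -> A -> Prop) :
  (forall n, exists a, P n a) -> exists f : nat -> A, forall n, P n (f n).
Proof.
  intros H; exists (fun n => proj1_sig (constructive_indefinite_description _ (H n))).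
  intros n; apply proj2_sig.
Qed.

Lemma bounded_cluster_point (a : nat -> R) I b :
  (forall i, (I <= i)%nat -> Rabs (a i) <= b) ->
  exists l, forall e N, 0 < e -> exists i, (N <= i)%nat /\ Rabs (a i - l) < e.
Proof.
  intros H.
  destruct (Bolzano_Weierstrass (fun i => a (i + I)%nat) (fun x => - b <= x <= b)) as [l Hl].
  - apply compact_P3.
  - intros i; apply Rabs_le_between, H; lia.
  - exists l; intros e N He.
    destruct (Hl (disc l (mkposreal e He)) N) as (p & Hp & HV).
    + exists (mkposreal e He); intros x Hx; exact Hx.
    + exists (p + I)%nat; split; [lia|exact HV].
Qed.

(** In place of nested subsequences only the cluster values are kept: [good n L] says that for
    arbitrarily large [i] the first [n] coordinates are simultaneously close to [L]. A further
    coordinate is added by Bolzano-Weierstrass along indices converging in the earlier ones, and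
    [phi] is read off at the end. *)
Lemma diagonal_extraction (X : nat -> nat -> R) :
  (forall j, exists I b, forall i, (I <= i)%nat -> Rabs (X i j) <= b) ->
  exists (phi : nat -> nat) (L : nat -> R), (forall i, (i <= phi i)%nat) /\
    forall j e, 0 < e -> exists N, forall i, (N <= i)%nat -> Rabs (X (phi i) j - L j) < e.
Proof.
  intros HX.
  pose (good := fun (n : nat) (L : nat -> R) => forall e N, 0 < e ->
    exists i, (N <= i)%nat /\ forall j, (j < n)%nat -> Rabs (X i j - L j) < e).
  assert (Hstep : forall n L, good n L ->
    exists c, good (S n) (fun j => if Nat.eq_dec j n then c else L j)).
  { intros n L HL.
    destruct (dependent_sequence (fun k i => (k <= i)%nat /\
      forall j, (j < n)%nat -> Rabs (X i j - L j) < / INR (S k))) as [f Hf].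
    { intros k; apply HL; apply Rinv_0_lt_compat, lt_0_INR; lia. }
    destruct (HX n) as (I & b & HI).
    destruct (bounded_cluster_point (fun k => X (f k) n) I b) as [c Hc].
    { intros k Hk; apply HI; generalize (proj1 (Hf k)); lia. }
    exists c; intros e N He.
    destruct (archimed_cor1 e He) as (M & HM & HM').
    destruct (Hc e (Nat.max N M) He) as (k & Hk & Hkc).
    exists (f k); destruct (Hf k) as [Hf1 Hf2]; split; [lia|].
    intros j Hj; destruct (Nat.eq_dec j n) as [->|Hne]; [assumption|].
    eapply Rlt_trans; [apply Hf2; lia|]; eapply Rle_lt_trans; [|exact HM].
    apply Rinv_le_contravar; [apply lt_0_INR; lia|apply le_INR; lia]. }
  assert (H0 : good 0%nat (fun _ => 0)) by (intros e N _; exists N; split; [lia|lia]).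
  pose (F := fix F (n : nat) : {L | good n L} :=
    match n with
    | O => exist _ _ H0
    | S m => let (c, Hc) := constructive_indefinite_description _ (Hstep m (proj1_sig (F m)) (proj2_sig (F m))) in
             exist _ _ Hc
    end).
  assert (HF : forall n j, (j < n)%nat -> proj1_sig (F (S n)) j = proj1_sig (F n) j).
  { intros n j Hj; cbn [F].
    destruct (constructive_indefinite_description _ (Hstep n (proj1_sig (F n)) (proj2_sig (F n)))) as [c Hc].
    cbn; destruct (Nat.eq_dec j n); [lia|reflexivity]. }
  pose (L := fun j => proj1_sig (F (S j)) j).
  assert (HL : forall n j, (j < n)%nat -> proj1_sig (F n) j = L j).
  { intros n; induction n as [|n IH]; intros j Hj; [lia|].
    destruct (Nat.eq_dec j n) as [->|Hne]; [reflexivity|].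
    rewrite HF by lia; apply IH; lia. }
  destruct (dependent_sequence (fun k i => (k <= i)%nat /\
    forall j, (j < k)%nat -> Rabs (X i j - L j) < / INR (S k))) as [phi Hphi].
  { intros k; destruct (proj2_sig (F k) (/ INR (S k)) k) as (i & Hi & Hj).
    - apply Rinv_0_lt_compat, lt_0_INR; lia.
    - exists i; split; [assumption|]; intros j Hjk; rewrite <- (HL k j Hjk); auto. }
  exists phi, L; split; [intros i; apply Hphi|].
  intros j e He; destruct (archimed_cor1 e He) as (M & HM & HM').
  exists (Nat.max (S j) M); intros i Hi.
  eapply Rlt_trans; [apply (proj2 (Hphi i)); lia|]; eapply Rle_lt_trans; [|exact HM].
  apply Rinv_le_contravar; [apply lt_0_INR; lia|apply le_INR; lia].
Qed.

Lemma diagonal_extraction_C (u : nat -> Z -> C) :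
  (forall l, exists I b, forall i, (I <= i)%nat -> Cmod (u i l) <= b) ->
  exists (phi : nat -> nat) (L : Z -> C), (forall i, (i <= phi i)%nat) /\
    forall l, Clim (fun i => u (phi i) l) (L l).
Proof.
  intros Hu.
  pose (X := fun i j => let z := u i (zof (Nat.div2 j)) in if Nat.even j then Re z else Im z).
  destruct (diagonal_extraction X) as (phi & L & Hphi & HL).
  { intros j; destruct (Hu (zof (Nat.div2 j))) as (I & b & H); exists I, b; intros i Hi.
    unfold X; eapply Rle_trans; [|apply (H i Hi)].
    destruct (Nat.even j); [apply re_le_Cmod|apply im_le_Cmod]. }
  assert (HX0 : forall i n, X i (2 * n)%nat = Re (u i (zof n))).
  { intros i n; unfold X; rewrite Nat.even_mul, Nat.div2_double; reflexivity. }
  assert (HX1 : forall i n, X i (2 * n + 1)%nat = Im (u i (zof n))).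
  { intros i n; unfold X; rewrite Nat.even_add, Nat.even_mul.
    replace (2 * n + 1)%nat with (S (2 * n)) by lia; rewrite Nat.div2_succ_double; reflexivity. }
  assert (Hlim : forall l, exists c, Clim (fun i => u (phi i) l) c).
  { intros l; destruct (zof_surjective l) as [n <-].
    exists ((L (2 * n)%nat, L (2 * n + 1)%nat) : C); intros e He.
    destruct (HL (2 * n)%nat (e / 2) ltac:(lra)) as [N1 H1].
    destruct (HL (2 * n + 1)%nat (e / 2) ltac:(lra)) as [N2 H2].
    exists (Nat.max N1 N2); intros i Hi.
    specialize (H1 i ltac:(lia)); specialize (H2 i ltac:(lia)); rewrite HX0 in H1; rewrite HX1 in H2.
    eapply Rle_lt_trans; [apply Cmod_le_Rabs|].
    destruct (u (phi i) (zof n)) as [x y]; cbn in *; unfold Rminus in *; lra. }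
  exists phi, (fun l => proj1_sig (constructive_indefinite_description _ (Hlim l))).
  split; [assumption|]; intros l; apply proj2_sig.
Qed.

(** * Generalized eigenfunctions of the dual operator *)

Lemma RtoC_two_cos t : RtoC (2 * cos (2 * PI * t)) = (expi t + expi (- t))%C.
Proof.
  unfold expi, RtoC, Cplus; cbn [fst snd].
  replace (2 * PI * - t) with (- (2 * PI * t)) by ring.
  rewrite cos_neg, sin_neg; f_equal; ring.
Qed.

Lemma csum_shift_support f a n s b m :
  (forall k, f k <> RtoC 0 -> (a <= k < a + Z.of_nat n)%Z /\ (b <= k - s < b + Z.of_nat m)%Z) ->
  csum (fun k => f (k + s)%Z) b m = csum f a n.
Proof.
  intros Hf; rewrite csum_shift.
  pose (lo := Z.min a (b + s)); pose (hi := Z.max (a + Z.of_nat n) (b + s + Z.of_nat m)).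
  transitivity (csum f lo (Z.to_nat (hi - lo))); [symmetry|];
    (apply csum_subrange; [unfold lo; lia|unfold lo, hi; lia|]);
    intros k _ Hk; apply NNPP; intros H0; apply Hf in H0; lia.
Qed.

(* On the dual side the Jacobi operator at [n] becomes multiplication by a
   cosine plus, through the Fourier series of [v], convolution with [c]. *)
Lemma trig_sum_duality psi B alpha lambda v E c D m :
  (forall n, (Z.of_nat B < Z.abs n)%Z -> psi n = RtoC 0) ->
  let uh := trig_sum psi (- alpha) B in
  Cmod (csym (fun k => RtoC lambda * c k * uh (m - k)%Z)%C D
      + (RtoC (2 * cos (2 * PI * (IZR m * alpha))) - RtoC E) * uh m
      - trig_sum (jacobi (fun n => lambda * v (IZR n * alpha) - E) psi) (- alpha) (S B) m)
  <= rsym (fun n => Cmod (psi n) * Rabs lambda *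
       Cmod (csym (fun k => c k * expi (IZR k * (IZR n * alpha)))%C D
             - RtoC (v (IZR n * alpha)))) B.
Proof.
  intros Hpsi uh.
  set (x := fun n => expi (IZR m * (IZR n * - alpha))).
  assert (Hx : forall n, x (n + 1)%Z = (expi (- (IZR m * alpha)) * x n)%C).
  { intros n; unfold x; rewrite <- expi_plus, plus_IZR; f_equal; ring. }
  assert (E1 : csym (fun k => RtoC lambda * c k * uh (m - k)%Z)%C D =
    csym (fun n => psi n * x n * (RtoC lambda * csym (fun k => c k * expi (IZR k * (IZR n * alpha))) D))%C B).
  { unfold csym at 2 3.
    rewrite (csum_ext (fun n => psi n * x n * _)%C (fun n => csum (fun k =>
      psi n * x n * RtoC lambda * (c k * expi (IZR k * (IZR n * alpha))))%C (- Z.of_nat D) (2 * D + 1))).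
    2:{ intros n _; rewrite csum_scal; ring. }
    rewrite <- csum_swap; apply csum_ext; intros k _.
    unfold uh, trig_sum, csym; rewrite <- csum_scal; apply csum_ext; intros n _.
    rewrite minus_IZR.
    replace ((IZR m - IZR k) * (IZR n * - alpha)) with (IZR m * (IZR n * - alpha) + IZR k * (IZR n * alpha)) by ring.
    rewrite expi_plus; unfold x; ring. }
  set (w := fun n => lambda * v (IZR n * alpha) - E).
  assert (E2 : trig_sum (jacobi w psi) (- alpha) (S B) m =
    (RtoC (2 * cos (2 * PI * (IZR m * alpha))) * uh m
      + csym (fun n => psi n * x n * RtoC (w n)) B)%C).
  { unfold trig_sum, csym at 1.
    rewrite (csum_ext _ (fun n => expi (IZR m * alpha) * (psi (n + 1)%Z * x (n + 1)%Z)
        + expi (- (IZR m * alpha)) * (psi (n + -1)%Z * x (n + -1)%Z) + psi n * x n * RtoC (w n))%C).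
    2:{ intros n _; fold (x n); rewrite (Hx n).
        assert (Hx' := Hx (n + -1)%Z); replace (n + -1 + 1)%Z with n in Hx' by lia.
        unfold jacobi; replace (n + -1)%Z with (n - 1)%Z in * by lia.
        replace (expi (IZR m * alpha) * (psi (n + 1)%Z * (expi (- (IZR m * alpha)) * x n)))%C
          with (expi (IZR m * alpha) * expi (- (IZR m * alpha)) * (psi (n + 1)%Z * x n))%C by ring.
        rewrite expi_opp, Hx'; ring. }
    rewrite !csum_plus, !csum_scal.
    assert (Hne : forall n, (psi n * x n)%C <> RtoC 0 -> (Z.abs n <= Z.of_nat B)%Z).
    { intros n Hn; apply NNPP; intros H; apply Hn; rewrite Hpsi by lia; ring. }
    rewrite (csum_shift_support (fun n => psi n * x n)%C (- Z.of_nat B) (2 * B + 1) 1)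
      by (intros k Hk; apply Hne in Hk; lia).
    rewrite (csum_shift_support (fun n => psi n * x n)%C (- Z.of_nat B) (2 * B + 1) (-1))
      by (intros k Hk; apply Hne in Hk; lia).
    rewrite (csum_subrange (fun n => psi n * x n * RtoC (w n))%C (- Z.of_nat B) (2 * B + 1));
      [|lia|lia|intros k _ Hk; rewrite Hpsi by lia; ring].
    rewrite RtoC_two_cos; fold (csym (fun n => psi n * x n * RtoC (w n))%C B).
    unfold uh, trig_sum, csym, x; ring. }
  rewrite E1, E2.
  match goal with |- Cmod ?e <= _ => replace e with
    (csym (fun n => psi n * x n * (RtoC lambda * csym (fun k => c k * expi (IZR k * (IZR n * alpha))) D)) B
     - RtoC E * csym (fun n => psi n * x n) B - csym (fun n => psi n * x n * RtoC (w n)) B)%C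
    by (unfold uh, trig_sum, x; ring) end.
  unfold csym at 1 3 4; rewrite <- csum_scal, <- !csum_minus.
  apply Cmod_csum_le; intros n _.
  match goal with |- Cmod ?e <= _ => replace e with
    (psi n * x n * (RtoC lambda * (csym (fun k => c k * expi (IZR k * (IZR n * alpha))) D
      - RtoC (v (IZR n * alpha)%R))))%C end.
  - rewrite !Cmod_mult; unfold x; rewrite Cmod_expi, Cmod_R; right; ring.
  - unfold w; rewrite RtoC_minus, RtoC_mult; ring.
Qed.

Lemma irrational_opp alpha : irrational alpha -> irrational (- alpha).
Proof.
  intros H p q Hq E; apply (H (- p)%Z q Hq).
  rewrite opp_IZR; replace alpha with (- - alpha) by ring; rewrite E; field; now apply not_0_IZR.
Qed.

Lemma cos_shift_Z t q : cos (2 * PI * (t + IZR q)) = cos (2 * PI * t).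
Proof. exact (f_equal fst (expi_period t q)). Qed.

(* Of order [|l|^(3/4)]: the weighted average only bounds [|u_l|^2] by
   [1 / weight l], and [weight l] decays like [|l|^(-3/2)]. *)
Definition growth (l : Z) : R := sqrt (128 * sqrt (1 + IZR (Z.abs l)) ^ 3).

Lemma growth_sqr l : growth l ^ 2 = 128 * sqrt (1 + IZR (Z.abs l)) ^ 3.
Proof.
  apply pow2_sqrt, Rmult_le_pos; [lra|]; apply pow_le, sqrt_pos.
Qed.

Lemma growth_linear l : growth l <= 12 * (1 + IZR (Z.abs l)).
Proof.
  assert (Hl := IZR_abs_pos l); assert (H2 := growth_sqr l).
  assert (Hg : 0 <= growth l) by apply sqrt_pos.
  set (s := sqrt (1 + IZR (Z.abs l))) in *.
  assert (Hs2 : s ^ 2 = 1 + IZR (Z.abs l)) by (apply pow2_sqrt; lra).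
  assert (Hs : 1 <= s) by (rewrite <- sqrt_1; apply sqrt_le_1_alt; lra).
  rewrite <- Hs2.
  assert (s ^ 3 <= s ^ 4) by (replace (s ^ 4) with (s * s ^ 3) by ring; assert (0 <= s ^ 3) by (apply pow_le; lra); nra).
  apply Rnot_lt_le; intros Hlt.
  assert ((12 * s ^ 2) ^ 2 < growth l ^ 2) by nra.
  nra.
Qed.

(** With [s = sqrt (1 + |l|)] the claim is [128 s^3 < s^4], true for [s > 128]; the threshold 20000
    gives [s >= 140]. *)
Lemma growth_sublinear l : (20000 <= Z.abs l)%Z -> growth l < 1 + IZR (Z.abs l).
Proof.
  intros Hl; apply IZR_le in Hl; assert (H2 := growth_sqr l).
  set (s := sqrt (1 + IZR (Z.abs l))) in *.
  assert (Hs2 : s ^ 2 = 1 + IZR (Z.abs l)) by (apply pow2_sqrt; lra).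
  assert (Hs : 140 <= s).
  { unfold s; rewrite <- (sqrt_pow2 140) by lra; apply sqrt_le_1_alt; lra. }
  rewrite <- Hs2.
  assert (Hs3 : 0 < s ^ 3) by (apply pow_lt; lra).
  assert (128 * s ^ 3 < s ^ 4) by (replace (s ^ 4) with (s * s ^ 3) by ring; nra).
  apply Rnot_le_lt; intros Hle.
  assert ((s ^ 2) ^ 2 <= growth l ^ 2) by (apply pow_incr; split; [apply pow2_ge_0|assumption]).
  nra.
Qed.

(** The 128 in [growth] is 16 times 8: the constant of [weight_lower] times the one supplied by
    [good_centre]. *)
Lemma weight_bound l a b :
  0 <= a -> 0 <= b -> weight l * a ^ 2 <= 8 * b ^ 2 -> a <= growth l * b.
Proof.
  intros Ha Hb H.
  assert (Hg : 0 <= growth l) by apply sqrt_pos.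
  assert (H2 := growth_sqr l); assert (Hw := weight_lower l).
  set (s := sqrt (1 + IZR (Z.abs l)) ^ 3) in *.
  assert (Hs : 0 <= s) by (apply pow_le, sqrt_pos).
  assert (Ha2 : a ^ 2 <= growth l ^ 2 * b ^ 2).
  { rewrite H2; apply Rle_trans with (16 * s * weight l * a ^ 2).
    - generalize (pow2_ge_0 a); nra.
    - replace (128 * s * b ^ 2) with (16 * s * (8 * b ^ 2)) by ring.
      rewrite Rmult_assoc; apply Rmult_le_compat_l; lra. }
  rewrite <- Rpow_mult_distr in Ha2.
  apply Rnot_lt_le; intros Hlt.
  assert (0 <= growth l * b) by nra; nra.
Qed.

(** [u] is the sampled Fourier series of an approximate eigenvector, recentred at a good [m] and
    divided by its value there; [theta] is [m alpha] modulo 1. The error has two sources: the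
    residual of the eigenvector, weighted by [growth], and the truncation at [D] of the Fourier
    series of [v]. *)
Lemma approximate_dual_solution alpha lambda v E V c i :
  irrational alpha -> (forall x, Rabs (v x) <= V) -> Sigma lambda v alpha E ->
  (forall x, Clim (csym (fun k => c k * expi (IZR k * x))%C) (RtoC (v x))) ->
  exists theta u D, 0 <= theta <= 1 /\ (i <= D)%nat /\ u 0%Z = RtoC 1 /\
    (forall l, (Z.abs l <= Z.of_nat (D + i))%Z -> Cmod (u l) <= growth l) /\
    forall l, (Z.abs l <= Z.of_nat i)%Z ->
      Cmod (csym (fun k => RtoC lambda * c k * u (l - k)%Z)%C D
        + (RtoC (2 * cos (2 * PI * (theta + IZR l * alpha))) - RtoC E) * u l)
      <= (growth l + 1) * / INR (S i).
Proof.
  intros Ha HV HE Hc.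
  set (eps := / INR (S i)).
  assert (Heps : 0 < eps) by (apply Rinv_0_lt_compat, lt_0_INR; lia).
  destruct (Sigma_approximate_eigenvector lambda v alpha E V eps HV HE Heps)
    as (psi & B & Hpsi & HN & HTpsi).
  set (w := fun n => lambda * v (IZR n * alpha) - E) in *.
  set (N := rsym (fun n => Cmod (psi n) ^ 2) B) in *.
  set (P := rsym (fun n => Cmod (psi n)) B).
  assert (HP : 0 <= P) by (apply rsum_ge0; intros; apply Cmod_ge_0).
  assert (HsN : 0 < sqrt N) by now apply sqrt_lt_R0.
  pose proof (Rabs_pos lambda) as Hlam.
  assert (HlP : 0 <= Rabs lambda * P) by now apply Rmult_le_pos.
  (* With this accuracy at the sites [|n| <= B] the truncation error is at most [eps sqrt N / 2],
     hence at most [eps A]. *)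
  set (d := sqrt N / 2 * eps / (Rabs lambda * P + 1)).
  assert (Hd : 0 < d) by (apply Rdiv_lt_0_compat; nra).
  destruct (Clim_uniform_finite (fun D n => csym (fun k => c k * expi (IZR k * (IZR n * alpha)))%C D)
    (fun n => RtoC (v (IZR n * alpha))) B d (fun n => Hc (IZR n * alpha)) Hd) as [D0 HD0].
  (* [D] is fixed before the centre, because the growth bound must cover every [u (l - k)] with
     [|l| <= i] and [|k| <= D]. *)
  set (D := Nat.max D0 i).
  destruct (good_centre psi (jacobi w psi) (- alpha) B eps (D + i) (irrational_opp _ Ha) Heps HN HTpsi)
    as (m & Hm & Hml).
  fold N in Hm; set (uh := trig_sum psi (- alpha) B) in *.
  set (A := Cmod (uh m)) in *.
  assert (HA : sqrt N / 2 <= A).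
  { apply Rnot_lt_le; intros Hlt.
    assert (Hs2 : sqrt N ^ 2 = N) by (apply pow2_sqrt; lra).
    assert (0 <= A) by apply Cmod_ge_0; nra. }
  assert (HA0 : 0 < A) by lra.
  assert (Hum : uh m <> RtoC 0) by (apply Cmod_gt_0; exact HA0).
  set (q := Int_part (IZR m * alpha)).
  exists (IZR m * alpha - IZR q), (fun l => uh (l + m)%Z / uh m)%C, D.
  split; [|split; [unfold D; lia|split; [|split]]].
  - destruct (base_Int_part (IZR m * alpha)); fold q in H, H0; lra.
  - rewrite Z.add_0_l; field; assumption.
  - intros l Hl; rewrite Cmod_div by assumption; fold A.
    apply (Rmult_le_reg_r A); [assumption|]; unfold Rdiv; rewrite Rmult_assoc, Rinv_l by lra.
    rewrite Rmult_1_r; apply weight_bound; [apply Cmod_ge_0|lra|apply (Hml l Hl)].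
  - intros l Hl.
    assert (Hcos : cos (2 * PI * (IZR m * alpha - IZR q + IZR l * alpha))
      = cos (2 * PI * (IZR (l + m) * alpha))).
    { rewrite <- (cos_shift_Z _ q), plus_IZR; do 2 f_equal; ring. }
    rewrite Hcos.
    assert (Hdual := trig_sum_duality psi B alpha lambda v E c D (l + m)%Z Hpsi).
    cbv zeta in Hdual; fold uh w in Hdual.
    set (err := trig_sum (jacobi w psi) (- alpha) (S B) (l + m)%Z) in *.
    set (X := (csym (fun k => RtoC lambda * c k * uh (l + m - k)%Z) D
      + (RtoC (2 * cos (2 * PI * (IZR (l + m) * alpha))) - RtoC E) * uh (l + m)%Z)%C) in *.
    match goal with |- Cmod ?e <= _ => replace e with (X / uh m)%C end.
    2:{ symmetry; unfold X, csym.
        rewrite (csum_ext _ (fun k => / uh m * (RtoC lambda * c k * uh (l + m - k)%Z))%C).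
        - rewrite csum_scal; field; assumption.
        - intros k _; replace (l - k + m)%Z with (l + m - k)%Z by lia; field; assumption. }
    rewrite Cmod_div by assumption; fold A.
    apply (Rmult_le_reg_r A); [assumption|]; unfold Rdiv; rewrite Rmult_assoc, Rinv_l by lra.
    rewrite Rmult_1_r.
    assert (Herr : Cmod err <= growth l * (eps * A)).
    { apply weight_bound; [apply Cmod_ge_0|nra|].
      rewrite Rpow_mult_distr, <- Rmult_assoc; apply Hml; lia. }
    assert (Htail : rsym (fun n => Cmod (psi n) * Rabs lambda *
      Cmod (csym (fun k => c k * expi (IZR k * (IZR n * alpha)))%C D - RtoC (v (IZR n * alpha)))) B
      <= eps * A).
    { apply Rle_trans with (rsym (fun n => d * Rabs lambda * Cmod (psi n)) B).
      - apply rsum_le; intros n Hn; specialize (HD0 D n ltac:(unfold D; lia) ltac:(lia)).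
        replace (d * Rabs lambda * Cmod (psi n)) with (Cmod (psi n) * Rabs lambda * d) by ring.
        apply Rmult_le_compat_l; [|lra].
        apply Rmult_le_pos; [apply Cmod_ge_0|assumption].
      - unfold rsym; rewrite rsum_scal; fold (rsym (fun n => Cmod (psi n)) B); fold P.
        apply Rle_trans with (d * (Rabs lambda * P + 1)); [nra|].
        unfold d; unfold Rdiv at 1; rewrite Rmult_assoc, Rinv_l by lra; nra. }
    replace X with (err + (X - err))%C by ring.
    eapply Rle_trans; [apply Cmod_triangle|]; fold eps.
    change (Cmod (X - err) <= rsym (fun n => Cmod (psi n) * Rabs lambda *
      Cmod (csym (fun k => c k * expi (IZR k * (IZR n * alpha)))%C D - RtoC (v (IZR n * alpha)))) B)
      in Hdual.
    replace ((growth l + 1) * eps * A) with (growth l * (eps * A) + eps * A) by ring.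
    lra.
Qed.

Lemma poly_exp_le g x : 0 < g -> 0 <= x -> (1 + x) * exp (- g * x) <= (1 + 2 / g) * exp (- (g / 2) * x).
Proof.
  intros Hg Hx.
  assert (H := exp_ineq1_le (g / 2 * x)).
  assert (Hig : 0 < 2 / g) by (apply Rdiv_lt_0_compat; lra).
  assert (E : exp (- (g / 2) * x) = exp (- g * x) * exp (g / 2 * x)).
  { rewrite <- exp_plus; f_equal; field. }
  rewrite E.
  assert (Hp := exp_pos (- g * x)).
  assert (1 + x <= (1 + 2 / g) * exp (g / 2 * x)).
  { apply Rle_trans with ((1 + 2 / g) * (1 + g / 2 * x)); [|apply Rmult_le_compat_l; lra].
    replace ((1 + 2 / g) * (1 + g / 2 * x)) with (1 + x + (2 / g + g / 2 * x)) by (field; lra).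
    assert (0 <= g / 2 * x) by nra; lra. }
  nra.
Qed.

Definition conv_const (lambda V g A : R) (l : Z) : R :=
  Rabs lambda * V * A * (1 + IZR (Z.abs l)) * (1 + 2 / g).

Lemma Cmod_conv_term_le lambda c u V g A l k :
  0 < g -> Cmod (c k) <= V * exp (- g * IZR (Z.abs k)) -> 0 <= V -> 0 <= A ->
  Cmod (u (l - k)%Z) <= A * (1 + IZR (Z.abs (l - k))) ->
  Cmod (RtoC lambda * c k * u (l - k)%Z)
    <= conv_const lambda V g A l * exp (- (g / 2) * IZR (Z.abs k)).
Proof.
  intros Hg Hc HV HA Hu.
  rewrite !Cmod_mult, Cmod_R; unfold conv_const.
  assert (Hl := IZR_abs_pos l); assert (Hk := IZR_abs_pos k).
  assert (Habs : 1 + IZR (Z.abs (l - k)) <= (1 + IZR (Z.abs l)) * (1 + IZR (Z.abs k))).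
  { assert (IZR (Z.abs (l - k)) <= IZR (Z.abs l) + IZR (Z.abs k))
      by (rewrite <- plus_IZR; apply IZR_le; lia).
    nra. }
  assert (Hpe := poly_exp_le g _ Hg Hk).
  apply Rle_trans with (Rabs lambda * (V * exp (- g * IZR (Z.abs k)))
    * (A * ((1 + IZR (Z.abs l)) * (1 + IZR (Z.abs k))))).
  - apply Rmult_le_compat.
    + apply Rmult_le_pos; [apply Rabs_pos|apply Cmod_ge_0].
    + apply Cmod_ge_0.
    + apply Rmult_le_compat_l; [apply Rabs_pos|assumption].
    + eapply Rle_trans; [exact Hu|]; now apply Rmult_le_compat_l.
  - replace (Rabs lambda * (V * exp (- g * IZR (Z.abs k))) * (A * ((1 + IZR (Z.abs l)) * (1 + IZR (Z.abs k)))))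
      with (Rabs lambda * V * A * (1 + IZR (Z.abs l)) * ((1 + IZR (Z.abs k)) * exp (- g * IZR (Z.abs k)))) by ring.
    rewrite (Rmult_assoc (Rabs lambda * V * A * (1 + IZR (Z.abs l)))).
    apply Rmult_le_compat_l; [|assumption].
    repeat apply Rmult_le_pos; try lra; apply Rabs_pos.
Qed.

Lemma exp_decay_eventually K g e :
  0 <= K -> 0 < g -> 0 < e -> exists N : nat, forall x, INR N <= x -> K * exp (- g * x) < e.
Proof.
  intros HK Hg He; destruct (INR_unbounded ((K / e) / g)) as [N HN].
  exists N; intros x Hx.
  assert (H1 : K / e < g * x).
  { apply (Rmult_lt_compat_r g) in HN; [|assumption].
    unfold Rdiv in HN; rewrite (Rmult_assoc _ (/ g)), Rinv_l, Rmult_1_r in HN by lra.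
    unfold Rdiv; nra. }
  assert (H2 := exp_ineq1_le (g * x)).
  assert (H3 : exp (- g * x) * exp (g * x) = 1) by (rewrite <- exp_plus, <- exp_0; f_equal; ring).
  assert (Hp := exp_pos (- g * x)).
  assert (H4 : K < e * exp (g * x)).
  { replace K with (e * (K / e)) by (field; lra); apply Rmult_lt_compat_l; lra. }
  apply (Rmult_lt_reg_r (exp (g * x))); [apply exp_pos|].
  rewrite Rmult_assoc, H3; lra.
Qed.

(** The approximate solutions satisfy equations truncated at varying lengths [Ds i]. Replacing that
    length by a fixed [D] costs an exponentially small tail, uniformly in [i]; letting first [i] and
    then [D] grow gives the exact equation. *)
Lemma dual_limit_solution alpha lambda v E V c Vc g :
  irrational alpha -> (forall x, Rabs (v x) <= V) -> Sigma lambda v alpha E ->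
  (forall x, Clim (csym (fun k => c k * expi (IZR k * x))%C) (RtoC (v x))) ->
  0 < g -> (forall k, Cmod (c k) <= Vc * exp (- g * IZR (Z.abs k))) ->
  exists theta u, u 0%Z = RtoC 1 /\ (forall l, Cmod (u l) <= growth l) /\
    forall l, Clim (csym (fun k => RtoC lambda * c k * u (l - k)%Z)%C)
      ((RtoC E - RtoC (2 * cos (2 * PI * (theta + IZR l * alpha)))) * u l)%C.
Proof.
  intros Ha HV HE Hc Hg Hdec.
  assert (HVc : 0 <= Vc).
  { generalize (Hdec 0%Z) (Cmod_ge_0 (c 0%Z)).
    change (IZR (Z.abs 0)) with 0; rewrite Rmult_0_r, exp_0; lra. }
  destruct (dependent_sequence (fun i (t : R * (Z -> C) * nat) =>
    let '(theta, u, D) := t in 0 <= theta <= 1 /\ (i <= D)%nat /\ u 0%Z = RtoC 1 /\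
    (forall l, (Z.abs l <= Z.of_nat (D + i))%Z -> Cmod (u l) <= growth l) /\
    forall l, (Z.abs l <= Z.of_nat i)%Z ->
      Cmod (csym (fun k => RtoC lambda * c k * u (l - k)%Z)%C D
        + (RtoC (2 * cos (2 * PI * (theta + IZR l * alpha))) - RtoC E) * u l)
      <= (growth l + 1) * / INR (S i))) as [F HF].
  { intros i; destruct (approximate_dual_solution alpha lambda v E V c i Ha HV HE Hc)
      as (theta & u & D & H); exists (theta, u, D); exact H. }
  pose (th := fun i => fst (fst (F i))).
  pose (us := fun i => snd (fst (F i))).
  pose (Ds := fun i => snd (F i)).
  assert (H1 : forall i, 0 <= th i <= 1) by (intros i; unfold th; specialize (HF i); destruct (F i) as [[? ?] ?]; apply HF).
  assert (H2 : forall i, (i <= Ds i)%nat) by (intros i; unfold Ds; specialize (HF i); destruct (F i) as [[? ?] ?]; apply HF).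
  assert (H3 : forall i, us i 0%Z = RtoC 1) by (intros i; unfold us; specialize (HF i); destruct (F i) as [[? ?] ?]; apply HF).
  assert (H4 : forall i l, (Z.abs l <= Z.of_nat (Ds i + i))%Z -> Cmod (us i l) <= growth l)
    by (intros i; unfold us, Ds; specialize (HF i); destruct (F i) as [[? ?] ?]; apply HF).
  assert (H5 : forall i l, (Z.abs l <= Z.of_nat i)%Z ->
      Cmod (csym (fun k => RtoC lambda * c k * us i (l - k)%Z)%C (Ds i)
        + (RtoC (2 * cos (2 * PI * (th i + IZR l * alpha))) - RtoC E) * us i l)
      <= (growth l + 1) * / INR (S i))
    by (intros i; unfold us, Ds, th; specialize (HF i); destruct (F i) as [[? ?] ?]; apply HF).
  (* The value at 0 is the constant 1, so its slot can carry the phases. *)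
  destruct (diagonal_extraction_C (fun i l => if Z.eq_dec l 0 then RtoC (th i) else us i l))
    as (phi & L & Hphi & HL).
  { intros l; destruct (Z.eq_dec l 0).
    - exists 0%nat, 1; intros i _; rewrite Cmod_R; specialize (H1 i); apply Rabs_le; lra.
    - exists (Z.abs_nat l), (growth l); intros i Hi; apply H4; lia. }
  set (theta := Re (L 0%Z)).
  set (u := fun l => if Z.eq_dec l 0 then RtoC 1 else L l).
  assert (Hu : forall l, Clim (fun i => us (phi i) l) (u l)).
  { intros l; unfold u; specialize (HL l); destruct (Z.eq_dec l 0) as [->|]; [|assumption].
    apply (Clim_ext (fun _ => RtoC 1)); [intros; now rewrite H3|apply Clim_const]. }
  assert (Hth : forall e, 0 < e -> exists N, forall i, (N <= i)%nat -> Rabs (th (phi i) - theta) < e).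
  { intros e He; destruct (HL 0%Z e He) as [N HN]; exists N; intros i Hi; specialize (HN i Hi).
    cbn in HN; eapply Rle_lt_trans; [|exact HN].
    eapply Rle_trans; [|apply re_le_Cmod]; right; unfold theta; destruct (L 0%Z); cbn; reflexivity. }
  assert (Hcos : forall l, Clim (fun i => RtoC (2 * cos (2 * PI * (th (phi i) + IZR l * alpha))))
    (RtoC (2 * cos (2 * PI * (theta + IZR l * alpha))))).
  { intros l.
    assert (Hc2 : Ccont (fun t => expi (1 * (t + IZR l * alpha)) + expi (-1 * (t + IZR l * alpha)))%C).
    { apply Ccont_plus; apply (Ccont_shift (fun t => expi (_ * t))), Ccont_expi. }
    intros e He; destruct (Hc2 theta e He) as (d & Hd & Hcd), (Hth _ Hd) as [N HN].
    exists N; intros i Hi; specialize (Hcd _ (HN i Hi)).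
    rewrite !RtoC_two_cos.
    replace (1 * (th (phi i) + IZR l * alpha)) with (th (phi i) + IZR l * alpha) in Hcd by ring.
    replace (-1 * (th (phi i) + IZR l * alpha)) with (- (th (phi i) + IZR l * alpha)) in Hcd by ring.
    replace (1 * (theta + IZR l * alpha)) with (theta + IZR l * alpha) in Hcd by ring.
    replace (-1 * (theta + IZR l * alpha)) with (- (theta + IZR l * alpha)) in Hcd by ring.
    assumption. }
  assert (Hub : forall l, Cmod (u l) <= growth l).
  { intros l; apply (Clim_Cmod_le _ _ _ (Hu l)).
    exists (Z.abs_nat l); intros n Hn; apply H4; specialize (Hphi n); lia. }
  exists theta, u; split; [reflexivity|]; split; [assumption|].
  intros l e He.
  (* 12 is the constant of [growth_linear]. *)
  set (K := conv_const lambda Vc g 12 l).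
  assert (HK : 0 <= K).
  { unfold K, conv_const.
    assert (0 < 2 / g) by (apply Rdiv_lt_0_compat; lra).
    generalize (IZR_abs_pos l); intros.
    repeat apply Rmult_le_pos; try lra; apply Rabs_pos. }
  assert (Hg2 : 0 < g / 2) by lra.
  assert (Hgc := geom_const_pos (g / 2) Hg2).
  destruct (exp_decay_eventually (K * geom_const (g / 2)) (g / 2) (e / 3) ltac:(nra) Hg2 ltac:(lra))
    as [D0 HD0].
  exists D0; intros D HD.
  assert (HI : INR D0 <= INR D) by (apply le_INR; lia).
  specialize (HD0 _ HI).
  set (f := fun i k => (RtoC lambda * c k * us i (l - k)%Z)%C).
  assert (Hlim : Clim (fun i => csym (f (phi i)) D
      + (RtoC (2 * cos (2 * PI * (th (phi i) + IZR l * alpha))) - RtoC E) * us (phi i) l)%C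
      (csym (fun k => RtoC lambda * c k * u (l - k)%Z) D
       + (RtoC (2 * cos (2 * PI * (theta + IZR l * alpha))) - RtoC E) * u l)%C).
  { apply Clim_plus.
    - apply (Clim_csum (fun i => f (phi i))); intros k; apply Clim_scal, Hu.
    - apply Clim_mult; [apply Clim_minus; [apply Hcos|apply Clim_const]|apply Hu]. }
  assert (Hfin : Cmod (csym (fun k => RtoC lambda * c k * u (l - k)%Z) D
       + (RtoC (2 * cos (2 * PI * (theta + IZR l * alpha))) - RtoC E) * u l)%C <= e / 3 + e / 3).
  { apply (Clim_Cmod_le _ _ _ Hlim).
    assert (Hgl : 0 <= growth l) by apply sqrt_pos.
    destruct (archimed_cor1 (e / 3 / (growth l + 1))) as (M & HM & HM0).
    { apply Rdiv_lt_0_compat; lra. }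
    exists (Nat.max M (Nat.max D (Z.abs_nat l))); intros i Hi.
    specialize (Hphi i).
    assert (HDp := H2 (phi i)).
    assert (Hmain := H5 (phi i) l ltac:(lia)).
    change (csym (fun k => RtoC lambda * c k * us (phi i) (l - k)%Z)%C (Ds (phi i)))
      with (csym (f (phi i)) (Ds (phi i))) in Hmain.
    assert (Hdiff : Cmod (csym (f (phi i)) (Ds (phi i)) - csym (f (phi i)) D)
      <= K * (geom_const (g / 2) * exp (- (g / 2) * INR D))).
    { eapply Rle_trans; [apply (csym_minus_le _ (fun k => K * exp (- (g / 2) * IZR (Z.abs k)))); [lia|]|].
      - intros k Hk; apply Cmod_conv_term_le; auto; [lra|].
        eapply Rle_trans; [apply H4; lia|apply growth_linear].
      - unfold rsym; rewrite !rsum_scal, <- Rmult_minus_distr_l.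
        apply Rmult_le_compat_l; [assumption|]; apply rsym_exp_tail; [assumption|lia]. }
    assert (Hsmall : (growth l + 1) * / INR (S (phi i)) <= e / 3).
    { apply Rle_trans with ((growth l + 1) * (e / 3 / (growth l + 1))); [|right; field; lra].
      apply Rmult_le_compat_l; [lra|]; left; eapply Rle_lt_trans; [|exact HM].
      apply Rinv_le_contravar; [apply lt_0_INR; lia|apply le_INR; lia]. }
    match goal with |- Cmod (?a + ?b) <= _ =>
      replace (a + b)%C with ((csym (f (phi i)) (Ds (phi i)) + b)
        + - (csym (f (phi i)) (Ds (phi i)) - a))%C by ring end.
    eapply Rle_trans; [apply Cmod_triangle|]; rewrite Cmod_opp.
    lra. }
  eapply Rle_lt_trans; [|apply Rle_lt_trans with (1 := Hfin); lra].
  right; f_equal; ring.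
Qed.

Lemma finite_maximum (f : Z -> R) B :
  exists k1, (Z.abs k1 <= Z.of_nat B)%Z /\ forall k, (Z.abs k <= Z.of_nat B)%Z -> f k <= f k1.
Proof.
  induction B as [|B (k1 & Hk1 & H)].
  - exists 0%Z; split; [lia|]; intros k Hk; replace k with 0%Z by lia; lra.
  - assert (Hex : exists k2, (Z.abs k2 <= Z.of_nat (S B))%Z /\
      f k1 <= f k2 /\ f (Z.of_nat (S B)) <= f k2 /\ f (- Z.of_nat (S B))%Z <= f k2).
    { destruct (Rle_dec (f k1) (f (Z.of_nat (S B)))).
      - destruct (Rle_dec (f (Z.of_nat (S B))) (f (- Z.of_nat (S B))%Z)).
        + exists (- Z.of_nat (S B))%Z; repeat split; try lra; lia.
        + exists (Z.of_nat (S B)); repeat split; try lra; lia.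
      - destruct (Rle_dec (f k1) (f (- Z.of_nat (S B))%Z)).
        + exists (- Z.of_nat (S B))%Z; repeat split; try lra; lia.
        + exists k1; repeat split; try lra; lia. }
    destruct Hex as (k2 & Hk2 & E1 & E2 & E3); exists k2; split; [assumption|].
    intros k Hk; destruct (Z.eq_dec k (Z.of_nat (S B))) as [->|]; [assumption|].
    destruct (Z.eq_dec k (- Z.of_nat (S B))) as [->|]; [assumption|].
    eapply Rle_trans; [apply H; lia|assumption].
Qed.

(* Recentring at a maximum of [|u_k| / (1 + |k|)] turns the bound of order
   [|k|^(3/4)] into the normalization [|u_k| <= 1 + |k|]. *)
Theorem dual_generalized_eigenfunction alpha lambda v E V c Vc g :
  irrational alpha -> (forall x, Rabs (v x) <= V) -> Sigma lambda v alpha E ->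
  (forall x, Clim (csym (fun k => c k * expi (IZR k * x))%C) (RtoC (v x))) ->
  0 < g -> (forall k, Cmod (c k) <= Vc * exp (- g * IZR (Z.abs k))) ->
  exists theta u, u 0%Z = RtoC 1 /\ (forall l, Cmod (u l) <= 1 + IZR (Z.abs l)) /\
    forall l, Clim (csym (fun k => RtoC lambda * c k * u (l - k)%Z)%C)
      ((RtoC E - RtoC (2 * cos (2 * PI * (theta + IZR l * alpha)))) * u l)%C.
Proof.
  intros Ha HV HE Hc Hg Hdec.
  destruct (dual_limit_solution alpha lambda v E V c Vc g Ha HV HE Hc Hg Hdec)
    as (theta & u & H0 & Hu & Heq).
  set (r := fun k => Cmod (u k) / (1 + IZR (Z.abs k))).
  assert (Hden : forall k, 0 < 1 + IZR (Z.abs k)) by (intros; generalize (IZR_abs_pos k); lra).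
  (* The ratio is 1 at 0 and, by [growth_sublinear], below 1 beyond 20000, so the maximum over this
     finite range is global. *)
  destruct (finite_maximum r (Z.to_nat 20000)) as (k1 & _ & Hmax).
  assert (Hr0 : 1 <= r k1).
  { eapply Rle_trans; [|apply (Hmax 0%Z); lia]; unfold r; rewrite H0, Cmod_1; cbn; lra. }
  assert (Hall : forall k, r k <= r k1).
  { intros k; destruct (Z_le_gt_dec (Z.abs k) 20000); [apply Hmax; lia|].
    apply Rle_trans with 1; [|assumption].
    apply (Rmult_le_reg_r (1 + IZR (Z.abs k))); [apply Hden|].
    unfold r, Rdiv; rewrite Rmult_assoc, Rinv_l by (generalize (Hden k); lra).
    generalize (Hu k) (growth_sublinear k ltac:(lia)); lra. }
  assert (Hk1 : 0 < Cmod (u k1)).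
  { apply Rnot_le_lt; intros Hle; assert (Cmod (u k1) = 0) by (generalize (Cmod_ge_0 (u k1)); lra).
    unfold r in Hr0; rewrite H in Hr0; unfold Rdiv in Hr0; lra. }
  assert (Hk1' : u k1 <> RtoC 0) by now apply Cmod_gt_0.
  exists (theta + IZR k1 * alpha), (fun l => u (l + k1)%Z / u k1)%C; split; [|split].
  - rewrite Z.add_0_l; field; assumption.
  - intros l; rewrite Cmod_div by assumption.
    assert (H := Hall (l + k1)%Z); unfold r in H.
    apply (Rmult_le_reg_r (Cmod (u k1))); [assumption|].
    unfold Rdiv; rewrite Rmult_assoc, Rinv_l, Rmult_1_r by lra.
    assert (Hd1 := Hden k1); assert (Hd2 := Hden (l + k1)%Z).
    apply (Rmult_le_compat_r ((1 + IZR (Z.abs (l + k1))) * (1 + IZR (Z.abs k1)))) in H; [|nra].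
    replace (Cmod (u (l + k1)%Z) / (1 + IZR (Z.abs (l + k1))) * ((1 + IZR (Z.abs (l + k1))) * (1 + IZR (Z.abs k1))))
      with (Cmod (u (l + k1)%Z) * (1 + IZR (Z.abs k1))) in H by (field; lra).
    replace (Cmod (u k1) / (1 + IZR (Z.abs k1)) * ((1 + IZR (Z.abs (l + k1))) * (1 + IZR (Z.abs k1))))
      with (Cmod (u k1) * (1 + IZR (Z.abs (l + k1)))) in H by (field; lra).
    assert (Htri : 1 + IZR (Z.abs (l + k1)) <= (1 + IZR (Z.abs l)) * (1 + IZR (Z.abs k1))).
    { assert (IZR (Z.abs (l + k1)) <= IZR (Z.abs l) + IZR (Z.abs k1))
        by (rewrite <- plus_IZR; apply IZR_le; lia).
      generalize (IZR_abs_pos l) (IZR_abs_pos k1); nra. }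
    apply (Rmult_le_reg_r (1 + IZR (Z.abs k1))); [assumption|].
    eapply Rle_trans; [exact H|].
    apply Rle_trans with (Cmod (u k1) * ((1 + IZR (Z.abs l)) * (1 + IZR (Z.abs k1)))); [|right; ring].
    apply Rmult_le_compat_l; lra.
  - intros l; specialize (Heq (l + k1)%Z).
    apply (Clim_scal (/ u k1)) in Heq.
    eapply Clim_ext; [|replace (theta + IZR k1 * alpha + IZR l * alpha) with (theta + IZR (l + k1) * alpha)
      by (rewrite plus_IZR; ring); match type of Heq with Clim _ ?a =>
      match goal with |- Clim _ ?b => replace b with a by (field; assumption) end end; exact Heq].
    intros n; unfold csym; rewrite <- csum_scal; apply csum_ext; intros k _.
    replace (l + k1 - k)%Z with (l - k + k1)%Z by lia; field; assumption.
Qed.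

(** * Arithmetic of the frequency *)

Definition badly_approximated (alpha : R) (K : nat) : Prop :=
  forall m p : Z, (1 <= Z.abs m <= Z.of_nat K)%Z -> / (4 * INR K) <= Rabs (IZR m * alpha - IZR p).

(* If every large [K] admitted [m <= K] with [|m alpha - p| < 1/(4K)], then
   consecutive such fractions [p/m] would all be equal. *)
Lemma badly_approximated_unbounded alpha K0 :
  irrational alpha -> exists K, (K0 <= K)%nat /\ (1 <= K)%nat /\ badly_approximated alpha K.
Proof.
  intros Ha; apply NNPP; intros Hno.
  pose (k := fun i => (S K0 + i)%nat).
  destruct (dependent_sequence (fun i (t : Z * Z) => (1 <= fst t <= Z.of_nat (k i))%Z /\
    Rabs (IZR (fst t) * alpha - IZR (snd t)) < / (4 * INR (k i)))) as [f Hf].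
  { intros i; apply NNPP; intros Hi; apply Hno; exists (k i); split; [unfold k; lia|].
    split; [unfold k; lia|]; intros m p Hm; apply Rnot_lt_le; intros Hlt; apply Hi.
    destruct (Z_le_gt_dec 0 m) as [Hm0|Hm0].
    - exists (m, p); cbn [fst snd]; split; [lia|assumption].
    - exists (- m, - p)%Z; cbn [fst snd]; split; [lia|].
      rewrite !opp_IZR; replace (- IZR m * alpha - - IZR p) with (- (IZR m * alpha - IZR p)) by ring.
      now rewrite Rabs_Ropp. }
  pose (m := fun i => fst (f i)); pose (p := fun i => snd (f i)).
  assert (Hm : forall i, (1 <= m i <= Z.of_nat (k i))%Z) by (intros; apply Hf).
  assert (Hp : forall i, Rabs (IZR (m i) * alpha - IZR (p i)) < / (4 * INR (k i))) by (intros; apply Hf).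
  assert (Hm1 : forall i, 1 <= IZR (m i) <= INR (k i)).
  { intros i; rewrite INR_IZR_INZ; split; apply IZR_le; apply Hm. }
  assert (Hstep : forall i, (m i * p (S i) = m (S i) * p i)%Z).
  { intros i.
    assert (Hk : INR (k (S i)) = INR (k i) + 1) by (unfold k; rewrite <- S_INR; f_equal; lia).
    assert (Hk1 : 1 <= INR (k i)) by (apply (le_INR 1); unfold k; lia).
    assert (Hlt : Rabs (IZR (m i * p (S i) - m (S i) * p i)) < 1).
    { rewrite minus_IZR, !mult_IZR.
      replace (IZR (m i) * IZR (p (S i)) - IZR (m (S i)) * IZR (p i)) with
        (IZR (m (S i)) * (IZR (m i) * alpha - IZR (p i))
          - IZR (m i) * (IZR (m (S i)) * alpha - IZR (p (S i)))) by ring.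
      unfold Rminus at 1; eapply Rle_lt_trans; [apply Rabs_triang|].
      rewrite Rabs_Ropp, !Rabs_mult, !(Rabs_right (IZR _)) by (generalize (Hm1 i) (Hm1 (S i)); lra).
      assert (P1 := Hp i); assert (P2 := Hp (S i)); assert (M1 := Hm1 i); assert (M2 := Hm1 (S i)).
      rewrite Hk in *.
      assert (B1 : IZR (m (S i)) * Rabs (IZR (m i) * alpha - IZR (p i)) <= 1 / 2).
      { apply Rle_trans with ((INR (k i) + 1) * / (4 * INR (k i))).
        - apply Rmult_le_compat; [lra|apply Rabs_pos|lra|lra].
        - apply (Rmult_le_reg_r (4 * INR (k i))); [lra|].
          rewrite Rmult_assoc, Rinv_l; lra. }
      assert (B2 : IZR (m i) * Rabs (IZR (m (S i)) * alpha - IZR (p (S i))) <= 1 / 4).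
      { apply Rle_trans with ((INR (k i) + 1) * / (4 * (INR (k i) + 1))).
        - apply Rmult_le_compat; [lra|apply Rabs_pos|lra|lra].
        - right; field; lra. }
      lra. }
    rewrite <- abs_IZR in Hlt; apply lt_IZR in Hlt; lia. }
  assert (Hconst : forall i, (m 0%nat * p i = m i * p 0%nat)%Z).
  { intros i; induction i as [|i IH]; [reflexivity|].
    apply (Z.mul_reg_l _ _ (m i)); [generalize (Hm i); lia|].
    rewrite Z.mul_assoc, (Z.mul_comm (m i)), <- Z.mul_assoc, Hstep.
    rewrite (Z.mul_assoc (m 0%nat)), (Z.mul_comm (m 0%nat)), <- Z.mul_assoc, IH; ring. }
  apply (Ha (p 0%nat) (m 0%nat)); [generalize (Hm 0%nat); lia|].
  assert (Hm0 : 0 < IZR (m 0%nat)) by (generalize (Hm1 0%nat); lra).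
  apply Rminus_diag_uniq, NNPP; intros Hne.
  apply Rabs_pos_lt in Hne; set (d := Rabs (alpha - IZR (p 0%nat) / IZR (m 0%nat))) in *.
  destruct (archimed_cor1 d Hne) as (i & Hi & Hi0).
  assert (Hd : d <= / (4 * INR (k i))).
  { assert (E : IZR (m i) * (alpha - IZR (p 0%nat) / IZR (m 0%nat)) = IZR (m i) * alpha - IZR (p i)).
    { assert (Hc := f_equal IZR (Hconst i)); rewrite !mult_IZR in Hc.
      replace (IZR (p i)) with (IZR (m i) * IZR (p 0%nat) / IZR (m 0%nat)) by (rewrite <- Hc; field; lra).
      field; lra. }
    assert (Hpi := Hp i); rewrite <- E, Rabs_mult, Rabs_right in Hpi by (generalize (Hm1 i); lra).
    fold d in Hpi; generalize (Hm1 i); nra. }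
  assert (Hki : / (4 * INR (k i)) <= / INR i).
  { assert (0 < INR i) by (apply lt_0_INR; lia).
    assert (INR i <= INR (k i)) by (apply le_INR; unfold k; lia).
    apply Rinv_le_contravar; lra. }
  lra.
Qed.

(** A Euclidean step: dividing 1 by [b = q alpha + p] leaves a remainder [1 - t b] in [[0, b)].
    Either the remainder or [b] minus it is at most [b / 2], and irrationality keeps the remainder
    from vanishing. *)
Lemma small_combination alpha n :
  irrational alpha -> exists q p : Z, q <> 0%Z /\ 0 < IZR q * alpha + IZR p <= / 2 ^ n.
Proof.
  intros Ha; induction n as [|n (q & p & Hq & Hb)].
  - exists 1%Z, (- Int_part alpha)%Z; split; [lia|].
    rewrite opp_IZR; destruct (base_Int_part alpha) as [H1 H2].
    cbn [pow]; rewrite Rinv_1; split; [|lra].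
    assert (alpha <> IZR (Int_part alpha)); [|lra].
    intros E; apply (Ha (Int_part alpha) 1%Z); [lia|]; rewrite <- E; field.
  - set (b := IZR q * alpha + IZR p) in *.
    assert (H2n : / 2 ^ n <= 1).
    { rewrite <- Rinv_1; apply Rinv_le_contravar; [lra|]; apply pow_R1_Rle; lra. }
    assert (E2 : / 2 ^ S n = / 2 ^ n / 2) by (cbn [pow]; field; apply pow_nonzero; lra).
    set (t := Int_part (/ b)).
    destruct (base_Int_part (/ b)) as [T1 T2]; fold t in T1, T2.
    assert (Hib : b * / b = 1) by (field; lra).
    assert (Ht : (1 <= t)%Z).
    { assert (1 <= / b) by (rewrite <- Rinv_1; apply Rinv_le_contravar; lra).
      assert (0 < IZR t) by lra; apply lt_IZR in H0; lia. }
    assert (Hg1 : 0 <= 1 - IZR t * b) by nra.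
    assert (Hg2 : 1 - IZR t * b < b) by nra.
    assert (Hg0 : 1 - IZR t * b <> 0).
    { intros E; apply (Ha (1 - t * p)%Z (t * q)%Z); [lia|].
      rewrite minus_IZR, !mult_IZR.
      assert (IZR t <> 0) by (apply not_0_IZR; lia).
      assert (IZR q <> 0) by (apply not_0_IZR; lia).
      apply (Rmult_eq_reg_r (IZR t * IZR q)); [|now apply Rmult_integral_contrapositive].
      unfold Rdiv; rewrite Rmult_assoc, Rinv_l by now apply Rmult_integral_contrapositive.
      unfold b in E; lra. }
    destruct (Rle_dec (1 - IZR t * b) (b / 2)).
    + exists (- (t * q))%Z, (1 - t * p)%Z; split; [lia|].
      rewrite opp_IZR, minus_IZR, !mult_IZR.
      replace (- (IZR t * IZR q) * alpha + (1 - IZR t * IZR p)) with (1 - IZR t * b) by (unfold b; ring).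
      lra.
    + exists (q + t * q)%Z, (p + t * p - 1)%Z; split; [nia|].
      rewrite minus_IZR, !plus_IZR, !mult_IZR.
      replace ((IZR q + IZR t * IZR q) * alpha + (IZR p + IZR t * IZR p - 1)) with (b - (1 - IZR t * b))
        by (unfold b; ring).
      lra.
Qed.

(** Iterating [|q|] times moves a point by [b] or [- b] modulo 1, with [0 < b <= r], so such moves
    cannot jump over an interval of length [r], and about [1 / b] of them suffice for every [x]. The
    sign of [q] decides between climbing just past the next integer and descending to just above the
    previous one; both use forward iterates. *)
Lemma orbit_density alpha r :
  irrational alpha -> 0 < r ->
  exists J0 : nat, forall x, exists (j : nat) (l : Z), (j <= J0)%nat /\ 0 <= x + INR j * alpha - IZR l <= r.
Proof.
  intros Ha Hr.
  assert (Hn : exists n, / 2 ^ n <= r).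
  { destruct (archimed_cor1 r Hr) as (n & Hn & Hn0); exists n.
    left; eapply Rle_lt_trans; [|exact Hn].
    apply Rinv_le_contravar; [apply lt_0_INR; lia|apply INR_le_pow2]. }
  destruct Hn as [n Hn].
  destruct (small_combination alpha n Ha) as (q & p & Hq & Hb).
  set (b := IZR q * alpha + IZR p) in *.
  destruct (INR_unbounded (/ b + 1)) as [M HM].
  exists (Z.abs_nat q * M)%nat; intros x.
  assert (Hib : b * / b = 1) by (field; lra).
  assert (Hi0 : 0 < / b) by (apply Rinv_0_lt_compat; lra).
  assert (Hbound : forall t : Z, (0 <= t)%Z -> IZR t <= / b + 1 -> (Z.to_nat t <= M)%nat).
  { intros t Ht0 Ht; apply INR_le; rewrite INR_IZR_INZ, Z2Nat.id by assumption; lra. }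
  destruct (Z_le_gt_dec 0 q) as [Hq0|Hq0].
  - set (L := up x); destruct (archimed x) as [U1 U2]; fold L in U1, U2.
    set (t := up ((IZR L - x) / b)); destruct (archimed ((IZR L - x) / b)) as [V1 V2]; fold t in V1, V2.
    assert (Hdiv : b * ((IZR L - x) / b) = IZR L - x) by (field; lra).
    assert (Hle : (IZR L - x) / b <= / b) by (unfold Rdiv; nra).
    assert (H0 : 0 < (IZR L - x) / b) by (apply Rdiv_lt_0_compat; lra).
    assert (Ht0 : (0 <= t)%Z) by (apply le_IZR; lra).
    exists (Z.abs_nat q * Z.to_nat t)%nat, (L - t * p)%Z; split.
    + apply Nat.mul_le_mono_l, Hbound; [assumption|lra].
    + rewrite mult_INR, !INR_IZR_INZ, Z2Nat.id, Zabs2Nat.id_abs, Z.abs_eq, minus_IZR, mult_IZR by assumption.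
      replace (x + IZR q * IZR t * alpha - (IZR L - IZR t * IZR p)) with (x - IZR L + IZR t * b) by (unfold b; ring).
      nra.
  - set (L := Int_part x); destruct (base_Int_part x) as [U1 U2]; fold L in U1, U2.
    set (t := Int_part ((x - IZR L) / b)); destruct (base_Int_part ((x - IZR L) / b)) as [V1 V2]; fold t in V1, V2.
    assert (Hdiv : b * ((x - IZR L) / b) = x - IZR L) by (field; lra).
    assert (Hle : (x - IZR L) / b <= / b) by (unfold Rdiv; nra).
    assert (H0 : 0 <= (x - IZR L) / b) by (unfold Rdiv; nra).
    assert (Ht0 : (0 <= t)%Z).
    { assert (-1 < IZR t) by lra; apply lt_IZR in H; lia. }
    exists (Z.abs_nat q * Z.to_nat t)%nat, (L + t * p)%Z; split.
    + apply Nat.mul_le_mono_l, Hbound; [assumption|lra].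
    + rewrite mult_INR, !INR_IZR_INZ, Z2Nat.id, Zabs2Nat.id_abs, Z.abs_neq, opp_IZR, plus_IZR, mult_IZR by lia.
      replace (x + - IZR q * IZR t * alpha - (IZR L + IZR t * IZR p)) with (x - IZR L - IZR t * b) by (unfold b; ring).
      nra.
Qed.

(** * Resonances *)

Lemma dist_RZ_glb x :
  is_glb_Rbar (fun r => exists l : Z, r = Rabs (x - IZR l)) (Finite (dist_RZ x)).
Proof.
  unfold dist_RZ; set (S := fun r => exists l : Z, r = Rabs (x - IZR l)).
  assert (H := Glb_Rbar_correct S).
  destruct (Glb_Rbar S) as [g| |] eqn:E; cbn [real].
  - exact H.
  - exfalso; apply (proj1 H (Rabs (x - IZR 0))); now exists 0%Z.
  - exfalso; apply (proj2 H (Finite 0)); intros r [l ->]; apply Rabs_pos.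
Qed.

Lemma dist_RZ_approx x e : 0 < e -> exists l : Z, Rabs (x - IZR l) < dist_RZ x + e.
Proof.
  intros He; apply NNPP; intros Hno.
  assert (H := proj2 (dist_RZ_glb x) (Finite (dist_RZ x + e))); cbn in H.
  assert (Hlb : is_lb_Rbar (fun r => exists l : Z, r = Rabs (x - IZR l)) (Finite (dist_RZ x + e))).
  { intros r [l ->]; cbn; apply Rnot_lt_le; intros Hlt; apply Hno; now exists l. }
  specialize (H Hlb); lra.
Qed.

Lemma dist_RZ_le x l : dist_RZ x <= Rabs (x - IZR l).
Proof. apply (proj1 (dist_RZ_glb x) (Rabs (x - IZR l))); now exists l. Qed.

Lemma resonance_0 alpha theta eps0 : resonance alpha theta eps0 0.
Proof.
  split.
  - change (IZR (Z.abs 0)) with 0; rewrite Rmult_0_r, exp_0.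
    destruct (archimed (2 * theta - IZR 0 * alpha)) as [H1 H2].
    eapply Rle_trans; [apply (dist_RZ_le _ (up (2 * theta - IZR 0 * alpha)))|].
    apply Rabs_le; lra.
  - intros j Hj; replace j with 0%Z by lia; lra.
Qed.

(** Two such resonances place [(r' - r) alpha] within [2 e] of an integer, [e = exp (- eps0 n1)],
    and approximating [dist_RZ] twice costs another [2 e]. The hypothesis on [16 K] says precisely
    [4 e < 1 / (4 K)]. *)
Lemma resonances_apart alpha theta eps0 K n1 r r' :
  0 < eps0 -> (1 <= K)%nat -> badly_approximated alpha K ->
  16 * INR K < exp (eps0 * INR n1) ->
  resonance alpha theta eps0 r -> resonance alpha theta eps0 r' ->
  (Z.of_nat n1 < Z.abs r)%Z -> (Z.of_nat n1 < Z.abs r')%Z ->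
  (Z.abs r + Z.abs r' <= Z.of_nat K)%Z -> r = r'.
Proof.
  intros He HK HbK Hn [H _] [H' _] Hr Hr' Hsum.
  apply NNPP; intros Hne.
  set (e := exp (- eps0 * INR n1)).
  assert (He0 : 0 < e) by apply exp_pos.
  assert (HKp : 0 < INR K) by (apply lt_0_INR; lia).
  assert (Hle : forall s, (Z.of_nat n1 < Z.abs s)%Z -> exp (- eps0 * IZR (Z.abs s)) <= e).
  { intros s Hs; apply exp_monotone; rewrite INR_IZR_INZ.
    apply Z.lt_le_incl, IZR_le in Hs; nra. }
  destruct (dist_RZ_approx (2 * theta - IZR r * alpha) e He0) as [l Hl].
  destruct (dist_RZ_approx (2 * theta - IZR r' * alpha) e He0) as [l' Hl'].
  assert (A := Hle r Hr); assert (A' := Hle r' Hr').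
  assert (Hb := HbK (r' - r)%Z (l - l')%Z ltac:(lia)).
  rewrite !minus_IZR in Hb.
  replace ((IZR r' - IZR r) * alpha - (IZR l - IZR l')) with
    ((2 * theta - IZR r * alpha - IZR l) - (2 * theta - IZR r' * alpha - IZR l')) in Hb by ring.
  assert (Htri : Rabs ((2 * theta - IZR r * alpha - IZR l) - (2 * theta - IZR r' * alpha - IZR l'))
    <= Rabs (2 * theta - IZR r * alpha - IZR l) + Rabs (2 * theta - IZR r' * alpha - IZR l')).
  { eapply Rle_trans; [apply Rabs_triang|]; rewrite Rabs_Ropp; lra. }
  assert (H4 : / (4 * INR K) < 4 * e) by lra.
  assert (Hee : e * exp (eps0 * INR n1) = 1) by (unfold e; rewrite <- exp_plus, <- exp_0; f_equal; ring).
  apply (Rmult_lt_compat_r (4 * INR K)) in H4; [|lra].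
  rewrite Rinv_l in H4 by lra; nra.
Qed.

(** * Enumeration of a set of integers by modulus, applied to the resonances *)

Definition next_index (P : Z -> Prop) (a b : nat) : Prop :=
  (a < b)%nat /\ P (zof b) /\ forall c, (a < c < b)%nat -> ~ P (zof c).

(** Positions along [zof], beginning with 0, of the successive integers satisfying [P]; [None] once
    the set is exhausted, as in [resonance_order]. An explicit ordering must be exhibited because
    [strong_localization] takes one as input. *)
Fixpoint enum_index (P : Z -> Prop) (j : nat) : option nat :=
  match j with
  | O => Some 0%nat
  | S i => match enum_index P i with
           | None => None
           | Some a =>
             match excluded_middle_informative (exists b, next_index P a b) with
             | left H => Some (proj1_sig (constructive_indefinite_description _ H))
             | right _ => None
             end
           end
  end.

Lemma enum_index_S P j a b :
  enum_index P j = Some a -> enum_index P (S j) = Some b -> next_index P a b.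
Proof.
  intros H; cbn [enum_index]; rewrite H.
  destruct excluded_middle_informative as [Hex|]; [|discriminate].
  intros E; injection E as <-; apply proj2_sig.
Qed.

Lemma enum_index_next P j a b :
  enum_index P j = Some a -> next_index P a b -> enum_index P (S j) = Some b.
Proof.
  intros H Hb.
  assert (Hex : exists c, enum_index P (S j) = Some c).
  { cbn [enum_index]; rewrite H; destruct excluded_middle_informative as [Hex|Hno]; [eauto|].
    exfalso; apply Hno; now exists b. }
  destruct Hex as [c Hc]; rewrite Hc; f_equal.
  destruct (enum_index_S P j a c H Hc) as (C1 & C2 & C3), Hb as (B1 & B2 & B3).
  destruct (Nat.lt_trichotomy c b) as [Hlt|[E|Hlt]]; [|exact E|].
  - exfalso; apply (B3 c); auto.
  - exfalso; apply (C3 b); auto.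
Qed.

Lemma enum_index_P (P : Z -> Prop) j a :
  P 0%Z -> enum_index P j = Some a -> P (zof a).
Proof.
  intros P_0; destruct j as [|j]; intros H.
  - injection H as <-; exact P_0.
  - destruct (enum_index P j) as [b|] eqn:E.
    + apply (enum_index_S P j b a E H).
    + cbn [enum_index] in H; rewrite E in H; discriminate.
Qed.

Lemma enum_index_upto P b :
  exists j a, enum_index P j = Some a /\ (a <= b)%nat /\ forall c, (a < c <= b)%nat -> ~ P (zof c).
Proof.
  induction b as [|b (j & a & H1 & H2 & H3)].
  - exists 0%nat, 0%nat; split; [reflexivity|split; [lia|]]; intros; lia.
  - destruct (classic (P (zof (S b)))) as [HP|HP].
    + exists (S j), (S b); split; [|split; [lia|intros; lia]].
      apply (enum_index_next P j a); [assumption|]; split; [lia|]; split; [assumption|].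
      intros c Hc; apply H3; lia.
    + exists j, a; split; [assumption|split; [lia|]]; intros c Hc.
      destruct (Nat.eq_dec c (S b)) as [->|]; [assumption|apply H3; lia].
Qed.

Lemma enum_index_increasing P i j a b :
  (i < j)%nat -> enum_index P i = Some a -> enum_index P j = Some b -> (a < b)%nat.
Proof.
  intros Hij; revert b; induction Hij as [|j Hij IH]; intros b Ha Hb.
  - apply (enum_index_S P i a b Ha Hb).
  - destruct (enum_index P j) as [c|] eqn:E.
    + specialize (IH c Ha eq_refl); generalize (enum_index_S P j c b E Hb); intros [H _]; lia.
    + cbn [enum_index] in Hb; rewrite E in Hb; discriminate.
Qed.

(** The positions up to [2 t] along [zof] carry exactly the integers of modulus at most [t]. The
    last resonance among them determines [j]; the next one, if any, lies beyond [t]. *)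
Lemma resonance_order_exists alpha theta eps0 (t : nat) :
  exists n j, resonance_order alpha theta eps0 n /\
    (exists nj, n j = Some nj /\ (Z.abs nj <= Z.of_nat t)%Z) /\
    forall m, n (S j) = Some m -> resonance alpha theta eps0 m /\ (Z.of_nat t < Z.abs m)%Z.
Proof.
  pose (P := resonance alpha theta eps0).
  assert (P0 : P 0%Z) by apply resonance_0.
  pose (n := fun j => option_map zof (enum_index P j)).
  destruct (enum_index_upto P (2 * t)) as (j & a & Ha & Hat & Hnone).
  exists n, j; split; [|split].
  - constructor.
    + reflexivity.
    + intros k; split.
      * intros Hk; destruct (zof_surjective k) as [b <-].
        destruct (enum_index_upto P b) as (i & c & Hc & Hcb & Hno).
        exists i; unfold n; rewrite Hc; cbn; do 2 f_equal.
        apply NNPP; intros Hne; apply (Hno b); [lia|exact Hk].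
      * intros [i Hi]; unfold n in Hi; destruct (enum_index P i) as [b|] eqn:E; [|discriminate].
        cbn in Hi; injection Hi as <-; exact (enum_index_P P i b P0 E).
    + intros i i' k Hi Hi'; unfold n in Hi, Hi'.
      destruct (enum_index P i) as [b|] eqn:E; [|discriminate].
      destruct (enum_index P i') as [b'|] eqn:E'; [|discriminate].
      cbn in Hi, Hi'; injection Hi as Hi; injection Hi' as Hi'.
      assert (b = b') by (apply zof_injective; congruence); subst b'.
      destruct (Nat.lt_trichotomy i i') as [H|[H|H]]; [|exact H|].
      * generalize (enum_index_increasing P i i' b b H E E'); lia.
      * generalize (enum_index_increasing P i' i b b H E' E); lia.
    + intros i Hi; unfold n in *; cbn [enum_index].
      destruct (enum_index P i); [discriminate|reflexivity].
    + intros i k l Hk Hl; unfold n in *.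
      destruct (enum_index P i) as [b|] eqn:E; [|discriminate].
      destruct (enum_index P (S i)) as [b'|] eqn:E'; [|discriminate].
      cbn in Hk, Hl; injection Hk as <-; injection Hl as <-.
      apply zof_monotone; generalize (enum_index_S P i b b' E E'); intros [H _]; lia.
  - exists (zof a); unfold n; rewrite Ha; split; [reflexivity|].
    generalize (zof_monotone a (2 * t) Hat); rewrite zof_double; lia.
  - intros m Hm; unfold n in Hm.
    destruct (enum_index P (S j)) as [b|] eqn:E; [|discriminate].
    cbn in Hm; injection Hm as <-.
    destruct (enum_index_S P j a b Ha E) as (B1 & B2 & B3).
    split; [exact B2|].
    assert (Hb : (2 * t < b)%nat) by (apply Nat.nle_gt; intros Hle; apply (Hnone b); [lia|exact B2]).
    generalize (zof_monotone (2 * t + 1) b ltac:(lia)); rewrite zof_double_S; lia.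
Qed.

Lemma localization_in_gap lambda v alpha theta C0 eps0 eps1 Cbar E u (t : nat) hi :
  1 < C0 -> strong_localization lambda v alpha theta C0 eps0 eps1 Cbar ->
  Sigma lambda v alpha E ->
  (forall n, dual_value lambda v alpha theta u n (RtoC E * u n)%C) ->
  u 0%Z = RtoC 1 -> (forall k, Cmod (u k) <= 1 + IZR (Z.abs k)) ->
  (forall r, resonance alpha theta eps0 r -> (Z.abs r <= Z.of_nat t)%Z \/ hi <= IZR (Z.abs r)) ->
  forall k, C0 * INR t < IZR (Z.abs k) -> IZR (Z.abs k) < / C0 * hi ->
    Cmod (u k) <= Cbar * exp (- eps1 * IZR (Z.abs k)).
Proof.
  intros HC0 Hloc HE Hdual Hu0 Hu Hgap k Hk1 Hk2.
  destruct (resonance_order_exists alpha theta eps0 t) as (n & j & Hord & (nj & Hnj & Hnjt) & Hnext).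
  apply (Hloc E u HE Hdual Hu0 Hu n j k Hord); split.
  - exists nj; split; [assumption|].
    apply IZR_le in Hnjt; rewrite <- INR_IZR_INZ in Hnjt.
    eapply Rle_lt_trans; [|exact Hk1]; apply Rmult_le_compat_l; lra.
  - destruct (n (S j)) as [m|] eqn:Em; [|exact I].
    destruct (Hnext m eq_refl) as [Hres Hm].
    destruct (Hgap m Hres) as [H|H]; [lia|].
    eapply Rlt_le_trans; [exact Hk2|]; apply Rmult_le_compat_l; [|assumption].
    left; apply Rinv_0_lt_compat; lra.
Qed.

Lemma resonance_dichotomy alpha theta eps0 K n1 T :
  0 < eps0 -> (1 <= K)%nat -> badly_approximated alpha K ->
  16 * INR K < exp (eps0 * INR n1) -> (n1 <= T)%nat -> (2 * T <= K)%nat ->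
  (forall r, resonance alpha theta eps0 r -> (Z.abs r <= Z.of_nat n1)%Z \/ INR T <= IZR (Z.abs r)) \/
  (forall r, resonance alpha theta eps0 r -> (Z.abs r <= Z.of_nat T)%Z \/ INR K / 2 <= IZR (Z.abs r)).
Proof.
  intros He HK HbK Hn HT HTK.
  destruct (classic (exists r0, resonance alpha theta eps0 r0 /\
    (Z.of_nat n1 < Z.abs r0 < Z.of_nat T)%Z)) as [(r0 & Hr0 & Hr0T)|Hno].
  - right; intros r Hr.
    destruct (Z_le_gt_dec (Z.abs r) (Z.of_nat T)) as [Hle|Hgt]; [now left|right].
    apply Rnot_lt_le; intros Hlt.
    assert (Hlt' : (2 * Z.abs r < Z.of_nat K)%Z).
    { apply lt_IZR; rewrite mult_IZR, <- INR_IZR_INZ; lra. }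
    assert (r = r0) by (apply (resonances_apart alpha theta eps0 K n1); auto; lia).
    subst r0; lia.
  - left; intros r Hr.
    destruct (Z_le_gt_dec (Z.abs r) (Z.of_nat n1)) as [Hle|Hgt]; [now left|right].
    apply Rnot_lt_le; intros Hlt; apply Hno; exists r; split; [assumption|split; [lia|]].
    apply lt_IZR; now rewrite <- INR_IZR_INZ.
Qed.

Lemma scales_exist alpha eps0 A :
  irrational alpha -> 0 < eps0 -> 1 <= A ->
  exists K n1 T : nat, (1 <= K)%nat /\ badly_approximated alpha K /\
    16 * INR K < exp (eps0 * INR n1) /\ (n1 <= T)%nat /\
    A * (INR n1 + 1) * (1 + ln (INR K)) <= INR T /\
    A * (INR T + 1) * (1 + ln (INR K)) <= INR K / 2.
Proof.
  intros Ha He HA.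
  pose (b := 4 / eps0 + 2).
  assert (Hb : 0 < 4 / eps0) by (apply Rdiv_lt_0_compat; lra).
  (* With [x = 1 + ln K], the bounds [n1 + 1 <= b x] and [T + 1 <= (2 A b + 2) x^2] obtained below
     give [A (T + 1) x <= c x^3], so the aim is [2 c x^3 <= K]. *)
  pose (c := A * (2 * A * b + 2)).
  assert (HAb : 0 < A * b) by (unfold b; nra).
  assert (Hc : 0 < c) by (unfold c; nra).
  destruct (INR_unbounded (exp (2 * c * 256 * 3))) as [K0 HK0].
  destruct (badly_approximated_unbounded alpha K0 Ha) as (K & HK0K & HK & HbK).
  assert (HKp : 1 <= INR K) by now apply (le_INR 1).
  set (x := 1 + ln (INR K)).
  assert (HKx : INR K = exp (x - 1)) by (unfold x; replace (1 + ln (INR K) - 1) with (ln (INR K)) by ring; rewrite exp_ln; lra).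
  assert (Hx : 2 * c * 256 * 3 < x).
  { assert (exp (2 * c * 256 * 3) < exp (x - 1)).
    { rewrite <- HKx; eapply Rlt_le_trans; [exact HK0|now apply le_INR]. }
    apply exp_lt_inv in H; lra. }
  assert (Hx1 : 1 <= x).
  { unfold x; assert (0 <= ln (INR K)); [|lra].
    rewrite <- ln_1; destruct HKp as [Hlt|<-]; [left; apply ln_increasing; lra|lra]. }
  (* [exp x <= 3 K] and [exp x >= (x / 4)^4 = x^4 / 256]; the lower bound on [x] trades one of the
     four factors for [2 c] times 768. *)
  assert (HKx3 : 2 * c * x ^ 3 <= INR K).
  { assert (E : exp x = exp (x / 4) ^ 4).
    { rewrite <- (exp_mult_INR (x / 4) 4); f_equal; cbn; field. }
    assert (Hq : x / 4 <= exp (x / 4)) by (generalize (exp_ineq1_le (x / 4)); lra).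
    assert (Hq4 : (x / 4) ^ 4 <= exp x) by (rewrite E; apply pow_incr; lra).
    assert (HeK : exp x <= 3 * INR K).
    { rewrite HKx; replace x with (1 + (x - 1)) at 1 by ring; rewrite exp_plus.
      apply Rmult_le_compat_r; [left; apply exp_pos|apply exp_le_3]. }
    assert (Hx3 : 0 < x ^ 3) by (apply pow_lt; lra).
    assert (2 * c * 256 * 3 * x ^ 3 <= x ^ 4) by (replace (x ^ 4) with (x * x ^ 3) by ring; nra).
    replace ((x / 4) ^ 4) with (x ^ 4 / 256) in Hq4 by field.
    lra. }
  (* Since [K = exp (x - 1)], the number [exp (3 + x)] is [exp 4] times [K], which exceeds
     [16 K]. *)
  destruct (archimed ((3 + x) / eps0)) as [N1 N2].
  set (n1z := up ((3 + x) / eps0)) in *.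
  assert (Hn0 : 0 < (3 + x) / eps0) by (apply Rdiv_lt_0_compat; lra).
  assert (Hn1z : (0 <= n1z)%Z) by (apply le_IZR; lra).
  set (n1 := Z.to_nat n1z).
  assert (Hn1 : INR n1 = IZR n1z) by (unfold n1; now rewrite INR_IZR_INZ, Z2Nat.id).
  assert (Hn1b : INR n1 + 1 <= b * x).
  { rewrite Hn1; apply Rle_trans with ((3 + x) / eps0 + 2); [lra|].
    unfold b; replace ((4 / eps0 + 2) * x) with (4 * x / eps0 + 2 * x) by (field; lra).
    assert ((3 + x) / eps0 <= 4 * x / eps0).
    { apply Rmult_le_compat_r; [left; now apply Rinv_0_lt_compat|lra]. }
    lra. }
  destruct (archimed (A * (INR n1 + 1) * x)) as [T1 T2].
  set (Tz := up (A * (INR n1 + 1) * x)) in *.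
  assert (Hn1p := pos_INR n1).
  assert (HAn : INR n1 + 1 <= A * (INR n1 + 1)) by nra.
  assert (HTn : INR n1 + 1 <= A * (INR n1 + 1) * x) by nra.
  assert (HTz : (0 <= Tz)%Z) by (apply le_IZR; lra).
  set (T := Z.to_nat Tz).
  assert (HT : INR T = IZR Tz) by (unfold T; now rewrite INR_IZR_INZ, Z2Nat.id).
  exists K, n1, T; split; [assumption|]; split; [assumption|].
  fold x; split; [|split; [apply INR_le; lra|split; [lra|]]].
  - apply Rlt_le_trans with (exp (3 + x)).
    + replace (3 + x) with (4 + (x - 1)) by ring; rewrite exp_plus, <- HKx.
      assert (16 < exp 4); [|nra].
      assert (E : exp 4 = exp 1 ^ 4) by (rewrite <- (exp_mult_INR 1 4); f_equal; cbn; ring).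
      assert (2 < exp 1) by (generalize (exp_ineq1 1); lra).
      rewrite E; assert (4 < exp 1 ^ 2) by nra.
      replace (exp 1 ^ 4) with (exp 1 ^ 2 * exp 1 ^ 2) by ring; nra.
    + apply exp_monotone; rewrite Hn1.
      apply Rle_trans with (eps0 * ((3 + x) / eps0)); [right; field; lra|].
      apply Rmult_le_compat_l; lra.
  - assert (HTb : INR T + 1 <= (2 * A * b + 2) * x ^ 2).
    { rewrite HT; apply Rle_trans with (A * (b * x) * x + 2).
      - assert (A * (INR n1 + 1) * x <= A * (b * x) * x); [|lra].
        apply Rmult_le_compat_r; [lra|]; apply Rmult_le_compat_l; lra.
      - replace (A * (b * x) * x) with (A * b * x ^ 2) by ring; nra. }
    apply Rle_trans with (c * x ^ 3); [|lra].
    unfold c; replace (A * (2 * A * b + 2) * x ^ 3) with (A * ((2 * A * b + 2) * x ^ 2) * x) by ring.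
    apply Rmult_le_compat_r; [lra|]; apply Rmult_le_compat_l; lra.
Qed.

(** * Truncated generalized eigenfunctions *)

Definition trig_poly (u : Z -> C) (M : nat) (z : C) : C := csym (fun k => u k * ez k z)%C M.

Definition cut (M : nat) (j : Z) : C :=
  if Z_le_dec (Z.abs j) (Z.of_nat M) then RtoC 1 else RtoC 0.

Lemma trig_poly_rotate u M z alpha theta :
  (expi theta * trig_poly u M (z + RtoC alpha) + expi (- theta) * trig_poly u M (z - RtoC alpha))%C
  = csym (fun m => RtoC (2 * cos (2 * PI * (theta + IZR m * alpha))) * (u m * ez m z))%C M.
Proof.
  unfold trig_poly, csym; rewrite <- !csum_scal, <- csum_plus; apply csum_ext; intros m _.
  assert (E1 : ez m (z + RtoC alpha)%C = (ez m z * expi (IZR m * alpha))%C) by now rewrite ez_plus, ez_real.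
  assert (E2 : ez m (z - RtoC alpha)%C = (ez m z * expi (- (IZR m * alpha)))%C).
  { unfold Cminus; rewrite <- RtoC_opp, ez_plus, ez_real; do 2 f_equal; ring. }
  rewrite E1, E2, RtoC_two_cos.
  replace (- (theta + IZR m * alpha)) with (- theta + - (IZR m * alpha)) by ring.
  rewrite !expi_plus; ring.
Qed.

(** The commutator of the cut-off at [M] with multiplication by [ez k]: only those [j] contribute
    that the shift by [k] carries across the cut-off. *)
Lemma commutator_term u M k z :
  (csym (fun j => u j * ez (j + k) z)%C M - csym (fun m => u (m - k)%Z * ez m z)%C M)%C
  = csym (fun j => (cut M j - cut M (j + k)) * (u j * ez (j + k) z))%C (M + Z.abs_nat k).
Proof.
  set (f := fun j => (u j * ez (j + k) z)%C).
  assert (E1 : csym f M = csym (fun j => cut M j * f j)%C (M + Z.abs_nat k)).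
  { transitivity (csym (fun j => cut M j * f j)%C M).
    - apply csum_ext; intros j Hj; unfold cut; destruct Z_le_dec; [ring|lia].
    - symmetry; apply csum_subrange; [lia|lia|]; intros j _ Hj; unfold cut.
      destruct Z_le_dec; [lia|ring]. }
  assert (E2 : csym (fun m => u (m - k)%Z * ez m z)%C M
    = csym (fun j => cut M (j + k) * f j)%C (M + Z.abs_nat k)).
  { transitivity (csum (fun m => f (m + - k)%Z) (- Z.of_nat M) (2 * M + 1)).
    { apply csum_ext; intros m _; unfold f; now replace (m + - k + k)%Z with m by lia. }
    rewrite csum_shift.
    transitivity (csum (fun j => cut M (j + k) * f j)%C (- Z.of_nat M + - k) (2 * M + 1)).
    - apply csum_ext; intros j Hj; unfold cut; destruct Z_le_dec; [ring|lia].
    - symmetry; apply csum_subrange; [lia|lia|]; intros j _ Hj; unfold cut.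
      destruct Z_le_dec; [lia|ring]. }
  fold f; rewrite E1, E2; unfold csym; rewrite <- csum_minus; apply csum_ext; intros; unfold f; ring.
Qed.

Lemma exp_le_1 x : x <= 0 -> exp x <= 1.
Proof. intros H; rewrite <- exp_0; now apply exp_monotone. Qed.

Definition gap_decay (u : Z -> C) (n : nat) (N eta Cb : R) : Prop :=
  (forall k, Cmod (u k) <= 1 + IZR (Z.abs k)) /\
  forall k, INR n < IZR (Z.abs k) -> IZR (Z.abs k) < N ->
    Cmod (u k) <= Cb * exp (- (2 * PI * eta) * IZR (Z.abs k)).

(* One of [j], [j + k] lies beyond the cut-off [M] and the other below it; each
   of the three positions of [j] relative to the gap gives exponential decay. *)
Lemma crossing_term_le (u c : Z -> C) n M N eta eta' h V Cb z j k :
  0 <= eta' -> eta' < eta -> eta <= h -> 0 <= V -> 0 <= Cb ->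
  gap_decay u n N eta Cb ->
  (forall k, Cmod (c k) <= V * exp (- (2 * PI * h) * IZR (Z.abs k))) ->
  (2 * n <= M)%nat -> 2 * INR M <= N -> Rabs (Im z) <= eta' ->
  let g := 2 * PI * (eta - eta') in
  let x := INR M + IZR (Z.abs k) in
  Cmod (c k) * Cmod ((cut M j - cut M (j + k)) * (u j * ez (j + k) z)) <=
    V * (1 + Cb) * exp (2 * PI * eta * INR n) * ((1 + x) * exp (- (g / 3) * x)).
Proof.
  intros He0 He1 He2 HV HCb [Hu Hgap] Hc HnM HMN Hz g x.
  pose proof PI_RGT_0 as HP.
  assert (Hg : 0 < g) by (unfold g; apply Rmult_lt_0_compat; lra).
  assert (HM0 := pos_INR M); assert (Hk0 := IZR_abs_pos k); assert (Hj0 := IZR_abs_pos j).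
  assert (Hn0 := pos_INR n).
  assert (Hx0 : 0 <= x) by (unfold x; lra).
  assert (Hrhs : 0 <= V * (1 + Cb) * exp (2 * PI * eta * INR n) * ((1 + x) * exp (- (g / 3) * x))).
  { repeat apply Rmult_le_pos; try lra; left; apply exp_pos. }
  assert (Hcut : (cut M j - cut M (j + k))%C = RtoC 0 \/
    (Cmod (cut M j - cut M (j + k)) = 1 /\
     (((Z.abs j <= Z.of_nat M)%Z /\ (Z.of_nat M < Z.abs (j + k))%Z) \/
      ((Z.of_nat M < Z.abs j)%Z /\ (Z.abs (j + k) <= Z.of_nat M)%Z)))).
  { unfold cut.
    destruct (Z_le_dec (Z.abs j) (Z.of_nat M)), (Z_le_dec (Z.abs (j + k)) (Z.of_nat M)).
    - left; ring.
    - right; split; [|left; lia].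
      replace (RtoC 1 - RtoC 0)%C with (RtoC 1) by ring; apply Cmod_1.
    - right; split; [|right; lia].
      replace (RtoC 0 - RtoC 1)%C with (- RtoC 1)%C by ring; rewrite Cmod_opp; apply Cmod_1.
    - left; ring. }
  destruct Hcut as [Hcut|[Hs Hcut]].
  { rewrite Hcut, Cmult_0_l, Cmod_0, Rmult_0_r; assumption. }
  rewrite Cmod_mult, Hs, Rmult_1_l, Cmod_mult; clear Hs.
  assert (Hez := Cmod_ez_le (j + k) z eta' Hz).
  set (a := IZR (Z.abs j)) in *; set (b := IZR (Z.abs k)) in *; set (d := IZR (Z.abs (j + k))) in *.
  assert (Hd : d <= a + b) by (unfold d, a, b; rewrite <- plus_IZR; apply IZR_le; lia).
  assert (Hd0 : 0 <= d) by (apply IZR_le; lia).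
  assert (Ha' : a <= d + b) by (unfold d, a, b; rewrite <- plus_IZR; apply IZR_le; lia).
  assert (HnM' : 2 * INR n <= INR M) by (apply le_INR in HnM; rewrite mult_INR in HnM; cbn in HnM; lra).
  (* Each case bounds [|u_j|] by [w exp e]: outside the gap [w = 1 + |j|] and [e = 0], inside it
     [w = Cb] with the localized exponent. What is left is an inequality between exponents. *)
  assert (Hmain : forall w e : R, 0 <= w -> Cmod (u j) <= w * exp e -> w <= (1 + Cb) * (1 + x) ->
     - (2 * PI * h) * b + e + 2 * PI * eta' * d <= 2 * PI * eta * INR n + - (g / 3) * x ->
     Cmod (c k) * (Cmod (u j) * Cmod (ez (j + k) z)) <=
     V * (1 + Cb) * exp (2 * PI * eta * INR n) * ((1 + x) * exp (- (g / 3) * x))).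
  { intros w e Hw Hue Hwx Hexp.
    apply Rle_trans with ((V * exp (- (2 * PI * h) * b)) * ((w * exp e) * exp (2 * PI * eta' * d))).
    - apply Rmult_le_compat; [apply Cmod_ge_0|apply Rmult_le_pos; apply Cmod_ge_0|apply Hc|].
      apply Rmult_le_compat; try apply Cmod_ge_0; assumption.
    - replace ((V * exp (- (2 * PI * h) * b)) * ((w * exp e) * exp (2 * PI * eta' * d)))
        with (V * w * (exp (- (2 * PI * h) * b) * exp e * exp (2 * PI * eta' * d))) by ring.
      replace (V * (1 + Cb) * exp (2 * PI * eta * INR n) * ((1 + x) * exp (- (g / 3) * x)))
        with (V * ((1 + Cb) * (1 + x)) * (exp (2 * PI * eta * INR n) * exp (- (g / 3) * x))) by ring.
      rewrite <- !exp_plus; apply Rmult_le_compat.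
      + now apply Rmult_le_pos.
      + left; apply exp_pos.
      + now apply Rmult_le_compat_l.
      + now apply exp_monotone. }
  assert (Hph : 2 * PI * eta' * d <= 2 * PI * eta' * (a + b)) by (apply Rmult_le_compat_l; nra).
  assert (Hgb : 2 * PI * eta' * b - 2 * PI * h * b <= - g * b)
    by (assert (0 <= 2 * PI * (h - eta) * b) by (apply Rmult_le_pos; nra); unfold g; lra).
  assert (Hen : 0 <= 2 * PI * eta * INR n) by (apply Rmult_le_pos; nra).
  destruct Hcut as [[Hj Hjk]|[Hj Hjk]].
  - apply IZR_lt in Hjk; fold d in Hjk; rewrite <- INR_IZR_INZ in Hjk.
    assert (Hj' : a <= INR M) by (rewrite INR_IZR_INZ; now apply IZR_le).
    destruct (Rle_dec a (INR n)) as [Han|Han].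
    + apply (Hmain (1 + a) 0); [lra|rewrite exp_0; generalize (Hu j); fold a; lra| |].
      * assert (1 + a <= 1 + x) by (unfold x; lra); nra.
      * assert (2 * PI * eta' * a <= 2 * PI * eta * INR n).
        { apply Rmult_le_compat; nra. }
        (* Here [|k| >= M - n >= M / 2], hence [(M + |k|) / 3 <= |k|]; this case dictates the rate
           [g / 3]. *)
        assert (g * ((INR M + b) / 3) <= g * b) by (apply Rmult_le_compat_l; lra).
        unfold x; lra.
    + apply (Hmain Cb (- (2 * PI * eta) * a)); [lra|apply Hgap; fold a; lra| |].
      * nra.
      * assert (2 * PI * eta' * a - 2 * PI * eta * a = - g * a) by (unfold g; ring).
        assert (g * ((INR M + b) / 3) <= g * (a + b)) by (apply Rmult_le_compat_l; lra).
        unfold x; lra.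
  - apply IZR_lt in Hj; fold a in Hj; rewrite <- INR_IZR_INZ in Hj.
    assert (Hjk' : d <= INR M) by (rewrite INR_IZR_INZ; now apply IZR_le).
    destruct (Rlt_dec a N) as [HaN|HaN].
    + apply (Hmain Cb (- (2 * PI * eta) * a)); [lra|apply Hgap; fold a; lra| |].
      * nra.
      * assert (2 * PI * eta' * a - 2 * PI * eta * a = - g * a) by (unfold g; ring).
        assert (g * ((INR M + b) / 3) <= g * (a + b)) by (apply Rmult_le_compat_l; lra).
        unfold x; lra.
    + apply (Hmain (1 + a) 0); [lra|rewrite exp_0; generalize (Hu j); fold a; lra| |].
      * assert (1 + a <= 1 + x) by (unfold x; lra); nra.
      * assert (Hbm : INR M <= b) by lra.
        assert (2 * PI * eta' * d <= 2 * PI * eta' * b) by (apply Rmult_le_compat_l; nra).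
        assert (g * ((INR M + b) / 3) <= g * b) by (apply Rmult_le_compat_l; lra).
        unfold x; lra.
Qed.

(** The squared factor pays for [(1 + x)^2], [x = M + |k|]: one power counts the indices [j], the
    other comes from [crossing_term_le]. Absorbing them lowers the rate from [g / 3] to [g / 6]. *)
Definition section_error_const (lambda V Cb g : R) : R :=
  Rabs lambda * (2 * V * (1 + Cb) * (1 + 12 / g) ^ 2 * geom_const (g / 6)).

(** [X D] is the invariance defect with [vc] replaced by a partial Fourier sum; [Y D] is the dual
    equation cut off at [M], which tends to 0 because [u] solves it exactly. In [X D - Y D] only the
    commutators of [commutator_term] survive, and these are bounded uniformly in [D]. *)
Lemma approximate_section_error (u c : Z -> C) vc n M N eta eta' h V Cb lambda E alpha theta z :
  0 <= eta' -> eta' < eta -> eta <= h -> 0 <= V -> 0 <= Cb ->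
  gap_decay u n N eta Cb ->
  (forall k, Cmod (c k) <= V * exp (- (2 * PI * h) * IZR (Z.abs k))) ->
  (2 * n <= M)%nat -> 2 * INR M <= N -> Rabs (Im z) <= eta' ->
  (forall l, Clim (csym (fun k => RtoC lambda * c k * u (l - k)%Z)%C)
      ((RtoC E - RtoC (2 * cos (2 * PI * (theta + IZR l * alpha)))) * u l)%C) ->
  Clim (csym (fun k => c k * ez k z)%C) (vc z) ->
  let g := 2 * PI * (eta - eta') in
  Cmod (expi theta * trig_poly u M (z + RtoC alpha) + expi (- theta) * trig_poly u M (z - RtoC alpha)
        + (RtoC lambda * vc z - RtoC E) * trig_poly u M z)
  <= section_error_const lambda V Cb g * exp (2 * PI * eta * INR n) * exp (- (g / 6) * INR M).
Proof.
  intros He0 He1 He2 HV HCb Hgap Hc HnM HMN Hz Heq Hvc g.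
  pose proof PI_RGT_0 as HP.
  assert (Hg : 0 < g) by (unfold g; apply Rmult_lt_0_compat; lra).
  set (X := fun D => (expi theta * trig_poly u M (z + RtoC alpha) + expi (- theta) * trig_poly u M (z - RtoC alpha)
        + (RtoC lambda * csym (fun k => c k * ez k z) D - RtoC E) * trig_poly u M z)%C).
  set (Y := fun D => csym (fun m => (csym (fun k => RtoC lambda * c k * u (m - k)%Z) D
      - (RtoC E - RtoC (2 * cos (2 * PI * (theta + IZR m * alpha)))) * u m) * ez m z)%C M).
  assert (HX : Clim X (expi theta * trig_poly u M (z + RtoC alpha) + expi (- theta) * trig_poly u M (z - RtoC alpha)
        + (RtoC lambda * vc z - RtoC E) * trig_poly u M z)%C).
  { apply Clim_plus; [apply Clim_const|]; apply Clim_mult; [|apply Clim_const].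
    apply Clim_minus; [now apply Clim_scal|apply Clim_const]. }
  assert (HY : Clim Y (RtoC 0)).
  { replace (RtoC 0) with (csym (fun m => (((RtoC E - RtoC (2 * cos (2 * PI * (theta + IZR m * alpha)))) * u m)
      - (RtoC E - RtoC (2 * cos (2 * PI * (theta + IZR m * alpha)))) * u m) * ez m z)%C M).
    - apply Clim_csum; intros m; apply Clim_mult; [|apply Clim_const].
      apply Clim_minus; [apply Heq|apply Clim_const].
    - apply csum_0; intros; ring. }
  assert (HXY := Clim_minus _ _ _ _ HX HY).
  match type of HXY with Clim _ (Cminus ?l ?m) => replace (Cminus l m) with l in HXY by ring end.
  apply (Clim_Cmod_le _ _ _ HXY); exists 0%nat; intros D _.
  assert (E1 : (X D - Y D)%C = csym (fun k => RtoC lambda * (c k *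
     csym (fun j => (cut M j - cut M (j + k)) * (u j * ez (j + k) z)) (M + Z.abs_nat k)))%C D).
  { unfold X, Y; rewrite trig_poly_rotate.
    transitivity (csym (fun k => RtoC lambda * (c k * (csym (fun j => u j * ez (j + k) z) M
       - csym (fun m => u (m - k)%Z * ez m z) M)))%C D).
    2:{ apply csum_ext; intros k _; now rewrite commutator_term. }
    transitivity (csum (fun k => RtoC lambda * c k * csym (fun j => u j * ez (j + k) z) M)%C (- Z.of_nat D) (2 * D + 1)
      - csum (fun k => RtoC lambda * c k * csym (fun m => u (m - k)%Z * ez m z) M)%C (- Z.of_nat D) (2 * D + 1))%C.
    2:{ rewrite <- csum_minus; apply csum_ext; intros; ring. }
    assert (F1 : csum (fun k => RtoC lambda * c k * csym (fun j => u j * ez (j + k) z) M)%C (- Z.of_nat D) (2 * D + 1)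
      = (RtoC lambda * csym (fun k => c k * ez k z) D * trig_poly u M z)%C).
    { unfold csym at 2; rewrite <- csum_scal, Cmult_comm, <- csum_scal.
      apply csum_ext; intros k _; unfold trig_poly, csym.
      rewrite (csum_ext (fun j => u j * ez (j + k) z)%C (fun j => ez k z * (u j * ez j z))%C)
        by (intros; rewrite ez_add; ring).
      rewrite csum_scal; ring. }
    assert (F2 : csum (fun k => RtoC lambda * c k * csym (fun m => u (m - k)%Z * ez m z) M)%C (- Z.of_nat D) (2 * D + 1)
      = csym (fun m => csym (fun k => RtoC lambda * c k * u (m - k)%Z) D * ez m z)%C M).
    { unfold csym at 1.
      rewrite (csum_ext _ (fun k => csum (fun m => RtoC lambda * c k * u (m - k)%Z * ez m z)%C (- Z.of_nat M) (2 * M + 1))).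
      2:{ intros k _; rewrite <- csum_scal; apply csum_ext; intros; ring. }
      rewrite csum_swap; apply csum_ext; intros m _.
      rewrite Cmult_comm; unfold csym; rewrite <- csum_scal; apply csum_ext; intros; ring. }
    rewrite F1, F2.
    unfold trig_poly, csym.
    rewrite (csum_ext (fun m => (csum _ _ _ - _) * ez m z)%C (fun m =>
      csum (fun k => RtoC lambda * c k * u (m - k)%Z)%C (- Z.of_nat D) (2 * D + 1) * ez m z
      - RtoC E * (u m * ez m z)
      + RtoC (2 * cos (2 * PI * (theta + IZR m * alpha))) * (u m * ez m z))%C) by (intros; ring).
    rewrite csum_plus, csum_minus, csum_scal; ring. }
  cbv beta; rewrite E1.
  set (Q := 2 * V * (1 + Cb) * exp (2 * PI * eta * INR n) * (1 + 12 / g) ^ 2).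
  assert (HQ : forall k, Cmod (RtoC lambda * (c k * csym (fun j => (cut M j - cut M (j + k)) * (u j * ez (j + k) z))%C (M + Z.abs_nat k)))
    <= Rabs lambda * Q * exp (- (g / 6) * INR M) * exp (- (g / 6) * IZR (Z.abs k))).
  { intros k; rewrite Cmod_mult, Cmod_R.
    set (x := INR M + IZR (Z.abs k)).
    assert (Hx : 0 <= x) by (unfold x; generalize (pos_INR M) (IZR_abs_pos k); lra).
    rewrite !Rmult_assoc; apply Rmult_le_compat_l; [apply Rabs_pos|].
    unfold csym; rewrite <- csum_scal.
    eapply Rle_trans.
    { apply (Cmod_csum_le _ (fun _ => V * (1 + Cb) * exp (2 * PI * eta * INR n) * ((1 + x) * exp (- (g / 3) * x)))).
      intros j _; rewrite Cmod_mult.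
      exact (crossing_term_le u c n M N eta eta' h V Cb z j k He0 He1 He2 HV HCb Hgap Hc HnM HMN Hz). }
    rewrite rsum_const.
    assert (Hcnt : INR (2 * (M + Z.abs_nat k) + 1) <= 2 * (1 + x)).
    { rewrite plus_INR, mult_INR, plus_INR, <- INR_IZR_abs; cbn [INR]; unfold x; lra. }
    assert (Hp := poly_exp_le (g / 6) x ltac:(lra) Hx).
    replace (1 + 2 / (g / 6)) with (1 + 12 / g) in Hp by (field; lra).
    assert (Hp2 : ((1 + x) * exp (- (g / 6) * x)) ^ 2 <= ((1 + 12 / g) * exp (- (g / 6 / 2) * x)) ^ 2).
    { apply pow_incr; split; [|assumption].
      apply Rmult_le_pos; [lra|left; apply exp_pos]. }
    rewrite !Rpow_mult_distr in Hp2.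
    assert (Ex1 : exp (- (g / 6) * x) ^ 2 = exp (- (g / 3) * x)).
    { cbn [pow]; rewrite Rmult_1_r, <- exp_plus; f_equal; field. }
    assert (Ex2 : exp (- (g / 6 / 2) * x) ^ 2 = exp (- (g / 6) * x)).
    { cbn [pow]; rewrite Rmult_1_r, <- exp_plus; f_equal; field. }
    rewrite Ex1, Ex2 in Hp2.
    assert (HF : 0 <= V * (1 + Cb) * exp (2 * PI * eta * INR n)).
    { repeat apply Rmult_le_pos; try lra; left; apply exp_pos. }
    assert (Hx1 : 0 <= (1 + x) * exp (- (g / 3) * x)) by (apply Rmult_le_pos; [lra|left; apply exp_pos]).
    apply Rle_trans with (2 * (1 + x) * (V * (1 + Cb) * exp (2 * PI * eta * INR n) * ((1 + x) * exp (- (g / 3) * x)))).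
    { apply Rmult_le_compat_r; [now apply Rmult_le_pos|assumption]. }
    replace (2 * (1 + x) * (V * (1 + Cb) * exp (2 * PI * eta * INR n) * ((1 + x) * exp (- (g / 3) * x))))
      with (2 * (V * (1 + Cb) * exp (2 * PI * eta * INR n)) * ((1 + x) ^ 2 * exp (- (g / 3) * x))) by ring.
    replace (Q * (exp (- (g / 6) * INR M) * exp (- (g / 6) * IZR (Z.abs k))))
      with (2 * (V * (1 + Cb) * exp (2 * PI * eta * INR n)) * ((1 + 12 / g) ^ 2 * exp (- (g / 6) * x))).
    2:{ replace (- (g / 6) * x) with (- (g / 6) * INR M + - (g / 6) * IZR (Z.abs k)) by (unfold x; ring).
        rewrite exp_plus; unfold Q; ring. }
    apply Rmult_le_compat_l; lra. }
  eapply Rle_trans; [apply Cmod_csum_le; intros k _; apply HQ|].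
  rewrite rsum_scal; fold (rsym (fun k => exp (- (g / 6) * IZR (Z.abs k))) D).
  assert (HQ0 : 0 <= Rabs lambda * Q * exp (- (g / 6) * INR M)).
  { assert (0 < 12 / g) by (apply Rdiv_lt_0_compat; lra).
    unfold Q; repeat apply Rmult_le_pos; try lra; try apply Rabs_pos; left; apply exp_pos. }
  eapply Rle_trans; [apply Rmult_le_compat_l; [exact HQ0|apply rsym_exp_le; lra]|].
  right; unfold section_error_const, Q; ring.
Qed.

(** * Newton interpolation for power series *)

Lemma is_derive_pow_scal n c x : is_derive (fun s => s ^ S n * c) x (x ^ n * ((INR n + 1) * c)).
Proof.
  auto_derive; [auto|].
  replace (match n with O => 1 | S _ => INR n + 1 end) with (INR n + 1) by (destruct n; cbn; ring).
  ring.
Qed.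

Lemma derive_bound_pow (f df : R -> R) n :
  (forall s, is_derive f s (df s)) -> f 0 = 0 ->
  (forall s, Rabs (df s) <= Rabs s ^ n / INR (fact n)) ->
  forall s, Rabs (f s) <= Rabs s ^ S n / INR (fact (S n)).
Proof.
  assert (Hpos : forall (f df : R -> R) s, (forall s, is_derive f s (df s)) -> f 0 = 0 ->
    (forall s, Rabs (df s) <= Rabs s ^ n / INR (fact n)) -> 0 <= s ->
    f s <= s ^ S n / INR (fact (S n))).
  { clear f df; intros f df s Hf H0 Hdf Hs.
    assert (Hfn : 0 < INR (fact n)) by apply INR_fact_lt_0.
    assert (HfS : INR (fact (S n)) = (INR n + 1) * INR (fact n)) by (rewrite fact_simpl, mult_INR, S_INR; ring).
    assert (Hn := pos_INR n).
    set (G := fun x => x ^ S n / INR (fact (S n)) - f x).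
    assert (HG : forall x, is_derive G x (x ^ n / INR (fact n) - df x)).
    { intros x; unfold G; apply (is_derive_minus (V := R_NormedModule)); [|apply Hf].
      replace (x ^ n / INR (fact n)) with (x ^ n * ((INR n + 1) * / INR (fact (S n))))
        by (rewrite HfS; field; lra).
      apply is_derive_pow_scal. }
    destruct (Req_dec s 0) as [->|Hs0].
    { rewrite H0; cbn [pow]; unfold Rdiv; rewrite Rmult_0_l, Rmult_0_l; lra. }
    destruct (MVT_gen G 0 s (fun x => x ^ n / INR (fact n) - df x)) as (c & Hc & Hd).
    - intros x _; apply HG.
    - intros x _; apply continuity_pt_filterlim, (ex_derive_continuous (V := R_NormedModule)).
      exists (x ^ n / INR (fact n) - df x); apply HG.
    - rewrite Rmin_left, Rmax_right in Hc by lra.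
      assert (HG0 : G 0 = 0).
      { unfold G; rewrite H0; cbn [pow]; unfold Rdiv; rewrite !Rmult_0_l; ring. }
      assert (Hdc := Hdf c); rewrite (Rabs_right c) in Hdc by lra.
      apply Rabs_le_between in Hdc.
      assert (0 <= G s - G 0) by (rewrite Hd; apply Rmult_le_pos; lra).
      unfold G at 1 in H; lra. }
  assert (Hpos2 : forall (f df : R -> R) s, (forall s, is_derive f s (df s)) -> f 0 = 0 ->
    (forall s, Rabs (df s) <= Rabs s ^ n / INR (fact n)) -> 0 <= s ->
    Rabs (f s) <= s ^ S n / INR (fact (S n))).
  { clear f df; intros f df s Hf H0 Hdf Hs; apply Rabs_le; split; [|now apply (Hpos f df)].
    assert (H := Hpos (fun x => - f x) (fun x => - df x) s).
    enough (- f s <= s ^ S n / INR (fact (S n))) by lra; apply H; auto.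
    - intros x; apply (is_derive_opp (V := R_NormedModule)), Hf.
    - rewrite H0; ring.
    - intros x; rewrite Rabs_Ropp; apply Hdf. }
  intros Hf H0 Hdf s; destruct (Rle_dec 0 s) as [Hs|Hs].
  - rewrite (Rabs_right s) by lra; now apply (Hpos2 f df).
  - rewrite (Rabs_left s) by lra.
    replace (f s) with (f (- - s)) by (f_equal; ring).
    apply (Hpos2 (fun x => f (- x)) (fun x => - df (- x)) (- s)); [| | |lra].
    + intros x.
      assert (H := is_derive_comp f (fun y => - y) x (df (- x)) (-1) (Hf (- x))).
      replace (- df (- x)) with (scal (V := R_NormedModule) (-1) (df (- x)))
        by (unfold scal; cbn; unfold mult; cbn; ring).
      apply H; auto_derive; [auto|ring].
    + now rewrite Ropp_0.
    + intros x; rewrite Rabs_Ropp, <- (Rabs_Ropp x); apply Hdf.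
Qed.

(** [i^n / n!], the Taylor coefficients of [e^(i s)], from which the power series of [trig_poly]
    along a horizontal line is assembled. *)
Definition cis_coef (i : nat) : C := (Ci ^ i * RtoC (/ INR (fact i)))%C.

Lemma RtoC_pow_C (s : R) n : (RtoC s ^ n)%C = RtoC (s ^ n).
Proof. induction n as [|n IH]; [reflexivity|]; cbn [Cpow pow]; now rewrite IH, RtoC_mult. Qed.

Lemma cis_coef_S n : (RtoC (INR n + 1) * cis_coef (S n))%C = (Ci * cis_coef n)%C.
Proof.
  unfold cis_coef; cbn [Cpow]; rewrite fact_simpl, mult_INR, S_INR.
  assert (Hn : INR n + 1 <> 0) by (generalize (pos_INR n); lra).
  assert (Hf : INR (fact n) <> 0) by apply INR_fact_neq_0.
  replace (/ ((INR n + 1) * INR (fact n))) with (/ (INR n + 1) * / INR (fact n)) by (field; auto).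
  rewrite RtoC_mult.
  transitivity (RtoC ((INR n + 1) * / (INR n + 1)) * (Ci * (Ci ^ n * RtoC (/ INR (fact n)))))%C.
  - rewrite RtoC_mult; ring.
  - rewrite Rinv_r by assumption; ring.
Qed.

Lemma cis_partial_derive N s :
  is_derive (fun s => Re (psum cis_coef (RtoC s) (S N))) s (- Im (psum cis_coef (RtoC s) N)) /\
  is_derive (fun s => Im (psum cis_coef (RtoC s) (S N))) s (Re (psum cis_coef (RtoC s) N)).
Proof.
  assert (HR : forall x c, Re (RtoC x * c) = x * Re c) by (intros x [a b]; cbn; ring).
  assert (HI : forall x c, Im (RtoC x * c) = x * Im c) by (intros x [a b]; cbn; ring).
  induction N as [|N [IH1 IH2]].
  - cbn [psum Cpow]; split.
    + apply (is_derive_ext (fun _ => Re (RtoC 0 + RtoC 1 * cis_coef 0))); [reflexivity|].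
      replace (- Im (RtoC 0)) with 0 by (cbn; ring); apply (is_derive_const (V := R_NormedModule)).
    + apply (is_derive_ext (fun _ => Im (RtoC 0 + RtoC 1 * cis_coef 0))); [reflexivity|].
      replace (Re (RtoC 0)) with 0 by (cbn; ring); apply (is_derive_const (V := R_NormedModule)).
  - assert (HreA : forall a b, Re (a + b)%C = Re a + Re b) by reflexivity.
    assert (HimA : forall a b, Im (a + b)%C = Im a + Im b) by reflexivity.
    assert (Hc := cis_coef_S N).
    assert (Hcr : (INR N + 1) * Re (cis_coef (S N)) = - Im (cis_coef N)).
    { rewrite <- HR, Hc; destruct (cis_coef N); cbn; ring. }
    assert (Hci : (INR N + 1) * Im (cis_coef (S N)) = Re (cis_coef N)).
    { rewrite <- HI, Hc; destruct (cis_coef N); cbn; ring. }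
    split.
    + apply (is_derive_ext (fun s => Re (psum cis_coef (RtoC s) (S N)) + s ^ S N * Re (cis_coef (S N)))).
      { intros t; change (psum cis_coef (RtoC t) (S (S N))) with (psum cis_coef (RtoC t) (S N) + RtoC t ^ S N * cis_coef (S N))%C.
        now rewrite HreA, RtoC_pow_C, HR. }
      replace (- Im (psum cis_coef (RtoC s) (S N))) with
        (- Im (psum cis_coef (RtoC s) N) + s ^ N * ((INR N + 1) * Re (cis_coef (S N)))).
      * apply (is_derive_plus (V := R_NormedModule)); [exact IH1|apply is_derive_pow_scal].
      * cbn [psum]; rewrite HimA, RtoC_pow_C, HI, Hcr; ring.
    + apply (is_derive_ext (fun s => Im (psum cis_coef (RtoC s) (S N)) + s ^ S N * Im (cis_coef (S N)))).
      { intros t; change (psum cis_coef (RtoC t) (S (S N))) with (psum cis_coef (RtoC t) (S N) + RtoC t ^ S N * cis_coef (S N))%C.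
        now rewrite HimA, RtoC_pow_C, HI. }
      replace (Re (psum cis_coef (RtoC s) (S N))) with
        (Re (psum cis_coef (RtoC s) N) + s ^ N * ((INR N + 1) * Im (cis_coef (S N)))).
      * apply (is_derive_plus (V := R_NormedModule)); [exact IH2|apply is_derive_pow_scal].
      * cbn [psum]; rewrite HreA, RtoC_pow_C, HR, Hci; ring.
Qed.

(** Differentiation exchanges the two remainders up to sign and lowers [N], so both are bounded
    together by repeated integration, starting from [|cos| <= 1] and [|sin| <= 1]. *)
Lemma cis_remainder N s :
  Rabs (cos s - Re (psum cis_coef (RtoC s) N)) <= Rabs s ^ N / INR (fact N) /\
  Rabs (sin s - Im (psum cis_coef (RtoC s) N)) <= Rabs s ^ N / INR (fact N).
Proof.
  revert s; induction N as [|N IH]; intros s.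
  - cbn; rewrite !Rminus_0_r; replace (1 / 1) with 1 by field.
    split; apply Rabs_le; [apply COS_bound|apply SIN_bound].
  - assert (H0 : psum cis_coef (RtoC 0) (S N) = RtoC 1).
    { clear; induction N as [|N IH].
      - unfold cis_coef; cbn; rewrite Rinv_1; ring.
      - change (psum cis_coef (RtoC 0) (S (S N))) with (psum cis_coef (RtoC 0) (S N) + RtoC 0 ^ S N * cis_coef (S N))%C.
        rewrite IH; cbn [Cpow]; ring. }
    split.
    + apply (derive_bound_pow (fun s => cos s - Re (psum cis_coef (RtoC s) (S N)))
        (fun s => - (sin s - Im (psum cis_coef (RtoC s) N)))).
      * intros t; replace (- (sin t - Im (psum cis_coef (RtoC t) N))) with
          (- sin t - - Im (psum cis_coef (RtoC t) N)) by ring.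
        apply (is_derive_minus (V := R_NormedModule)); [|apply cis_partial_derive].
        apply is_derive_Reals, derivable_pt_lim_cos.
      * rewrite H0, cos_0; cbn; ring.
      * intros t; rewrite Rabs_Ropp; apply IH.
    + apply (derive_bound_pow (fun s => sin s - Im (psum cis_coef (RtoC s) (S N)))
        (fun s => cos s - Re (psum cis_coef (RtoC s) N))).
      * intros t; apply (is_derive_minus (V := R_NormedModule)); [|apply cis_partial_derive].
        apply is_derive_Reals, derivable_pt_lim_sin.
      * rewrite H0, sin_0; cbn; ring.
      * intros t; apply IH.
Qed.

Lemma cis_series s : Clim (psum cis_coef (RtoC s)) (cos s, sin s).
Proof.
  intros eps He.
  destruct (cv_speed_pow_fact (Rabs s) (eps / 2) ltac:(lra)) as [N HN].
  exists N; intros n Hn; specialize (HN n Hn); unfold Rdist in HN; rewrite Rminus_0_r in HN.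
  assert (H1 := Rle_abs (Rabs s ^ n / INR (fact n))).
  destruct (cis_remainder n s) as [R1 R2].
  replace (psum cis_coef (RtoC s) n - (cos s, sin s))%C with (- ((cos s, sin s) - psum cis_coef (RtoC s) n))%C by ring.
  rewrite Cmod_opp; eapply Rle_lt_trans; [apply Cmod_le_Rabs|].
  destruct (psum cis_coef (RtoC s) n) as [a b]; cbn in *; unfold Rminus in *; lra.
Qed.

Lemma psum_scale a w t n : psum (fun i => w ^ i * a i)%C t n = psum a (t * w)%C n.
Proof.
  induction n as [|n IH]; [reflexivity|]; cbn [psum]; rewrite IH, Cpow_mult_l; ring.
Qed.

Lemma pow_fact_le_exp x n : 0 <= x -> x ^ n / INR (fact n) <= exp x.
Proof.
  intros Hx; eapply Rle_trans; [|apply (exp_ge_taylor x n Hx)].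
  destruct n as [|n]; [cbn; lra|].
  rewrite tech5.
  assert (0 <= sum_f_R0 (fun k => x ^ k / INR (fact k)) n); [|lra].
  apply cond_pos_sum; intros k; apply Rmult_le_pos; [now apply pow_le|].
  left; apply Rinv_0_lt_compat, INR_fact_lt_0.
Qed.

(** Two points with [|t| <= r / 10] are at most [r / 5] apart; multiplied by the bound [2 A / r] of
    a divided difference this gives the gain [2 / 5] per interpolation node. *)
Definition ps_bounded (r A : R) (f : R -> C) : Prop :=
  exists a : nat -> C, (forall i, Cmod (a i) * r ^ i <= A) /\
    forall t, Rabs t <= r / 10 -> Clim (psum a (RtoC t)) (f t).

Lemma Clim_S u l : Clim u l -> Clim (fun n => u (S n)) l.
Proof.
  intros H eps He; destruct (H eps He) as [N HN]; exists N; intros n Hn; apply HN; lia.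
Qed.

Lemma psum_S_left a w n : psum a w (S n) = (a 0%nat + w * psum (fun i => a (S i)) w n)%C.
Proof.
  induction n as [|n IH]; [cbn; ring|].
  change (psum a w (S (S n))) with (psum a w (S n) + w ^ S n * a (S n))%C.
  rewrite IH; cbn [psum Cpow]; ring.
Qed.

Lemma ps_term_le (a : nat -> C) r A t i :
  0 < r -> Cmod (a i) * r ^ i <= A -> Rabs t <= r / 10 ->
  Cmod (RtoC t ^ i * a i) <= A * (/ 2) ^ i.
Proof.
  intros Hr Ha Ht; rewrite Cmod_mult, Cmod_pow, Cmod_R, Rmult_comm.
  apply Rle_trans with (Cmod (a i) * (r ^ i * (/ 2) ^ i)).
  - apply Rmult_le_compat_l; [apply Cmod_ge_0|].
    rewrite <- Rpow_mult_distr; apply pow_incr; split; [apply Rabs_pos|lra].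
  - rewrite <- Rmult_assoc; apply Rmult_le_compat_r; [apply pow_le; lra|assumption].
Qed.

Lemma ps_bounded_le r A f t : 0 < r -> ps_bounded r A f -> Rabs t <= r / 10 -> Cmod (f t) <= 2 * A.
Proof.
  intros Hr (a & Ha & Hf) Ht.
  assert (HA : 0 <= A).
  { eapply Rle_trans; [|apply (Ha 0%nat)]; cbn; generalize (Cmod_ge_0 (a 0%nat)); lra. }
  apply (Clim_Cmod_le _ _ _ (Hf t Ht)); exists 0%nat; intros n _.
  apply (psum_bound (fun i => RtoC t ^ i * a i)%C); auto.
  intros i; now apply (ps_term_le a r).
Qed.

(** The quotient has coefficients [b_i], the sum over [l] of [a_(i+1+l) t1^l]. They satisfy
    [b_i = a_(i+1) + t1 b_(i+1)], which is the division of the series by [t - t1]. *)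
Lemma ps_bounded_divide r A f t1 :
  0 < r -> ps_bounded r A f -> Rabs t1 <= r / 10 ->
  exists g, ps_bounded r (2 * A / r) g /\
    forall t, Rabs t <= r / 10 -> (f t - f t1)%C = (RtoC (t - t1) * g t)%C.
Proof.
  intros Hr (a & Ha & Hf) Ht1.
  assert (HA : 0 <= A).
  { eapply Rle_trans; [|apply (Ha 0%nat)]; cbn; generalize (Cmod_ge_0 (a 0%nat)); lra. }
  assert (Hri : forall i, 0 < r ^ i) by (intros; now apply pow_lt).
  assert (HAi : forall i, 0 <= A / r ^ S i).
  { intros i; apply Rmult_le_pos; [assumption|left; now apply Rinv_0_lt_compat]. }
  assert (Hsh : forall i l, Cmod (RtoC t1 ^ l * a (S i + l)%nat) <= A / r ^ S i * (/ 2) ^ l).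
  { intros i l; apply (ps_term_le (fun l => a (S i + l)%nat) r); [assumption| |assumption].
    apply (Rmult_le_reg_r (r ^ S i)); [apply Hri|].
    replace (A / r ^ S i * r ^ S i) with A by (field; apply Rgt_not_eq, Hri).
    rewrite Rmult_assoc, <- pow_add, Nat.add_comm; apply Ha. }
  destruct (dependent_sequence (fun i b => Clim (psum (fun l => a (S i + l)%nat) (RtoC t1)) b)) as [b Hb].
  { intros i; apply (geometric_Clim_exists (fun l => RtoC t1 ^ l * a (S i + l)%nat)%C _ (A / r ^ S i) (/ 2));
      auto; lra. }
  assert (Hbb : forall i, Cmod (b i) * r ^ i <= 2 * A / r).
  { intros i.
    assert (H : Cmod (b i) <= 2 * (A / r ^ S i)).
    { apply (Clim_Cmod_le _ _ _ (Hb i)); exists 0%nat; intros n _.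
      apply (psum_bound (fun l => RtoC t1 ^ l * a (S i + l)%nat)%C); auto. }
    apply Rle_trans with (2 * (A / r ^ S i) * r ^ i).
    - apply Rmult_le_compat_r; [left; apply Hri|assumption].
    - right; cbn [pow]; field; split; [lra|apply Rgt_not_eq, Hri]. }
  assert (Hrec : forall i, b i = (a (S i) + RtoC t1 * b (S i))%C).
  { intros i; apply (Clim_unique _ _ _ (Clim_S _ _ (Hb i))).
    apply (Clim_ext (fun n => a (S i) + RtoC t1 * psum (fun l => a (S (S i) + l)%nat) (RtoC t1) n)%C).
    - intros n; rewrite psum_S_left, Nat.add_0_r; do 2 f_equal.
      clear; induction n as [|n IH]; [reflexivity|]; cbn [psum]; rewrite IH.
      now replace (S i + S n)%nat with (S (S i) + n)%nat by lia.
    - apply Clim_plus; [apply Clim_const|apply Clim_scal, Hb]. }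
  assert (Hf1 : f t1 = (a 0%nat + RtoC t1 * b 0%nat)%C).
  { apply (Clim_unique _ _ _ (Clim_S _ _ (Hf t1 Ht1))).
    apply (Clim_ext (fun n => a 0%nat + RtoC t1 * psum (fun l => a (1 + l)%nat) (RtoC t1) n)%C).
    - intros n; now rewrite psum_S_left.
    - apply Clim_plus; [apply Clim_const|apply Clim_scal, Hb]. }
  assert (HAr : 0 <= 2 * A / r).
  { apply Rmult_le_pos; [lra|left; now apply Rinv_0_lt_compat]. }
  assert (Hg : forall t, exists l, Rabs t <= r / 10 -> Clim (psum b (RtoC t)) l).
  { intros t; destruct (Rle_dec (Rabs t) (r / 10)) as [Ht|Ht]; [|exists (RtoC 0); tauto].
    destruct (geometric_Clim_exists (fun i => RtoC t ^ i * b i)%C (psum b (RtoC t)) (2 * A / r) (/ 2)) as [l Hl];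
      [lra|reflexivity|reflexivity| |now exists l].
    intros i; now apply (ps_term_le b r). }
  exists (fun t => proj1_sig (constructive_indefinite_description _ (Hg t))); split.
  - exists b; split; [assumption|]; intros t Ht.
    destruct (constructive_indefinite_description _ (Hg t)) as [l Hl]; auto.
  - intros t Ht; destruct (constructive_indefinite_description _ (Hg t)) as [l Hl]; cbn.
    specialize (Hl Ht).
    (* The partial sums telescope up to [t1] times the last term of the series of [g], which tends
       to 0. *)
    assert (Htel : forall n, (RtoC (t - t1) * psum b (RtoC t) n)%C =
      (psum a (RtoC t) (S n) - f t1 + RtoC t1 * (psum b (RtoC t) (S n) - psum b (RtoC t) n))%C).
    { intros n; induction n as [|n IH].
      - rewrite Hf1; cbn; ring.
      - change (psum b (RtoC t) (S n)) with (psum b (RtoC t) n + RtoC t ^ n * b n)%C at 1.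
        rewrite Cmult_plus_distr_l, IH.
        change (psum a (RtoC t) (S (S n))) with (psum a (RtoC t) (S n) + RtoC t ^ S n * a (S n))%C.
        change (psum b (RtoC t) (S (S n))) with (psum b (RtoC t) (S n) + RtoC t ^ S n * b (S n))%C.
        change (psum b (RtoC t) (S n)) with (psum b (RtoC t) n + RtoC t ^ n * b n)%C.
        rewrite (Hrec n), RtoC_minus; cbn [Cpow]; ring. }
    apply (Clim_unique (fun n => psum a (RtoC t) (S n) - f t1
      + RtoC t1 * (psum b (RtoC t) (S n) - psum b (RtoC t) n))%C).
    + replace (f t - f t1)%C with (f t - f t1 + RtoC t1 * (l - l))%C by ring.
      apply Clim_plus.
      * apply Clim_minus; [apply Clim_S, Hf, Ht|apply Clim_const].
      * apply Clim_scal, Clim_minus; [now apply Clim_S|assumption].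
    + apply (Clim_ext (fun n => RtoC (t - t1) * psum b (RtoC t) n)%C); [exact Htel|].
      now apply Clim_scal.
Qed.

(* Newton's divided differences: each node costs a factor [2 / d] on the data
   and gains a factor [2 / 5] on the remainder, whatever the spacing [d]. *)
Lemma newton_interpolation_bound r d J :
  0 < r <= 5 -> 0 < d <= 1 -> forall f A s (t : nat -> R),
  ps_bounded r A f ->
  (forall i, (i < J)%nat -> Rabs (t i) <= r / 10 /\ Cmod (f (t i)) <= s) ->
  (forall i j, (i < j < J)%nat -> d <= Rabs (t j - t i)) -> 0 <= s ->
  forall x, Rabs x <= r / 10 -> Cmod (f x) <= INR J * (2 / d) ^ J * s + 2 * A * (2 / 5) ^ J.
Proof.
  intros Hr Hd; induction J as [|J IH]; intros f A s t Hf Ht Hsep Hs x Hx.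
  - cbn [pow INR]; rewrite Rmult_0_l, Rmult_0_l, Rplus_0_l, Rmult_1_r.
    apply (ps_bounded_le r A f x); auto; lra.
  - destruct (Ht 0%nat ltac:(lia)) as [Ht0 Hf0].
    destruct (ps_bounded_divide r A f (t 0%nat) ltac:(lra) Hf Ht0) as (g & Hg & Hfg).
    assert (Hg' := IH g (2 * A / r) (2 * s / d) (fun i => t (S i)) Hg).
    assert (H2d : 2 <= 2 / d).
    { apply (Rmult_le_reg_r d); [lra|]; unfold Rdiv; rewrite Rmult_assoc, Rinv_l; lra. }
    assert (Hsd : 0 <= 2 * s / d).
    { apply Rmult_le_pos; [lra|left; apply Rinv_0_lt_compat; lra]. }
    assert (Hgx : Cmod (g x) <= INR J * (2 / d) ^ J * (2 * s / d) + 2 * (2 * A / r) * (2 / 5) ^ J).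
    { apply Hg'; auto.
      - intros i Hi; destruct (Ht (S i) ltac:(lia)) as [Hti Hfi]; split; [assumption|].
        assert (E := Hfg (t (S i)) Hti); apply (f_equal Cmod) in E.
        rewrite Cmod_mult, Cmod_R in E.
        assert (Hsi := Hsep 0%nat (S i) ltac:(lia)).
        assert (Hnum : Cmod (f (t (S i)) - f (t 0%nat)) <= 2 * s).
        { unfold Cminus; eapply Rle_trans; [apply Cmod_triangle|]; rewrite Cmod_opp; lra. }
        apply (Rmult_le_reg_r d); [lra|].
        replace (2 * s / d * d) with (2 * s) by (field; lra).
        generalize (Cmod_ge_0 (g (t (S i)))); nra.
      - intros i j Hij; apply Hsep; lia. }
    replace (f x) with (f (t 0%nat) + (f x - f (t 0%nat)))%C by ring.
    rewrite (Hfg x Hx); eapply Rle_trans; [apply Cmod_triangle|].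
    rewrite Cmod_mult, Cmod_R.
    assert (Hxt : Rabs (x - t 0%nat) <= r / 5).
    { unfold Rminus; eapply Rle_trans; [apply Rabs_triang|]; rewrite Rabs_Ropp; lra. }
    assert (Hpd : 1 <= (2 / d) ^ S J) by (apply pow_R1_Rle; lra).
    assert (HX1 : 0 <= INR J * (2 / d) ^ J * (2 * s / d)).
    { apply Rmult_le_pos; [apply Rmult_le_pos; [apply pos_INR|apply pow_le; lra]|assumption]. }
    assert (HA : 0 <= A).
    { destruct Hf as (a & Ha & _); eapply Rle_trans; [|apply (Ha 0%nat)]; cbn.
      generalize (Cmod_ge_0 (a 0%nat)); lra. }
    apply Rle_trans with (s + r / 5 * (INR J * (2 / d) ^ J * (2 * s / d) + 2 * (2 * A / r) * (2 / 5) ^ J)).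
    + apply Rplus_le_compat; [assumption|].
      apply Rmult_le_compat; [apply Rabs_pos|apply Cmod_ge_0|assumption|assumption].
    + rewrite Rmult_plus_distr_l.
      replace (r / 5 * (2 * (2 * A / r) * (2 / 5) ^ J)) with (2 * A * (2 / 5) ^ S J) by (cbn [pow]; field; lra).
      assert (r / 5 * (INR J * (2 / d) ^ J * (2 * s / d)) <= INR J * (2 / d) ^ S J * s).
      { replace (INR J * (2 / d) ^ S J * s) with (1 * (INR J * (2 / d) ^ J * (2 * s / d))) by (cbn [pow]; field; lra).
        apply Rmult_le_compat_r; lra. }
      rewrite S_INR; nra.
Qed.

(** * Bounds for the truncated polynomial on the strip and as a power series *)

Lemma gap_weighted_le u n M N eta eta' Cb m :
  0 <= eta' -> eta' < eta -> 0 <= Cb -> gap_decay u n N eta Cb -> INR M < N ->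
  (Z.abs m <= Z.of_nat M)%Z ->
  let g := 2 * PI * (eta - eta') in
  Cmod (u m) * exp ((2 * PI * eta - g / 2) * IZR (Z.abs m)) <=
    (1 + Cb) * (1 + INR n) * exp (2 * PI * eta * INR n) * exp (- (g / 2) * IZR (Z.abs m)).
Proof.
  intros He0 He1 HCb [Hu Hgap] HMN Hm g; pose proof PI_RGT_0 as HP.
  assert (Hg : 0 < g) by (unfold g; apply Rmult_lt_0_compat; lra).
  assert (Hm0 := IZR_abs_pos m); assert (Hn0 := pos_INR n).
  apply IZR_le in Hm; rewrite <- INR_IZR_INZ in Hm.
  set (x := IZR (Z.abs m)) in *.
  assert (Hp : 0 <= 2 * PI * eta) by nra.
  replace ((2 * PI * eta - g / 2) * x) with (2 * PI * eta * x + - (g / 2) * x) by ring.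
  rewrite exp_plus, <- Rmult_assoc; apply Rmult_le_compat_r; [left; apply exp_pos|].
  assert (He : 1 <= exp (2 * PI * eta * INR n)).
  { rewrite <- exp_0; apply exp_monotone; nra. }
  destruct (Rle_dec x (INR n)) as [Hxn|Hxn].
  - apply Rmult_le_compat; [apply Cmod_ge_0|left; apply exp_pos| |].
    + eapply Rle_trans; [apply Hu|]; fold x; nra.
    + apply exp_monotone; nra.
  - apply Rle_trans with (Cb * exp (- (2 * PI * eta) * x) * exp (2 * PI * eta * x)).
    + apply Rmult_le_compat_r; [left; apply exp_pos|]; apply Hgap; fold x; lra.
    + rewrite Rmult_assoc, <- exp_plus.
      replace (- (2 * PI * eta) * x + 2 * PI * eta * x) with 0 by ring; rewrite exp_0, Rmult_1_r.
      assert (Cb <= (1 + Cb) * (1 + INR n)) by nra.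
      assert (0 <= (1 + Cb) * (1 + INR n)) by nra; nra.
Qed.

(** The factor [exp (2 pi eta n)] is the price of the coefficients with [|k| <= n], for which only
    the linear bound is available. *)
Definition section_bound (n : nat) (eta Cb g : R) : R :=
  (1 + Cb) * (1 + INR n) * exp (2 * PI * eta * INR n) * geom_const (g / 2).

(** The exponent [2 pi eta - g / 2] is [2 pi] times the midpoint of [eta'] and [eta]. Half of the
    gap makes the sum converge; the other half remains as radius for the power series at points of
    the smaller strip. *)
Lemma trig_poly_weighted_sum u n M N eta eta' Cb :
  0 <= eta' -> eta' < eta -> 0 <= Cb -> gap_decay u n N eta Cb -> INR M < N ->
  let g := 2 * PI * (eta - eta') in
  rsym (fun m => Cmod (u m) * exp ((2 * PI * eta - g / 2) * IZR (Z.abs m))) M <= section_bound n eta Cb g.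
Proof.
  intros He0 He1 HCb Hgap HMN g; pose proof PI_RGT_0 as HP.
  assert (Hg : 0 < g) by (unfold g; apply Rmult_lt_0_compat; lra).
  eapply Rle_trans.
  { apply rsum_le; intros m Hm.
    apply (gap_weighted_le u n M N eta eta' Cb m He0 He1 HCb Hgap HMN); lia. }
  rewrite rsum_scal; unfold section_bound; fold g.
  apply Rmult_le_compat_l; [|apply rsym_exp_le; lra].
  repeat apply Rmult_le_pos; try lra; [generalize (pos_INR n); lra|left; apply exp_pos].
Qed.

Lemma trig_poly_bound u n M N eta eta' Cb z :
  0 <= eta' -> eta' < eta -> 0 <= Cb -> gap_decay u n N eta Cb -> INR M < N -> Rabs (Im z) <= eta' ->
  Cmod (trig_poly u M z) <= section_bound n eta Cb (2 * PI * (eta - eta')).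
Proof.
  intros He0 He1 HCb Hgap HMN Hz; pose proof PI_RGT_0 as HP.
  eapply Rle_trans; [|apply (trig_poly_weighted_sum u n M N eta eta' Cb He0 He1 HCb Hgap HMN)].
  apply Cmod_csum_le; intros m _; rewrite Cmod_mult; apply Rmult_le_compat_l; [apply Cmod_ge_0|].
  eapply Rle_trans; [apply (Cmod_ez_le m z eta' Hz)|]; apply exp_monotone.
  apply Rmult_le_compat_r; [apply IZR_abs_pos|].
  assert (0 <= PI * (eta - eta')) by (apply Rmult_le_pos; lra); lra.
Qed.

Lemma psum_csum (q : Z -> C) (e : Z -> nat -> C) w a m n :
  psum (fun i => csum (fun k => q k * e k i)%C a m) w n = csum (fun k => q k * psum (e k) w n)%C a m.
Proof.
  induction n as [|n IH]; cbn [psum].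
  - symmetry; apply csum_0; intros; ring.
  - rewrite IH, <- csum_scal, <- csum_plus; apply csum_ext; intros; ring.
Qed.

(** The [i]-th coefficient of each frequency [m] is controlled by
    [(2 pi |m| r)^i / i! <= exp (2 pi |m| r)]. With [r = (eta - eta') / 2] this exponential uses
    exactly the room up to the midpoint strip. *)
Lemma trig_poly_ps_bounded u n M N eta eta' Cb z :
  0 <= eta' -> eta' < eta -> 0 <= Cb -> gap_decay u n N eta Cb -> INR M < N -> Rabs (Im z) <= eta' ->
  ps_bounded ((eta - eta') / 2) (section_bound n eta Cb (2 * PI * (eta - eta')))
    (fun t => trig_poly u M (z + RtoC t)%C).
Proof.
  intros He0 He1 HCb Hgap HMN Hz; pose proof PI_RGT_0 as HP.
  set (w := fun m : Z => RtoC (2 * PI * IZR m)).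
  exists (fun i => csym (fun m => (u m * ez m z) * (w m ^ i * cis_coef i))%C M); split.
  - intros i; set (r := (eta - eta') / 2).
    assert (Hr : 0 < r) by (unfold r; lra).
    eapply Rle_trans; [|apply (trig_poly_weighted_sum u n M N eta eta' Cb He0 He1 HCb Hgap HMN)].
    rewrite Rmult_comm.
    eapply Rle_trans; [apply Rmult_le_compat_l; [apply pow_le; lra|apply Cmod_csum]|].
    rewrite <- rsum_scal; apply rsum_le; intros m _.
    rewrite !Cmod_mult, Cmod_pow; unfold w, cis_coef; rewrite Cmod_R, Cmod_mult, Cmod_pow, Cmod_Ci, pow1, Cmod_R.
    assert (Hm0 := IZR_abs_pos m); set (x := IZR (Z.abs m)) in *.
    assert (Habs : Rabs (2 * PI * IZR m) = 2 * PI * x).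
    { rewrite !Rabs_mult, (Rabs_right 2), (Rabs_right PI) by lra; unfold x; now rewrite abs_IZR. }
    rewrite Habs, (Rabs_right (/ INR (fact i))) by (left; apply Rinv_0_lt_compat, INR_fact_lt_0).
    replace (r ^ i * (Cmod (u m) * Cmod (ez m z) * ((2 * PI * x) ^ i * (1 * / INR (fact i)))))
      with (Cmod (u m) * (Cmod (ez m z) * ((2 * PI * x * r) ^ i / INR (fact i))))
      by (rewrite (Rpow_mult_distr (2 * PI * x) r); unfold Rdiv; ring).
    apply Rmult_le_compat_l; [apply Cmod_ge_0|].
    replace ((2 * PI * eta - 2 * PI * (eta - eta') / 2) * x) with (2 * PI * eta' * x + 2 * PI * x * r)
      by (unfold r; field).
    rewrite exp_plus.
    assert (Hxr : 0 <= 2 * PI * x * r) by (apply Rmult_le_pos; [apply Rmult_le_pos; lra|lra]).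
    apply Rmult_le_compat; [apply Cmod_ge_0| |apply (Cmod_ez_le m z eta' Hz)|now apply pow_fact_le_exp].
    apply Rmult_le_pos; [now apply pow_le|left; apply Rinv_0_lt_compat, INR_fact_lt_0].
  - intros t _.
    apply (Clim_ext (fun k => csum (fun m => (u m * ez m z) * psum (fun i => w m ^ i * cis_coef i) (RtoC t) k)%C
      (- Z.of_nat M) (2 * M + 1))).
    + intros k; unfold csym; now rewrite psum_csum.
    + apply (Clim_csum (fun k m => (u m * ez m z) * psum (fun i => w m ^ i * cis_coef i) (RtoC t) k)%C
        (fun m => u m * ez m (z + RtoC t)%C)%C); intros m.
      rewrite ez_plus, Cmult_assoc; apply Clim_scal.
      apply (Clim_ext (psum cis_coef (RtoC (2 * PI * (IZR m * t))))).
      * intros k; rewrite psum_scale; f_equal; unfold w; rewrite <- RtoC_mult; f_equal; ring.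
      * rewrite ez_real; apply cis_series.
Qed.

(** * Lower bound for the approximate section *)

Lemma trig_poly_period u M z l : trig_poly u M (z + RtoC (IZR l))%C = trig_poly u M z.
Proof.
  apply csum_ext; intros k _; rewrite ez_plus, ez_real, <- mult_IZR, expi_Z; ring.
Qed.

(* Orbit averages of [trig_poly u M] tend to its constant term. *)
Lemma trig_poly_not_small u M alpha z :
  irrational alpha -> u 0%Z = RtoC 1 ->
  ~ (forall m : nat, Cmod (trig_poly u M (z + RtoC (INR m * alpha)))%C <= / 2).
Proof.
  intros Ha Hu0 Hsmall.
  set (q := fun k => if Z.eq_dec k 0 then RtoC 0 else (u k * ez k z)%C).
  set (b := rsum (fun k => Cmod (q k)%C * (2 / Cmod (expi (IZR k * alpha) - 1)%C)) (- Z.of_nat M) (2 * M + 1)).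
  assert (E : forall m : Z, trig_poly u M (z + RtoC (IZR m * alpha))%C =
    (RtoC 1 + csum (fun k => q k * expi (IZR m * (IZR k * alpha)))%C (- Z.of_nat M) (2 * M + 1))%C).
  { intros m.
    replace (RtoC 1) with (csum (fun k => if Z.eq_dec k 0 then RtoC 1 else RtoC 0) (- Z.of_nat M) (2 * M + 1)).
    2:{ rewrite (csum_single _ _ _ 0%Z); [reflexivity|lia|].
        intros j _ Hj; destruct (Z.eq_dec j 0); tauto. }
    rewrite <- csum_plus; apply csum_ext; intros k _; unfold q.
    destruct (Z.eq_dec k 0) as [->|Hk].
    - rewrite Hu0, ez_0; ring.
    - rewrite ez_plus, ez_real.
      replace (IZR m * (IZR k * alpha)) with (IZR k * (IZR m * alpha)) by ring; ring. }
  destruct (INR_unbounded (2 * b)) as [Q HQ].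
  assert (Hsum : csum (fun m => trig_poly u M (z + RtoC (IZR m * alpha))%C) 0 Q =
    (RtoC (INR Q) + csum (fun m => csum (fun k => q k * expi (IZR m * (IZR k * alpha)))%C (- Z.of_nat M) (2 * M + 1)) 0 Q)%C).
  { rewrite (csum_ext _ _ _ _ (fun m _ => E m)), csum_plus; f_equal.
    rewrite (csum_RtoC (fun _ => 1)), rsum_const; f_equal; ring. }
  assert (H1 : Cmod (csum (fun m => trig_poly u M (z + RtoC (IZR m * alpha))%C) 0 Q)%C <= INR Q * / 2).
  { rewrite <- (rsum_const (/ 2) 0 Q); apply Cmod_csum_le; intros k Hk.
    rewrite <- (Z2Nat.id k), <- INR_IZR_INZ by lia; apply Hsmall. }
  assert (H2 : Cmod (csum (fun m => csum (fun k => q k * expi (IZR m * (IZR k * alpha)))%C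
      (- Z.of_nat M) (2 * M + 1)) 0 Q)%C <= b).
  { apply csum_trig_bounded; intros k Hk; unfold q in Hk.
    destruct (Z.eq_dec k 0); [tauto|now apply irrational_expi]. }
  assert (H3 : INR Q <= INR Q * / 2 + b).
  { rewrite <- (Rabs_right (INR Q)) at 1 by (apply Rle_ge, pos_INR); rewrite <- Cmod_R.
    match type of Hsum with ?a = (_ + ?c)%C => replace (RtoC (INR Q)) with (a + - c)%C by (rewrite Hsum; ring) end.
    eapply Rle_trans; [apply Cmod_triangle|]; rewrite Cmod_opp; lra. }
  lra.
Qed.

(** The small defect is read as a two-step recursion for [|W|]: each step multiplies by at most
    [L + 1] and adds [tau]. *)
Lemma section_orbit_growth (W : C -> C) (pot : C -> C) alpha theta eta' L tau :
  0 <= L -> 0 <= tau ->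
  (forall z, Rabs (Im z) <= eta' -> Cmod (pot z)%C <= L) ->
  (forall z, Rabs (Im z) <= eta' ->
     Cmod (expi theta * W (z + RtoC alpha) + expi (- theta) * W (z - RtoC alpha) + pot z * W z)%C <= tau) ->
  forall (j : nat) z, Rabs (Im z) <= eta' ->
    Cmod (W (z + RtoC (INR j * alpha)))%C + Cmod (W (z + RtoC (INR j * alpha) - RtoC alpha))%C
    <= (L + 1) ^ j * (Cmod (W z)%C + Cmod (W (z - RtoC alpha))%C + INR j * tau).
Proof.
  intros HL Htau Hpot Herr j z Hz.
  assert (HIm : forall x, Im (z + RtoC x)%C = Im z) by (intros x; destruct z; cbn; ring).
  induction j as [|j IH].
  - replace (z + RtoC (INR 0 * alpha))%C with z by (cbn; rewrite Rmult_0_l; ring).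
    cbn; lra.
  - set (z' := (z + RtoC (INR j * alpha))%C) in *.
    assert (Hz' : Rabs (Im z') <= eta') by (unfold z'; now rewrite HIm).
    replace (z + RtoC (INR (S j) * alpha))%C with (z' + RtoC alpha)%C
      by (unfold z'; rewrite S_INR, Rmult_plus_distr_r, Rmult_1_l, RtoC_plus; ring).
    replace (z' + RtoC alpha - RtoC alpha)%C with z' by ring.
    specialize (Hpot z' Hz'); specialize (Herr z' Hz').
    assert (Hnext : Cmod (W (z' + RtoC alpha))%C <= tau + Cmod (W (z' - RtoC alpha))%C + L * Cmod (W z')%C).
    { rewrite <- (Rmult_1_l (Cmod (W (z' + RtoC alpha)%C)%C)), <- (Cmod_expi theta), <- Cmod_mult.
      replace (expi theta * W (z' + RtoC alpha))%C with
        ((expi theta * W (z' + RtoC alpha) + expi (- theta) * W (z' - RtoC alpha) + pot z' * W z')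
         + - (expi (- theta) * W (z' - RtoC alpha)) + - (pot z' * W z'))%C by ring.
      eapply Rle_trans; [apply Cmod_triangle|]; rewrite Cmod_opp, (Cmod_mult (pot z')).
      apply Rplus_le_compat; [|apply Rmult_le_compat_r; [apply Cmod_ge_0|assumption]].
      eapply Rle_trans; [apply Cmod_triangle|]; rewrite Cmod_opp, Cmod_mult, Cmod_expi; lra. }
    set (F := Cmod (W z)%C + Cmod (W (z - RtoC alpha)%C)%C) in *.
    assert (Hp : 1 <= (L + 1) ^ S j) by (apply pow_R1_Rle; lra).
    generalize (Cmod_ge_0 (W z')) (Cmod_ge_0 (W (z' - RtoC alpha)%C)); intros G1 G2.
    apply Rle_trans with ((L + 1) * (Cmod (W z')%C + Cmod (W (z' - RtoC alpha)%C)%C) + tau); [nra|].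
    apply Rle_trans with ((L + 1) * ((L + 1) ^ j * (F + INR j * tau)) + tau).
    + apply Rplus_le_compat_r, Rmult_le_compat_l; [lra|assumption].
    + rewrite S_INR; cbn [pow] in *; nra.
Qed.

(** The long numerical hypothesis is the bound the argument yields for [|W|] at an arbitrary orbit
    point: [(L + 1)^T] transports smallness to the nodes, Newton interpolation gives [X] on an
    interval, [2 X] serves the two summands of [F], and [(L + 1)^J0] spreads it over the line. Being
    at most 1/2, it contradicts [trig_poly_not_small]. *)
Lemma section_lower_bound u n M N eta eta' Cb alpha theta (pot : C -> C) L tau sigma (J0 J K : nat) :
  irrational alpha -> u 0%Z = RtoC 1 ->
  0 <= eta' -> eta' < eta -> eta - eta' <= 10 -> 0 <= Cb -> gap_decay u n N eta Cb -> INR M < N ->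
  0 <= L -> 0 <= tau -> 0 <= sigma ->
  (forall z, Rabs (Im z) <= eta' -> Cmod (pot z)%C <= L) ->
  (forall z, Rabs (Im z) <= eta' ->
     Cmod (expi theta * trig_poly u M (z + RtoC alpha) + expi (- theta) * trig_poly u M (z - RtoC alpha)
           + pot z * trig_poly u M z)%C <= tau) ->
  (forall x, exists (j : nat) (l : Z), (j <= J0)%nat /\
     0 <= x + INR j * alpha - IZR l <= (eta - eta') / 20) ->
  (1 <= K)%nat -> badly_approximated alpha K -> ((J0 + 1) * J <= K)%nat ->
  (L + 1) ^ J0 * (2 * (INR J * (8 * INR K) ^ J *
        ((L + 1) ^ ((J0 + 1) * J) * (sigma + INR ((J0 + 1) * J) * tau))
      + 2 * section_bound n eta Cb (2 * PI * (eta - eta')) * (2 / 5) ^ J) + INR J0 * tau) <= / 2 ->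
  forall z, Rabs (Im z) <= eta' ->
    sigma <= Cmod (trig_poly u M z)%C + Cmod (trig_poly u M (z - RtoC alpha))%C.
Proof.
  intros Ha Hu0 He0 He1 He10 HCb Hgap HMN HL Htau Hsig Hpot Herr Hdens HK HbK HJK Hsmall z Hz.
  set (W := trig_poly u M) in *.
  set (A := section_bound n eta Cb (2 * PI * (eta - eta'))) in *.
  apply Rnot_lt_le; intros Hlt.
  set (F := fun z => Cmod (W z)%C + Cmod (W (z - RtoC alpha)%C)%C).
  assert (Horb : forall (j : nat) z, Rabs (Im z) <= eta' ->
    F (z + RtoC (INR j * alpha))%C <= (L + 1) ^ j * (F z + INR j * tau))
    by exact (section_orbit_growth W pot alpha theta eta' L tau HL Htau Hpot Herr).
  set (r := (eta - eta') / 2).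
  set (T := ((J0 + 1) * J)%nat) in *.
  set (s := (L + 1) ^ T * (sigma + INR T * tau)) in *.
  assert (HKp : 1 <= INR K) by now apply (le_INR 1).
  set (zi := (Ci * RtoC (Im z))%C).
  assert (Hzi : forall x, Im (zi + RtoC x)%C = Im z) by (intros x; unfold zi; cbn; ring).
  assert (Hzi0 : Im zi = Im z) by (unfold zi; cbn; ring).
  (* One visit to the interval is chosen in each block of [J0 + 1] iterates. The times [js i] then
     increase strictly and stay at most [T <= K], so two nodes differ by [m alpha] modulo 1 with
     [0 < |m| <= K]. *)
  destruct (dependent_sequence (fun i (jl : nat * Z) => (fst jl <= J0)%nat /\
    0 <= Re z + INR (i * (J0 + 1)) * alpha + INR (fst jl) * alpha - IZR (snd jl) <= (eta - eta') / 20)) as [jl Hjl].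
  { intros i; destruct (Hdens (Re z + INR (i * (J0 + 1)) * alpha)) as (j & l & H1 & H2).
    exists (j, l); split; assumption. }
  set (js := fun i => (i * (J0 + 1) + fst (jl i))%nat).
  set (t := fun i => Re z + INR (js i) * alpha - IZR (snd (jl i))).
  assert (Ht : forall i, 0 <= t i <= r / 10).
  { intros i; destruct (Hjl i) as [_ H]; unfold t, js, r; rewrite plus_INR.
    rewrite Rmult_plus_distr_r; lra. }
  assert (Hjs : forall i, (i < J)%nat -> (js i <= T)%nat).
  { intros i Hi; destruct (Hjl i) as [H _]; unfold js, T; nia. }
  assert (Hjs2 : forall i j, (i < j)%nat -> (js i < js j)%nat).
  { intros i j Hij; destruct (Hjl i) as [H _]; unfold js; nia. }
  assert (Hval : forall i x, W (z + RtoC (INR (js i) * alpha) + RtoC x)%C = W (zi + RtoC x + RtoC (t i))%C).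
  { intros i x; unfold W; rewrite <- (trig_poly_period u M (zi + RtoC x + RtoC (t i)) (snd (jl i))); f_equal.
    unfold t, zi; destruct z as [a b]; unfold Cplus, Cmult, RtoC, Ci, Re, Im; cbn [fst snd]; f_equal; ring. }
  assert (HFs : forall i, (i < J)%nat -> F (z + RtoC (INR (js i) * alpha))%C <= s).
  { intros i Hi; eapply Rle_trans; [now apply Horb|]; unfold s.
    specialize (Hjs i Hi).
    assert (Hji := le_INR _ _ Hjs).
    assert (0 <= F z) by (unfold F; generalize (Cmod_ge_0 (W z)) (Cmod_ge_0 (W (z - RtoC alpha)%C)); lra).
    assert (0 <= INR (js i)) by apply pos_INR.
    apply Rmult_le_compat; [apply pow_le; lra|nra|apply Rle_pow; [lra|assumption]|].
    apply Rplus_le_compat; [unfold F; lra|now apply Rmult_le_compat_r]. }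
  set (X := INR J * (8 * INR K) ^ J * s + 2 * A * (2 / 5) ^ J).
  assert (Hs0 : 0 <= s).
  { unfold s; apply Rmult_le_pos; [apply pow_le; lra|].
    generalize (pos_INR T); nra. }
  (* [w] moves the base point: [w = 0] handles [W] and [w = - alpha] its translate, with the same
     nodes. *)
  assert (Hnewton : forall w : R, (forall i, (i < J)%nat -> Cmod (W (zi + RtoC w + RtoC (t i)))%C <= s) ->
    forall x, 0 <= x <= r / 10 -> Cmod (W (zi + RtoC w + RtoC x))%C <= X).
  { intros w Hw x Hx.
    replace X with (INR J * (2 / (/ (4 * INR K))) ^ J * s + 2 * A * (2 / 5) ^ J)
      by (unfold X; replace (2 / (/ (4 * INR K))) with (8 * INR K) by (field; lra); reflexivity).
    apply (newton_interpolation_bound r (/ (4 * INR K)) J) with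
      (f := fun x => W (zi + RtoC w + RtoC x)%C) (t := t); auto.
    - unfold r; lra.
    - split; [apply Rinv_0_lt_compat; lra|].
      rewrite <- Rinv_1; apply Rinv_le_contravar; lra.
    - apply (trig_poly_ps_bounded u n M N eta eta' Cb (zi + RtoC w)%C He0 He1 HCb Hgap HMN).
      now rewrite Hzi.
    - intros i Hi; split; [|now apply Hw].
      specialize (Ht i); rewrite Rabs_right; lra.
    - intros i j Hij.
      replace (t j - t i) with (IZR (Z.of_nat (js j) - Z.of_nat (js i)) * alpha - IZR (snd (jl j) - snd (jl i)))
        by (unfold t; rewrite !minus_IZR, !INR_IZR_INZ; ring).
      apply HbK; generalize (Hjs2 i j ltac:(lia)) (Hjs j ltac:(lia)); unfold T in *; lia.
    - rewrite Rabs_right; lra. }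
  assert (HFX : forall x, 0 <= x <= r / 10 -> F (zi + RtoC x)%C <= 2 * X).
  { intros x Hx; unfold F.
    assert (Hz0 : forall y, (zi + RtoC 0 + RtoC y)%C = (zi + RtoC y)%C) by (intros; ring).
    assert (N1 := Hnewton 0); assert (N2 := Hnewton (- alpha)).
    assert (Hm : forall y, (zi + RtoC (- alpha) + RtoC y)%C = (zi + RtoC y - RtoC alpha)%C)
      by (intros; rewrite RtoC_opp; ring).
    rewrite <- Hz0 at 1; rewrite <- Hm.
    assert (Cmod (W (zi + RtoC 0 + RtoC x)%C)%C <= X).
    { apply N1; [|assumption]; intros i Hi; rewrite <- Hval, Cplus_0_r.
      eapply Rle_trans; [|apply (HFs i Hi)]; unfold F.
      generalize (Cmod_ge_0 (W (z + RtoC (INR (js i) * alpha) - RtoC alpha)%C)); lra. }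
    assert (Cmod (W (zi + RtoC (- alpha) + RtoC x)%C)%C <= X).
    { apply N2; [|assumption]; intros i Hi; rewrite <- Hval, RtoC_opp.
      eapply Rle_trans; [|apply (HFs i Hi)]; unfold F, Cminus.
      generalize (Cmod_ge_0 (W (z + RtoC (INR (js i) * alpha))%C)); lra. }
    lra. }
  assert (HX0 : 0 <= X).
  { assert (H := HFX 0 ltac:(unfold r; lra)).
    unfold F in H; generalize (Cmod_ge_0 (W (zi + RtoC 0)%C)) (Cmod_ge_0 (W (zi + RtoC 0 - RtoC alpha)%C)); lra. }
  apply (trig_poly_not_small u M alpha z Ha Hu0); intros m.
  set (x := Re z + INR m * alpha).
  (* Density is applied [J0] steps before the target, so that the remaining [J0 - j] steps lead
     forward from the interval to it. *)
  destruct (Hdens (x - INR J0 * alpha)) as (j & l & Hj & Hx).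
  set (x1 := x - INR J0 * alpha + INR j * alpha - IZR l) in *.
  assert (E : trig_poly u M (z + RtoC (INR m * alpha))%C = W (zi + RtoC x1 + RtoC (INR (J0 - j) * alpha))%C).
  { unfold W; rewrite <- (trig_poly_period u M (z + RtoC (INR m * alpha)) (- l)); f_equal.
    unfold x1, x, zi; rewrite minus_INR, opp_IZR by assumption.
    destruct z as [a b]; unfold Cplus, Cmult, RtoC, Ci, Re, Im; cbn [fst snd]; f_equal; ring. }
  rewrite E.
  apply Rle_trans with (F (zi + RtoC x1 + RtoC (INR (J0 - j) * alpha))%C).
  { unfold F; match goal with |- _ <= _ + Cmod ?c => generalize (Cmod_ge_0 c) end; lra. }
  eapply Rle_trans; [apply Horb; now rewrite Hzi|].
  eapply Rle_trans; [|exact Hsmall].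
  assert (Hjj : INR (J0 - j) <= INR J0) by (apply le_INR; lia).
  assert (HF0 : F (zi + RtoC x1)%C <= 2 * X) by (apply HFX; unfold r; lra).
  assert (0 <= F (zi + RtoC x1)%C)
    by (unfold F; generalize (Cmod_ge_0 (W (zi + RtoC x1)%C)) (Cmod_ge_0 (W (zi + RtoC x1 - RtoC alpha)%C)); lra).
  assert (0 <= INR (J0 - j)) by apply pos_INR.
  apply Rmult_le_compat; [apply pow_le; lra|nra|apply Rle_pow; [lra|lia]|].
  apply Rplus_le_compat; [exact HF0|now apply Rmult_le_compat_r].
Qed.

(** * Growth of solutions along an approximate section *)

(* [xi] and [zeta] are the coordinates of [(x, y)] in the unimodular frame
   [(p, q)], [(- conj q, conj p) / (|p|^2 + |q|^2)]; the invariance of [(p, q)]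
   makes the cocycle upper triangular up to [tau] in this frame. *)
Lemma growth_along_section theta (g e p q x y : nat -> C) tau sigma Y L eps :
  0 <= tau -> 0 < sigma -> 0 < Y -> 0 <= L -> 0 < eps ->
  (forall k, (expi theta * p (S k))%C = (g k * p k - q k - e k)%C) ->
  (forall k, (expi theta * q (S k))%C = p k) ->
  (forall k, x (S k) = (g k * x k - y k)%C) -> (forall k, y (S k) = x k) ->
  (forall k, Cmod (e k)%C <= tau) -> (forall k, Cmod (g k)%C <= L) ->
  (forall k, Cmod (p k)%C <= Y) -> (forall k, Cmod (q k)%C <= Y) ->
  (forall k, sigma <= Cmod (p k)%C + Cmod (q k)%C) ->
  Cmod (x 0%nat)%C <= 1 -> Cmod (y 0%nat)%C <= 1 ->
  let w := 4 * Y ^ 2 * (L + 2) / sigma ^ 4 / eps in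
  2 * tau * Y / sigma ^ 2 <= eps -> w * (tau * Y) <= eps ->
  forall k, Cmod (x k)%C <= (Y + 2 * Y / (w * sigma ^ 2)) * (4 * Y / sigma ^ 2 + 2 * w * Y) * (1 + 2 * eps) ^ k.
Proof.
  intros Htau Hsig HY HL Heps Hp Hq Hx Hy He Hg HpY HqY Hlow Hx0 Hy0 w Hc1 Hc2.
  set (S_ := fun k => Cmod (p k)%C ^ 2 + Cmod (q k)%C ^ 2).
  assert (Hs2 : 0 < sigma ^ 2) by (apply pow_lt; lra).
  assert (HS : forall k, sigma ^ 2 / 2 <= S_ k).
  { intros k; specialize (Hlow k); unfold S_; generalize (Cmod_ge_0 (p k)) (Cmod_ge_0 (q k)).
    generalize (pow2_ge_0 (Cmod (p k)%C - Cmod (q k)%C)); nra. }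
  assert (HSi : forall k, / S_ k <= 2 / sigma ^ 2).
  { intros k; replace (2 / sigma ^ 2) with (/ (sigma ^ 2 / 2)) by (field; lra).
    apply Rinv_le_contravar; [lra|apply HS]. }
  assert (HSi0 : forall k, 0 < / S_ k) by (intros k; apply Rinv_0_lt_compat; specialize (HS k); lra).
  assert (HSC : forall k, RtoC (S_ k) = (Cconj (p k) * p k + Cconj (q k) * q k)%C).
  { intros k; unfold S_; rewrite RtoC_plus, !Cmod2_conj; ring. }
  assert (HSC0 : forall k, RtoC (S_ k) <> RtoC 0).
  { intros k E; injection E; specialize (HS k); lra. }
  set (xi := fun k => ((Cconj (p k) * x k + Cconj (q k) * y k) / RtoC (S_ k))%C).
  set (zeta := fun k => (p k * y k - q k * x k)%C).
  assert (Ex : forall k, x k = (xi k * p k - zeta k / RtoC (S_ k) * Cconj (q k))%C).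
  { intros k; unfold xi, zeta.
    transitivity ((x k * (Cconj (p k) * p k + Cconj (q k) * q k)) / RtoC (S_ k))%C.
    - rewrite <- HSC; field; apply HSC0.
    - field; apply HSC0. }
  assert (Ey : forall k, y k = (xi k * q k + zeta k / RtoC (S_ k) * Cconj (p k))%C).
  { intros k; unfold xi, zeta.
    transitivity ((y k * (Cconj (p k) * p k + Cconj (q k) * q k)) / RtoC (S_ k))%C.
    - rewrite <- HSC; field; apply HSC0.
    - field; apply HSC0. }
  (* [zeta] is the Wronskian of the solution and the section; up to the phase both follow the same
     recursion of determinant 1, so it changes only through the error [e]. *)
  assert (Hzeta : forall k, (expi theta * zeta (S k))%C = (zeta k - e k * x k)%C).
  { intros k; unfold zeta; rewrite Hx, Hy.
    replace (expi theta * (p (S k) * x k - q (S k) * (g k * x k - y k)))%C with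
      ((expi theta * p (S k)) * x k - (expi theta * q (S k)) * (g k * x k - y k))%C by ring.
    rewrite Hp, Hq; ring. }
  assert (Hxi : forall k, xi (S k) = (xi k * expi theta + xi k * (Cconj (p (S k)) * e k) / RtoC (S_ (S k))
     + zeta k / RtoC (S_ k) * ((Cconj (p (S k)) * (- g k * Cconj (q k) - Cconj (p k)) - Cconj (q (S k)) * Cconj (q k))
       / RtoC (S_ (S k))))%C).
  { intros k.
    assert (E1 : x (S k) = (xi k * (expi theta * p (S k) + e k)
      + zeta k / RtoC (S_ k) * (- g k * Cconj (q k) - Cconj (p k)))%C).
    { rewrite Hp, Hx, (Ex k), (Ey k) at 1; field; apply HSC0. }
    assert (E2 : y (S k) = (xi k * (expi theta * q (S k)) - zeta k / RtoC (S_ k) * Cconj (q k))%C).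
    { rewrite Hq, Hy; apply Ex. }
    unfold xi at 1; rewrite E1, E2.
    transitivity ((xi k * expi theta * (Cconj (p (S k)) * p (S k) + Cconj (q (S k)) * q (S k))
      + xi k * (Cconj (p (S k)) * e k)
      + zeta k / RtoC (S_ k) * (Cconj (p (S k)) * (- g k * Cconj (q k) - Cconj (p k)) - Cconj (q (S k)) * Cconj (q k)))
      / RtoC (S_ (S k)))%C.
    - field; split; apply HSC0.
    - rewrite <- HSC; field; split; apply HSC0. }
  assert (HCS : forall c k, Cmod (c / RtoC (S_ k))%C <= Cmod c * (2 / sigma ^ 2)).
  { intros c k; rewrite Cmod_div, Cmod_R by apply HSC0.
    rewrite Rabs_right by (specialize (HS k); lra).
    apply Rmult_le_compat_l; [apply Cmod_ge_0|apply HSi]. }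
  assert (H2s : 0 < 2 / sigma ^ 2) by (apply Rdiv_lt_0_compat; lra).
  assert (Hxb : forall k, Cmod (x k)%C <= Y * Cmod (xi k)%C + Y * (2 / sigma ^ 2) * Cmod (zeta k)%C).
  { intros k; rewrite Ex at 1; unfold Cminus; eapply Rle_trans; [apply Cmod_triangle|].
    rewrite Cmod_opp, !Cmod_mult, Cmod_conj.
    generalize (HCS (zeta k) k) (HpY k) (HqY k) (Cmod_ge_0 (xi k)) (Cmod_ge_0 (q k)) (Cmod_ge_0 (zeta k)); intros.
    apply Rplus_le_compat; [rewrite Rmult_comm; now apply Rmult_le_compat_r|].
    replace (Y * (2 / sigma ^ 2) * Cmod (zeta k)%C) with (Cmod (zeta k)%C * (2 / sigma ^ 2) * Y) by ring.
    apply Rmult_le_compat; auto; apply Cmod_ge_0. }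
  set (beta := 4 * Y ^ 2 * (L + 2) / sigma ^ 4) in *.
  assert (Hs4 : 0 < sigma ^ 4) by (apply pow_lt; lra).
  assert (Hbeta : 0 < beta) by (unfold beta; apply Rdiv_lt_0_compat; [|assumption]; assert (0 < Y ^ 2) by (apply pow_lt; lra); nra).
  assert (Hw : 0 < w) by (unfold w; now apply Rdiv_lt_0_compat).
  assert (Hwb : w * eps = beta) by (unfold w; field; lra).
  assert (Htriv : forall a : C, Cmod (expi theta * a)%C = Cmod a) by (intros; rewrite Cmod_mult, Cmod_expi; ring).
  assert (Hz1 : forall k, Cmod (zeta (S k))%C <= Cmod (zeta k)%C + tau * (Y * Cmod (xi k)%C + Y * (2 / sigma ^ 2) * Cmod (zeta k)%C)).
  { intros k; rewrite <- Htriv, Hzeta; unfold Cminus; eapply Rle_trans; [apply Cmod_triangle|].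
    rewrite Cmod_opp, Cmod_mult; apply Rplus_le_compat_l.
    apply Rmult_le_compat; auto; apply Cmod_ge_0. }
  assert (Hx1 : forall k, Cmod (xi (S k))%C <= Cmod (xi k)%C + Cmod (xi k)%C * (Y * tau * (2 / sigma ^ 2)) + Cmod (zeta k)%C * beta).
  { intros k; rewrite Hxi.
    eapply Rle_trans; [apply Cmod_triangle|]; apply Rplus_le_compat.
    - eapply Rle_trans; [apply Cmod_triangle|]; apply Rplus_le_compat.
      + rewrite Cmod_mult, Cmod_expi; lra.
      + eapply Rle_trans; [apply HCS|]; rewrite !Cmod_mult, Cmod_conj.
        rewrite Rmult_assoc; apply Rmult_le_compat_l; [apply Cmod_ge_0|].
        apply Rmult_le_compat_r; [lra|]; apply Rmult_le_compat; auto; apply Cmod_ge_0.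
    - rewrite Cmod_mult.
      set (c := (Cconj (p (S k)) * (- g k * Cconj (q k) - Cconj (p k)) - Cconj (q (S k)) * Cconj (q k))%C).
      assert (Hcb : Cmod c <= Y ^ 2 * (L + 2)).
      { unfold c, Cminus; eapply Rle_trans; [apply Cmod_triangle|].
        rewrite Cmod_opp, !Cmod_mult, !Cmod_conj.
        assert (Hin : Cmod (- g k * Cconj (q k) + - Cconj (p k))%C <= L * Y + Y).
        { eapply Rle_trans; [apply Cmod_triangle|]; rewrite Cmod_opp, Cmod_mult, Cmod_opp, !Cmod_conj.
          apply Rplus_le_compat; [|auto]; apply Rmult_le_compat; auto; apply Cmod_ge_0. }
        assert (T1 : Cmod (p (S k))%C * Cmod (- g k * Cconj (q k) + - Cconj (p k))%C <= Y * (L * Y + Y))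
          by (apply Rmult_le_compat; auto; apply Cmod_ge_0).
        assert (T2 : Cmod (q (S k))%C * Cmod (q k)%C <= Y * Y) by (apply Rmult_le_compat; auto; apply Cmod_ge_0).
        nra. }
      apply Rle_trans with ((Cmod (zeta k)%C * (2 / sigma ^ 2)) * ((Y ^ 2 * (L + 2)) * (2 / sigma ^ 2))).
      + apply Rmult_le_compat; try apply Cmod_ge_0; [apply HCS|].
        eapply Rle_trans; [apply HCS|]; apply Rmult_le_compat_r; lra.
      + right; unfold beta; field; lra. }
  (* The weight satisfies [w eps = beta], so the off-diagonal contribution [beta |zeta|] is [eps]
     times the weighted term. In exchange [tau Y] is multiplied by [w], which [Hc2] permits. *)
  set (Q := fun k => Cmod (xi k)%C + w * Cmod (zeta k)%C).
  assert (HQ0 : Q 0%nat <= 4 * Y / sigma ^ 2 + 2 * w * Y).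
  { unfold Q; apply Rplus_le_compat.
    - unfold xi; eapply Rle_trans; [apply HCS|].
      replace (4 * Y / sigma ^ 2) with (2 * Y * (2 / sigma ^ 2)) by (field; lra).
      apply Rmult_le_compat_r; [lra|].
      eapply Rle_trans; [apply Cmod_triangle|]; rewrite !Cmod_mult, !Cmod_conj.
      generalize (HpY 0%nat) (HqY 0%nat) (Cmod_ge_0 (p 0%nat)) (Cmod_ge_0 (q 0%nat)) (Cmod_ge_0 (x 0%nat)) (Cmod_ge_0 (y 0%nat)); nra.
    - replace (2 * w * Y) with (w * (2 * Y)) by ring; apply Rmult_le_compat_l; [lra|].
      unfold zeta, Cminus; eapply Rle_trans; [apply Cmod_triangle|]; rewrite Cmod_opp, !Cmod_mult.
      generalize (HpY 0%nat) (HqY 0%nat) (Cmod_ge_0 (p 0%nat)) (Cmod_ge_0 (q 0%nat)) (Cmod_ge_0 (x 0%nat)) (Cmod_ge_0 (y 0%nat)); nra. }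
  assert (HQS : forall k, Q (S k) <= (1 + 2 * eps) * Q k).
  { intros k; unfold Q.
    generalize (Hz1 k) (Hx1 k) (Cmod_ge_0 (xi k)) (Cmod_ge_0 (zeta k)); intros A1 A2 A3 A4.
    set (a := Cmod (xi k)%C) in *; set (b := Cmod (zeta k)%C) in *.
    assert (Hd : Y * tau * (2 / sigma ^ 2) <= eps) by (replace (Y * tau * (2 / sigma ^ 2)) with (2 * tau * Y / sigma ^ 2) by (field; lra); assumption).
    assert (A5 : w * Cmod (zeta (S k))%C <= w * (b + tau * (Y * a + Y * (2 / sigma ^ 2) * b))) by (apply Rmult_le_compat_l; lra).
    assert (A6 : a * (Y * tau * (2 / sigma ^ 2)) <= a * eps) by (apply Rmult_le_compat_l; lra).
    assert (A7 : a * (w * (tau * Y)) <= a * eps) by (apply Rmult_le_compat_l; lra).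
    assert (A8 : w * b * (Y * tau * (2 / sigma ^ 2)) <= w * b * eps) by (apply Rmult_le_compat_l; [nra|lra]).
    assert (A9 : b * beta = w * b * eps) by (rewrite <- Hwb; ring).
    lra. }
  assert (HQk : forall k, Q k <= Q 0%nat * (1 + 2 * eps) ^ k).
  { intros k; induction k as [|k IH]; [cbn; lra|].
    eapply Rle_trans; [apply HQS|]; cbn [pow].
    replace (Q 0%nat * ((1 + 2 * eps) * (1 + 2 * eps) ^ k)) with ((1 + 2 * eps) * (Q 0%nat * (1 + 2 * eps) ^ k)) by ring.
    apply Rmult_le_compat_l; lra. }
  intros k; eapply Rle_trans; [apply Hxb|].
  assert (HQk0 : 0 <= (1 + 2 * eps) ^ k) by (apply pow_le; lra).
  assert (Hws : 0 < w * sigma ^ 2) by now apply Rmult_lt_0_compat.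
  assert (Hc : 0 <= Y + 2 * Y / (w * sigma ^ 2)).
  { assert (0 < 2 * Y / (w * sigma ^ 2)) by (apply Rdiv_lt_0_compat; lra); lra. }
  apply Rle_trans with ((Y + 2 * Y / (w * sigma ^ 2)) * Q k).
  - unfold Q; generalize (Cmod_ge_0 (xi k)) (Cmod_ge_0 (zeta k)); intros A3 A4.
    replace ((Y + 2 * Y / (w * sigma ^ 2)) * (Cmod (xi k)%C + w * Cmod (zeta k)%C)) with
      (Y * Cmod (xi k)%C + Y * (2 / sigma ^ 2) * Cmod (zeta k)%C + (Y * w * Cmod (zeta k)%C + 2 * Y / (w * sigma ^ 2) * Cmod (xi k)%C))
      by (field; split; lra).
    assert (0 <= Y * w * Cmod (zeta k)%C) by (apply Rmult_le_pos; nra).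
    assert (0 <= 2 * Y / (w * sigma ^ 2) * Cmod (xi k)%C).
    { apply Rmult_le_pos; [left; apply Rdiv_lt_0_compat; lra|assumption]. }
    lra.
  - rewrite Rmult_assoc; apply Rmult_le_compat_l; [assumption|].
    eapply Rle_trans; [apply HQk|]; now apply Rmult_le_compat_r.
Qed.

(** * Choice of scales *)

Lemma le_exp_mult a w : 0 <= a -> 1 <= w -> a <= exp (a * w).
Proof.
  intros Ha Hw; apply Rle_trans with (exp a).
  - generalize (exp_ineq1_le a); lra.
  - apply exp_monotone; nra.
Qed.

Lemma pow_two_fifths_le J : (2 / 5) ^ J <= exp (- (/ 2) * INR J).
Proof.
  rewrite exp_mult_INR; apply pow_incr; split; [lra|].
  assert (E : exp (- / 2) * exp (- / 2) * exp 1 = 1) by (rewrite <- !exp_plus; replace (- / 2 + - / 2 + 1) with 0 by lra; apply exp_0).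
  assert (He := exp_le_3); assert (Hp := exp_pos (- / 2)); assert (Hp1 := exp_pos 1).
  apply Rnot_lt_le; intros Hlt; nra.
Qed.

(* With [J] of order [n + 1] the factor [(2/5)^J] absorbs [Y], which grows like
   [exp (2 pi eta n)]; [sigma] of order [exp (- c (n + 1) (1 + ln K))] absorbs
   [(8 K)^J]; and a cut-off [M] that is a large multiple of [(n + 1) (1 + ln K)]
   makes [tau] negligible against [sigma^4].  This fixes the required [A0]. *)
Lemma section_parameters eta g Cb ST L eps C0 (J0 : nat) :
  0 <= eta -> 0 < g -> 0 <= Cb -> 0 <= ST -> 0 <= L -> 0 < eps -> 1 < C0 ->
  exists A0, 1 <= A0 /\ forall (t K : nat) hi, (1 <= K)%nat -> hi <= INR K ->
    A0 * (INR t + 1) * (1 + ln (INR K)) <= hi ->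
    exists (n M J : nat) sigma,
      C0 * INR t <= INR n /\ (2 * n <= M)%nat /\ 2 * INR M <= / C0 * hi /\ INR M < / C0 * hi /\
      ((J0 + 1) * J <= K)%nat /\ 0 < sigma /\
      let tau := ST * exp (2 * PI * eta * INR n) * exp (- (g / 6) * INR M) in
      let Y := section_bound n eta Cb g in
      (L + 1) ^ J0 * (2 * (INR J * (8 * INR K) ^ J *
          ((L + 1) ^ ((J0 + 1) * J) * (sigma + INR ((J0 + 1) * J) * tau))
        + 2 * Y * (2 / 5) ^ J) + INR J0 * tau) <= / 2 /\
      2 * tau * Y / sigma ^ 2 <= eps /\
      4 * Y ^ 2 * (L + 2) / sigma ^ 4 / eps * (tau * Y) <= eps.
Proof.
  intros Heta Hg HCb HST HL Heps HC0; pose proof PI_RGT_0 as HP.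
  set (l := ln (L + 1)).
  assert (Hl : 0 <= l).
  { unfold l; rewrite <- ln_1; destruct (Req_dec L 0) as [E|E]; [rewrite E, Rplus_0_l; lra|].
    left; apply ln_increasing; lra. }
  assert (Hel : exp l = L + 1) by (apply exp_ln; lra).
  set (CY := (1 + Cb) * geom_const (g / 2)).
  assert (HCY : 0 <= CY).
  { apply Rmult_le_pos; [lra|]; left; apply geom_const_pos; lra. }
  set (y := CY + 1 + 2 * PI * eta).
  assert (Hpe : 0 <= 2 * PI * eta) by (apply Rmult_le_pos; lra).
  set (LJ := (L + 1) ^ J0).
  assert (HLJ : 1 <= LJ) by (apply pow_R1_Rle; lra).
  (* Below, [Y <= exp (y q)] with [q = n + 1], and [(2/5)^J <= exp (- J / 2)]. Taking [J = kap q]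
     then makes [32 LJ Y (2/5)^J] at most 1. *)
  destruct (INR_unbounded (2 * (32 * LJ + y))) as [kap Hkap].
  assert (HJ0 := pos_INR J0).
  assert (Hkap0 : 0 <= INR kap) by apply pos_INR.
  (* The decay that [sigma] needs, in units of [w = q X] with [X = 1 + ln K]: the 4 covers
     [J <= exp J] and [8 K <= exp (3 X)], the terms with [l] cover the powers of [L + 1]. *)
  set (c2 := l * INR J0 + INR kap * (4 + l * (INR J0 + 1))).
  assert (Hc2 : 0 <= c2).
  { assert (0 <= l * INR J0) by now apply Rmult_le_pos.
    assert (0 <= l * (INR J0 + 1)) by (apply Rmult_le_pos; lra).
    assert (0 <= INR kap * (4 + l * (INR J0 + 1))) by (apply Rmult_le_pos; lra).
    unfold c2; lra. }
  (* [/ sigma] is at most [exp (s1 w)]. The numbers [d1] to [d4] are likewise exponents for what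
     [tau] has to beat: [T / sigma], [8 LJ J0], and the factors multiplying it in the last two
     inequalities. *)
  set (s1 := 16 + c2).
  set (d1 := INR kap * (INR J0 + 1) + s1).
  set (d2 := 8 * LJ * INR J0).
  set (d3 := 2 / eps + y + 2 * s1).
  set (d4 := 4 * (L + 2) / eps ^ 2 + 3 * y + 4 * s1).
  assert (Hie : 0 < 2 / eps) by (apply Rdiv_lt_0_compat; lra).
  assert (He2 : 0 < eps ^ 2) by (apply pow_lt; lra).
  assert (Hie2 : 0 < 4 * (L + 2) / eps ^ 2) by (apply Rdiv_lt_0_compat; lra).
  assert (Hd1 : 0 <= d1) by (unfold d1, s1; nra).
  assert (Hd2 : 0 <= d2) by (unfold d2; nra).
  assert (Hd3 : 0 <= d3) by (unfold d3, y, s1; lra).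
  assert (Hd4 : 0 <= d4) by (unfold d4, y, s1; lra).
  set (D := d1 + d2 + d3 + d4).
  (* As [M >= (A1 + 2) w], the factor [exp (- (g / 6) M)] absorbs [ST] and [exp (2 pi eta n)] and
     still leaves [tau <= exp (- D w)]. *)
  set (A1 := 6 / g * (ST + 2 * PI * eta + D)).
  assert (HA1 : 0 <= A1).
  { unfold A1; apply Rmult_le_pos; [left; apply Rdiv_lt_0_compat; lra|unfold D; lra]. }
  assert (HgA : g / 6 * A1 = ST + 2 * PI * eta + D) by (unfold A1; field; lra).
  (* The first summand makes room for [M] in half of [hi / C0], the second gives [(J0 + 1) J <= K];
     [C0 + 2] bounds the ratio of [n + 1] to [t + 1]. *)
  set (A0 := 2 * C0 * ((A1 + 2) * (C0 + 2) + 1) + (INR J0 + 1) * INR kap * (C0 + 2)).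
  assert (HP1 : 0 <= (A1 + 2) * (C0 + 2)) by (apply Rmult_le_pos; lra).
  assert (HP2 : 0 <= (INR J0 + 1) * INR kap * (C0 + 2)) by (repeat apply Rmult_le_pos; lra).
  assert (HP3 : 1 <= 2 * C0 * ((A1 + 2) * (C0 + 2) + 1)) by nra.
  exists A0; split; [unfold A0; lra|].
  intros t K hi HK HhiK Hhi.
  assert (HKp : 1 <= INR K) by now apply (le_INR 1).
  set (X := 1 + ln (INR K)) in *.
  assert (HX : 1 <= X).
  { unfold X; assert (0 <= ln (INR K)); [|lra].
    rewrite <- ln_1; destruct HKp as [Hlt|<-]; [left; apply ln_increasing; lra|lra]. }
  assert (Ht := pos_INR t).
  destruct (archimed (C0 * INR t)) as [U1 U2].
  assert (Hup : (0 <= up (C0 * INR t))%Z) by (apply le_IZR; nra).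
  set (n := Z.to_nat (up (C0 * INR t))).
  assert (Hn : INR n = IZR (up (C0 * INR t))) by (unfold n; now rewrite INR_IZR_INZ, Z2Nat.id).
  assert (Hn0 := pos_INR n).
  set (q := INR n + 1).
  assert (Hq : q <= (C0 + 2) * (INR t + 1)) by (unfold q; nra).
  assert (Hq1 : 1 <= q) by (unfold q; lra).
  set (w := q * X).
  assert (Hw1 : q <= w) by (unfold w; nra).
  assert (Hw : w <= (C0 + 2) * ((INR t + 1) * X)).
  { unfold w; rewrite <- Rmult_assoc; apply Rmult_le_compat_r; lra. }
  assert (HtX : 1 <= (INR t + 1) * X) by nra.
  set (p := (INR t + 1) * X) in *.
  assert (Hhi' : A0 * p <= hi) by (unfold p; rewrite <- Rmult_assoc; exact Hhi).
  assert (HiC : 0 < / C0) by (apply Rinv_0_lt_compat; lra).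
  assert (HN : 2 * ((A1 + 2) * w + 1) <= / C0 * hi).
  { apply (Rmult_le_reg_l C0); [lra|].
    replace (C0 * (/ C0 * hi)) with hi by (field; lra).
    eapply Rle_trans; [|exact Hhi'].
    apply Rle_trans with (2 * C0 * ((A1 + 2) * (C0 + 2) + 1) * p).
    - replace (C0 * (2 * ((A1 + 2) * w + 1))) with (2 * C0 * ((A1 + 2) * w + 1)) by ring.
      rewrite (Rmult_assoc (2 * C0)); apply Rmult_le_compat_l; [lra|].
      assert ((A1 + 2) * w <= (A1 + 2) * ((C0 + 2) * p)) by (apply Rmult_le_compat_l; lra).
      lra.
    - apply Rmult_le_compat_r; unfold A0; lra. }
  destruct (base_Int_part (/ C0 * hi / 2)) as [V1 V2].
  set (M := Z.to_nat (Int_part (/ C0 * hi / 2))).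
  assert (Hw0 : 1 <= w) by lra.
  assert (HAw : 0 <= (A1 + 2) * w) by nra.
  assert (HIp : (0 <= Int_part (/ C0 * hi / 2))%Z).
  { assert (-1 < IZR (Int_part (/ C0 * hi / 2))) by lra; apply lt_IZR in H; lia. }
  assert (HM : INR M = IZR (Int_part (/ C0 * hi / 2))) by (unfold M; now rewrite INR_IZR_INZ, Z2Nat.id).
  assert (HMw : (A1 + 2) * w <= INR M) by lra.
  set (J := (kap * (n + 1))%nat).
  assert (HJ : INR J = INR kap * q) by (unfold J, q; rewrite mult_INR, plus_INR; cbn [INR]; ring).
  set (T := ((J0 + 1) * J)%nat).
  assert (HT : INR T = (INR J0 + 1) * (INR kap * q)) by (unfold T; rewrite mult_INR, plus_INR, HJ; cbn [INR]; ring).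
  set (sigma := exp (- c2 * w) / 16).
  assert (Hsig : 0 < sigma) by (unfold sigma; generalize (exp_pos (- c2 * w)); lra).
  exists n, M, J, sigma.
  split; [lra|]; split; [|split; [lra|split; [|split; [|split; [assumption|]]]]].
  - apply INR_le; rewrite mult_INR; cbn [INR]; unfold q in *; nra.
  - lra.
  - apply INR_le; fold T; rewrite HT; eapply Rle_trans; [|exact HhiK].
    eapply Rle_trans; [|exact Hhi'].
    apply Rle_trans with ((INR J0 + 1) * INR kap * (C0 + 2) * p).
    + replace ((INR J0 + 1) * (INR kap * q)) with ((INR J0 + 1) * INR kap * q) by ring.
      rewrite (Rmult_assoc ((INR J0 + 1) * INR kap) (C0 + 2)).
      apply Rmult_le_compat_l; [nra|lra].
    + apply Rmult_le_compat_r; unfold A0; lra.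
  - cbv zeta; fold LJ T.
    set (tau := ST * exp (2 * PI * eta * INR n) * exp (- (g / 6) * INR M)).
    set (Y := section_bound n eta Cb g).
    assert (Htau0 : 0 <= tau) by (unfold tau; repeat apply Rmult_le_pos; try assumption; left; apply exp_pos).
    assert (Htau : tau <= exp (- D * w)).
    { unfold tau; apply Rle_trans with (exp (ST * w) * exp (2 * PI * eta * w) * exp (- (g / 6) * ((A1 + 2) * w))).
      - apply Rmult_le_compat; [|left; apply exp_pos| |].
        + apply Rmult_le_pos; [assumption|left; apply exp_pos].
        + apply Rmult_le_compat; [assumption|left; apply exp_pos|now apply le_exp_mult|].
          apply exp_monotone; apply Rmult_le_compat_l; [assumption|unfold q in *; lra].
        + apply exp_monotone; nra.
      - rewrite <- !exp_plus; apply exp_monotone.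
        assert (g / 6 * ((A1 + 2) * w) >= (ST + 2 * PI * eta + D) * w).
        { rewrite <- HgA; assert (0 <= g / 6 * 2 * w) by (repeat apply Rmult_le_pos; lra); lra. }
        lra. }
    assert (HtauE : forall d z, 0 <= z -> d <= D -> z <= exp (d * w) -> tau * z <= 1).
    { intros d z Hz0 Hd Hz; apply Rle_trans with (exp (- D * w) * exp (d * w)).
      - apply Rmult_le_compat; assumption.
      - rewrite <- exp_plus; apply exp_le_1; nra. }
    assert (HY0 : 0 <= Y).
    { unfold Y, section_bound; apply Rmult_le_pos; [|left; apply geom_const_pos; lra].
      apply Rmult_le_pos; [apply Rmult_le_pos; lra|left; apply exp_pos]. }
    assert (HYq : Y <= exp (y * q)).
    { replace Y with (CY * q * exp (2 * PI * eta * INR n)) by (unfold Y, section_bound, CY, q; ring).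
      unfold y; rewrite !Rmult_plus_distr_r, !exp_plus.
      apply Rmult_le_compat; [apply Rmult_le_pos; lra|left; apply exp_pos| |].
      - apply Rmult_le_compat; [assumption|lra|now apply le_exp_mult|].
        rewrite Rmult_1_l; generalize (exp_ineq1_le q); lra.
      - apply exp_monotone, Rmult_le_compat_l; [assumption|unfold q; lra]. }
    assert (Hy0 : 0 <= y) by (unfold y; lra).
    assert (HYw : Y <= exp (y * w)).
    { eapply Rle_trans; [exact HYq|]; apply exp_monotone, Rmult_le_compat_l; lra. }
    assert (His : / sigma = 16 * exp (c2 * w)).
    { unfold sigma; replace (- c2 * w) with (- (c2 * w)) by ring; rewrite exp_Ropp; field.
      apply Rgt_not_eq, exp_pos. }
    assert (Hisw : / sigma <= exp (s1 * w)).
    { rewrite His; unfold s1; rewrite Rmult_plus_distr_r, exp_plus.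
      apply Rmult_le_compat_r; [left; apply exp_pos|apply le_exp_mult; lra]. }
    assert (His0 : 0 < / sigma) by now apply Rinv_0_lt_compat.
    assert (HJ0w : INR J <= INR kap * w) by (rewrite HJ; apply Rmult_le_compat_l; lra).
    assert (HTsig : INR T * tau <= sigma).
    { apply (Rmult_le_reg_r (/ sigma)); [assumption|]; rewrite Rinv_r by lra.
      replace (INR T * tau * / sigma) with (tau * (INR T * / sigma)) by ring.
      apply (HtauE d1); [|unfold D; lra|].
      - apply Rmult_le_pos; [apply pos_INR|lra].
      - unfold d1; rewrite Rmult_plus_distr_r, exp_plus.
        apply Rmult_le_compat; [apply pos_INR|lra| |assumption].
        rewrite HT; apply Rle_trans with (INR kap * (INR J0 + 1) * w).
        + replace ((INR J0 + 1) * (INR kap * q)) with (INR kap * (INR J0 + 1) * q) by ring.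
          apply Rmult_le_compat_l; nra.
        + match goal with |- ?a <= _ => generalize (exp_ineq1_le a) end; lra. }
    split; [|split].
    + assert (P1 : LJ * (4 * Y * (2 / 5) ^ J) <= / 8).
      { apply Rle_trans with (LJ * (4 * exp (y * q) * exp (- / 2 * INR J))).
        - apply Rmult_le_compat_l; [lra|]; apply Rmult_le_compat.
          + lra.
          + apply pow_le; lra.
          + lra.
          + apply pow_two_fifths_le.
        - assert (H32 : 32 * LJ <= exp (32 * LJ * q)) by (apply le_exp_mult; lra).
          assert (H1 : exp (32 * LJ * q) * exp (y * q) * exp (- / 2 * INR J) <= 1).
          { rewrite <- !exp_plus; apply exp_le_1; rewrite HJ; nra. }
          assert (H2 : 32 * LJ * (exp (y * q) * exp (- / 2 * INR J)) <= 1).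
          { eapply Rle_trans; [|exact H1]; rewrite (Rmult_assoc (exp (32 * LJ * q))).
            apply Rmult_le_compat_r; [|assumption].
            apply Rmult_le_pos; left; apply exp_pos. }
          lra. }
      assert (P2 : LJ * (2 * (INR J * (8 * INR K) ^ J * ((L + 1) ^ T * sigma))) <= / 8).
      { assert (E1 : LJ = exp (l * INR J0)) by (rewrite exp_mult_INR, Hel; reflexivity).
        assert (E2 : (L + 1) ^ T = exp (l * INR T)) by (rewrite exp_mult_INR, Hel; reflexivity).
        assert (E3 : (8 * INR K) ^ J <= exp (3 * X * INR J)).
        { rewrite exp_mult_INR; apply pow_incr; split; [lra|].
          assert (EK : INR K = exp (X - 1)) by (unfold X; replace (1 + ln (INR K) - 1) with (ln (INR K)) by ring; rewrite exp_ln; lra).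
          rewrite EK; apply Rle_trans with (exp 3 * exp (X - 1)).
          - apply Rmult_le_compat_r; [left; apply exp_pos|].
            assert (E : exp 3 = exp 1 ^ 3) by (rewrite <- (exp_mult_INR 1 3); f_equal; cbn; ring).
            assert (2 <= exp 1) by (generalize (exp_ineq1_le 1); lra).
            rewrite E; replace 8 with (2 ^ 3) by ring; apply pow_incr; lra.
          - rewrite <- exp_plus; apply exp_monotone; lra. }
        assert (E4 : INR J <= exp (INR J)) by (generalize (exp_ineq1_le (INR J)); lra).
        apply Rle_trans with (exp (l * INR J0) * (2 * (exp (INR J) * exp (3 * X * INR J) * (exp (l * INR T) * sigma)))).
        - rewrite E1, E2; apply Rmult_le_compat_l; [left; apply exp_pos|].
          apply Rmult_le_compat_l; [lra|].
          apply Rmult_le_compat_r; [apply Rmult_le_pos; [left; apply exp_pos|lra]|].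
          apply Rmult_le_compat; [apply pos_INR|apply pow_le; lra|assumption|assumption].
        - unfold sigma.
          replace (exp (l * INR J0) * (2 * (exp (INR J) * exp (3 * X * INR J) * (exp (l * INR T) * (exp (- c2 * w) / 16)))))
            with (/ 8 * (exp (l * INR J0) * exp (INR J) * exp (3 * X * INR J) * exp (l * INR T) * exp (- c2 * w))) by field.
          rewrite <- !exp_plus.
          rewrite <- (Rmult_1_r (/ 8)) at 2; apply Rmult_le_compat_l; [lra|]; apply exp_le_1.
          assert (F1 : l * INR J0 <= l * INR J0 * w) by (assert (0 <= l * INR J0) by nra; nra).
          assert (F2 : 3 * X * INR J = 3 * INR kap * w) by (rewrite HJ; unfold w; ring).
          assert (F3 : l * INR T <= l * (INR J0 + 1) * INR kap * w).
          { rewrite HT; replace (l * ((INR J0 + 1) * (INR kap * q))) with (l * (INR J0 + 1) * INR kap * q) by ring.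
            apply Rmult_le_compat_l; [repeat apply Rmult_le_pos; lra|lra]. }
          rewrite F2; unfold c2; lra. }
      assert (P3 : LJ * (INR J0 * tau) <= / 8).
      { assert (H : tau * (8 * LJ * INR J0) <= 1).
        { apply (HtauE d2); [exact Hd2|unfold D; lra|]; apply le_exp_mult; [exact Hd2|lra]. }
        lra. }
      assert (P4 : LJ * (2 * (INR J * (8 * INR K) ^ J * ((L + 1) ^ T * (INR T * tau)))) <= / 8).
      { eapply Rle_trans; [|exact P2].
        apply Rmult_le_compat_l; [lra|]; apply Rmult_le_compat_l; [lra|].
        apply Rmult_le_compat_l; [apply Rmult_le_pos; [apply pos_INR|apply pow_le; lra]|].
        apply Rmult_le_compat_l; [apply pow_le; lra|assumption]. }
      lra.
    + apply (Rmult_le_reg_r (/ eps)); [now apply Rinv_0_lt_compat|]; rewrite Rinv_r by lra.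
      replace (2 * tau * Y / sigma ^ 2 * / eps) with (tau * (2 / eps * (Y * (/ sigma * / sigma)))) by (field; lra).
      apply (HtauE d3); [|unfold D; lra|].
      * apply Rmult_le_pos; [lra|apply Rmult_le_pos; [lra|apply Rmult_le_pos; lra]].
      * unfold d3; replace ((2 / eps + y + 2 * s1) * w) with (2 / eps * w + (y * w + (s1 * w + s1 * w))) by ring.
        rewrite !exp_plus.
        assert (0 <= / sigma * / sigma) by (apply Rmult_le_pos; lra).
        apply Rmult_le_compat; [lra|apply Rmult_le_pos; lra|apply le_exp_mult; lra|].
        apply Rmult_le_compat; [lra|lra|assumption|]; apply Rmult_le_compat; lra.
    + apply (Rmult_le_reg_r (/ eps)); [now apply Rinv_0_lt_compat|]; rewrite Rinv_r by lra.
      replace (4 * Y ^ 2 * (L + 2) / sigma ^ 4 / eps * (tau * Y) * / eps)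
        with (tau * (4 * (L + 2) / eps ^ 2 * (Y ^ 3 * (/ sigma) ^ 4))) by (field; lra).
      assert (HY3 : 0 <= Y ^ 3) by now apply pow_le.
      assert (Hs4 : 0 <= (/ sigma) ^ 4) by (apply pow_le; lra).
      apply (HtauE d4); [|unfold D; lra|].
      * apply Rmult_le_pos; [lra|now apply Rmult_le_pos].
      * unfold d4; replace ((4 * (L + 2) / eps ^ 2 + 3 * y + 4 * s1) * w)
          with (4 * (L + 2) / eps ^ 2 * w + (y * w * INR 3 + s1 * w * INR 4)) by (cbn [INR]; ring).
        rewrite !exp_plus, !exp_mult_INR.
        apply Rmult_le_compat; [lra|now apply Rmult_le_pos|apply le_exp_mult; lra|].
        apply Rmult_le_compat; [assumption|assumption| |]; apply pow_incr; lra.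
Qed.

(** * Growth of the cocycle *)

(** The orbit of the vector [(x0, y0)] under the transfer matrices. Its starting values [(1, 0)] and
    [(0, 1)] give the columns of [A_k], which reduces the matrix bound to scalar sequences. *)
Fixpoint cocycle (g : nat -> C) (x0 y0 : C) (k : nat) : C * C :=
  match k with
  | O => (x0, y0)
  | S m => ((g m * fst (cocycle g x0 y0 m) - snd (cocycle g x0 y0 m))%C, fst (cocycle g x0 y0 m))
  end.

Lemma cocycle_crude_bound g x0 y0 L k :
  0 <= L -> (forall m, Cmod (g m)%C <= L) ->
  Cmod (fst (cocycle g x0 y0 k))%C + Cmod (snd (cocycle g x0 y0 k))%C
    <= (L + 1) ^ k * (Cmod x0 + Cmod y0).
Proof.
  intros HL Hg; induction k as [|k IH]; [cbn; lra|].
  cbn [cocycle fst snd pow].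
  set (x := fst (cocycle g x0 y0 k)) in *; set (y := snd (cocycle g x0 y0 k)) in *.
  assert (H : Cmod (g k * x - y)%C <= L * Cmod x + Cmod y).
  { unfold Cminus; eapply Rle_trans; [apply Cmod_triangle|]; rewrite Cmod_opp, Cmod_mult.
    apply Rplus_le_compat_r, Rmult_le_compat_r; [apply Cmod_ge_0|apply Hg]. }
  generalize (Cmod_ge_0 x) (Cmod_ge_0 y); intros; nra.
Qed.

Definition potential (lambda : R) (vc : C -> C) (alpha E : R) (z : C) (m : nat) : C :=
  (RtoC E - RtoC lambda * vc (z + RtoC (INR m * alpha)))%C.

Lemma holo_strip_ext h f g :
  (forall z, f z = g z) -> holo_strip h f -> holo_strip h g.
Proof.
  intros E (Hp & B & s & Hs & HB & H); split; [intros; rewrite <- !E; auto|].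
  exists B, s; split; [assumption|split; [assumption|]]; intros z Hz.
  destruct (H z Hz) as (H1 & d & H2 & H3); split; [now rewrite <- E|].
  exists d; split; [assumption|]; intros; rewrite <- !E; auto.
Qed.

Lemma holo_strip_cocycle h lambda vc alpha E x0 y0 k :
  holo_strip h vc ->
  holo_strip h (fun z => fst (cocycle (potential lambda vc alpha E z) x0 y0 k)) /\
  holo_strip h (fun z => snd (cocycle (potential lambda vc alpha E z) x0 y0 k)).
Proof.
  intros Hv; induction k as [|k [IH1 IH2]]; [split; [exact (holo_strip_const h x0)|exact (holo_strip_const h y0)]|].
  split; [|exact IH1]; cbn [cocycle fst snd].
  apply (holo_strip_ext h (fun z =>
    (RtoC E + (- RtoC lambda) * vc (z + RtoC (INR k * alpha))) * fst (cocycle (potential lambda vc alpha E z) x0 y0 k)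
     + (- RtoC 1) * snd (cocycle (potential lambda vc alpha E z) x0 y0 k))%C).
  - intros z; unfold potential; ring.
  - apply holo_strip_plus; apply holo_strip_mult; auto using holo_strip_const.
    apply holo_strip_plus; [apply holo_strip_const|].
    apply holo_strip_mult; [apply holo_strip_const|]; now apply holo_strip_translate.
Qed.

Lemma transfer_iter_coeff lambda vc alpha E k z :
  let M := transfer_iter lambda vc alpha E k z in
  let g := potential lambda vc alpha E z in
  coeff_mat (RtoC 0) M 0 0 = fst (cocycle g (RtoC 1) (RtoC 0) k) /\
  coeff_mat (RtoC 0) M 1 0 = snd (cocycle g (RtoC 1) (RtoC 0) k) /\
  coeff_mat (RtoC 0) M 0 1 = fst (cocycle g (RtoC 0) (RtoC 1) k) /\
  coeff_mat (RtoC 0) M 1 1 = snd (cocycle g (RtoC 0) (RtoC 1) k).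
Proof.
  intros M g; unfold M; clear M; induction k as [|k (H1 & H2 & H3 & H4)].
  - repeat split; cbn [transfer_iter cocycle fst snd]; unfold Mone;
      rewrite coeff_mat_bij by lia; reflexivity.
  - assert (Hm : forall i j, (i < 2)%nat -> (j < 2)%nat ->
      coeff_mat (RtoC 0) (transfer_iter lambda vc alpha E (S k) z) i j =
      (coeff_mat (RtoC 0) (transfer lambda vc E (z + RtoC (INR k * alpha))) i 0
         * coeff_mat (RtoC 0) (transfer_iter lambda vc alpha E k z) 0 j
       + coeff_mat (RtoC 0) (transfer lambda vc E (z + RtoC (INR k * alpha))) i 1
         * coeff_mat (RtoC 0) (transfer_iter lambda vc alpha E k z) 1 j)%C).
    { intros i j Hi Hj; cbn [transfer_iter]; unfold Mmult; rewrite coeff_mat_bij by assumption.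
      cbn [pred]; rewrite sum_Sn, sum_O; reflexivity. }
    assert (T : forall i j, (i < 2)%nat -> (j < 2)%nat ->
      coeff_mat (RtoC 0) (transfer lambda vc E (z + RtoC (INR k * alpha))) i j =
      match i, j with
      | O, O => g k
      | O, _ => (- (1))%C
      | _, O => RtoC 1
      | _, _ => RtoC 0
      end).
    { intros i j Hi Hj; unfold transfer; rewrite coeff_mat_bij by assumption; reflexivity. }
    cbn [cocycle fst snd].
    rewrite !Hm, !T, H1, H2, H3, H4 by lia.
    repeat split; ring.
Qed.

Lemma opnorm_le M X :
  0 <= X -> (forall i j, (i < 2)%nat -> (j < 2)%nat -> Cmod (coeff_mat (RtoC 0) M i j)%C <= X) ->
  opnorm M <= 4 * X.
Proof.
  intros HX HM; unfold opnorm.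
  set (P := fun r => exists w : matrix (T := C) 2 1, vnorm w <= 1 /\ r = vnorm (Mmult (T := C_Ring) M w)).
  assert (Hub : is_ub_Rbar P (Finite (4 * X))).
  { intros r (w & Hw & ->); cbn [Rbar_le].
    set (w0 := coeff_mat (RtoC 0) w 0 0); set (w1 := coeff_mat (RtoC 0) w 1 0).
    assert (Hw01 : Cmod w0 <= 1 /\ Cmod w1 <= 1).
    { unfold vnorm in Hw; fold w0 w1 in Hw.
      assert (Hs : Cmod w0 ^ 2 + Cmod w1 ^ 2 <= 1).
      { apply sqrt_le_0; [|lra|now rewrite sqrt_1].
        generalize (pow2_ge_0 (Cmod w0)) (pow2_ge_0 (Cmod w1)); lra. }
      generalize (Cmod_ge_0 w0) (Cmod_ge_0 w1); split; nra. }
    assert (Hc : forall i, (i < 2)%nat -> Cmod (coeff_mat (RtoC 0) (Mmult (T := C_Ring) M w) i 0)%C <= 2 * X).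
    { intros i Hi.
      assert (E : coeff_mat (RtoC 0) (Mmult (T := C_Ring) M w) i 0 =
        (coeff_mat (RtoC 0) M i 0 * w0 + coeff_mat (RtoC 0) M i 1 * w1)%C).
      { unfold Mmult; rewrite coeff_mat_bij by lia; cbn [pred]; rewrite sum_Sn, sum_O; reflexivity. }
      rewrite E; eapply Rle_trans; [apply Cmod_triangle|]; rewrite !Cmod_mult.
      assert (A : Cmod (coeff_mat (RtoC 0) M i 0)%C * Cmod w0 <= X * 1)
        by (apply Rmult_le_compat; try apply Cmod_ge_0; [apply HM; lia|apply Hw01]).
      assert (B : Cmod (coeff_mat (RtoC 0) M i 1)%C * Cmod w1 <= X * 1)
        by (apply Rmult_le_compat; try apply Cmod_ge_0; [apply HM; lia|apply Hw01]).
      lra. }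
    unfold vnorm; rewrite <- (sqrt_pow2 (4 * X)) by lra; apply sqrt_le_1_alt.
    assert (A := Hc 0%nat ltac:(lia)); assert (B := Hc 1%nat ltac:(lia)).
    set (a := Cmod (coeff_mat (RtoC 0) (Mmult (T := C_Ring) M w) 0 0)%C) in *.
    set (b := Cmod (coeff_mat (RtoC 0) (Mmult (T := C_Ring) M w) 1 0)%C) in *.
    assert (0 <= a) by apply Cmod_ge_0; assert (0 <= b) by apply Cmod_ge_0.
    assert (a ^ 2 <= (2 * X) ^ 2) by (apply pow_incr; split; assumption).
    assert (b ^ 2 <= (2 * X) ^ 2) by (apply pow_incr; split; assumption).
    generalize (pow2_ge_0 X); lra. }
  assert (H := proj2 (Lub_Rbar_correct P) _ Hub).
  (* The upper bound excludes [p_infty]; at [m_infty] the projection [real] returns 0, which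
     [0 <= X] covers. *)
  destruct (Lub_Rbar P) as [l| |]; cbn in H |- *; lra.
Qed.

Lemma section_error_const_nonneg lambda V Cb g :
  0 <= V -> 0 <= Cb -> 0 < g -> 0 <= section_error_const lambda V Cb g.
Proof.
  intros HV HCb Hg; assert (Hgc := geom_const_pos (g / 6) ltac:(lra)).
  unfold section_error_const; apply Rmult_le_pos; [apply Rabs_pos|].
  apply Rmult_le_pos; [|lra].
  apply Rmult_le_pos; [|apply pow2_ge_0].
  apply Rmult_le_pos; lra.
Qed.

(** [K1] is fixed by the window, its scales and [sigma] before [E], [theta] and [u] are introduced:
    this order of quantifiers secures uniformity in the energy. *)
Lemma cocycle_bound_at_scale alpha lambda eta eta' h vc V Cb L eps C0 (J0 : nat) t K hi n M J sigma :
  irrational alpha -> 0 <= eta' -> eta' < eta -> eta - eta' <= 10 -> eta <= h ->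
  0 <= V -> 0 <= Cb -> 0 <= L -> 0 < eps -> 1 < C0 ->
  holo_strip h vc ->
  (forall k, Cmod (coef vc k)%C <= V * exp (- (2 * PI * h) * IZR (Z.abs k))) ->
  (forall x, exists (j : nat) (l : Z), (j <= J0)%nat /\
     0 <= x + INR j * alpha - IZR l <= (eta - eta') / 20) ->
  (1 <= K)%nat -> badly_approximated alpha K ->
  C0 * INR t <= INR n -> (2 * n <= M)%nat -> 2 * INR M <= / C0 * hi -> INR M < / C0 * hi ->
  ((J0 + 1) * J <= K)%nat -> 0 < sigma ->
  (let g := 2 * PI * (eta - eta') in
   let tau := section_error_const lambda V Cb g * exp (2 * PI * eta * INR n) * exp (- (g / 6) * INR M) in
   let Y := section_bound n eta Cb g in
   (L + 1) ^ J0 * (2 * (INR J * (8 * INR K) ^ J *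
       ((L + 1) ^ ((J0 + 1) * J) * (sigma + INR ((J0 + 1) * J) * tau))
     + 2 * Y * (2 / 5) ^ J) + INR J0 * tau) <= / 2 /\
   2 * tau * Y / sigma ^ 2 <= eps /\
   4 * Y ^ 2 * (L + 2) / sigma ^ 4 / eps * (tau * Y) <= eps) ->
  exists K1, forall E theta u x0 y0 z k,
    (forall z, Rabs (Im z) <= eta' -> Cmod (RtoC lambda * vc z - RtoC E)%C <= L) ->
    u 0%Z = RtoC 1 -> (forall k, Cmod (u k)%C <= 1 + IZR (Z.abs k)) ->
    (forall l, Clim (csym (fun k => RtoC lambda * coef vc k * u (l - k)%Z)%C)
      ((RtoC E - RtoC (2 * cos (2 * PI * (theta + IZR l * alpha)))) * u l)%C) ->
    (forall k, C0 * INR t < IZR (Z.abs k) -> IZR (Z.abs k) < / C0 * hi ->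
      Cmod (u k)%C <= Cb * exp (- (2 * PI * eta) * IZR (Z.abs k))) ->
    Cmod x0 <= 1 -> Cmod y0 <= 1 -> Rabs (Im z) <= eta' ->
    Cmod (fst (cocycle (potential lambda vc alpha E z) x0 y0 k))%C <= K1 * (1 + 2 * eps) ^ k.
Proof.
  intros Ha He0 He1 He10 Heh HV HCb HL Heps HC0 Hvc Hcoef Hdens HK HbK Hn HnM HMN HMN' HJK Hsig Hpar.
  cbv zeta in Hpar.
  set (g := 2 * PI * (eta - eta')) in *.
  set (tau := section_error_const lambda V Cb g * exp (2 * PI * eta * INR n) * exp (- (g / 6) * INR M)) in *.
  set (Y := section_bound n eta Cb g) in *.
  destruct Hpar as (Hsmall & Hc1 & Hc2).
  pose proof PI_RGT_0 as HP.
  assert (Hg : 0 < g) by (unfold g; apply Rmult_lt_0_compat; lra).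
  assert (HY : 0 < Y).
  { unfold Y, section_bound; apply Rmult_lt_0_compat; [|apply geom_const_pos; lra].
    apply Rmult_lt_0_compat; [|apply exp_pos]; generalize (pos_INR n); nra. }
  assert (Htau : 0 <= tau).
  { unfold tau; apply Rmult_le_pos; [apply Rmult_le_pos|left; apply exp_pos].
    - now apply section_error_const_nonneg.
    - left; apply exp_pos. }
  set (w := 4 * Y ^ 2 * (L + 2) / sigma ^ 4 / eps) in *.
  exists ((Y + 2 * Y / (w * sigma ^ 2)) * (4 * Y / sigma ^ 2 + 2 * w * Y)).
  intros E theta u x0 y0 z k Hpot Hu0 Hu Heq Hgapu Hx0 Hy0 Hz.
  assert (Hgap : gap_decay u n (/ C0 * hi) eta Cb).
  { split; [assumption|]; intros j Hj1 Hj2; apply Hgapu; lra. }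
  set (W := trig_poly u M).
  set (pot := fun z => (RtoC lambda * vc z - RtoC E)%C).
  assert (Herr : forall z, Rabs (Im z) <= eta' ->
     Cmod (expi theta * W (z + RtoC alpha) + expi (- theta) * W (z - RtoC alpha) + pot z * W z)%C <= tau).
  { intros z' Hz'; unfold W, pot, tau, g.
    apply (approximate_section_error u (coef vc) vc n M (/ C0 * hi) eta eta' h V Cb lambda E alpha theta z'); auto.
    apply (fourier_inversion h); [assumption|lra]. }
  assert (Hlow : forall z, Rabs (Im z) <= eta' -> sigma <= Cmod (W z)%C + Cmod (W (z - RtoC alpha)%C)%C).
  { apply (section_lower_bound u n M (/ C0 * hi) eta eta' Cb alpha theta pot L tau sigma J0 J K); auto; lra. }
  assert (Hup : forall z, Rabs (Im z) <= eta' -> Cmod (W z)%C <= Y).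
  { intros z' Hz'; apply (trig_poly_bound u n M (/ C0 * hi) eta eta' Cb z'); auto. }
  set (zk := fun k : nat => (z + RtoC (INR k * alpha))%C).
  assert (HIm : forall x, Im (z + RtoC x)%C = Im z) by (intros x; destruct z; cbn; ring).
  assert (Hzk : forall k, Rabs (Im (zk k)) <= eta') by (intros j; unfold zk; now rewrite HIm).
  assert (Hzk' : forall k, Rabs (Im (zk k - RtoC alpha)%C) <= eta').
  { intros j; replace (zk j - RtoC alpha)%C with (z + RtoC (INR j * alpha - alpha))%C
      by (unfold zk; rewrite RtoC_minus; ring); now rewrite HIm. }
  assert (HzS : forall k, zk (S k) = (zk k + RtoC alpha)%C).
  { intros j; unfold zk; rewrite S_INR, Rmult_plus_distr_r, Rmult_1_l, RtoC_plus; ring. }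
  assert (HzS' : forall k, (zk (S k) - RtoC alpha)%C = zk k) by (intros j; rewrite HzS; ring).
  (* The section is [p = expi theta W(z_k)], [q = W(z_k - alpha)]; the defect multiplied by
     [- expi theta] plays the role of [e]. *)
  apply (growth_along_section theta (potential lambda vc alpha E z)
    (fun k => - expi theta * (expi theta * W (zk k + RtoC alpha) + expi (- theta) * W (zk k - RtoC alpha) + pot (zk k) * W (zk k)))%C
    (fun k => expi theta * W (zk k))%C (fun k => W (zk k - RtoC alpha)%C)
    (fun k => fst (cocycle (potential lambda vc alpha E z) x0 y0 k))
    (fun k => snd (cocycle (potential lambda vc alpha E z) x0 y0 k)) tau sigma Y L eps); auto.
  - intros j; rewrite HzS; unfold potential, pot; fold (zk j).
    replace (- expi theta * (expi theta * W (zk j + RtoC alpha) + expi (- theta) * W (zk j - RtoC alpha)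
      + (RtoC lambda * vc (zk j) - RtoC E) * W (zk j)))%C with
      (- (expi theta * expi theta * W (zk j + RtoC alpha)) - (expi theta * expi (- theta)) * W (zk j - RtoC alpha)
       - expi theta * (RtoC lambda * vc (zk j) - RtoC E) * W (zk j))%C by ring.
    rewrite expi_opp; ring.
  - intros j; now rewrite HzS'.
  - intros j; rewrite Cmod_mult, Cmod_opp, Cmod_expi, Rmult_1_l; now apply Herr.
  - intros j; unfold potential; fold (zk j).
    replace (RtoC E - RtoC lambda * vc (zk j))%C with (- (RtoC lambda * vc (zk j) - RtoC E))%C by ring.
    rewrite Cmod_opp; now apply Hpot.
  - intros j; rewrite Cmod_mult, Cmod_expi, Rmult_1_l; now apply Hup.
  - intros j; rewrite Cmod_mult, Cmod_expi, Rmult_1_l; now apply Hlow.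
Qed.

(** Besides the eigenfunction this bounds the spectrum: the dual equation at site 0, where
    [u_0 = 1], expresses [E - 2 cos] as a convergent sum. The bound makes [L] independent of [E] in
    the final theorem. *)
Lemma dual_eigenfunction_of_spectrum alpha lambda h v vc B E :
  irrational alpha -> 0 < h -> holo_strip h vc -> (forall x : R, vc (RtoC x) = RtoC (v x)) ->
  (forall z, Rabs (Im z) <= h -> Cmod (vc z)%C <= B) -> 0 <= B ->
  Sigma lambda v alpha E ->
  Rabs E <= 2 + conv_const lambda B (2 * PI * h) 1 0 * geom_const (PI * h) /\
  exists theta u, u 0%Z = RtoC 1 /\ (forall k, Cmod (u k)%C <= 1 + IZR (Z.abs k)) /\
    (forall l, Clim (csym (fun k => RtoC lambda * coef vc k * u (l - k)%Z)%C)
      ((RtoC E - RtoC (2 * cos (2 * PI * (theta + IZR l * alpha)))) * u l)%C) /\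
    (forall n, dual_value lambda v alpha theta u n (RtoC E * u n)%C).
Proof.
  intros Ha Hh Hvc Hreal HB HB0 HE; pose proof PI_RGT_0 as HP.
  assert (Hg : 0 < 2 * PI * h) by (apply Rmult_lt_0_compat; lra).
  assert (Hcoef := Cmod_coef_le h vc B h Hvc ltac:(lra) HB).
  assert (HvB : forall x, Rabs (v x) <= B).
  { intros x; rewrite <- Cmod_R, <- Hreal; apply HB.
    replace (Im (RtoC x)) with 0 by reflexivity; rewrite Rabs_R0; lra. }
  assert (Hinv : forall x, Clim (csym (fun k => coef vc k * expi (IZR k * x))%C) (RtoC (v x))).
  { intros x; rewrite <- Hreal.
    refine (Clim_ext _ _ _ _ (fourier_inversion h vc (RtoC x) Hvc _)).
    - intros n; apply csum_ext; intros k _; now rewrite ez_real.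
    - replace (Im (RtoC x)) with 0 by reflexivity; rewrite Rabs_R0; lra. }
  destruct (dual_generalized_eigenfunction alpha lambda v E B (coef vc) B (2 * PI * h) Ha HvB HE Hinv Hg Hcoef)
    as (theta & u & Hu0 & Hu & Heq).
  assert (Hterm : forall l k, Cmod (RtoC lambda * coef vc k * u (l - k)%Z)%C
    <= conv_const lambda B (2 * PI * h) 1 l * exp (- (2 * PI * h / 2) * IZR (Z.abs k))).
  { intros l k; apply Cmod_conv_term_le; auto; [lra|]; rewrite Rmult_1_l; apply Hu. }
  split.
  - assert (H0 : Cmod ((RtoC E - RtoC (2 * cos (2 * PI * (theta + IZR 0 * alpha)))) * u 0%Z)%C
      <= conv_const lambda B (2 * PI * h) 1 0 * geom_const (PI * h)).
    { apply (Clim_Cmod_le _ _ _ (Heq 0%Z)); exists 0%nat; intros n _.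
      eapply Rle_trans; [apply Cmod_csum_le; intros k _; apply Hterm|].
      rewrite rsum_scal; apply Rmult_le_compat_l.
      - unfold conv_const; assert (0 < 2 / (2 * PI * h)) by (apply Rdiv_lt_0_compat; lra).
        repeat apply Rmult_le_pos; try lra; try apply Rabs_pos; cbn; lra.
      - replace (PI * h) with (2 * PI * h / 2) by field; apply rsym_exp_le; lra. }
    rewrite Hu0, Cmult_1_r, <- RtoC_minus, Cmod_R in H0.
    replace E with ((E - 2 * cos (2 * PI * (theta + IZR 0 * alpha))) + 2 * cos (2 * PI * (theta + IZR 0 * alpha))) by ring.
    eapply Rle_trans; [apply Rabs_triang|].
    assert (Rabs (2 * cos (2 * PI * (theta + IZR 0 * alpha))) <= 2); [|lra].
    apply Rabs_le; generalize (COS_bound (2 * PI * (theta + IZR 0 * alpha))); lra.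
  - exists theta, u; split; [assumption|split; [assumption|split; [assumption|]]].
    intros n; exists ((RtoC E - RtoC (2 * cos (2 * PI * (theta + IZR n * alpha)))) * u n)%C; split; [|ring].
    apply (is_sumZ_intro _ _ (conv_const lambda B (2 * PI * h) 1 n) (2 * PI * h / 2)); [lra| |].
    + intros k; rewrite (fourier_coef_eq v vc Hreal); apply Hterm.
    + refine (Clim_ext _ _ _ _ (Heq n)); intros N; apply csum_ext; intros k _.
      now rewrite (fourier_coef_eq v vc Hreal).
Qed.

(** Which of the two windows is free depends on [theta], hence on [E]; the constants [Ka] and [Kb]
    of both are obtained beforehand, and their maximum serves. *)
Lemma cocycle_subexponential_inside alpha lambda eta eta' h v vc C0 eps0 Cbar eps B L :
  irrational alpha -> 0 <= eta' -> eta' < eta -> eta - eta' <= 10 -> eta <= h ->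
  holo_strip h vc -> (forall x : R, vc (RtoC x) = RtoC (v x)) ->
  (forall z, Rabs (Im z) <= h -> Cmod (vc z)%C <= B) -> 0 <= B ->
  1 < C0 -> 0 < eps0 -> 0 < Cbar -> 0 < eps -> 0 <= L ->
  (forall E z, Sigma lambda v alpha E -> Rabs (Im z) <= h -> Cmod (RtoC lambda * vc z - RtoC E)%C <= L) ->
  (forall theta, strong_localization lambda v alpha theta C0 eps0 (2 * PI * eta) Cbar) ->
  exists K1, forall E x0 y0 z k, Sigma lambda v alpha E ->
    Cmod x0 <= 1 -> Cmod y0 <= 1 -> Rabs (Im z) <= eta' ->
    Cmod (fst (cocycle (potential lambda vc alpha E z) x0 y0 k))%C <= K1 * (1 + 2 * eps) ^ k.
Proof.
  intros Ha He0 He1 He10 Heh Hvc Hreal HB HB0 HC0 Heps0 HCbar Heps HL HEL Hloc.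
  pose proof PI_RGT_0 as HP.
  set (g := 2 * PI * (eta - eta')).
  assert (Hg : 0 < g) by (unfold g; apply Rmult_lt_0_compat; lra).
  assert (HST : 0 <= section_error_const lambda B Cbar g) by (apply section_error_const_nonneg; lra).
  destruct (orbit_density alpha ((eta - eta') / 20) Ha ltac:(lra)) as [J0 Hdens].
  destruct (section_parameters eta g Cbar _ L eps C0 J0 ltac:(lra) Hg ltac:(lra) HST HL Heps HC0) as (A0 & HA0 & Hpar).
  destruct (scales_exist alpha eps0 A0 Ha Heps0 HA0) as (K & n1 & T & HK & HbK & Hn1 & Hn1T & HT & HTK).
  assert (HKp : 1 <= INR K) by now apply (le_INR 1).
  assert (HX : 1 <= 1 + ln (INR K)).
  { assert (0 <= ln (INR K)); [|lra].
    rewrite <- ln_1; destruct HKp as [Hlt|<-]; [left; apply ln_increasing; lra|lra]. }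
  assert (HTK2 : INR T <= INR K / 2).
  { generalize (pos_INR T); intros.
    assert (INR T + 1 <= A0 * (INR T + 1)) by nra.
    assert (A0 * (INR T + 1) <= A0 * (INR T + 1) * (1 + ln (INR K))) by nra; lra. }
  assert (HTK' : (2 * T <= K)%nat) by (apply INR_le; rewrite mult_INR; cbn [INR]; lra).
  assert (Hcoef := Cmod_coef_le h vc B h Hvc ltac:(lra) HB).
  destruct (Hpar n1 K (INR T) HK ltac:(lra) HT) as (na & Ma & Ja & sa & A1 & A2 & A3 & A4 & A5 & A6 & A7).
  destruct (Hpar T K (INR K / 2) HK ltac:(lra) HTK) as (nb & Mb & Jb & sb & B1 & B2 & B3 & B4 & B5 & B6 & B7).
  destruct (cocycle_bound_at_scale alpha lambda eta eta' h vc B Cbar L eps C0 J0 n1 K (INR T) na Ma Ja sa)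
    as [Ka HKa]; auto; [lra|].
  destruct (cocycle_bound_at_scale alpha lambda eta eta' h vc B Cbar L eps C0 J0 T K (INR K / 2) nb Mb Jb sb)
    as [Kb HKb]; auto; [lra|].
  exists (Rmax Ka Kb); intros E x0 y0 z k HE Hx0 Hy0 Hz.
  destruct (dual_eigenfunction_of_spectrum alpha lambda h v vc B E) as (_ & theta & u & Hu0 & Hu & Heq & Hdual);
    auto; [lra|].
  assert (HEL' : forall z, Rabs (Im z) <= eta' -> Cmod (RtoC lambda * vc z - RtoC E)%C <= L)
    by (intros; apply HEL; [assumption|lra]).
  assert (Hpow : 0 <= (1 + 2 * eps) ^ k) by (apply pow_le; lra).
  destruct (resonance_dichotomy alpha theta eps0 K n1 T Heps0 HK HbK Hn1 Hn1T HTK') as [Hgap|Hgap].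
  - eapply Rle_trans; [apply (HKa E theta u); auto|].
    + apply (localization_in_gap lambda v alpha theta C0 eps0 (2 * PI * eta) Cbar E u n1 (INR T)); auto.
    + apply Rmult_le_compat_r; [assumption|apply Rmax_l].
  - eapply Rle_trans; [apply (HKb E theta u); auto|].
    + apply (localization_in_gap lambda v alpha theta C0 eps0 (2 * PI * eta) Cbar E u T (INR K / 2)); auto.
    + apply Rmult_le_compat_r; [assumption|apply Rmax_r].
Qed.

Theorem theorem4p1 :
  forall (alpha lambda eta : R) (v : R -> R) (vc : C -> C)
         (C0 eps0 Cbar : R),
    irrational alpha ->
    0 < eta ->
    (forall x : R, v (x + 1) = v x) ->
    analytic_extension v eta vc ->
    1 < C0 -> 0 < eps0 -> 0 < Cbar ->
    (forall theta : R,
       strong_localization lambda v alpha theta C0 eps0 (2 * PI * eta) Cbar) ->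
    forall delta : R, 0 < delta ->
      exists K : R,
        forall (E : R) (k : nat),
          Sigma lambda v alpha E -> (1 <= k)%nat ->
          Rbar_le
            (Lub_Rbar (fun r => exists z : C, Rabs (Im z) < eta /\
               r = opnorm (transfer_iter lambda vc alpha E k z)))
            (Finite (K * exp (delta * INR k))).
Proof.
  intros alpha lambda eta v vc C0 eps0 Cbar Ha Heta _ Hext HC0 Heps0 HCbar Hloc delta Hdelta.
  pose proof PI_RGT_0 as HP.
  destruct (analytic_extension_holo_strip v eta vc ltac:(lra) Hext) as (h & Hh & Hvc).
  assert (Hreal : forall x : R, vc (RtoC x) = RtoC (v x)) by (destruct Hext as (U & H); apply H).
  destruct (holo_strip_bounded h vc Hvc) as (B & HB0 & HB).
  set (Eb := 2 + conv_const lambda B (2 * PI * h) 1 0 * geom_const (PI * h)).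
  set (L := Rabs lambda * B + Rmax 0 Eb).
  assert (HL : 0 <= L).
  { unfold L; generalize (Rmult_le_pos _ _ (Rabs_pos lambda) HB0) (Rmax_l 0 Eb); lra. }
  assert (HEL : forall E z, Sigma lambda v alpha E -> Rabs (Im z) <= h ->
    Cmod (RtoC lambda * vc z - RtoC E)%C <= L).
  { intros E z HE Hz; unfold Cminus; eapply Rle_trans; [apply Cmod_triangle|].
    rewrite Cmod_opp, Cmod_mult, !Cmod_R; unfold L; apply Rplus_le_compat.
    - apply Rmult_le_compat_l; [apply Rabs_pos|now apply HB].
    - eapply Rle_trans; [|apply Rmax_r].
      apply (dual_eigenfunction_of_spectrum alpha lambda h v vc B E); auto; lra. }
  set (l := ln (L + 1)).
  assert (Hl : 0 <= l).
  { unfold l; rewrite <- ln_1; destruct (Req_dec L 0) as [E0|E0]; [rewrite E0, Rplus_0_l; lra|].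
    left; apply ln_increasing; lra. }
  assert (Hel : exp l = L + 1) by (apply exp_ln; lra).
  (* The crude bound [exp (l k)] enters three lines with share [s], so it costs at most
     [exp (delta k / 2)]. *)
  set (s := Rmin 1 (delta / 2 / (l + 1))).
  assert (Hs0 : 0 < s) by (apply Rmin_pos; [lra|apply Rdiv_lt_0_compat; lra]).
  assert (Hs1 : s <= 1) by apply Rmin_l.
  assert (Hsl : s * l <= delta / 2).
  { apply Rle_trans with (delta / 2 / (l + 1) * (l + 1)); [|right; field; lra].
    assert (s <= delta / 2 / (l + 1)) by apply Rmin_r.
    apply Rmult_le_compat; lra. }
  (* [eta' = eta - mu] must be nonnegative, within 10 of [eta], and so close that the weighted mean
     [(1 - s) eta' + s h] still exceeds [eta]. *)
  set (mu := Rmin (Rmin (eta / 2) (s * (h - eta) / 2)) 10).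
  assert (Hsh : 0 < s * (h - eta)) by (apply Rmult_lt_0_compat; lra).
  assert (Hmu : 0 < mu) by (repeat apply Rmin_pos; lra).
  assert (Hmu10 : mu <= 10) by apply Rmin_r.
  assert (Hmu1 : mu <= eta / 2) by (eapply Rle_trans; [apply Rmin_l|apply Rmin_l]).
  assert (Hmu2 : mu <= s * (h - eta) / 2) by (eapply Rle_trans; [apply Rmin_l|apply Rmin_r]).
  set (eta' := eta - mu).
  assert (Heta' : eta < (1 - s) * eta' + s * h) by (unfold eta'; nra).
  (* With [eps = delta / 4] the growth factor is [1 + delta / 2 <= exp (delta / 2)]; the other half
     of [delta] is kept for the crude bound. *)
  destruct (cocycle_subexponential_inside alpha lambda eta eta' h v vc C0 eps0 Cbar (delta / 4) B L)
    as [K1 HK1]; auto; try (unfold eta'; lra).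
  (* [three_lines] takes its bounds as exponentials, and [m0 >= 0] allows [(1 - s) m0] to be
     replaced by [m0]. *)
  set (m0 := Rmax 0 K1).
  assert (Hm0 : K1 <= exp m0 /\ 0 <= m0).
  { split; [|apply Rmax_l]; apply Rle_trans with m0; [apply Rmax_r|].
    generalize (exp_ineq1_le m0); lra. }
  set (gc := geom_const (2 * PI * ((1 - s) * eta' + s * h - eta))).
  assert (Hgc : 0 < gc) by (apply geom_const_pos, Rmult_lt_0_compat; lra).
  assert (Hfst : forall E x0 y0 z k, Sigma lambda v alpha E -> Cmod x0 + Cmod y0 <= 1 -> Rabs (Im z) <= eta ->
    Cmod (fst (cocycle (potential lambda vc alpha E z) x0 y0 k))%C <= gc * exp m0 * exp (delta * INR k)).
  { intros E x0 y0 z k HE Hxy Hz.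
    generalize (Cmod_ge_0 x0) (Cmod_ge_0 y0); intros Hx0 Hy0.
    assert (HIm : forall z x, Im (z + RtoC x)%C = Im z) by (intros [a b] x; cbn; ring).
    eapply Rle_trans.
    { apply (three_lines h eta eta' s (fun z => fst (cocycle (potential lambda vc alpha E z) x0 y0 k))
        (m0 + delta / 2 * INR k) (l * INR k)); auto; try (unfold eta'; lra).
      - now apply holo_strip_cocycle.
      - intros z' Hz'; eapply Rle_trans; [apply HK1; auto; lra|].
        rewrite exp_plus.
        assert (Hp : (1 + 2 * (delta / 4)) ^ k <= exp (delta / 2 * INR k)).
        { rewrite exp_mult_INR; apply pow_incr; generalize (exp_ineq1_le (delta / 2)); lra. }
        assert (Hp0 : 0 <= (1 + 2 * (delta / 4)) ^ k) by (apply pow_le; lra).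
        generalize (exp_pos m0); intros; nra.
      - intros z' Hz'; rewrite exp_mult_INR, Hel.
        assert (Hcr := cocycle_crude_bound (potential lambda vc alpha E z') x0 y0 L k HL).
        eapply Rle_trans; [|eapply Rle_trans; [apply Hcr|]].
        + match goal with |- _ <= _ + Cmod ?c => generalize (Cmod_ge_0 c) end; lra.
        + intros m; unfold potential.
          match goal with |- Cmod (_ - ?b)%C <= _ => replace (RtoC E - b)%C with (- (b - RtoC E))%C by ring end.
          rewrite Cmod_opp; apply HEL; [assumption|now rewrite HIm].
        + assert (0 <= (L + 1) ^ k) by (apply pow_le; lra); nra. }
    fold gc; rewrite Rmult_assoc; apply Rmult_le_compat_l; [lra|].
    rewrite <- exp_plus; apply exp_monotone.
    assert (Hk := pos_INR k).
    assert (s * l * INR k <= delta / 2 * INR k) by (apply Rmult_le_compat_r; lra).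
    assert (0 <= delta / 2 * INR k) by (apply Rmult_le_pos; lra).
    assert (0 <= s * (m0 + delta / 2 * INR k)) by (apply Rmult_le_pos; lra).
    lra. }
  exists (4 * (gc * exp m0)); intros E k HE Hk.
  apply (proj2 (Lub_Rbar_correct _)).
  intros r (z & Hz & ->); cbn [Rbar_le].
  rewrite Rmult_assoc.
  set (X := gc * exp m0 * exp (delta * INR k)).
  assert (HX : 0 <= X) by (left; unfold X; apply Rmult_lt_0_compat; [apply Rmult_lt_0_compat; [assumption|]|]; apply exp_pos).
  apply opnorm_le; [assumption|]; intros i j Hi Hj.
  (* For [k >= 1] the second coordinate at time [k] is the first coordinate at time [k - 1]. *)
  assert (Hsnd : forall x0 y0, Cmod x0 + Cmod y0 <= 1 ->
    Cmod (snd (cocycle (potential lambda vc alpha E z) x0 y0 k))%C <= X).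
  { intros x0 y0 Hxy; destruct k as [|k]; [lia|]; cbn [cocycle snd].
    eapply Rle_trans; [apply Hfst; auto; lra|]; unfold X.
    apply Rmult_le_compat_l; [generalize (exp_pos m0); nra|].
    apply exp_monotone; rewrite S_INR; nra. }
  assert (Hf : forall x0 y0, Cmod x0 + Cmod y0 <= 1 ->
    Cmod (fst (cocycle (potential lambda vc alpha E z) x0 y0 k))%C <= X).
  { intros x0 y0 Hxy; apply Hfst; auto; lra. }
  assert (H10 : Cmod (RtoC 1)%C + Cmod (RtoC 0)%C <= 1) by (rewrite Cmod_1, Cmod_0; lra).
  assert (H01 : Cmod (RtoC 0)%C + Cmod (RtoC 1)%C <= 1) by (rewrite Cmod_1, Cmod_0; lra).
  destruct (transfer_iter_coeff lambda vc alpha E k z) as (T1 & T2 & T3 & T4).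
  destruct i as [|[|i]]; [| |lia]; (destruct j as [|[|j]]; [| |lia]).
  - rewrite T1; auto.
  - rewrite T3; auto.
  - rewrite T2; auto.
  - rewrite T4; auto.
Qed.
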